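(* There exists a constant $C$ independent of $k$ such that $$\bigg|\int_{\mathbb{R}^2}\int_{\mathbb{R}^2}G(\tilde x,\tilde y)\,g(y)\,v(x)\,dy\,dx\bigg|\le C\,k^{-1}\,\|g\|_{L^2(\mathbb{R}^2)}\|v\|_{L^2(\mathbb{R}^2)}\qquad\forall\,g,v\in L^2(\mathbb{R}^2).$$
   Context: Wavenumber $k\ge1$; $l_1,l_2,\sigma_0>0$ fixed. For $j=1,2$: $\sigma_j(t)=0$ if $|t|\le l_j$, $\sigma_j(t)=\sigma_0$ if $|t|>l_j$; $\alpha_j=1+\mathrm{i}\sigma_j$. For $x\in\mathbb{R}^2$, $\tilde x=(\tilde x_1,\tilde x_2)$ with $\tilde x_j=\int_0^{x_j}\alpha_j(t)\,dt$. $\rho(\tilde x,\tilde y)=[(\tilde x_1-\tilde y_1)^2+(\tilde x_2-\tilde y_2)^2]^{1/2}$ with the square-root branch satisfying $\mathrm{Re}\,z^{1/2}>0$ for $z\in\mathbb{C}\setminus(-\infty,0]$. $G(\tilde x,\tilde y)=\frac{\mathrm{i}}4H_0^{(1)}(k\rho(\tilde x,\tilde y))$ for $x\ne y$, with $H_0^{(1)}$ the Hankel function of the first kind of order zero. $C$ may depend on the fixed $l_1,l_2,\sigma_0$. *)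

(* Defs.v *)
From HB Require Import structures.
From mathcomp Require Import all_boot all_order all_algebra.
From mathcomp Require Import complex.
From mathcomp Require Import all_classical all_reals all_analysis.
Set Implicit Arguments.
Unset Strict Implicit.
Unset Printing Implicit Defensive.
Import Order.TTheory GRing.Theory Num.Theory.
Import numFieldNormedType.Exports.
Import complex Normc.
Local Open Scope classical_set_scope.
Local Open Scope ring_scope.
Local Open Scope complex_scope.

(* Lebesgue measure on R^2, on the Borel sigma-algebra. *)
Definition leb2 (R : realType) : {measure set (measurableTypeR R * measurableTypeR R) -> \bar R} :=
  (@lebesgue_measure R \x @lebesgue_measure R)%E.

(* Complex-valued functions are measured, integrated and summed through their
   real and imaginary parts. *)
Section complex_valued.
Context {d : measure_display} {T : measurableType d} {R : realType}.
Variable mu : {measure set T -> \bar R}.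
Implicit Types (D : set T) (f : T -> R[i]).

Definition cmeasurable D f : Prop :=
  measurable_fun D (fun x => Re (f x)) /\ measurable_fun D (fun x => Im (f x)).

Definition cintegrable D f : Prop :=
  mu.-integrable D (fun x => (Re (f x))%:E) /\
  mu.-integrable D (fun x => (Im (f x))%:E).

Definition cintegral D f : R[i] :=
  (\int[mu]_(x in D) Re (f x)) +i* (\int[mu]_(x in D) Im (f x)).

Definition eL2norm f : \bar R := 'N[mu]_2%:E[(fun x => (normc (f x))%:E)]%E.

Definition L2 f : Prop := cmeasurable setT f /\ (eL2norm f < +oo)%E.

(* Meaningful for f in L2, where [eL2norm f] is finite. *)
Definition L2norm f : R := fine (eL2norm f).

End complex_valued.

Definition csum {R : realType} (u : nat -> R[i]) : R[i] :=
  limn (series (fun m => Re (u m))) +i* limn (series (fun m => Im (u m))).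

Section hankel.
Context {R : realType}.
Implicit Types z : R[i].

(* Principal argument, in ]-pi, pi] for z <> 0. *)
Definition carg z : R :=
  if 0 <= Im z then acos (Re z / normc z) else - acos (Re z / normc z).

(* Principal logarithm, for z <> 0. *)
Definition cln z : R[i] := ln (normc z) +i* carg z.

(* [series harmonic n] is 1 + 1/2 + ... + 1/n. *)
Definition euler_gamma : R :=
  limn (fun n : nat => series harmonic n - ln n%:R).

Definition besselJ0 z : R[i] :=
  csum (fun m => (-1) ^+ m * (z ^+ 2 / 4) ^+ m / (m`!%:R) ^+ 2).

(* Y_0(z) = 2/pi (ln(z/2) + gamma) J_0(z)
            - 2/pi sum_m (-1)^m (1 + ... + 1/m) (z^2/4)^m / (m!)^2,
   principal branch, for z <> 0. *)
Definition besselY0 z : R[i] :=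
  (2 / pi)%:C * ((cln (z / 2) + euler_gamma%:C) * besselJ0 z
    - csum (fun m => (-1) ^+ m * (series harmonic m)%:C
                     * (z ^+ 2 / 4) ^+ m / (m`!%:R) ^+ 2)).

Definition hankel10 z : R[i] := besselJ0 z + 'i%C * besselY0 z.

End hankel.

Section pml.
Context {R : realType}.
Implicit Types (l t k : R).

Definition sigma (sigma0 : R) l t : R := if `|t| <= l then 0 else sigma0.

Definition alpha (sigma0 : R) l t : R[i] := 1 + 'i%C * (sigma sigma0 l t)%:C.

(* The oriented integral of [alpha sigma0 l] from 0 to t. *)
Definition stretch (sigma0 : R) l t : R[i] :=
  if 0 <= t then cintegral lebesgue_measure `[0, t] (alpha sigma0 l)
  else - cintegral lebesgue_measure `[t, 0] (alpha sigma0 l).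

Definition stretch2 (sigma0 : R) l1 l2 (x : R * R) : R[i] * R[i] :=
  (stretch sigma0 l1 x.1, stretch sigma0 l2 x.2).

(* [sqrtc] is the principal square root, see [Re_sqrtc_gt0]. *)
Definition rho (x y : R[i] * R[i]) : R[i] :=
  sqrtc ((x.1 - y.1) ^+ 2 + (x.2 - y.2) ^+ 2).

(* Takes a junk value for x = y. *)
Definition green k (x y : R[i] * R[i]) : R[i] :=
  'i%C / 4 * hankel10 (k%:C * rho x y).

Lemma Re_sqrtc_gt0 (z : R[i]) : ~ (Re z <= 0 /\ Im z = 0) -> 0 < Re (sqrtc z).
Proof.
case: z => a b /= nz; rewrite sqrtr_gt0 divr_gt0// -ltrBlDr sub0r.
have [b0|b0] := eqVneq b 0.
  have a0 : 0 < a by rewrite ltNge; apply/negP => a0; apply: nz.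
  by rewrite (lt_le_trans _ (sqrtr_ge0 _))// oppr_lt0.
apply: (le_lt_trans (ler_norm _)); rewrite normrN -sqrtr_sqr ltr_sqrt.
  by rewrite ltrDl exprn_even_gt0.
by rewrite ltr_pwDr// ?sqr_ge0// exprn_even_gt0.
Qed.

End pml.

(* Main.v *)
Require Import Defs.
From HB Require Import structures.
From mathcomp Require Import all_boot all_order all_algebra.
From mathcomp Require Import complex ring lra.
From mathcomp Require Import all_classical all_reals all_analysis.
From mathcomp Require Import measurable_realfun.
Import Order.TTheory GRing.Theory Num.Theory.
Import numFieldNormedType.Exports.
Local Open Scope classical_set_scope.
Local Open Scope ring_scope.
Local Open Scope complex_scope.
Set Implicit Arguments.
Unset Strict Implicit.
Unset Printing Implicit Defensive.
Import complex Normc.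

(** The Green function is a superposition of Gaussian kernels, that is of free
    Schroedinger propagators at complex times [tau]. Schlaefli's integral for the
    Hankel function gives
<<
      G(x, y) = (4 pi)^-1 int exp (i k^2 tau + i rho^2 / (4 tau)) dtau / tau,
>>
    and since [rho ^ 2] is a sum over the two stretched coordinates, the kernel under
    the integral is a tensor product of one-dimensional ones. The path is free; it goes
    from 0 to a point [a (1 - i kap)] with [a] and [kap] of order [1 / k], and then to
    infinity in a direction [1 + i m] ([green_integral]).

    On the segment the one-dimensional kernel [exp (i e (x - y) ^ 2)], with
    [e = 1 / (4 |tau|)] and stretched [x] and [y], has norm [O (1 / sqrt e)] on square
    integrable functions ([l2bound_stretched_kernel]). When both points lie where there
    is no absorption, this comes from oscillation, by composing the operator with its
    adjoint ([TstarT], [normc_gauss_overlap]). Otherwise the absorption bounds the kernel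
    in absolute value, either by a Lorentzian in [x - y] or, when an endpoint [b] of the
    interval without absorption lies between the points, by the kernel
    [1 / (1 + c |x - b| |y - b|)]; the latter is bounded by Schur's test with the weight
    [1 / sqrt |x - b|] ([hyperbolic_l2bound]). The tensor product then has norm
    [O (|tau|)], which cancels the density [1 / |tau|], and the segment contributes
    [O (a) = O (1 / k)]. The damping [kap] makes all integrals absolutely convergent, but
    does not enter these norms.

    On the ray the factor [exp (i k^2 tau)] decays like [exp (- k^2 m t)]. The
    absorption makes the kernel decay in [x - y] beyond a fixed multiple of the width of
    that interval, and for shorter distances the growth of the kernel is weaker than this
    decay, because [a] is a large enough multiple of [1 / k] ([far_exponent]). Schur's
    condition bounds the kernel by [O (k) exp (- c k^2 t)], and the ray contributes
    [O (1 / k)] as well.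

    Schlaefli's integral is proved by uniqueness for the first order system of the Bessel
    equation ([bessel_system_unique]): the integral and the series that defines the
    Hankel function satisfy the same system and have the same logarithmic behaviour at 0.
    The constant term at 0 requires Euler's constant, obtained from exponential
    integrals at integers ([Ein_nat_harmonic]). The estimates for the single kernels are
    put together by [superposition]. *)

(** * Complex numbers and derivatives along the real line *)

Section complex_algebra.
Context {R : realType}.
Implicit Types (z w : R[i]) (a b : R).

Lemma Re_mul z w : Re (z * w) = Re z * Re w - Im z * Im w.
Proof. by case: z w => a b [c d]. Qed.

Lemma Im_mul z w : Im (z * w) = Re z * Im w + Im z * Re w.
Proof. by case: z w => a b [c d]. Qed.

Lemma Re_add z w : Re (z + w) = Re z + Re w. Proof. by case: z w => a b [c d]. Qed.
Lemma Im_add z w : Im (z + w) = Im z + Im w. Proof. by case: z w => a b [c d]. Qed.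
Lemma Re_opp z : Re (- z) = - Re z. Proof. by case: z. Qed.
Lemma Im_opp z : Im (- z) = - Im z. Proof. by case: z. Qed.
Lemma Re_sub z w : Re (z - w) = Re z - Re w. Proof. by rewrite Re_add Re_opp. Qed.
Lemma Im_sub z w : Im (z - w) = Im z - Im w. Proof. by rewrite Im_add Im_opp. Qed.
Lemma Re_1 : Re (1 : R[i]) = 1. Proof. by []. Qed.
Lemma Im_1 : Im (1 : R[i]) = 0. Proof. by []. Qed.
Lemma Re_0 : Re (0 : R[i]) = 0. Proof. by []. Qed.
Lemma Im_0 : Im (0 : R[i]) = 0. Proof. by []. Qed.
Lemma Re_real a : Re a%:C = a. Proof. by []. Qed.
Lemma Im_real a : Im a%:C = 0. Proof. by []. Qed.
Lemma Re_i : Re ('i : R[i]) = 0. Proof. by []. Qed.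
Lemma Im_i : Im ('i : R[i]) = 1. Proof. by []. Qed.

Lemma sqr_Re_Im_neq0 z : z != 0 -> Re z ^+ 2 + Im z ^+ 2 != 0.
Proof.
case: z => a b; rewrite eq_complex /= => h.
rewrite paddr_eq0 ?sqr_ge0 // !sqrf_eq0.
by apply: contra h.
Qed.

Lemma Re_inv z : Re z^-1 = Re z / (Re z ^+ 2 + Im z ^+ 2).
Proof. by case: z. Qed.

Lemma Im_inv z : Im z^-1 = - Im z / (Re z ^+ 2 + Im z ^+ 2).
Proof. by case: z => a b /=; rewrite mulNr. Qed.

Definition ReImE := (Re_mul, Im_mul, Re_add, Im_add, Re_opp, Im_opp, Re_1, Im_1, Re_0, Im_0, Re_real, Im_real, Re_i, Im_i).

Lemma complex_ext z w : Re z = Re w -> Im z = Im w -> z = w.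
Proof. by case: z w => a b [c d] /= -> ->. Qed.

Lemma normc_sqr z : normc z ^+ 2 = Re z ^+ 2 + Im z ^+ 2.
Proof. by case: z => a b; rewrite /normc sqr_sqrtr// addr_ge0// sqr_ge0. Qed.

Lemma normc_ge0 z : 0 <= normc z.
Proof. by case: z => a b; rewrite sqrtr_ge0. Qed.

Lemma Re_le_normc z : `|Re z| <= normc z.
Proof.
rewrite -(ler_pXn2r (n := 2))// ?nnegrE ?normc_ge0// normc_sqr.
by rewrite real_normK ?num_real// lerDl sqr_ge0.
Qed.

Lemma Im_le_normc z : `|Im z| <= normc z.
Proof.
rewrite -(ler_pXn2r (n := 2))// ?nnegrE ?normc_ge0// normc_sqr.
by rewrite real_normK ?num_real// lerDr sqr_ge0.
Qed.

Lemma normc_le_ReIm z : normc z <= `|Re z| + `|Im z|.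
Proof.
rewrite -(ler_pXn2r (n := 2))// ?nnegrE ?normc_ge0 ?addr_ge0// normc_sqr.
rewrite sqrrD !real_normK ?num_real// lerD2r lerDl.
by rewrite mulrn_wge0// mulr_ge0.
Qed.

Lemma normcD_le z w : normc (z + w) <= normc z + normc w.
Proof. exact: le_normcD. Qed.

Lemma normcC a : normc a%:C = `|a|.
Proof. by rewrite /normc /= expr0n addr0 sqrtr_sqr. Qed.

Lemma normc_gt0 z : z != 0 -> 0 < normc z.
Proof.
move=> z0; rewrite lt_neqAle normc_ge0 andbT eq_sym.
by apply: contra z0 => /eqP /eq0_normc ->.
Qed.

Definition cexp z : R[i] :=
  (expR (Re z) * cos (Im z)) +i* (expR (Re z) * sin (Im z)).

Lemma cexp0 : cexp 0 = 1.
Proof. by rewrite /cexp /= expR0 cos0 sin0 mulr1 mulr0. Qed.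

Lemma cexpD z w : cexp (z + w) = cexp z * cexp w.
Proof.
by apply: complex_ext; rewrite ?Re_mul ?Im_mul /= Re_add Im_add expRD ?cosD ?sinD; ring.
Qed.

Lemma normc_cexp z : normc (cexp z) = expR (Re z).
Proof.
apply/eqP; rewrite -(eqrXn2 (n := 2))// ?normc_ge0 ?expR_ge0// normc_sqr /=.
by rewrite !exprMn -mulrDr cos2Dsin2 mulr1.
Qed.

Lemma cexp_neq0 z : cexp z != 0.
Proof.
apply/eqP => h; have := normc_cexp z; rewrite h normc0 => /eqP.
by rewrite eq_sym expR_eq0.
Qed.

Lemma cexpN z : cexp (- z) = (cexp z)^-1.
Proof.
apply: (mulfI (cexp_neq0 z)).
by rewrite -cexpD subrr cexp0 divff // cexp_neq0.
Qed.

End complex_algebra.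

Section real_derivative.
Context {R : realType}.
Implicit Types (f g : R -> R) (t a b : R).

Lemma rderD f g t a b : is_derive t 1 f a -> is_derive t 1 g b ->
  is_derive t 1 (fun s => f s + g s) (a + b).
Proof. exact: is_deriveD. Qed.

Lemma rderN f t a : is_derive t 1 f a -> is_derive t 1 (fun s => - f s) (- a).
Proof. exact: is_deriveN. Qed.

Lemma rderB f g t a b : is_derive t 1 f a -> is_derive t 1 g b ->
  is_derive t 1 (fun s => f s - g s) (a - b).
Proof. exact: is_deriveB. Qed.

Lemma rderM f g t a b : is_derive t 1 f a -> is_derive t 1 g b ->
  is_derive t 1 (fun s => f s * g s) (a * g t + f t * b).
Proof.
move=> h k; apply: (is_derive_eq (is_deriveM h k)).
by rewrite /GRing.scale /= addrC [g t * a]mulrC.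
Qed.

Lemma rderMl c f t a : is_derive t 1 f a ->
  is_derive t 1 (fun s => c * f s) (c * a).
Proof. by move=> h; apply: is_deriveZ. Qed.

Lemma rderV f t a : f t != 0 -> is_derive t 1 f a ->
  is_derive t 1 (fun s => (f s)^-1) (- a / f t ^+ 2).
Proof.
move=> f0 h; apply: (is_derive_eq (is_deriveV f0 h)).
by rewrite /GRing.scale /= mulNr mulrC mulNr.
Qed.

Lemma rder_comp f g t a b : is_derive (g t) 1 f a -> is_derive t 1 g b ->
  is_derive t 1 (fun s => f (g s)) (a * b).
Proof. by move=> h k; exact: (is_derive1_comp h k). Qed.

Lemma rder_continuous f t a : is_derive t 1 f a -> {for t, continuous f}.
Proof.
by move=> [h _]; apply: differentiable_continuous; apply/derivable1_diffP.
Qed.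

End real_derivative.

Section complex_derivative.
Context {R : realType}.
Implicit Types (f g : R -> R[i]) (t : R).

Definition cderive f t (l : R[i]) :=
  is_derive t (1 : R) (fun s => Re (f s)) (Re l) /\
  is_derive t (1 : R) (fun s => Im (f s)) (Im l).

Lemma cderive_eq f t l l' : cderive f t l -> l = l' -> cderive f t l'.
Proof. by move=> h <-. Qed.

Lemma cderive_cst (c : R[i]) t : cderive (fun=> c) t 0.
Proof. by split; apply: is_derive_cst. Qed.

Lemma cderive_real (f : R -> R) t (l : R) :
  is_derive t (1 : R) f l -> cderive (fun s => (f s)%:C) t l%:C.
Proof. by move=> h; split => //=; apply: is_derive_cst. Qed.

Lemma cderive_id t : cderive (fun s => s%:C) t 1.
Proof. by apply: (cderive_real (f := id)); apply: is_derive_id. Qed.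

Lemma cderiveD f g t a b :
  cderive f t a -> cderive g t b -> cderive (fun s => f s + g s) t (a + b).
Proof.
move=> [f1 f2] [g1 g2]; split; rewrite !ReImE.
  by under eq_fun do rewrite Re_add; apply: rderD.
by under eq_fun do rewrite Im_add; apply: rderD.
Qed.

Lemma cderiveM f g t a b :
  cderive f t a -> cderive g t b ->
  cderive (fun s => f s * g s) t (a * g t + f t * b).
Proof.
move=> [f1 f2] [g1 g2]; split.
  under eq_fun do rewrite Re_mul.
  apply: (is_derive_eq (rderB (rderM f1 g1) (rderM f2 g2))).
  by rewrite !ReImE; ring.
under eq_fun do rewrite Im_mul.
apply: (is_derive_eq (rderD (rderM f1 g2) (rderM f2 g1))).
by rewrite !ReImE; ring.
Qed.

Lemma cderiveMl (c : R[i]) f t a :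
  cderive f t a -> cderive (fun s => c * f s) t (c * a).
Proof.
move=> h; apply: cderive_eq (cderiveM (cderive_cst c t) h) _.
by rewrite mul0r add0r.
Qed.

Lemma cderiveN f t a : cderive f t a -> cderive (fun s => - f s) t (- a).
Proof.
move=> h; have := cderiveMl (-1) h; rewrite mulN1r.
by under eq_fun do rewrite mulN1r.
Qed.

Lemma cderiveB f g t a b :
  cderive f t a -> cderive g t b -> cderive (fun s => f s - g s) t (a - b).
Proof. by move=> h k; apply: cderiveD => //; apply: cderiveN. Qed.

Lemma cderive_cexp f t a :
  cderive f t a -> cderive (fun s => cexp (f s)) t (a * cexp (f t)).
Proof.
move=> [f1 f2].
have e := rder_comp (is_derive_expR (Re (f t))) f1.
have c := rder_comp (is_derive_cos (Im (f t))) f2.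
have s := rder_comp (is_derive_sin (Im (f t))) f2.
split => /=.
  apply: (is_derive_eq (rderM e c)).
  rewrite Re_mul /=.
  ring.
apply: (is_derive_eq (rderM e s)).
rewrite Im_mul /=.
ring.
Qed.

Lemma cderiveV f t a :
  f t != 0 -> cderive f t a -> cderive (fun s => (f s)^-1) t (- a / f t ^+ 2).
Proof.
move=> ft0 [f1 f2].
pose n s := Re (f s) * Re (f s) + Im (f s) * Im (f s).
have n0 : n t != 0 by rewrite /n -!expr2; apply: sqr_Re_Im_neq0.
have dn : is_derive t 1 n _ := rderD (rderM f1 f1) (rderM f2 f2).
have dv := rderV n0 dn.
split.
  under eq_fun do rewrite Re_inv !expr2.
  apply: (is_derive_eq (rderM f1 dv)).
  rewrite /n expr2 !(Re_inv, Im_inv, ReImE) /=.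
  by field; rewrite -!expr2 ; apply/andP; split => //; move: (sqr_Re_Im_neq0 (mulf_neq0 ft0 ft0)); rewrite !ReImE.
under eq_fun do rewrite Im_inv !expr2.
apply: (is_derive_eq (rderM (rderN f2) dv)).
rewrite /n expr2 !(Re_inv, Im_inv, ReImE) /=.
by field; rewrite -!expr2 ; apply/andP; split => //; move: (sqr_Re_Im_neq0 (mulf_neq0 ft0 ft0)); rewrite !ReImE.
Qed.

Lemma cderive_continuous f t a : cderive f t a ->
  {for t, continuous (fun s => Re (f s))} /\ {for t, continuous (fun s => Im (f s))}.
Proof. by move=> [/rder_continuous h1 /rder_continuous h2]. Qed.

End complex_derivative.

(** * Integrals of complex-valued functions *)

Section halfline_integral.
Context {R : realType}.

Lemma rder_expR (g : R -> R) t b : is_derive t (1 : R) g b ->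
  is_derive t (1 : R) (fun s => expR (g s)) (expR (g t) * b).
Proof. by move=> h; apply: rder_comp => //; apply: is_derive_expR. Qed.

Lemma rder_scale (b t : R) : is_derive t (1 : R) (fun s => b * s) b.
Proof.
by apply: (is_derive_eq (rderMl b (is_derive_id _ _))); rewrite mulr1.
Qed.

Notation mu := (@lebesgue_measure R).
Notation Rp := (`[(0:R), +oo[%classic).

Lemma continuous_measurable_on (D : set R) (f : R -> R) : measurable D ->
  (forall t, D t -> {for t, continuous f}) -> measurable_fun D f.
Proof.
move=> mD h; apply: subspace_continuous_measurable_fun => //.
by apply: continuous_in_subspaceT => t /set_mem; exact: h.
Qed.

Lemma dominated_integrable_on d (T : measurableType d)
    (m : {measure set T -> \bar R}) (D : set T) (f g : T -> R) :
  measurable D -> measurable_fun D f -> (forall t, D t -> `|f t| <= g t) ->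
  m.-integrable D (EFin \o g) -> m.-integrable D (EFin \o f).
Proof.
move=> mD mf fg ig; apply: le_integrable ig => //; first exact/measurable_EFinP.
by move=> t Dt /=; rewrite lee_fin (le_trans (fg _ Dt))// ler_norm.
Qed.

Lemma Rdominated_cvg d (T : measurableType d)
    (m : {measure set T -> \bar R}) (D : set T) (fn : nat -> T -> R) (f g : T -> R) :
  measurable D -> (forall n, measurable_fun D (fn n)) -> measurable_fun D f ->
  (forall t, D t -> fn n t @[n --> \oo] --> f t) ->
  m.-integrable D (EFin \o g) -> (forall n t, D t -> `|fn n t| <= g t) ->
  \int[m]_(t in D) fn n t @[n --> \oo] --> \int[m]_(t in D) f t.
Proof.
move=> mD mfn mf fnf ig fng.
have ae1 : {ae m, forall t, D t -> (fn n t)%:E @[n --> \oo] --> (f t)%:E}.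
  by apply: aeW => t Dt; apply: cvg_EFin; [exact: nearW|exact: fnf].
have ae2 : {ae m, forall t n, D t -> (`|(fn n t)%:E| <= (g t)%:E)%E}.
  by apply: aeW => t n Dt; rewrite lee_fin fng.
have [||fi _ H] := @dominated_convergence _ _ _ m D mD
  (fun n t => (fn n t)%:E) (fun t => (f t)%:E) (fun t => (g t)%:E) _ _ ae1 ig ae2.
- by move=> n; apply/measurable_EFinP.
- exact/measurable_EFinP.
rewrite /Rintegral; apply: fine_cvg; rewrite fineK //.
exact: integrable_fin_num.
Qed.

Lemma FTC_halfline (F f : R -> R) (l : R) :
  (forall t : R, 0 <= t -> is_derive t (1 : R) F (f t)) ->
  (forall t : R, 0 <= t -> {for t, continuous f}) ->
  mu.-integrable Rp (EFin \o f) ->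
  F t @[t --> +oo] --> l ->
  \int[mu]_(t in Rp) f t = l - F 0.
Proof.
move=> dF cf fi Fl.
pose fn (n : nat) (t : R) : R := (f \_ `[0, n.+1%:R]) t.
have mf : measurable_fun Rp f.
  by apply: continuous_measurable_on => // t; rewrite /= in_itv /= andbT; exact: cf.
have key n : (\int[mu]_(t in Rp) (fn n t)%:E)%E = (F n.+1%:R - F 0)%:E.
  rewrite EFinB -(@continuous_FTC2 _ f F 0 n.+1%:R) //.
  - rewrite [in RHS](_ : `[0, n.+1%:R]%classic = Rp `&` `[0, n.+1%:R]%classic); last first.
      apply/seteqP; split => t /=; rewrite !in_itv /= ?andbT.
        by move=> /andP[a b]; rewrite a b.
      by move=> [].
    rewrite integral_mkcondr; apply: eq_integral => t _.
    by rewrite /fn patchE [RHS]patchE; case: ifP.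
  - apply: continuous_in_subspaceT => t /set_mem /=; rewrite in_itv /= => /andP[t0 _].
    exact: cf.
  - split => [t|t|].
    + rewrite in_itv /= => /andP[t0 _]; exact: (@ex_derive _ _ _ _ _ _ _ (dF t (ltW t0))).
    + apply: cvg_at_right_filter; exact: rder_continuous (dF 0 (lexx 0)).
    + apply: cvg_at_left_filter; exact: rder_continuous (dF n.+1%:R (ler0n _ _)).
  - move=> t; rewrite in_itv /= => /andP[t0 _].
    by rewrite derive1E; apply: derive_val; exact: dF (ltW t0).
have lim1 : \int[mu]_(t in Rp) fn n t @[n --> \oo] --> \int[mu]_(t in Rp) f t.
  apply: (@Rdominated_cvg _ _ mu Rp fn f (fun t => `|f t|)) => //.
  - move=> n.
    apply: measurable_funTS.
    apply: (measurable_restrictT f (measurable_itv `[0, n.+1%:R])).1.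
    by apply: measurable_funS mf => // t /=; rewrite !in_itv /= => /andP[->].
  - move=> t; rewrite /= in_itv /= andbT => t0.
    apply: cvg_near_cst.
    near=> n; rewrite /fn patchE mem_set//= in_itv /= t0 /=.
    apply: (@le_trans _ _ n%:R); last by rewrite ler_nat.
    by near: n; exact: nbhs_infty_ger.
  - exact: (integrable_norm fi).
  - move=> n t _ /=; rewrite /fn patchE; case: ifP => //= _.
    by rewrite normr0.
have lim2 : F n.+1%:R - F 0 @[n --> \oo] --> l - F 0.
  apply: cvgB; last exact: cvg_cst.
  apply: (cvg_comp _ _ _ Fl).
  by apply/cvgrnyP; have := cvg_addnr 1; under eq_fun do rewrite addn1.
have E : (fun n => \int[mu]_(t in Rp) fn n t) = (fun n => F n.+1%:R - F 0).
  by apply/funext => n; rewrite /Rintegral key.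
rewrite E in lim1.
exact: (cvg_unique (@Rhausdorff R) lim1 lim2).
Unshelve. all: by end_near. Qed.

Lemma integral_inv_sqr : (\int[mu]_(t in Rp) ((1 + t) ^- 2)%:E = 1)%E.
Proof.
have p1 (t : R) : 0 <= t -> 1 + t != 0 by move=> t0; rewrite gt_eqF// ltr_pwDl.
pose F (t : R) := - (1 + t)^-1.
have dF (t : R) : 0 <= t -> is_derive t (1 : R) F ((1 + t) ^- 2).
  move=> t0; rewrite /F.
  apply: (is_derive_eq (rderN (rderV (p1 _ t0) (rderD (is_derive_cst _ _ _) (is_derive_id _ _))))).
  by rewrite add0r mulN1r opprK.
have cf (t : R) : 0 <= t -> {for t, continuous (fun t : R => (1 + t) ^- 2)}.
  move=> t0; apply: continuousV; first by rewrite expf_neq0// p1.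
  rewrite (_ : (fun x : R => (1 + x) ^+ 2) = (fun x => (1 + x) * (1 + x))); last first.
    by apply/funext => x; rewrite expr2.
  have h := rderD (is_derive_cst (1:R) t (1:R)) (is_derive_id t (1:R)).
  exact: (rder_continuous (rderM h h)).
rewrite (@ge0_continuous_FTC2y _ (fun t : R => (1 + t) ^- 2) F 0 0).
- by rewrite /F addr0 invr1 -EFinB sub0r opprK.
- by move=> t _; rewrite invr_ge0 sqr_ge0.
- apply: continuous_in_subspaceT => t /set_mem /=; rewrite in_itv /= andbT; exact: cf.
- rewrite /F -[X in _ --> X]oppr0; apply: cvgN.
  apply/gtr0_cvgV0 => //.
    by near=> t; rewrite ltr_pwDl//; near: t; exact: nbhs_pinfty_ge.
  exact: cvg_addrl.
- by move=> t /ltW /dF [].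
- apply: cvg_at_right_filter; exact: rder_continuous (dF 0 (lexx 0)).
- by move=> t; rewrite in_itv /= andbT => /ltW /dF [h1 h2]; rewrite derive1E.
Unshelve. all: by end_near. Qed.

Lemma integrable_inv_sqr : mu.-integrable Rp (fun t => ((1 + t) ^- 2)%:E).
Proof.
apply/integrableP; split.
  apply/measurable_EFinP; apply: continuous_measurable_on => // t.
  rewrite /= in_itv /= andbT => t0.
  have h := rderD (is_derive_cst (1:R) t (1:R)) (is_derive_id t (1:R)).
  apply: continuousV; first by rewrite expf_neq0// gt_eqF// ltr_pwDl.
  rewrite (_ : (fun x : R => (1 + x) ^+ 2) = (fun x => (1 + x) * (1 + x))); last first.
    by apply/funext => x; rewrite expr2.
  exact: (rder_continuous (rderM h h)).
under eq_integral => t _ do rewrite gee0_abs ?lee_fin ?invr_ge0 ?sqr_ge0//.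
by rewrite integral_inv_sqr ltry.
Qed.

Lemma cvg_expRN (c : R) : 0 < c -> expR (- (c * t)) @[t --> +oo] --> 0.
Proof.
move=> c0.
have h : c * t @[t --> +oo] --> +oo by apply: gt0_cvgMry => //; exact: cvg_id.
exact: (cvg_comp _ (fun x : R => expR (- x)) h (@cvgr_expR R)).
Qed.

Lemma integral_expRN (c : R) : 0 < c ->
  (\int[mu]_(t in Rp) (expR (- (c * t)))%:E = (c^-1)%:E)%E.
Proof.
move=> c0.
pose F (t : R) := - c^-1 * expR (- (c * t)).
have dF (t : R) : is_derive t (1 : R) F (expR (- (c * t))).
  apply: (is_derive_eq (rderMl _ (rder_expR (rderN (rder_scale c t))))).
  by field; rewrite gt_eqF.
have cf (t : R) : {for t, continuous (fun t : R => expR (- (c * t)))}.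
  exact: rder_continuous (rder_expR (rderN (rder_scale c t))).
rewrite (@ge0_continuous_FTC2y _ (fun t : R => expR (- (c * t))) F 0 0).
- by rewrite /F mulr0 oppr0 expR0 mulr1 -EFinB opprK add0r.
- by move=> t _; exact: expR_ge0.
- by apply: continuous_in_subspaceT => t _; exact: cf.
- by rewrite /F -[X in _ --> X](mulr0 (- c^-1)); apply: cvgMr; exact: cvg_expRN.
- by move=> t _; exact: (@ex_derive _ _ _ _ _ _ _ (dF t)).
- by apply: cvg_at_right_filter; exact: rder_continuous (dF 0).
- by move=> t _; rewrite derive1E; exact: (@derive_val _ _ _ _ _ _ _ (dF t)).
Qed.

Lemma integrable_expRN (c : R) : 0 < c ->
  mu.-integrable Rp (fun t => (expR (- (c * t)))%:E).
Proof.
move=> c0; apply/integrableP; split.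
  apply/measurable_EFinP; apply: continuous_measurable_on => // t _.
  exact: rder_continuous (rder_expR (rderN (rder_scale c t))).
under eq_integral => t _ do rewrite gee0_abs ?lee_fin ?expR_ge0//.
by rewrite integral_expRN// ltry.
Qed.

End halfline_integral.

Section complex_integral.
Context {R : realType}.
Notation mu := (@lebesgue_measure R).
Notation Rp := (`[(0:R), +oo[%classic).

Lemma eq_cintegral d (T : measurableType d) (m : {measure set T -> \bar R})
    (D : set T) (f g : T -> R[i]) : (forall t, D t -> f t = g t) ->
  cintegral m D f = cintegral m D g.
Proof.
move=> h; rewrite /cintegral; congr Complex; apply: eq_Rintegral => t /set_mem Dt;
  by rewrite h.
Qed.

Lemma cintegrable_dominated d (T : measurableType d) (m : {measure set T -> \bar R})
    (D : set T) (f : T -> R[i]) (g : T -> R) :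
  measurable D -> cmeasurable D f -> (forall t, D t -> normc (f t) <= g t) ->
  m.-integrable D (EFin \o g) -> cintegrable m D f.
Proof.
move=> mD [mr mi] fg ig; split.
  apply: dominated_integrable_on ig => // t Dt.
  exact: le_trans (Re_le_normc _) (fg _ Dt).
apply: dominated_integrable_on ig => // t Dt.
exact: le_trans (Im_le_normc _) (fg _ Dt).
Qed.

Lemma cintegralD d (T : measurableType d) (m : {measure set T -> \bar R})
    (D : set T) (f g : T -> R[i]) :
  measurable D -> cintegrable m D f -> cintegrable m D g ->
  cintegral m D (fun t => f t + g t) = cintegral m D f + cintegral m D g.
Proof.
move=> mD [f1 f2] [g1 g2]; apply: complex_ext; rewrite ?Re_add ?Im_add /=.
  by rewrite -RintegralD //; apply: eq_Rintegral => t _; rewrite Re_add.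
by rewrite -RintegralD //; apply: eq_Rintegral => t _; rewrite Im_add.
Qed.

Lemma cintegrableD d (T : measurableType d) (m : {measure set T -> \bar R})
    (D : set T) (f g : T -> R[i]) :
  measurable D -> cintegrable m D f -> cintegrable m D g ->
  cintegrable m D (fun t => f t + g t).
Proof.
move=> mD [f1 f2] [g1 g2]; split.
  apply: eq_integrable (integrableD mD f1 g1) => // t _ /=.
  by rewrite Re_add EFinD.
apply: eq_integrable (integrableD mD f2 g2) => // t _ /=.
by rewrite Im_add EFinD.
Qed.

Lemma cintegrableMl d (T : measurableType d) (m : {measure set T -> \bar R})
    (D : set T) (c : R[i]) (f : T -> R[i]) :
  measurable D -> cintegrable m D f -> cintegrable m D (fun t => c * f t).
Proof.
move=> mD [f1 f2]; split.
  apply: eq_integrable (integrableB mD (integrableZl mD (Re c) f1) (integrableZl mD (Im c) f2)) => // t _ /=.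
  by rewrite Re_mul EFinB !EFinM.
apply: eq_integrable (integrableD mD (integrableZl mD (Re c) f2) (integrableZl mD (Im c) f1)) => // t _ /=.
by rewrite Im_mul EFinD !EFinM.
Qed.

Lemma cintegralMl d (T : measurableType d) (m : {measure set T -> \bar R})
    (D : set T) (c : R[i]) (f : T -> R[i]) :
  measurable D -> cintegrable m D f ->
  cintegral m D (fun t => c * f t) = c * cintegral m D f.
Proof.
move=> mD [f1 f2].
have i1 a (g : T -> R) : m.-integrable D (EFin \o g) -> m.-integrable D (EFin \o (fun t => a * g t)).
  by move=> ig; apply: eq_integrable (integrableZl mD a ig) => // t _ /=; rewrite EFinM.
apply: complex_ext.
  rewrite Re_mul /= -(RintegralZl (Re c) mD f1) -(RintegralZl (Im c) mD f2) -RintegralB //; try exact: i1.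
  by apply: eq_Rintegral => t _; rewrite Re_mul.
rewrite Im_mul /= -(RintegralZl (Re c) mD f2) -(RintegralZl (Im c) mD f1) -RintegralD //; try exact: i1.
by apply: eq_Rintegral => t _; rewrite Im_mul.
Qed.

Lemma cintegralB d (T : measurableType d) (m : {measure set T -> \bar R})
    (D : set T) (f g : T -> R[i]) :
  measurable D -> cintegrable m D f -> cintegrable m D g ->
  cintegral m D (fun t => f t - g t) = cintegral m D f - cintegral m D g.
Proof.
move=> mD fi gi.
under eq_cintegral => t _ do rewrite -mulN1r.
by rewrite cintegralD // ?cintegralMl // ?mulN1r //; exact: cintegrableMl.
Qed.

Definition cdiff (f : R -> R[i]) t := exists l, cderive f t l.

Lemma cdiff_cst (c : R[i]) t : cdiff (fun=> c) t.
Proof. by exists 0; exact: cderive_cst. Qed.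

Lemma cdiff_id t : cdiff (fun s => s%:C) t.
Proof. by exists 1; exact: cderive_id. Qed.

Lemma cdiff_of (f : R -> R[i]) t l : cderive f t l -> cdiff f t.
Proof. by exists l. Qed.

Lemma cdiffD (f g : R -> R[i]) t : cdiff f t -> cdiff g t -> cdiff (fun s => f s + g s) t.
Proof. by move=> [a h] [b k]; exists (a + b); exact: cderiveD. Qed.

Lemma cdiffN (f : R -> R[i]) t : cdiff f t -> cdiff (fun s => - f s) t.
Proof. by move=> [a h]; exists (- a); exact: cderiveN. Qed.

Lemma cdiffM (f g : R -> R[i]) t : cdiff f t -> cdiff g t -> cdiff (fun s => f s * g s) t.
Proof. by move=> [a h] [b k]; eexists; exact: (cderiveM h k). Qed.

Lemma cdiffV (f : R -> R[i]) t : f t != 0 -> cdiff f t -> cdiff (fun s => (f s)^-1) t.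
Proof. by move=> f0 [a h]; eexists; exact: (cderiveV f0 h). Qed.

Lemma cdiff_cexp (f : R -> R[i]) t : cdiff f t -> cdiff (fun s => cexp (f s)) t.
Proof. by move=> [a h]; eexists; exact: (cderive_cexp h). Qed.

Lemma cdiff_cmeasurable (D : set R) (f : R -> R[i]) : measurable D ->
  (forall t, D t -> cdiff f t) -> cmeasurable D f.
Proof.
move=> mD h; split; apply: continuous_measurable_on => // t /h [l];
  by move=> /cderive_continuous [].
Qed.

Definition ccvg (F : set_system R) (f : R -> R[i]) (l : R[i]) :=
  (Re (f x) @[x --> F] --> Re l) /\ (Im (f x) @[x --> F] --> Im l).

Lemma cFTC_halfline (F f : R -> R[i]) (l : R[i]) :
  (forall t, 0 <= t -> cderive F t (f t)) ->
  (forall t, 0 <= t -> cdiff f t) ->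
  cintegrable mu Rp f -> ccvg +oo F l ->
  cintegral mu Rp f = l - F 0.
Proof.
move=> dF cf [f1 f2] [l1 l2]; apply: complex_ext; rewrite ?Re_sub ?Im_sub /=.
  apply: (FTC_halfline (F := fun t => Re (F t))) => // t t0.
    by case: (dF t t0).
  by have [a /cderive_continuous []] := cf t t0.
apply: (FTC_halfline (F := fun t => Im (F t))) => // t t0.
  by case: (dF t t0).
by have [a /cderive_continuous []] := cf t t0.
Qed.

Lemma Rderive_under d (Y : measurableType d) (m : {measure set Y -> \bar R})
    (f fd : R -> Y -> R) (B : set Y) (a u v : R) (G : Y -> R) :
  measurable B -> u < a < v ->
  (forall x, u < x < v -> m.-integrable B (EFin \o f x)) ->
  (forall x y, u < x < v -> B y -> is_derive x (1 : R) (fun s => f s y) (fd x y)) ->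
  (forall y, 0 <= G y) -> m.-integrable B (EFin \o G) ->
  (forall x y, u < x < v -> B y -> `|fd x y| <= G y) ->
  is_derive a (1 : R) (fun x => \int[m]_(y in B) f x y) (\int[m]_(y in B) fd a y).
Proof.
move=> mB auv fi df G0 Gi fG.
have Ia : (`]u, v[%classic : set R) a by rewrite /= in_itv.
have fi' (x : R) : (`]u, v[%classic : set R) x -> m.-integrable B (EFin \o f x).
  by rewrite /= in_itv => /= /fi.
have pE (x : R) y : (`]u, v[%classic : set R) x -> B y -> partial1of2 f x y = fd x y.
  rewrite /= in_itv /= => xuv By; rewrite partial1of2E.
  exact: (@derive_val _ _ _ _ _ _ _ (df x y xuv By)).
have df' (x : R) y : (`]u, v[%classic : set R) x -> B y -> derivable (f^~ y) x 1.
  by rewrite /= in_itv /= => xuv By; case: (df x y xuv By).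
have fG' (x : R) y : (`]u, v[%classic : set R) x -> B y -> `|partial1of2 f x y| <= G y.
  by move=> Ix By; rewrite pE //; apply: fG => //; move: Ix; rewrite /= in_itv.
split; first exact: (derivable_under_integral mB Ia fi' df' G0 Gi fG').
rewrite -derive1E (differentiation_under_integral mB Ia fi' df' G0 Gi fG').
by apply: eq_Rintegral => y /set_mem By; rewrite pE.
Qed.

Lemma cderive_under d (Y : measurableType d) (m : {measure set Y -> \bar R})
    (f fd : R -> Y -> R[i]) (B : set Y) (a u v : R) (G : Y -> R) :
  measurable B -> u < a < v ->
  (forall x, u < x < v -> cintegrable m B (f x)) ->
  (forall x y, u < x < v -> B y -> cderive (fun s => f s y) x (fd x y)) ->
  (forall y, 0 <= G y) -> m.-integrable B (EFin \o G) ->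
  (forall x y, u < x < v -> B y -> normc (fd x y) <= G y) ->
  cderive (fun x => cintegral m B (f x)) a (cintegral m B (fd a)).
Proof.
move=> mB auv fi df G0 Gi fG; split.
  apply: (@Rderive_under _ _ m (fun x y => Re (f x y)) (fun x y => Re (fd x y)) B a u v G mB auv) => //.
  - by move=> x /fi [].
  - by move=> x y xuv By; case: (df x y xuv By).
  - by move=> x y xuv By; apply: le_trans (Re_le_normc _) _; exact: fG.
apply: (@Rderive_under _ _ m (fun x y => Im (f x y)) (fun x y => Im (fd x y)) B a u v G mB auv) => //.
- by move=> x /fi [].
- by move=> x y xuv By; case: (df x y xuv By).
- by move=> x y xuv By; apply: le_trans (Im_le_normc _) _; exact: fG.
Qed.

Lemma Rcvg_under0 d (Y : measurableType d) (m : {measure set Y -> \bar R})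
    (f : R -> Y -> R) (B : set Y) (G : Y -> R) :
  measurable B ->
  (forall x, 0 <= x < 1 -> measurable_fun B (f x)) ->
  (forall x y, 0 <= x < 1 -> B y -> {for x, continuous (fun s => f s y)}) ->
  m.-integrable B (EFin \o G) ->
  (forall x y, 0 <= x < 1 -> B y -> `|f x y| <= G y) ->
  \int[m]_(y in B) f x y @[x --> 0^'+] --> \int[m]_(y in B) f 0 y.
Proof.
move=> mB mf cf Gi fG.
apply/cvg_at_rightP => u [u0 ul].
have [N _ uN] : \forall n \near \oo, u n < 1.
  by apply: (cvgr_lt _ ul); rewrite ltr01.
rewrite -(cvg_shiftn N (fun n => \int[m]_(y in B) f (u n) y)).
have un n : 0 <= u (n + N)%N < 1 by rewrite (ltW (u0 _)) /=; apply: uN; exact: leq_addl.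
apply: (@Rdominated_cvg _ _ _ m B (fun n => f (u (n + N)%N)) (f 0) G) => //.
- by move=> n; exact: mf.
- by apply: mf; rewrite lexx ltr01.
- move=> t Bt; have c0 : f x t @[x --> 0] --> f 0 t by apply: cf; rewrite ?lexx ?ltr01.
  have ul' : u (n + N)%N @[n --> \oo] --> 0 by rewrite (cvg_shiftn N).
  exact: (cvg_comp _ _ ul' c0).
- by move=> n t Bt; exact: fG.
Qed.

Lemma ccvg_under0 d (Y : measurableType d) (m : {measure set Y -> \bar R})
    (f : R -> Y -> R[i]) (B : set Y) (G : Y -> R) :
  measurable B ->
  (forall x, 0 <= x < 1 -> cmeasurable B (f x)) ->
  (forall x y, 0 <= x < 1 -> B y -> cdiff (fun s => f s y) x) ->
  m.-integrable B (EFin \o G) ->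
  (forall x y, 0 <= x < 1 -> B y -> normc (f x y) <= G y) ->
  ccvg 0^'+ (fun x => cintegral m B (f x)) (cintegral m B (f 0)).
Proof.
move=> mB mf cf Gi fG; split.
  apply: (Rcvg_under0 (f := fun x y => Re (f x y)) (G := G)) => //.
  - by move=> x /mf [].
  - by move=> x y x01 By; have [l /cderive_continuous []] := cf x y x01 By.
  - by move=> x y x01 By; apply: le_trans (Re_le_normc _) _; exact: fG.
apply: (Rcvg_under0 (f := fun x y => Im (f x y)) (G := G)) => //.
- by move=> x /mf [].
- by move=> x y x01 By; have [l /cderive_continuous []] := cf x y x01 By.
- by move=> x y x01 By; apply: le_trans (Im_le_normc _) _; exact: fG.
Qed.

Section ccvg_algebra.
Variables (F : set_system R).
Context {FF : Filter F}.

Lemma ccvg_cst (c : R[i]) : ccvg F (fun=> c) c.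
Proof. by split; exact: cvg_cst. Qed.

Lemma ccvgD f g a b : ccvg F f a -> ccvg F g b -> ccvg F (fun x => f x + g x) (a + b).
Proof.
move=> [f1 f2] [g1 g2]; split; rewrite ?Re_add ?Im_add.
  by under eq_fun do rewrite Re_add; apply: cvgD.
by under eq_fun do rewrite Im_add; apply: cvgD.
Qed.

Lemma ccvgM f g a b : ccvg F f a -> ccvg F g b -> ccvg F (fun x => f x * g x) (a * b).
Proof.
move=> [f1 f2] [g1 g2]; split; rewrite ?Re_mul ?Im_mul.
  by under eq_fun do rewrite Re_mul; apply: cvgB; apply: cvgM.
by under eq_fun do rewrite Im_mul; apply: cvgD; apply: cvgM.
Qed.

Lemma ccvgN f a : ccvg F f a -> ccvg F (fun x => - f x) (- a).
Proof.
move=> [f1 f2]; split; rewrite ?Re_opp ?Im_opp.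
  by under eq_fun do rewrite Re_opp; apply: cvgN.
by under eq_fun do rewrite Im_opp; apply: cvgN.
Qed.

Lemma ccvg_squeeze0 (f : R -> R[i]) (g : R -> R) :
  (\forall x \near F, normc (f x) <= g x) -> g x @[x --> F] --> 0 -> ccvg F f 0.
Proof.
move=> fg g0; split.
  apply: (@squeeze_cvgr _ _ _ _ (fun x => - g x) g) => //.
    near=> x; rewrite -ler_norml; apply: le_trans (Re_le_normc _) _; by near: x.
  by rewrite -oppr0; apply: cvgN.
apply: (@squeeze_cvgr _ _ _ _ (fun x => - g x) g) => //.
  near=> x; rewrite -ler_norml; apply: le_trans (Im_le_normc _) _; by near: x.
by rewrite -oppr0; apply: cvgN.
Unshelve. all: by end_near. Qed.

End ccvg_algebra.

End complex_integral.

(** * Exponential integrals *)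

Section exponential_integrals.
Context {R : realType}.
Notation mu := (@lebesgue_measure R).
Notation Rp := (`[(0:R), +oo[%classic).
Implicit Types (z w p u : R[i]) (s t x : R).

Lemma RpE t : Rp t -> 0 <= t.
Proof. by rewrite /= in_itv /= andbT. Qed.

Lemma mean_value_bound (f f' : R -> R) (a b M : R) : a <= b ->
  (forall x, a <= x <= b -> is_derive x (1 : R) f (f' x)) ->
  (forall x, a <= x <= b -> `|f' x| <= M) -> `|f b - f a| <= M * (b - a).
Proof.
rewrite le_eqVlt => /predU1P[->|ab] df fM; first by rewrite !subrr normr0 mulr0.
have [||c cab ->] := @MVT _ f f' a b ab.
- move=> x; rewrite in_itv /= => /andP[ax xb]; apply: df.
  by rewrite (ltW ax) (ltW xb).
- apply: continuous_in_subspaceT => x /set_mem /=; rewrite in_itv /= => xab.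
  exact: rder_continuous (df x xab).
rewrite normrM (gtr0_norm (x := b - a)) ?subr_gt0// ler_wpM2r ?subr_ge0 ?(ltW ab)//.
by apply: fM; move: cab; rewrite in_itv /= => /andP[ax xb]; rewrite (ltW ax) (ltW xb).
Qed.

Lemma cderive0_eq (f : R -> R[i]) (a b : R) : a <= b ->
  (forall x, a <= x <= b -> cderive f x 0) -> f a = f b.
Proof.
move=> ab df; apply/esym/complex_ext; apply/eqP; rewrite -subr_eq0 -normr_le0.
  rewrite -(mul0r (b - a)).
  apply: (@mean_value_bound (fun x => Re (f x)) (fun=> 0)) => // x xab.
    by have [] := df x xab.
  by rewrite normr0.
rewrite -(mul0r (b - a)).
apply: (@mean_value_bound (fun x => Im (f x)) (fun=> 0)) => // x xab.
  by have [] := df x xab.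
by rewrite normr0.
Qed.

Lemma cderive_affine w0 w x : cderive (fun x => w0 + x%:C * w) x w.
Proof.
apply: cderive_eq (cderiveD (cderive_cst w0 x) (cderiveM (cderive_id x) (cderive_cst w x))) _.
by rewrite mulr0 addr0 mul1r add0r.
Qed.

Lemma normcB_le z w : normc (z - w) <= normc z + normc w.
Proof. by rewrite (le_trans (normcD_le _ _))// normcN. Qed.

Lemma normc_cexp_le z : normc (cexp z) <= expR (normc z).
Proof. by rewrite normc_cexp ler_expR (le_trans _ (Re_le_normc z))// ler_norm. Qed.

Lemma normc_cexpB1 z : normc (cexp z - 1) <= 2 * normc z * expR (normc z).
Proof.
have d x : cderive (fun x => cexp (0 + x%:C * z)) x (z * cexp (x%:C * z)).
  by apply: cderive_eq (cderive_cexp (cderive_affine 0 z x)) _; rewrite add0r.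
have b x : 0 <= x <= 1 -> normc (z * cexp (x%:C * z)) <= normc z * expR (normc z).
  move=> /andP[x0 x1]; rewrite normcM ler_wpM2l ?normc_ge0//.
  rewrite (le_trans (normc_cexp_le _))// ler_expR normcM normcC ger0_norm//.
  by rewrite ler_piMl// normc_ge0.
apply: le_trans (normc_le_ReIm _) _.
rewrite Re_sub Im_sub Re_1 Im_1 -mulrA mulr_natl mulr2n.
rewrite -[X in _ <= X + X]mulr1 -[X in _ <= _ * X + _ * X](subr0 (1:R)).
apply: lerD.
  have := @mean_value_bound (fun x => Re (cexp (0 + x%:C * z))) (fun x => Re (z * cexp (x%:C * z))) 0 1
    (normc z * expR (normc z)) ler01.
  rewrite !add0r mul0r cexp0 mul1r Re_1; apply => x x01; first by case: (d x).
  exact: le_trans (Re_le_normc _) (b x x01).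
have := @mean_value_bound (fun x => Im (cexp (0 + x%:C * z))) (fun x => Im (z * cexp (x%:C * z))) 0 1
    (normc z * expR (normc z)) ler01.
rewrite !add0r mul0r cexp0 mul1r Im_1; apply => x x01; first by case: (d x).
exact: le_trans (Im_le_normc _) (b x x01).
Qed.

(** All half-line integrals below run over [t >= 0]; [rinv t] is then the point of
    a unit segment that moves from 1 down to 0. *)
Definition rinv t : R[i] := ((1 + t)^-1)%:C.

Lemma onep_neq0 t : 0 <= t -> 1 + t != 0.
Proof. by move=> t0; rewrite gt_eqF// ltr_pwDl. Qed.

Lemma rinvE t : 0 <= t -> rinv t * (1 + t)%:C = 1.
Proof. by move=> t0; rewrite /rinv -rmorphM /= mulVf// onep_neq0. Qed.

Lemma cderive_onep t : cderive (fun t => (1 + t)%:C) t 1.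
Proof.
apply: (cderive_real (f := fun t => 1 + t)).
apply: (is_derive_eq (rderD (is_derive_cst _ _ _) (is_derive_id _ _))).
by rewrite add0r.
Qed.

Lemma cderive_rinv t : 0 <= t -> cderive rinv t (- rinv t ^+ 2).
Proof.
move=> t0.
have h := rderV (onep_neq0 t0) (rderD (is_derive_cst (1:R) t 1) (is_derive_id t (1:R))).
have := cderive_real h; rewrite add0r => /cderive_eq; apply.
by rewrite /rinv -rmorphXn -rmorphN /= mulN1r exprVn.
Qed.

Lemma normc_rinv t : 0 <= t -> normc (rinv t) = (1 + t)^-1.
Proof. by move=> t0; rewrite normcC ger0_norm// invr_ge0 addr_ge0. Qed.

Lemma normc_rinv2 t : 0 <= t -> normc (rinv t ^+ 2) = (1 + t) ^- 2.
Proof. by move=> t0; rewrite expr2 normcM normc_rinv// -expr2 exprVn. Qed.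

Lemma rinv_le1 t : 0 <= t -> (1 + t)^-1 <= 1.
Proof. by move=> t0; rewrite invf_le1 ?ltr_pwDl// lerDl. Qed.

Lemma cvg_rinv : (1 + t)^-1 @[t --> +oo] --> (0 : R).
Proof.
apply/gtr0_cvgV0 => //; last exact: cvg_addrl.
by near=> t; rewrite ltr_pwDl//; near: t; exact: nbhs_pinfty_ge.
Unshelve. all: by end_near. Qed.

Lemma integrable_scale_inv_sqr (c : R) :
  mu.-integrable Rp (EFin \o (fun t => c * (1 + t) ^- 2)).
Proof.
have mD : measurable (Rp : set (measurableTypeR R)) by exact: measurable_itv.
have := integrableZl mD c integrable_inv_sqr.
by congr (_.-integrable _ _); apply/funext => t /=; rewrite EFinM.
Qed.

Lemma integrable_scale_expRN (a c : R) : 0 < c ->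
  mu.-integrable Rp (EFin \o (fun t => a * expR (- (c * t)))).
Proof.
move=> c0.
have mD : measurable (Rp : set (measurableTypeR R)) by exact: measurable_itv.
have := integrableZl mD a (integrable_expRN c0).
by congr (_.-integrable _ _); apply/funext => t /=; rewrite EFinM.
Qed.

Lemma cintegrable_halfline (f : R -> R[i]) (g : R -> R) :
  (forall t, 0 <= t -> cdiff f t) -> (forall t, 0 <= t -> normc (f t) <= g t) ->
  mu.-integrable Rp (EFin \o g) -> cintegrable mu Rp f.
Proof.
move=> df fg ig; apply: (@cintegrable_dominated _ _ _ mu Rp f g) => //.
  by apply: cdiff_cmeasurable => // t /RpE; exact: df.
by move=> t /RpE; exact: fg.
Qed.

(** The classical integrals of [(1 - exp (- z v)) / v] over the unit interval and of
    [exp (- z v) / v] from 1 to infinity, in the variables [v = rinv t] and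
    [v = 1 + t]: since [d v / v] is [rinv t * d t] up to sign in both cases, both
    live on the same half-line. *)
Definition ein z t := (1 - cexp (- z * rinv t)) * rinv t.
Definition Ein z := cintegral mu Rp (ein z).
Definition eone z t := cexp (- z * (1 + t)%:C) * rinv t.
Definition E1 z := cintegral mu Rp (eone z).

Lemma cdiff_rinv t : 0 <= t -> cdiff rinv t.
Proof. by move=> t0; exists (- rinv t ^+ 2); exact: cderive_rinv. Qed.

Lemma cdiff_onep t : cdiff (fun t => (1 + t)%:C) t.
Proof. by exists 1; exact: cderive_onep. Qed.

Lemma cdiff_ein z t : 0 <= t -> cdiff (ein z) t.
Proof.
move=> t0; apply: cdiffM; last exact: cdiff_rinv.
apply: cdiffD; first exact: cdiff_cst.
apply: cdiffN; apply: cdiff_cexp; apply: cdiffM; first exact: cdiff_cst.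
exact: cdiff_rinv.
Qed.

Lemma cdiff_eone z t : 0 <= t -> cdiff (eone z) t.
Proof.
move=> t0; apply: cdiffM; last exact: cdiff_rinv.
apply: cdiff_cexp; apply: cdiffM; first exact: cdiff_cst.
exact: cdiff_onep.
Qed.

Lemma normc_ein z t : 0 <= t ->
  normc (ein z t) <= 2 * normc z * expR (normc z) * (1 + t) ^- 2.
Proof.
move=> t0; rewrite /ein normcM normc_rinv// -exprVn expr2 mulrA.
rewrite ler_wpM2r ?invr_ge0 ?addr_ge0// -normcN opprB.
apply: le_trans (normc_cexpB1 _) _; rewrite normcM normcN normc_rinv//.
have h : normc z / (1 + t) <= normc z.
  by rewrite ler_piMr ?normc_ge0// rinv_le1.
rewrite mulrA -!mulrA [(1 + t)^-1 * _]mulrC.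
rewrite ler_wpM2l// ler_wpM2l ?normc_ge0//.
by rewrite ler_wpM2r ?invr_ge0 ?addr_ge0// ler_expR.
Qed.

Lemma cintegrable_ein z : cintegrable mu Rp (ein z).
Proof.
apply: (cintegrable_halfline (g := fun t => 2 * normc z * expR (normc z) * (1 + t) ^- 2)) => //.
- by move=> t t0; exact: cdiff_ein.
- exact: normc_ein.
- exact: integrable_scale_inv_sqr.
Qed.

Lemma normc_eone z t : 0 <= t -> 0 < Re z -> normc (eone z t) <= expR (- (Re z * t)).
Proof.
move=> t0 z0; rewrite normcM normc_rinv// normc_cexp.
rewrite -[leRHS]mulr1 ler_pM ?expR_ge0 ?invr_ge0 ?addr_ge0 ?rinv_le1//.
rewrite ler_expR Re_mul Re_opp Re_real Im_real mulr0 subr0 mulrDr mulr1 mulNr.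
by rewrite gerDr oppr_le0 ltW.
Qed.

Lemma cintegrable_eone z : 0 < Re z -> cintegrable mu Rp (eone z).
Proof.
move=> z0; apply: (cintegrable_halfline (g := fun t => 1 * expR (- (Re z * t)))) => //.
- by move=> t t0; exact: cdiff_eone.
- by move=> t t0; rewrite mul1r normc_eone.
- exact: integrable_scale_expRN.
Qed.

Lemma ccvg_cexp (F : set_system R) {FF : Filter F} (f : R -> R[i]) l :
  ccvg F f l -> ccvg F (fun t => cexp (f t)) (cexp l).
Proof.
move=> [f1 f2].
have e : expR (Re (f x)) @[x --> F] --> expR (Re l).
  exact: (cvg_comp _ _ f1 (@continuous_expR R (Re l))).
have c : cos (Im (f x)) @[x --> F] --> cos (Im l).
  exact: (cvg_comp _ _ f2 (@continuous_cos R (Im l))).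
have s : sin (Im (f x)) @[x --> F] --> sin (Im l).
  exact: (cvg_comp _ _ f2 (@continuous_sin R (Im l))).
by split; apply: cvgM.
Qed.

Lemma ccvg_real (F : set_system R) {FF : Filter F} (f : R -> R) (l : R) :
  f x @[x --> F] --> l -> ccvg F (fun t => (f t)%:C) l%:C.
Proof. by move=> h; split => //=; exact: cvg_cst. Qed.

Lemma integral_cexp_rinv z : z != 0 ->
  cintegral mu Rp (fun t => rinv t ^+ 2 * cexp (- z * rinv t)) = (1 - cexp (- z)) / z.
Proof.
move=> z0.
have df t : 0 <= t -> cdiff (fun t => rinv t ^+ 2 * cexp (- z * rinv t)) t.
  move=> t0; apply: cdiffM.
    under eq_fun do rewrite expr2.
    by apply: cdiffM; exact: cdiff_rinv.
  by apply: cdiff_cexp; apply: cdiffM; [exact: cdiff_cst|exact: cdiff_rinv].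
rewrite (@cFTC_halfline _ (fun t => z^-1 * cexp (- z * rinv t)) _ (z^-1 * cexp (- z * 0))) //.
- rewrite mulr0 cexp0 mulr1 /rinv addr0 invr1 mulr1.
  by rewrite -[X in X - _]mulr1 -mulrBr mulrC.
- move=> t t0.
  apply: cderive_eq (cderiveMl _ (cderive_cexp (cderiveMl (- z) (cderive_rinv t0)))) _.
  by rewrite mulrA mulrN mulNr opprK mulKf.
- apply: (cintegrable_halfline (g := fun t => expR (normc z) * (1 + t) ^- 2)) => //.
  + move=> t t0; rewrite normcM normc_rinv2// mulrC ler_wpM2r ?invr_ge0 ?sqr_ge0//.
    apply: le_trans (normc_cexp_le _) _; rewrite ler_expR normcM normcN normc_rinv//.
    by rewrite ler_piMr ?normc_ge0// rinv_le1.
  + exact: integrable_scale_inv_sqr.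
- apply: ccvgM; first exact: ccvg_cst.
  apply: ccvg_cexp; apply: ccvgM; first exact: ccvg_cst.
  by apply: ccvg_real; exact: cvg_rinv.
Qed.

Lemma cderive_Ein w0 w x : w0 + x%:C * w != 0 ->
  cderive (fun x => Ein (w0 + x%:C * w)) x
    (w * ((1 - cexp (- (w0 + x%:C * w))) / (w0 + x%:C * w))).
Proof.
move=> W0; pose W x := w0 + x%:C * w.
pose fd x t := w * (rinv t ^+ 2 * cexp (- W x * rinv t)).
pose M := normc w0 + (`|x| + 1) * normc w.
have WM y : x - 1 < y < x + 1 -> normc (W y) <= M.
  move=> /andP[y1 y2]; rewrite (le_trans (normcD_le _ _))// lerD2l normcM normcC.
  rewrite ler_wpM2r ?normc_ge0// -(subrK x y) (le_trans (ler_normD _ _))//.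
  by rewrite addrC lerD2l ler_norml; apply/andP; split; lra.
have bd y t : x - 1 < y < x + 1 -> 0 <= t -> normc (rinv t ^+ 2 * cexp (- W y * rinv t)) <= expR M * (1 + t) ^- 2.
  move=> yx t0; rewrite normcM normc_rinv2// mulrC ler_wpM2r ?invr_ge0 ?sqr_ge0//.
  apply: le_trans (normc_cexp_le _) _; rewrite ler_expR normcM normcN normc_rinv//.
  by apply: le_trans (WM y yx); rewrite ler_piMr ?normc_ge0// rinv_le1.
have xx : x - 1 < x < x + 1 by lra.
have cf y t : 0 <= t -> cdiff (fun t => rinv t ^+ 2 * cexp (- W y * rinv t)) t.
  move=> t0; apply: cdiffM.
    under eq_fun do rewrite expr2.
    by apply: cdiffM; exact: cdiff_rinv.
  by apply: cdiff_cexp; apply: cdiffM; [exact: cdiff_cst|exact: cdiff_rinv].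
rewrite -integral_cexp_rinv// -cintegralMl //; last first.
  apply: (cintegrable_halfline (g := fun t => expR M * (1 + t) ^- 2)) => //.
  + by move=> t t0; exact: cf.
  + by move=> t t0; exact: bd.
  + exact: integrable_scale_inv_sqr.
apply: (@cderive_under _ _ _ mu (fun x => ein (W x)) fd Rp x (x - 1) (x + 1)
   (fun t => normc w * expR M * (1 + t) ^- 2)) => //.
- by move=> y _; exact: cintegrable_ein.
- move=> y t _ /RpE t0; rewrite /ein.
  have h := cderive_cexp (cderiveM (cderiveN (cderive_affine w0 w y)) (cderive_cst (rinv t) y)).
  have h2 := cderiveM (cderiveB (cderive_cst 1 y) h) (cderive_cst (rinv t) y).
  by apply: cderive_eq h2 _; rewrite /fd /W; ring.
- by move=> t; rewrite !mulr_ge0 ?expR_ge0 ?normc_ge0 ?invr_ge0 ?sqr_ge0.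
- exact: integrable_scale_inv_sqr.
- by move=> y t yx /RpE t0; rewrite /fd normcM -mulrA ler_wpM2l ?normc_ge0// bd.
Qed.

Lemma integral_cexp_onep z : 0 < Re z ->
  cintegral mu Rp (fun t => cexp (- z * (1 + t)%:C)) = cexp (- z) / z.
Proof.
move=> z0.
have zn0 : z != 0 by apply/eqP => h; move: z0; rewrite h ltxx.
have nE t : normc (cexp (- z * (1 + t)%:C)) = expR (- Re z) * expR (- (Re z * t)).
  by rewrite normc_cexp Re_mul Re_opp Re_real Im_real mulr0 subr0 mulNr mulrDr mulr1 opprD expRD.
have df t : cdiff (fun t => cexp (- z * (1 + t)%:C)) t.
  by apply: cdiff_cexp; apply: cdiffM; [exact: cdiff_cst|exact: cdiff_onep].
rewrite (@cFTC_halfline _ (fun t => - z^-1 * cexp (- z * (1 + t)%:C)) _ (- z^-1 * 0)) //.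
- by rewrite mulr0 add0r addr0 mulr1 mulNr opprK mulrC.
- move=> t t0.
  apply: cderive_eq (cderiveMl _ (cderive_cexp (cderiveMl (- z) (cderive_onep t)))) _.
  by rewrite mulr1 mulrA mulrNN mulVf // mul1r.
- apply: (cintegrable_halfline (g := fun t => expR (- Re z) * expR (- (Re z * t)))) => //.
  + by move=> t _; rewrite nE.
  + exact: integrable_scale_expRN.
- apply: ccvgM; first exact: ccvg_cst.
  apply: (ccvg_squeeze0 (g := fun t => expR (- Re z) * expR (- (Re z * t)))).
    by apply: nearW => t; rewrite nE.
  rewrite -[X in _ --> X](mulr0 (expR (- Re z))); apply: cvgM; first exact: cvg_cst.
  exact: cvg_expRN.
Qed.

Lemma cderive_E1 w0 w x : 0 < Re (w0 + x%:C * w) ->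
  cderive (fun x => E1 (w0 + x%:C * w)) x
    (- w * (cexp (- (w0 + x%:C * w)) / (w0 + x%:C * w))).
Proof.
move=> W0; pose W x := w0 + x%:C * w.
pose fd x t := - w * cexp (- W x * (1 + t)%:C).
pose c := Re (W x) / 2.
have c0 : 0 < c by rewrite divr_gt0.
pose e := c / (normc w + 1).
have n0 : 0 < normc w + 1 by rewrite ltr_wpDl ?normc_ge0.
have e0 : 0 < e by rewrite divr_gt0.
have Wc y : x - e < y < x + e -> c <= Re (W y).
  move=> /andP[y1 y2].
  have -> : Re (W y) = Re (W x) + (y - x) * Re w.
    by rewrite /W !Re_add !Re_mul !Re_real !Im_real; ring.
  have -> : Re (W x) = c + c by rewrite /c; field.
  rewrite -addrA lerDl -lerBlDl sub0r lerNl -mulNr.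
  apply: le_trans (ler_norm _) _; rewrite normrM normrN.
  have h1 : `|y - x| <= e by rewrite ler_norml; apply/andP; split; lra.
  have h2 : `|Re w| <= normc w + 1 by rewrite (le_trans (Re_le_normc w))// lerDl.
  by apply: (le_trans (ler_pM _ _ h1 h2)) => //; rewrite /e divfK// gt_eqF.
have bd y t : x - e < y < x + e -> 0 <= t -> normc (cexp (- W y * (1 + t)%:C)) <= expR (- (c * t)).
  move=> yx t0; rewrite normc_cexp ler_expR Re_mul Re_opp Re_real Im_real mulr0 subr0 mulNr.
  rewrite lerN2; apply: ler_pM => //; [exact: ltW|exact: Wc|by rewrite lerDr].
have xx : x - e < x < x + e by lra.
have df y t : cdiff (fun t => cexp (- W y * (1 + t)%:C)) t.
  by apply: cdiff_cexp; apply: cdiffM; [exact: cdiff_cst|exact: cdiff_onep].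
rewrite -integral_cexp_onep// -cintegralMl //; last first.
  apply: (cintegrable_halfline (g := fun t => 1 * expR (- (c * t)))) => //.
  + by move=> t t0; exact: df.
  + by move=> t t0; rewrite mul1r; exact: bd.
  + exact: integrable_scale_expRN.
apply: (@cderive_under _ _ _ mu (fun x => eone (W x)) fd Rp x (x - e) (x + e)
   (fun t => normc w * expR (- (c * t)))) => //.
- by move=> y yx; apply: cintegrable_eone; apply: lt_le_trans c0 (Wc y yx).
- move=> y t _ /RpE t0; rewrite /eone.
  have h := cderive_cexp (cderiveM (cderiveN (cderive_affine w0 w y)) (cderive_cst ((1 + t)%:C) y)).
  have h2 := cderiveM h (cderive_cst (rinv t) y).
  apply: cderive_eq h2 _; rewrite /fd /W mulr0 mulr0 !addr0.
  by rewrite -[RHS]mulr1 -(rinvE t0); ring.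
- by move=> t; rewrite mulr_ge0 ?expR_ge0 ?normc_ge0.
- exact: integrable_scale_expRN.
- by move=> y t yx /RpE t0; rewrite /fd normcM normcN ler_wpM2l ?normc_ge0// bd.
Qed.

(** The principal logarithm on the right half-plane only, written so that both of
    its components can be differentiated along lines. *)
Definition clog z : R[i] :=
  (2^-1 * ln (Re z ^+ 2 + Im z ^+ 2)) +i* atan (Im z / Re z).

Lemma cderive_clog w0 w x : 0 < Re (w0 + x%:C * w) ->
  cderive (fun x => clog (w0 + x%:C * w)) x (w / (w0 + x%:C * w)).
Proof.
move=> W0; have [d1 d2] := cderive_affine w0 w x.
set W := fun x => w0 + x%:C * w.
have r0 : Re (W x) != 0 by rewrite gt_eqF.
have n0 : 0 < Re (W x) * Re (W x) + Im (W x) * Im (W x).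
  by rewrite ltr_pwDl ?mulr_gt0// -expr2 sqr_ge0.
split.
  have h := rderMl 2^-1 (rder_comp (f := @ln R) (g := fun x => Re (W x) * Re (W x) + Im (W x) * Im (W x))
     (is_derive1_ln n0) (rderD (rderM d1 d1) (rderM d2 d2))).
  rewrite (_ : (fun s => Re (clog (w0 + s%:C * w))) =
    (fun s => 2^-1 * ln (Re (W s) * Re (W s) + Im (W s) * Im (W s)))); last first.
    by apply/funext => s; rewrite /= !expr2.
  apply: (is_derive_eq h).
  rewrite -[w0 + _ * w]/(W x) Re_mul Re_inv Im_inv !expr2 -/W.
  by field; rewrite gt_eqF.
have h := rder_comp (f := @atan R) (g := fun x => Im (W x) / Re (W x))
     (is_derive1_atan _) (rderM d2 (rderV r0 d1)).
apply: (is_derive_eq h).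
rewrite -[w0 + _ * w]/(W x) Im_mul Re_inv Im_inv !expr2 -/W.
field.
by rewrite r0 gt_eqF//= -!expr2.
Qed.

Lemma clog1 : clog 1 = 0.
Proof. by rewrite /clog /= mul0r atan0 expr1n expr0n addr0 ln1 mulr0. Qed.

Lemma Re_segment_gt0 p x : 0 < Re p -> 0 <= x <= 1 -> 0 < Re (1 + x%:C * (p - 1)).
Proof.
move=> p0 /andP[x0 x1].
rewrite Re_add Re_mul Re_sub /= mul0r subr0.
have [->|xn1] := eqVneq x 1; first by rewrite mul1r addrC subrK.
have {}x1 : x < 1 by rewrite lt_neqAle xn1.
have -> : 1 + x * (Re p - 1) = (1 - x) + x * Re p by ring.
by rewrite ltr_pwDl ?subr_gt0// mulr_ge0// ltW.
Qed.

Lemma Re_gt0_neq0 z : 0 < Re z -> z != 0.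
Proof. by move=> z0; apply/eqP => h; move: z0; rewrite h ltxx. Qed.

Lemma segment0 p : 1 + (0 : R)%:C * (p - 1) = 1.
Proof. by rewrite rmorph0 mul0r addr0. Qed.

Lemma segment1 p : 1 + (1 : R)%:C * (p - 1) = p.
Proof. by rewrite rmorph1 mul1r addrC subrK. Qed.

Lemma cexp_clog p : 0 < Re p -> cexp (clog p) = p.
Proof.
move=> p0.
pose f x := cexp (clog (1 + x%:C * (p - 1))) * (1 + x%:C * (p - 1))^-1.
have h : f 0 = f 1.
  apply: (@cderive0_eq f 0 1 ler01) => x x01.
  have W0 := Re_segment_gt0 p0 x01.
  have Wn0 := Re_gt0_neq0 W0.
  have d1 := cderive_cexp (cderive_clog W0).
  have d2 := cderiveV Wn0 (cderive_affine 1 (p - 1) x).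
  apply: (cderive_eq (cderiveM d1 d2)).
  rewrite expr2; field; exact: Wn0.
move: h; rewrite /f segment0 segment1 clog1 cexp0 invr1 mulr1.
by move=> h; rewrite -[LHS](divfK (Re_gt0_neq0 p0)) -h mul1r.
Qed.

(** Along the segment from 1 to [p] the exponentials in the derivatives of [Ein] and
    [E1] cancel, which leaves the derivative of the logarithm. *)
Lemma Ein_E1_clog p : 0 < Re p -> Ein p - E1 p = Ein 1 - E1 1 + clog p.
Proof.
move=> p0.
pose f x := Ein (1 + x%:C * (p - 1)) - E1 (1 + x%:C * (p - 1)) -
  clog (1 + x%:C * (p - 1)).
have h : f 0 = f 1.
  apply: (@cderive0_eq f 0 1 ler01) => x x01.
  have W0 := Re_segment_gt0 p0 x01.
  have Wn0 := Re_gt0_neq0 W0.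
  apply: cderive_eq (cderiveB (cderiveB (cderive_Ein Wn0) (cderive_E1 W0)) (cderive_clog W0)) _.
  by field.
move: h; rewrite /f segment0 segment1 clog1 subr0 => ->.
by rewrite subrK.
Qed.

Lemma normc_cintegral (f : R -> R[i]) (g : R -> R) (I : R) :
  (forall t, 0 <= t -> cdiff f t) -> (forall t, 0 <= t -> normc (f t) <= g t) ->
  mu.-integrable Rp (EFin \o g) -> \int[mu]_(t in Rp) g t = I ->
  normc (cintegral mu Rp f) <= 2 * I.
Proof.
move=> df fg ig <-.
have [i1 i2] := cintegrable_halfline df fg ig.
have b (h : R -> R) : mu.-integrable Rp (EFin \o h) ->
    (forall t, 0 <= t -> `|h t| <= g t) ->
    `|\int[mu]_(t in Rp) h t| <= \int[mu]_(t in Rp) g t.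
  move=> ih hg; apply: le_trans (le_normr_Rintegral _ _) _ => //.
  apply: le_Rintegral => //; first exact: (integrable_norm ih).
  by move=> t /RpE; exact: hg.
apply: le_trans (normc_le_ReIm _) _; rewrite mulr_natl mulr2n lerD //=; apply: b => //.
  by move=> t t0; apply: le_trans (Re_le_normc _) _; exact: fg.
by move=> t t0; apply: le_trans (Im_le_normc _) _; exact: fg.
Qed.

Lemma Rintegral_expRN c : 0 < c -> \int[mu]_(t in Rp) expR (- (c * t)) = c^-1.
Proof. by move=> c0; rewrite /Rintegral integral_expRN. Qed.

Lemma normc_E1 z : 0 < Re z -> normc (E1 z) <= 2 * (Re z)^-1.
Proof.
move=> z0; apply: (normc_cintegral (g := fun t => expR (- (Re z * t)))).
- by move=> t t0; exact: cdiff_eone.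
- by move=> t t0; exact: normc_eone.
- exact: integrable_expRN.
- exact: Rintegral_expRN.
Qed.

Lemma FTC_cintegral_real (F f g : R -> R) (l : R) :
  (forall t, 0 <= t -> is_derive t (1 : R) F (f t)) ->
  (forall t, 0 <= t -> cdiff (fun t => (f t)%:C) t) ->
  (forall t, 0 <= t -> `|f t| <= g t) -> mu.-integrable Rp (EFin \o g) ->
  F t @[t --> +oo] --> l ->
  mu.-integrable Rp (EFin \o f) /\ \int[mu]_(t in Rp) f t = l - F 0.
Proof.
move=> dF cf fg ig Fl.
have fi : mu.-integrable Rp (EFin \o f).
  have fg' t : 0 <= t -> normc (f t)%:C <= g t by move=> t0; rewrite normcC fg.
  by have [] := cintegrable_halfline cf fg' ig.
split => //; apply: FTC_halfline => // t t0.
by have [a /cderive_continuous []] := cf t t0.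
Qed.

End exponential_integrals.

(** * Euler's constant *)

Section euler_constant.
Context {R : realType}.
Notation mu := (@lebesgue_measure R).
Notation Rp := (`[(0:R), +oo[%classic).
Implicit Types (z w p u : R[i]) (s t x : R).

Let r t : R := (1 + t)^-1.

Let rder_r t : 0 <= t -> is_derive t (1 : R) r (- r t ^+ 2).
Proof. by move=> t0; have [] := cderive_rinv t0; rewrite -rmorphXn -rmorphN. Qed.

Let r01 t : 0 <= t -> 0 <= r t <= 1.
Proof. by move=> t0; rewrite invr_ge0 addr_ge0//= rinv_le1. Qed.

Lemma rder_exp (f : R -> R) t a n : is_derive t (1 : R) f a ->
  is_derive t (1 : R) (fun s => f s ^+ n.+1) (n.+1%:R * f t ^+ n * a).
Proof.
move=> h; elim: n => [|n IH].
  by under eq_fun do rewrite expr1; rewrite expr0 mulr1 mul1r.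
under eq_fun do rewrite exprS.
apply: (is_derive_eq (rderM h IH)).
by rewrite exprS -[n.+2%:R]natr1; ring.
Qed.

Lemma cdiff_rexp n t : 0 <= t -> cdiff (fun t => (r t ^+ n)%:C) t.
Proof.
move=> t0; case: n => [|n].
  by under eq_fun do rewrite expr0; exact: cdiff_cst.
by eexists; apply: cderive_real; apply: rder_exp; exact: rder_r.
Qed.

Lemma cdiff_1Br n t : 0 <= t -> cdiff (fun t => ((1 - r t) ^+ n)%:C) t.
Proof.
move=> t0; case: n => [|n].
  by under eq_fun do rewrite expr0; exact: cdiff_cst.
eexists; apply: cderive_real; apply: rder_exp.
exact: (rderB (is_derive_cst (1 : R) t (1:R)) (rder_r t0)).
Qed.

(** With [v = r t], this is the integral of [(1 - (1 - v) ^ n) / v] over the unit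
    interval; adding one factor [1 - v] adds the integral of [(1 - v) ^ n]. *)
Lemma harmonic_integral n :
  mu.-integrable Rp (EFin \o (fun t => (1 - (1 - r t) ^+ n) * r t)) /\
  \int[mu]_(t in Rp) ((1 - (1 - r t) ^+ n) * r t) = series harmonic n.
Proof.
have r0 : r 0 = 1 by rewrite /r addr0 invr1.
have h1 m : mu.-integrable Rp (EFin \o (fun t => (1 - r t) ^+ m * r t ^+ 2)) /\
   \int[mu]_(t in Rp) ((1 - r t) ^+ m * r t ^+ 2) = m.+1%:R^-1.
  have := @FTC_cintegral_real _ (fun t => m.+1%:R^-1 * (1 - r t) ^+ m.+1)
    (fun t => (1 - r t) ^+ m * r t ^+ 2) (fun t => 1 * (1 + t) ^- 2) m.+1%:R^-1.
  rewrite r0 subrr [0 ^+ _]exprS mul0r mulr0 subr0; apply.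
  - move=> t t0.
    have := rderMl m.+1%:R^-1 (rder_exp m (rderB (is_derive_cst (1 : R) t (1:R)) (rder_r t0))).
    move=> /is_derive_eq; apply.
    by rewrite sub0r opprK !mulrA mulVf ?mul1r// pnatr_eq0.
  - move=> t t0; under eq_fun do rewrite rmorphM.
    by apply: cdiffM; [exact: cdiff_1Br|exact: cdiff_rexp].
  - move=> t t0; have /andP[a b] := r01 t0.
    rewrite normrM [X in _ * X]ger0_norm ?sqr_ge0// -exprVn -/(r t) ler_wpM2r ?sqr_ge0//.
    by rewrite ger0_norm ?exprn_ge0 ?exprn_ile1 ?subr_ge0// gerBl.
  - exact: integrable_scale_inv_sqr.
  - have C j : (1 - r t) ^+ j @[t --> +oo] --> (1 : R).
      elim: j => [|j IH]; first by under eq_fun do rewrite expr0; exact: cvg_cst.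
      under eq_fun do rewrite exprS.
      have h : 1 - r t @[t --> +oo] --> (1 : R).
        rewrite -[X in _ --> X](subr0 (1 : R)).
        by apply: cvgB; [exact: cvg_cst|exact: cvg_rinv].
      have := cvgM h IH; rewrite mulr1; exact.
    have := cvgM (cvg_cst (m.+1%:R^-1 : R)) (C m.+1); rewrite mulr1; exact.
have E m t : (1 - (1 - r t) ^+ m.+1) * r t = (1 - (1 - r t) ^+ m) * r t + (1 - r t) ^+ m * r t ^+ 2.
  by rewrite exprSr; ring.
have mD : measurable (Rp : set (measurableTypeR R)) by exact: measurable_itv.
elim: n => [|n [IH1 IH2]].
  rewrite /series /= big_nil; split.
    have := @integrable0 _ _ _ mu Rp.
    by congr (_.-integrable _ _); apply/funext => t /=; rewrite expr0 subrr mul0r.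
  by under eq_Rintegral => t _ do rewrite expr0 subrr mul0r; rewrite Rintegral_cst// mul0r.
have [g1 g2] := h1 n.
split.
  have := integrableD mD IH1 g1.
  by congr (_.-integrable _ _); apply/funext => t /=; rewrite E EFinD.
under eq_Rintegral => t _ do rewrite E.
rewrite RintegralD // IH2 g2 /series /= big_nat_recr //=.
Qed.

(** From [1 - v <= exp (- v)] and [(1 - v ^ 2) exp (- v) <= 1 - v], the latter
    raised to the power [n] by Bernoulli. *)
Lemma expRN_le_pow (v : R) n : 0 <= v <= 1 ->
  0 <= expR (- (n%:R * v)) - (1 - v) ^+ n <= n%:R * v ^+ 2 * expR (- (n%:R * v)).
Proof.
move=> /andP[v0 v1].
have e1 : expR (- (n%:R * v)) = expR (- v) ^+ n by rewrite -expRM_natl mulrN.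
have h1 : 1 - v <= expR (- v) by exact: expR_ge1Dx.
rewrite subr_ge0 e1 lerXn2r ?nnegrE ?subr_ge0 ?expR_ge0//=.
have h2 : (1 - v ^+ 2) * expR (- v) <= 1 - v.
  have : (1 + v) * expR (- v) <= 1.
    have := ler_wpM2r (expR_ge0 (- v)) (expR_ge1Dx v).
    by rewrite expRxMexpNx_1.
  move=> h; rewrite (_ : 1 - v ^+ 2 = (1 - v) * (1 + v)); last by ring.
  by rewrite -mulrA -[leRHS]mulr1 ler_wpM2l// subr_ge0.
have v2 : 0 <= v ^+ 2 <= 1 by rewrite sqr_ge0 exprn_ile1.
have h3 : 1 - n%:R * v ^+ 2 <= (1 - v ^+ 2) ^+ n.
  elim: n {e1} => [|n IH]; first by rewrite mul0r subr0 expr0.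
  rewrite [leRHS]exprS; apply: (@le_trans _ _ ((1 - v ^+ 2) * (1 - n%:R * v ^+ 2))).
    rewrite -[n.+1%:R]natr1 -subr_ge0.
    rewrite (_ : _ - _ = n%:R * (v ^+ 2) ^+ 2); last by ring.
    by rewrite mulr_ge0// sqr_ge0.
  by rewrite ler_wpM2l// subr_ge0; case/andP: v2.
rewrite lerBlDr -lerBlDl.
apply: (@le_trans _ _ (((1 - v ^+ 2) * expR (- v)) ^+ n)).
  rewrite exprMn -{1}[expR _ ^+ n]mul1r -mulrBl ler_wpM2r ?exprn_ge0 ?expR_ge0//.
rewrite lerXn2r ?nnegrE ?subr_ge0// mulr_ge0 ?expR_ge0// subr_ge0.
by case/andP: v2.
Qed.

Lemma Re_ein_nat n t : Re (ein n%:R t) = (1 - expR (- (n%:R * r t))) * r t :> R.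
Proof.
have E : (- n%:R * rinv t : R[i]) = (- (n%:R * r t))%:C.
  by rewrite rmorphN rmorphM /= rmorph_nat mulNr.
by rewrite /ein E Re_mul Re_sub Im_real /cexp /= cos0 mulr1 mulr0 subr0.
Qed.

(** The integrands differ by [(exp (- n v) - (1 - v) ^ n) / v], at most
    [n v exp (- n v)], whose integral over the unit interval is less than [1 / n]. *)
Lemma Ein_nat_harmonic n :
  `|Re (Ein n.+1%:R) - series harmonic n.+1| <= (n.+1%:R)^-1 :> R.
Proof.
set N := n.+1; have N0 : 0 < N%:R :> R by rewrite ltr0n.
have [iE _] := cintegrable_ein (N%:R : R[i]).
have [iH <-] := @harmonic_integral N.
have mD : measurable (Rp : set (measurableTypeR R)) by exact: measurable_itv.
have dG t : 0 <= t -> is_derive t (1 : R) (fun t => (r t + N%:R^-1) * expR (- (N%:R * r t)))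
   (N%:R * r t ^+ 3 * expR (- (N%:R * r t))).
  move=> t0; have d1 := rderD (rder_r t0) (is_derive_cst (N%:R^-1 : R) t (1:R)).
  have d2 := rder_expR (rderN (rderMl N%:R (rder_r t0))).
  apply: (is_derive_eq (rderM d1 d2)); rewrite /cst.
  by field; rewrite gt_eqF.
have [||||iG eG] := @FTC_cintegral_real _ _ _ (fun t => N%:R * (1 + t) ^- 2) N%:R^-1 dG.
- move=> t t0; eexists; apply: cderive_real; apply: rderM.
    by apply: rderMl; apply: (rder_exp 2); exact: rder_r.
  by apply: rder_expR; apply: rderN; apply: rderMl; exact: rder_r.
- move=> t t0; have /andP[a b] := r01 t0.
  rewrite ger0_norm; last by rewrite !mulr_ge0 ?exprn_ge0 ?expR_ge0// ltW.
  rewrite -exprVn -/(r t).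
  rewrite (_ : _ * _ = N%:R * r t ^+ 2 * (r t * expR (- (N%:R * r t)))); last by ring.
  rewrite ler_piMr ?mulr_ge0 ?sqr_ge0 ?(ltW N0)//.
  rewrite -[leRHS]mulr1 ler_pM ?expR_ge0//.
  by rewrite -expR0 ler_expR oppr_le0 mulr_ge0// ltW.
- exact: integrable_scale_inv_sqr.
- have h : N%:R * r t @[t --> +oo] --> N%:R * (0 : R).
    by apply: cvgM; [exact: cvg_cst|exact: cvg_rinv].
  have h0 : - (N%:R * r t) @[t --> +oo] --> - (N%:R * (0 : R)) by exact: cvgN.
  have h1 := cvg_comp _ _ h0 (@continuous_expR R _).
  have h2 : (r t + N%:R^-1) * expR (- (N%:R * r t)) @[t --> +oo] -->
     (0 + N%:R^-1) * expR (- (N%:R * (0 : R))).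
    apply: cvgM; last exact: h1.
    by apply: cvgD; [exact: cvg_rinv|exact: cvg_cst].
  by move: h2; rewrite mulr0 oppr0 expR0 mulr1 add0r; exact.
rewrite -RintegralB //.
have iD : mu.-integrable Rp (EFin \o (fun t => Re (ein N%:R t) - (1 - (1 - r t) ^+ N) * r t)).
  have := integrableB mD iE iH.
  by congr (_.-integrable _ _); apply/funext => t /=; rewrite EFinB.
apply: (le_trans (le_normr_Rintegral mD iD)).
apply: (@le_trans _ _ (\int[mu]_(t in Rp) (N%:R * r t ^+ 3 * expR (- (N%:R * r t))))).
  apply: le_Rintegral => //; first exact: (integrable_norm iD).
  move=> t /RpE t0; rewrite Re_ein_nat -mulrBl.
  have /andP[h1 h2] := expRN_le_pow N (r01 t0).
  have /andP[a b] := r01 t0.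
  rewrite normrM [X in _ * X]ger0_norm// opprB addrC addrA subrK distrC ger0_norm//.
  by rewrite exprSr mulrA -mulrA [r t * _]mulrC mulrA ler_wpM2r.
rewrite eG gerBl mulr_ge0 ?expR_ge0// addr_ge0 ?invr_ge0 ?(ltW N0)//.
Qed.

Lemma clog_nat n : clog n.+1%:R = (ln (n.+1%:R : R))%:C.
Proof.
have -> : (n.+1%:R : R[i]) = (n.+1%:R : R)%:C by rewrite rmorph_nat.
rewrite /clog /= mul0r atan0 expr0n addr0 lnXn ?ltr0n//.
by rewrite -[X in 2^-1 * X]mulr_natl mulrA mulVf ?mul1r.
Qed.

(** The integral [Ein n] is within [1 / n] of the harmonic number [H_n], and it
    is [Ein 1 - E1 1 + ln n] up to the vanishing [E1 n]. *)
Lemma Re_Ein1_E1 : Re (Ein 1 - E1 1) = euler_gamma :> R.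
Proof.
set c := Re _; pose u n : R := series harmonic n - ln n%:R.
suff : u n.+1 @[n --> \oo] --> c.
  by rewrite (cvg_shiftS u) => /(cvg_lim (@Rhausdorff R)) <-.
pose e n : R := 3 * n.+1%:R^-1.
have e0 : e n @[n --> \oo] --> (0 : R).
  by have := cvgM (cvg_cst (3 : R)) (@cvg_harmonic R); rewrite mulr0; exact.
have ue n : `|u n.+1 - c| <= e n.
  have N0 : 0 < Re (n.+1%:R : R[i]).
    by rewrite -(rmorph_nat (real_complex R)) /= ltr0n.
  have h : Re (Ein n.+1%:R) - Re (E1 n.+1%:R) = c + ln n.+1%:R.
    by rewrite -Re_sub (Ein_E1_clog N0) clog_nat [LHS]Re_add.
  have h1 := Ein_nat_harmonic n.
  have h2 := le_trans (Re_le_normc _) (normc_E1 N0).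
  have h3 : Re (n.+1%:R : R[i]) = n.+1%:R by rewrite -(rmorph_nat (real_complex R)).
  rewrite h3 in h2.
  have -> : u n.+1 - c = (Re (E1 n.+1%:R) - (Re (Ein n.+1%:R) - series harmonic n.+1)) by rewrite /u; lra.
  apply: le_trans (ler_normB _ _) _; apply: le_trans (lerD h2 h1) _.
  by rewrite /e (_ : 2 / n.+1%:R + n.+1%:R^-1 = 3 / n.+1%:R)//; ring.
apply: (@squeeze_cvgr _ _ _ _ (fun n => c - e n) (fun n => c + e n)).
- by apply: nearW => n; rewrite -ler_distl; exact: ue.
- by have := cvgB (cvg_cst c) e0; rewrite subr0; exact.
- by have := cvgD (cvg_cst c) e0; rewrite addr0; exact.
Qed.

Lemma Im_Ein1_E1 : Im (Ein 1 - E1 1) = 0 :> R.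
Proof.
have E0 (f : R -> R[i]) : (forall t, Im (f t) = 0) -> Im (cintegral mu Rp f) = 0.
  move=> f0; rewrite /cintegral /=.
  by under eq_Rintegral => t _ do rewrite f0; rewrite Rintegral_cst// mul0r.
rewrite Im_sub !E0 ?subr0// => t.
  rewrite /eone Im_mul Im_real mulr0 add0r mulN1r /cexp /=.
  by rewrite oppr0 sin0 mulr0 mul0r.
rewrite /ein Im_mul Im_real mulr0 add0r mulN1r Im_sub /cexp /=.
by rewrite oppr0 sin0 mulr0 subr0 mul0r.
Qed.

Lemma Ein_E1 p : 0 < Re p -> Ein p - E1 p = euler_gamma%:C + clog p.
Proof.
move=> p0; rewrite Ein_E1_clog//; congr (_ + _).
by apply: complex_ext; rewrite ?Re_Ein1_E1 ?Im_Ein1_E1.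
Qed.

End euler_constant.

(** * The Bessel system: solution by contour integrals *)

Section macdonald_integral.
Context {R : realType}.
Notation mu := (@lebesgue_measure R).
Notation Rp := (`[(0:R), +oo[%classic).
Implicit Types (z : R[i]) (s t x : R).

Lemma atan_inv (x : R) : 0 < x -> atan x^-1 = pi / 2 - atan x.
Proof.
move=> x0.
have a0 : 0 < atan x by rewrite -(@atan0 R) lt_atan.
have a1 := atan_ltpi2 x.
rewrite -[RHS]tanK; last by rewrite in_itv /=; apply/andP; split; lra.
congr atan; rewrite /tan sinB cosB sin_pihalf cos_pihalf !mul0r !mul1r subr0 add0r.
by rewrite -{1}(atanK x) /tan invf_div.
Qed.

Lemma Re_muli z : Re ('i * z) = - Im z.
Proof. by case: z => a b; rewrite /= mul0r mul1r sub0r. Qed.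

Lemma Im_muli z : Im ('i * z) = Re z.
Proof. by case: z => a b; rewrite /= mul0r mul1r add0r. Qed.

(** In the fourth quadrant a quarter turn does not cross the cut. *)
Lemma clog_mul_i z : 0 < Re z -> Im z < 0 -> clog ('i * z) = clog z + (pi / 2 : R) *i.
Proof.
move=> x0 y0.
apply: complex_ext; rewrite ?Re_add ?Im_add /clog /=.
  by rewrite Re_muli Im_muli sqrrN [X in ln X]addrC addr0.
rewrite Re_muli Im_muli.
have h : 0 < - Im z / Re z by rewrite divr_gt0// oppr_gt0.
have -> : Re z / - Im z = (- Im z / Re z)^-1 by rewrite invf_div.
by rewrite atan_inv// mulNr atanN opprK addrC.
Qed.

Lemma normc_Ein z : normc (Ein z) <= 2 * (2 * normc z * expR (normc z)).
Proof.
have i1 := integrable_scale_inv_sqr (2 * normc z * expR (normc z)).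
apply: (normc_cintegral (g := fun t => 2 * normc z * expR (normc z) * (1 + t) ^- 2)) i1 _.
- by move=> t t0; exact: cdiff_ein.
- by move=> t t0; exact: normc_ein.
have := @FTC_cintegral_real R (fun t => - (1 + t)^-1) (fun t => (1 + t) ^- 2) (fun t => 1 * (1 + t) ^- 2) 0.
rewrite addr0 invr1 sub0r opprK => h.
have [|||||i2 e2] := h.
- move=> t t0; have [d1 _] := cderive_rinv t0.
  apply: (is_derive_eq (rderN d1)).
  by rewrite Re_opp opprK expr2 Re_mul Im_real mul0r subr0 -expr2 exprVn.
- move=> t t0; under eq_fun do rewrite -exprVn expr2 rmorphM.
  by apply: cdiffM; exact: cdiff_rinv.
- by move=> t t0; rewrite mul1r ger0_norm// invr_ge0 sqr_ge0.
- exact: integrable_scale_inv_sqr.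
- by rewrite -oppr0; apply: cvgN; exact: cvg_rinv.
have mD : measurable (Rp : set (measurableTypeR R)) by exact: measurable_itv.
by rewrite (RintegralZl (2 * normc z * expR (normc z)) mD i2) e2 mulr1.
Qed.

Variables (u w p : R[i]).
Hypotheses (hu : Im u < 0) (hw : 0 < Re w) (hw' : Im w <= 0) (hp : 0 < Re p).

Let U t : R[i] := u + t%:C * w.
Let m : R := - Im u.
Let m0 : 0 < m. Proof. by rewrite oppr_gt0. Qed.

Let Im_U t : 0 <= t -> Im (U t) <= Im u.
Proof.
move=> t0; rewrite Im_add Im_mul Re_real Im_real mul0r addr0 gerDl.
by rewrite mulr_ge0_le0.
Qed.

Let Re_U t : Re (U t) = Re u + Re w * t.
Proof. by rewrite Re_add Re_mul Re_real Im_real mul0r subr0 mulrC. Qed.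

Let m_le_U t : 0 <= t -> m <= normc (U t).
Proof.
move=> t0; apply: le_trans (Im_le_normc _).
by rewrite ler0_norm ?lerN2 ?Im_U// (le_trans (Im_U t0))// ltW.
Qed.

Let U_neq0 t : 0 <= t -> U t != 0.
Proof.
move=> t0; apply/eqP => h; have := m_le_U t0; rewrite h normc0.
by rewrite leNgt m0.
Qed.

Let invU_le t : 0 <= t -> normc (U t)^-1 <= m^-1.
Proof.
by move=> t0; rewrite normcV lef_pV2 ?m_le_U// posrE// (lt_le_trans m0)// m_le_U.
Qed.

Let iU t : 'i * U t = 'i * u + t%:C * ('i * w) :> R[i].
Proof. by rewrite /U; ring. Qed.

Let Re_iU t : 0 <= t -> 0 < Re ('i * u + t%:C * ('i * w)).
Proof.
move=> t0; rewrite -iU Re_muli oppr_gt0.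
by rewrite (le_lt_trans (Im_U t0)).
Qed.

Let cdiff_U t : cdiff U t.
Proof. by exists w; exact: cderive_affine. Qed.

(** The exponential integral of [u], along a half-line that may start outside the
    right half-plane: the primitive [clog (i v) - Ein v] exists along the whole
    half-line, and far away, where [v] has positive real part, it equals a constant
    minus [E1 v]. *)
Lemma integral_cexp_ray :
  cintegral mu Rp (fun t => cexp (- U t) * (w / U t)) =
  (pi / 2 : R) *i - euler_gamma%:C - clog ('i * u) + Ein u.
Proof.
rewrite (@cFTC_halfline _ (fun t => clog ('i * u + t%:C * ('i * w)) - Ein (U t)) _
  ((pi / 2 : R) *i - euler_gamma%:C)).
- by rewrite /U rmorph0 !mul0r !addr0 opprB addrA addrAC.
- move=> t t0; apply: cderive_eq (cderiveB (cderive_clog (Re_iU t0)) (cderive_Ein (U_neq0 t0))) _.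
  rewrite -iU -/(U t); have := U_neq0 t0 => U0.
  have i0 : ('i : R[i]) != 0 by rewrite eq_complex /= oner_eq0 andbF.
  by field; rewrite U0 i0.
- move=> t t0; apply: cdiffM; first by apply: cdiff_cexp; apply: cdiffN; exact: cdiff_U.
  by apply: cdiffM; [exact: cdiff_cst|apply: cdiffV; [exact: U_neq0|exact: cdiff_U]].
- apply: (cintegrable_halfline (g := fun t => expR (- Re u) * (normc w / m) * expR (- (Re w * t)))).
  + move=> t t0; apply: cdiffM; first by apply: cdiff_cexp; apply: cdiffN; exact: cdiff_U.
    by apply: cdiffM; [exact: cdiff_cst|apply: cdiffV; [exact: U_neq0|exact: cdiff_U]].
  + move=> t t0; rewrite !normcM normc_cexp Re_opp Re_U opprD expRD mulrAC.
    rewrite ler_wpM2r ?expR_ge0// ler_wpM2l ?expR_ge0// ler_wpM2l ?normc_ge0//.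
    exact: invU_le.
  + exact: integrable_scale_expRN.
- have h : ccvg +oo (fun t => (pi / 2 : R) *i - euler_gamma%:C - E1 (U t))
     ((pi / 2 : R) *i - euler_gamma%:C).
    rewrite -[X in ccvg _ _ X]subr0; apply: ccvgD; first exact: ccvg_cst.
    apply: ccvgN; apply: (ccvg_squeeze0 (g := fun t => 2 * (Re (U t))^-1)).
      near=> t; apply: normc_E1; rewrite Re_U.
      rewrite -ltrBlDl sub0r -ltr_pdivrMl//; near: t; apply: nbhs_pinfty_gt; rewrite ?num_real//.
    rewrite -[X in _ --> X](mulr0 (2 : R)); apply: cvgM; first exact: cvg_cst.
    under eq_fun do rewrite Re_U.
    have h : Re u + Re w * t @[t --> +oo] --> +oo.
      have h1 : Re w * t @[t --> +oo] --> +oo by apply: gt0_cvgMry => //; exact: cvg_id.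
      exact: (cvg_comp _ _ h1 (cvg_addrl (Re u))).
    apply/gtr0_cvgV0 => //.
    near=> t; rewrite -ltrBlDl sub0r -ltr_pdivrMl//; near: t; apply: nbhs_pinfty_gt; rewrite ?num_real//.
  have E : \forall t \near +oo, (pi / 2 : R) *i - euler_gamma%:C - E1 (U t) =
      clog ('i * u + t%:C * ('i * w)) - Ein (U t).
    near=> t.
    have t0 : 0 <= t by near: t; exact: nbhs_pinfty_ge.
    have r0 : 0 < Re (U t).
      rewrite Re_U -ltrBlDl sub0r -ltr_pdivrMl//; near: t; apply: nbhs_pinfty_gt; rewrite ?num_real//.
    rewrite -iU clog_mul_i// ?(le_lt_trans (Im_U t0))//.
    by have := Ein_E1 r0 => /(canRL (subrK _)) ->; ring.
  case: h => h1 h2; split.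
    apply: cvg_trans h1; apply: near_eq_cvg; near=> t; congr Re; near: t; exact: E.
  apply: cvg_trans h2; apply: near_eq_cvg; near=> t; congr Im; near: t; exact: E.
Unshelve. all: by end_near. Qed.

Let q : R[i] := p * u.
(** The exponential [exp (- v - s q / v)] with [q = p u] at the two kinds of points of
    a broken path: [v = u * rinv t] on the segment from 0 to [u], where [q / v] is
    [p * (1 + t)], and [v = U t] on the half-line from [u] in direction [w]. *)
Definition segment_term s t : R[i] := cexp (- (u * rinv t) - s%:C * (p * (1 + t)%:C)).
Definition ray_term s t : R[i] := cexp (- U t - s%:C * (q / U t)).

Let cdiff_segment_term s t : 0 <= t -> cdiff (segment_term s) t.
Proof.
move=> t0; apply: cdiff_cexp; apply: cdiffD; apply: cdiffN.
  by apply: cdiffM; [exact: cdiff_cst|exact: cdiff_rinv].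
apply: cdiffM; first exact: cdiff_cst.
by apply: cdiffM; [exact: cdiff_cst|exact: cdiff_onep].
Qed.

Let cdiff_ray_term s t : 0 <= t -> cdiff (ray_term s) t.
Proof.
move=> t0; apply: cdiff_cexp; apply: cdiffD; apply: cdiffN; first exact: cdiff_U.
apply: cdiffM; first exact: cdiff_cst.
apply: cdiffM; first exact: cdiff_cst.
by apply: cdiffV; [exact: U_neq0|exact: cdiff_U].
Qed.

Let cderive_segment_term s t : cderive (fun s => segment_term s t) s (- (p * (1 + t)%:C) * segment_term s t).
Proof.
apply: cderive_cexp.
have h := cderiveB (cderive_cst (- (u * rinv t)) s)
  (cderiveM (cderive_id s) (cderive_cst (p * (1 + t)%:C) s)).
by apply: cderive_eq h _; ring.
Qed.

Let cderive_ray_term s t : cderive (fun s => ray_term s t) s (- (q / U t) * ray_term s t).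
Proof.
apply: cderive_cexp.
have h := cderiveB (cderive_cst (- U t) s)
  (cderiveM (cderive_id s) (cderive_cst (q / U t) s)).
by apply: cderive_eq h _; ring.
Qed.

Let normc_segment_term s t : 0 <= t -> 0 <= s ->
  normc (segment_term s t) <= expR (normc u) * expR (- (s * Re p * t)).
Proof.
move=> t0 s0; rewrite normc_cexp -expRD ler_expR Re_sub Re_opp.
rewrite (Re_mul s%:C) Re_real Im_real mul0r subr0 (Re_mul p) Re_real Im_real mulr0 subr0.
apply: lerD.
  rewrite -Re_opp; apply: le_trans (ler_norm _) _; apply: le_trans (Re_le_normc _) _.
  rewrite normcN normcM normc_rinv//.
  by rewrite ler_piMr ?normc_ge0// rinv_le1.
rewrite lerN2 -mulrA ler_wpM2l// ler_wpM2l ?(ltW hp)// lerDr //.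
Qed.

Let normc_segment_term_le s t : 0 <= t -> 0 <= s -> normc (segment_term s t) <= expR (normc u).
Proof.
move=> t0 s0; apply: le_trans (normc_segment_term t0 s0) _.
rewrite ler_piMr ?expR_ge0// -expR0 ler_expR oppr_le0.
by rewrite !mulr_ge0// ltW.
Qed.

Let normc_ray_term (b s t : R) : 0 <= t -> 0 <= s <= b ->
  normc (ray_term s t) <= expR (- Re u + b * (normc q / m)) * expR (- (Re w * t)).
Proof.
move=> t0 /andP[s0 sb]; rewrite normc_cexp -expRD ler_expR Re_sub Re_opp Re_U opprD -!addrA.
rewrite lerD2l addrC lerD2r -Re_opp.
apply: le_trans (ler_norm _) _; apply: le_trans (Re_le_normc _) _.
rewrite normcN normcM normcC ger0_norm// normcM ler_pM ?mulr_ge0 ?normc_ge0//.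
by rewrite ler_wpM2l ?normc_ge0// invU_le.
Qed.

Let b_near s x : 0 < s -> s / 2 < x < 2 * s -> 0 <= x <= 2 * s.
Proof. by move=> s0 /andP[h1 h2]; apply/andP; split; lra. Qed.

Lemma cderive_segment_integral (g : R -> R[i]) (G s : R) : 0 < s ->
  (forall t, 0 <= t -> cdiff g t) ->
  (forall t, 0 <= t -> normc ((1 + t)%:C * g t) <= G) ->
  cderive (fun s => cintegral mu Rp (fun t => segment_term s t * g t)) s
    (cintegral mu Rp (fun t => - (p * ((1 + t)%:C * g t)) * segment_term s t)).
Proof.
move=> s0 dg gG; have c0 : 0 < s / 2 * Re p by rewrite mulr_gt0// divr_gt0.
have G0 : 0 <= G by apply: le_trans (normc_ge0 _) (gG 0 (lexx 0)).
have gG' t : 0 <= t -> normc (g t) <= G.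
  move=> t0; apply: le_trans (gG t t0); rewrite normcM normcC ger0_norm ?addr_ge0//.
  by rewrite ler_peMl ?normc_ge0// lerDl.
have kb x t : s / 2 < x < 2 * s -> 0 <= t -> normc (segment_term x t) <= expR (normc u) * expR (- (s / 2 * Re p * t)).
  move=> xs t0; have /andP[x0 _] := b_near s0 xs; have /andP[x1 _] := xs.
  apply: le_trans (normc_segment_term t0 x0) _; rewrite ler_wpM2l ?expR_ge0// ler_expR lerN2.
  by rewrite ler_wpM2r// ler_wpM2r ?ltW.
apply: (@cderive_under _ _ _ mu (fun x t => segment_term x t * g t)
  (fun x t => - (p * ((1 + t)%:C * g t)) * segment_term x t) Rp s (s / 2) (2 * s)
  (fun t => normc p * G * expR (normc u) * expR (- (s / 2 * Re p * t)))) => //.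
- by apply/andP; split; lra.
- move=> x xs; apply: (cintegrable_halfline (g := fun t => G * expR (normc u) * expR (- (s / 2 * Re p * t)))).
  + by move=> t t0; apply: cdiffM; [exact: cdiff_segment_term|exact: dg].
  + by move=> t t0; rewrite normcM mulrC -mulrA ler_pM ?normc_ge0 ?gG'// kb.
  + exact: integrable_scale_expRN.
- move=> x t xs /RpE t0.
  by apply: cderive_eq (cderiveM (cderive_segment_term x t) (cderive_cst (g t) x)) _; ring.
- by move=> t; rewrite !mulr_ge0 ?normc_ge0 ?expR_ge0.
- exact: integrable_scale_expRN.
- move=> x t xs /RpE t0; rewrite normcM normcN normcM -[leRHS]mulrA.
  by rewrite ler_pM ?mulr_ge0 ?normc_ge0 ?kb// ler_wpM2l ?normc_ge0// gG.
Qed.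

Lemma cderive_ray_integral (g : R -> R[i]) (G s : R) : 0 < s ->
  (forall t, 0 <= t -> cdiff g t) -> (forall t, 0 <= t -> normc (g t) <= G) ->
  cderive (fun s => cintegral mu Rp (fun t => ray_term s t * g t)) s
    (cintegral mu Rp (fun t => - (q / U t * g t) * ray_term s t)).
Proof.
move=> s0 dg gG.
have G0 : 0 <= G by apply: le_trans (normc_ge0 _) (gG 0 (lexx 0)).
set E := expR (- Re u + 2 * s * (normc q / m)).
have kb x t : s / 2 < x < 2 * s -> 0 <= t -> normc (ray_term x t) <= E * expR (- (Re w * t)).
  by move=> xs t0; apply: normc_ray_term => //; exact: b_near s0 xs.
apply: (@cderive_under _ _ _ mu (fun x t => ray_term x t * g t)
  (fun x t => - (q / U t * g t) * ray_term x t) Rp s (s / 2) (2 * s)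
  (fun t => normc q / m * G * E * expR (- (Re w * t)))) => //.
- by apply/andP; split; lra.
- move=> x xs; apply: (cintegrable_halfline (g := fun t => G * E * expR (- (Re w * t)))).
  + by move=> t t0; apply: cdiffM; [exact: cdiff_ray_term|exact: dg].
  + by move=> t t0; rewrite normcM mulrC -mulrA ler_pM ?normc_ge0 ?gG// kb.
  + exact: integrable_scale_expRN.
- move=> x t xs /RpE t0.
  by apply: cderive_eq (cderiveM (cderive_ray_term x t) (cderive_cst (g t) x)) _; ring.
- by move=> t; rewrite !mulr_ge0 ?normc_ge0 ?expR_ge0// invr_ge0 ltW.
- exact: integrable_scale_expRN.
- move=> x t xs /RpE t0; rewrite normcM normcN normcM -[leRHS]mulrA.
  rewrite ler_pM ?mulr_ge0 ?normc_ge0 ?kb//.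
  by rewrite ler_pM ?normc_ge0 ?gG// normcM ler_wpM2l ?normc_ge0// invU_le.
Qed.

(** The integrals along the broken path of [exp (- v - s q / v)] against [d v / v]
    and against [d v]. *)
Definition besselF s := cintegral mu Rp (fun t => segment_term s t * rinv t) +
  cintegral mu Rp (fun t => ray_term s t * (w / U t)).
Definition besselP s := cintegral mu Rp (fun t => segment_term s t * (u * rinv t ^+ 2)) +
  cintegral mu Rp (fun t => ray_term s t * w).

Let cdiff_wU t : 0 <= t -> cdiff (fun t => w / U t) t.
Proof.
by move=> t0; apply: cdiffM; [exact: cdiff_cst|apply: cdiffV; [exact: U_neq0|exact: cdiff_U]].
Qed.

Let cdiff_ur2 t : 0 <= t -> cdiff (fun t => u * rinv t ^+ 2) t.
Proof.
move=> t0; under eq_fun do rewrite expr2.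
by apply: cdiffM; [exact: cdiff_cst|apply: cdiffM; exact: cdiff_rinv].
Qed.

Let q_div_u : q / u = p.
Proof. by rewrite /q mulfK//; have := U_neq0 (lexx 0); rewrite /U rmorph0 mul0r addr0. Qed.

Let segment_term0 s : segment_term s 0 = cexp (- u - s%:C * p).
Proof. by rewrite /segment_term /rinv addr0 invr1 rmorph1 !mulr1. Qed.

Let ray_term0 s : ray_term s 0 = cexp (- u - s%:C * p).
Proof. by rewrite /ray_term /U rmorph0 mul0r addr0 q_div_u. Qed.

(** Differentiating under the integral brings out [- q / v]; integrating the
    derivative of [exp (- v - s q / v)] along the path trades the resulting
    [s q / v ^ 2] for 1. *)
Lemma cderive_besselF s : 0 < s -> cderive besselF s (- (s^-1)%:C * besselP s).
Proof.
move=> s0.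
have s1 : s%:C != 0 :> R[i] by rewrite eq_complex /= gt_eqF.
have c0 : 0 < s * Re p by rewrite mulr_gt0.
have d1 := @cderive_segment_integral rinv 1 s s0 (@cdiff_rinv R).
have d2 := @cderive_ray_integral (fun t => w / U t) (normc w / m) s s0 cdiff_wU.
apply: cderive_eq (cderiveD (d1 _) (d2 _)) _.
- by move=> t t0; rewrite mulrC rinvE// normc1.
- by move=> t t0; rewrite normcM ler_wpM2l ?normc_ge0// invU_le.
set e := cexp (- u - s%:C * p).
have i1 g G : (forall t, 0 <= t -> cdiff g t) -> (forall t, 0 <= t -> normc (g t) <= G) ->
    cintegrable mu Rp (fun t => segment_term s t * g t).
  move=> dg gG; apply: (cintegrable_halfline (g := fun t => G * expR (normc u) * expR (- (s * Re p * t)))).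
  - by move=> t t0; apply: cdiffM; [exact: cdiff_segment_term|exact: dg].
  - move=> t t0; rewrite normcM mulrC -mulrA ler_pM ?normc_ge0 ?gG//.
    exact: normc_segment_term t0 (ltW s0).
  - exact: integrable_scale_expRN.
have i2 g G : (forall t, 0 <= t -> cdiff g t) -> (forall t, 0 <= t -> normc (g t) <= G) ->
    cintegrable mu Rp (fun t => ray_term s t * g t).
  move=> dg gG; apply: (cintegrable_halfline (g := fun t => G * expR (- Re u + s * (normc q / m)) * expR (- (Re w * t)))).
  - by move=> t t0; apply: cdiffM; [exact: cdiff_ray_term|exact: dg].
  - move=> t t0; rewrite normcM mulrC -mulrA ler_pM ?normc_ge0 ?gG//.
    by apply: normc_ray_term => //; rewrite ltW//=.
  - exact: integrable_scale_expRN.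
have n1 t : 0 <= t -> normc (u * rinv t ^+ 2 - s%:C * p) <= normc u + normc (s%:C * p).
  move=> t0; apply: le_trans (normcB_le _ _) _; rewrite lerD2r normcM normc_rinv2//.
  by rewrite ler_piMr ?normc_ge0// -exprVn exprn_ile1 ?rinv_le1// invr_ge0 addr_ge0.
have j1 := i1 _ _ (fun t h => cdiffD (cdiff_ur2 h) (cdiffN (cdiff_cst (s%:C * p) t))) n1.
(* The boundary terms of the two pieces at [u], both equal to [e], cancel. *)
have F1 : cintegral mu Rp (fun t => segment_term s t * (u * rinv t ^+ 2 - s%:C * p)) = 0 - segment_term s 0.
  apply: cFTC_halfline j1 _.
  - move=> t t0.
    have h := cderive_cexp (cderiveB (cderiveN (cderiveM (cderive_cst u t) (cderive_rinv t0)))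
      (cderiveM (cderive_cst s%:C t) (cderiveM (cderive_cst p t) (cderive_onep t)))).
    by apply: cderive_eq h _; rewrite -/(segment_term s t); ring.
  - move=> t t0; apply: cdiffM; first exact: cdiff_segment_term.
    by apply: cdiffD; [exact: cdiff_ur2|exact: cdiff_cst].
  - apply: (ccvg_squeeze0 (g := fun t => expR (normc u) * expR (- (s * Re p * t)))).
      near=> t; apply: normc_segment_term (ltW s0); near: t; exact: nbhs_pinfty_ge.
    rewrite -[X in _ --> X](mulr0 (expR (normc u))); apply: cvgM; first exact: cvg_cst.
    exact: cvg_expRN.
pose g2 t : R[i] := s%:C * (q / U t * (w / U t)) - w.
have dg2 t : 0 <= t -> cdiff (fun t => q / U t * (w / U t)) t.
  move=> t0; apply: cdiffM; last exact: cdiff_wU.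
  by apply: cdiffM; [exact: cdiff_cst|apply: cdiffV; [exact: U_neq0|exact: cdiff_U]].
have n2 t : 0 <= t -> normc (q / U t * (w / U t)) <= normc q / m * (normc w / m).
  by move=> t0; rewrite normcM (normcM q) (normcM w) ler_pM ?mulr_ge0 ?normc_ge0// ler_wpM2l ?normc_ge0 ?invU_le.
have n2' t : 0 <= t -> normc (g2 t) <= s * (normc q / m * (normc w / m)) + normc w.
  move=> t0; apply: le_trans (normcB_le _ _) _; rewrite lerD2r normcM normcC gtr0_norm//.
  by rewrite ler_wpM2l ?n2// ltW.
have j2 := i2 g2 _ (fun t h => cdiffD (cdiffM (cdiff_cst (s%:C) t) (dg2 t h)) (cdiffN (cdiff_cst w t))) n2'.
have F2 : cintegral mu Rp (fun t => ray_term s t * g2 t) = 0 - ray_term s 0.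
  apply: cFTC_halfline j2 _.
  - move=> t t0.
    have h := cderive_cexp (cderiveB (cderiveN (cderive_affine u w t))
      (cderiveM (cderive_cst s%:C t) (cderiveM (cderive_cst q t) (cderiveV (U_neq0 t0) (cderive_affine u w t))))).
    apply: cderive_eq h _; rewrite -/(U t) -/(ray_term s t) /g2.
    by have := U_neq0 t0 => U0; field.
  - move=> t t0; apply: cdiffM; first exact: cdiff_ray_term.
    apply: cdiffD; last exact: cdiff_cst.
    by apply: cdiffM; [exact: cdiff_cst|exact: dg2].
  - apply: (ccvg_squeeze0 (g := fun t => expR (- Re u + s * (normc q / m)) * expR (- (Re w * t)))).
      near=> t; apply: normc_ray_term; last by rewrite (ltW s0)/=.
      near: t; exact: nbhs_pinfty_ge.
    rewrite -[X in _ --> X](mulr0 (expR (- Re u + s * (normc q / m)))); apply: cvgM; first exact: cvg_cst.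
    exact: cvg_expRN.
have b1 : cintegrable mu Rp (fun t => segment_term s t * (u * rinv t ^+ 2)).
  apply: (i1 _ (normc u)) => // t t0; rewrite normcM normc_rinv2//.
  by rewrite ler_piMr ?normc_ge0// -exprVn exprn_ile1 ?rinv_le1// invr_ge0 addr_ge0.
have c1 : cintegrable mu Rp (fun t => segment_term s t * p).
  by apply: (i1 _ (normc p)) => // t t0; exact: cdiff_cst.
have b2 : cintegrable mu Rp (fun t => ray_term s t * w).
  by apply: (i2 _ (normc w)) => // t t0; exact: cdiff_cst.
have c2 : cintegrable mu Rp (fun t => ray_term s t * (q / U t * (w / U t))) by exact: (i2 _ _ dg2 n2).
have mD : measurable (Rp : set (measurableTypeR R)) by exact: measurable_itv.
have G1 : cintegral mu Rp (fun t => segment_term s t * (u * rinv t ^+ 2)) -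
    s%:C * cintegral mu Rp (fun t => segment_term s t * p) = - e.
  rewrite -(cintegralMl _ mD c1) -(cintegralB mD b1); last exact: cintegrableMl.
  rewrite -[RHS]add0r /e -segment_term0 -F1; apply: eq_cintegral => t _; ring.
have G2 : s%:C * cintegral mu Rp (fun t => ray_term s t * (q / U t * (w / U t))) -
   cintegral mu Rp (fun t => ray_term s t * w) = - e.
  rewrite -(cintegralMl _ mD c2) -(cintegralB mD _ b2); last exact: cintegrableMl.
  rewrite -[RHS]add0r /e -ray_term0 -F2; apply: eq_cintegral => t _; rewrite /g2; ring.
have H1 : cintegral mu Rp (fun t => - (p * ((1 + t)%:C * rinv t)) * segment_term s t) =
    - cintegral mu Rp (fun t => segment_term s t * p).
  rewrite -mulN1r -(cintegralMl _ mD c1); apply: eq_cintegral => t /RpE t0.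
  by rewrite [_ * rinv t]mulrC rinvE//; ring.
have H2 : cintegral mu Rp (fun t => - (q / U t * (w / U t)) * ray_term s t) =
    - cintegral mu Rp (fun t => ray_term s t * (q / U t * (w / U t))).
  rewrite -mulN1r -(cintegralMl _ mD c2); apply: eq_cintegral => t /RpE t0; ring.
rewrite H1 H2; apply: (mulfI s1); rewrite /besselP.
have -> : s%:C * (- (s^-1)%:C * (cintegral mu Rp (fun t => segment_term s t * (u * rinv t ^+ 2)) +
   cintegral mu Rp (fun t => ray_term s t * w))) = - (cintegral mu Rp (fun t => segment_term s t * (u * rinv t ^+ 2)) +
   cintegral mu Rp (fun t => ray_term s t * w)).
  by rewrite mulrA mulrN -rmorphM /= divff ?gt_eqF// rmorph1 mulN1r.
rewrite mulrDr !mulrN.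
have -> : s%:C * cintegral mu Rp (fun t => segment_term s t * p) =
   cintegral mu Rp (fun t => segment_term s t * (u * rinv t ^+ 2)) + e.
  by rewrite -[e]opprK -G1; ring.
have -> : s%:C * cintegral mu Rp (fun t => ray_term s t * (q / U t * (w / U t))) =
   cintegral mu Rp (fun t => ray_term s t * w) - e.
  by rewrite -G2; ring.
ring.
Unshelve. all: by end_near. Qed.

Lemma cderive_besselP s : 0 < s -> cderive besselP s (- q * besselF s).
Proof.
move=> s0.
have d1 := @cderive_segment_integral (fun t => u * rinv t ^+ 2) (normc u) s s0 cdiff_ur2.
have d2 := @cderive_ray_integral (fun=> w) (normc w) s s0 (fun t _ => cdiff_cst w t) (fun=> fun=> lexx _).
have mD : measurable (Rp : set (measurableTypeR R)) by exact: measurable_itv.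
have c0 : 0 < s * Re p by rewrite mulr_gt0.
apply: cderive_eq (cderiveD (d1 _) d2) _.
  move=> t t0; rewrite (_ : _ * _ = u * rinv t * (rinv t * (1 + t)%:C)); last by ring.
  rewrite rinvE// mulr1 normcM normc_rinv//.
  by rewrite ler_piMr ?normc_ge0// rinv_le1.
rewrite /besselF mulrDr -!cintegralMl//.
- congr (_ + _); apply: eq_cintegral => t /RpE t0; last by ring.
  rewrite (_ : (1 + t)%:C * _ = u * rinv t * (rinv t * (1 + t)%:C)); last by ring.
  by rewrite rinvE// /q; ring.
- apply: (cintegrable_halfline (g := fun t => expR (- Re u + s * (normc q / m)) * (normc w / m) * expR (- (Re w * t)))).
  + by move=> t t0; apply: cdiffM; [exact: cdiff_ray_term|exact: cdiff_wU].
  + move=> t t0; rewrite normcM mulrAC ler_pM ?normc_ge0//.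
      by apply: normc_ray_term => //; rewrite ltW//=.
    by rewrite normcM ler_wpM2l ?normc_ge0 ?invU_le.
  + exact: integrable_scale_expRN.
- apply: (cintegrable_halfline (g := fun t => expR (normc u) * expR (- (s * Re p * t)))).
  + by move=> t t0; apply: cdiffM; [exact: cdiff_segment_term|exact: cdiff_rinv].
  + move=> t t0; rewrite normcM -[leRHS]mulr1 ler_pM ?normc_ge0//; first exact: normc_segment_term t0 (ltW s0).
    by rewrite normc_rinv// rinv_le1.
  + exact: integrable_scale_expRN.
Qed.

Lemma ccvg_besselP : ccvg 0^'+ besselP 1.
Proof.
have u0 : u != 0 by have := U_neq0 (lexx 0); rewrite /U rmorph0 mul0r addr0.
have e1 : cintegral mu Rp (fun t => segment_term 0 t * (u * rinv t ^+ 2)) = 1 - cexp (- u).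
  have -> : 1 - cexp (- u) = u * ((1 - cexp (- u)) / u) by rewrite mulrC divfK.
  rewrite -integral_cexp_rinv// -cintegralMl//.
    by apply: eq_cintegral => t _; rewrite /segment_term rmorph0 mul0r subr0 mulNr; ring.
  apply: (cintegrable_halfline (g := fun t => expR (normc u) * (1 + t) ^- 2)).
  - move=> t t0; apply: cdiffM.
      by under eq_fun do rewrite expr2; apply: cdiffM; exact: cdiff_rinv.
    by apply: cdiff_cexp; apply: cdiffM; [exact: cdiff_cst|exact: cdiff_rinv].
  - move=> t t0; rewrite normcM normc_rinv2// mulrC ler_wpM2r ?invr_ge0 ?sqr_ge0//.
    apply: le_trans (normc_cexp_le _) _; rewrite ler_expR normcM normcN normc_rinv//.
    by rewrite ler_piMr ?normc_ge0// rinv_le1.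
  - exact: integrable_scale_inv_sqr.
have e2 : cintegral mu Rp (fun t => ray_term 0 t * w) = cexp (- u).
  rewrite (@cFTC_halfline _ (fun t => - cexp (- U t)) _ (- 0)).
  - by rewrite oppr0 sub0r opprK /U rmorph0 mul0r addr0.
  - move=> t t0; apply: cderive_eq (cderiveN (cderive_cexp (cderiveN (cderive_affine u w t)))) _.
    by rewrite /ray_term rmorph0 mul0r subr0 -/(U t); ring.
  - by move=> t t0; apply: cdiffM; [exact: cdiff_ray_term|exact: cdiff_cst].
  - apply: (cintegrable_halfline (g := fun t => expR (- Re u + 0 * (normc q / m)) * normc w * expR (- (Re w * t)))).
    + by move=> t t0; apply: cdiffM; [exact: cdiff_ray_term|exact: cdiff_cst].
    + move=> t t0; rewrite normcM mulrAC ler_wpM2r ?normc_ge0//.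
      by apply: normc_ray_term => //; rewrite lexx.
    + exact: integrable_scale_expRN.
  - apply: ccvgN; apply: (ccvg_squeeze0 (g := fun t => expR (- Re u) * expR (- (Re w * t)))).
      by apply: nearW => t; rewrite normc_cexp Re_opp Re_U opprD expRD.
    rewrite -[X in _ --> X](mulr0 (expR (- Re u))); apply: cvgM; first exact: cvg_cst.
    exact: cvg_expRN.
rewrite (_ : 1 = (1 - cexp (- u)) + cexp (- u)); last by rewrite subrK.
rewrite -e1 -e2; apply: ccvgD.
  apply: (@ccvg_under0 _ _ _ mu (fun s t => segment_term s t * (u * rinv t ^+ 2)) Rp
    (fun t => expR (normc u) * normc u * (1 + t) ^- 2)).
  - exact: measurable_itv.
  - move=> s _; apply: cdiff_cmeasurable; first exact: measurable_itv.
    by move=> t /RpE t0; apply: cdiffM; [exact: cdiff_segment_term|exact: cdiff_ur2].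
  - move=> s t _ _; apply: cdiffM; last exact: cdiff_cst.
    by eexists; exact: cderive_segment_term.
  - exact: integrable_scale_inv_sqr.
  - move=> s t /andP[s0 _] /RpE t0; rewrite normcM [normc (u * _)]normcM normc_rinv2// -[leRHS]mulrA.
    by rewrite ler_wpM2r ?mulr_ge0 ?normc_ge0 ?invr_ge0 ?sqr_ge0 ?normc_segment_term_le.
apply: (@ccvg_under0 _ _ _ mu (fun s t => ray_term s t * w) Rp
    (fun t => expR (- Re u + 1 * (normc q / m)) * normc w * expR (- (Re w * t)))).
- exact: measurable_itv.
- move=> s _; apply: cdiff_cmeasurable; first exact: measurable_itv.
  by move=> t /RpE t0; apply: cdiffM; [exact: cdiff_ray_term|exact: cdiff_cst].
- move=> s t _ _; apply: cdiffM; last exact: cdiff_cst.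
  by eexists; exact: cderive_ray_term.
- exact: integrable_scale_expRN.
- move=> s t /andP[s0 s1] /RpE t0; rewrite normcM mulrAC ler_wpM2r ?normc_ge0//.
  by apply: normc_ray_term => //; rewrite s0 ltW.
Qed.

Lemma clog_scale s z : 0 < s -> 0 < Re z -> clog (s%:C * z) = (ln s)%:C + clog z.
Proof.
move=> s0 z0.
have n0 : 0 < Re z ^+ 2 + Im z ^+ 2 by rewrite ltr_pwDl ?exprn_gt0// sqr_ge0.
apply: complex_ext; rewrite ?Re_add ?Im_add /clog /=.
  rewrite Re_mul Im_mul Re_real Im_real !mul0r subr0 addr0 !exprMn -mulrDr.
  rewrite lnM ?posrE ?exprn_gt0// mulrDr lnXn// -[X in 2^-1 * X]mulr_natl mulrA mulVf// mul1r//.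
rewrite Re_mul Im_mul Re_real Im_real !mul0r subr0 addr0 add0r.
by rewrite invfM mulrACA divff ?gt_eqF// mul1r.
Qed.

Lemma ccvg_near (F : set_system R) {FF : Filter F} (f g : R -> R[i]) l :
  (\forall s \near F, f s = g s) -> ccvg F f l -> ccvg F g l.
Proof.
move=> E [h1 h2]; split.
  apply: cvg_trans h1; apply: near_eq_cvg; near=> s; congr Re; near: s; exact: E.
apply: cvg_trans h2; apply: near_eq_cvg; near=> s; congr Im; near: s; exact: E.
Unshelve. all: by end_near. Qed.

(** On the segment, subtracting [1 / v] from [exp (- v) / v] leaves an integral that
    is continuous at [s = 0] and the exponential integral [E1 (s p)], which carries
    the logarithm. *)
Lemma ccvg_besselF : ccvg 0^'+ (fun s => besselF s + (ln s)%:C)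
  ((pi / 2 : R) *i - euler_gamma%:C - clog ('i * u) - (euler_gamma%:C + clog p)).
Proof.
have mD : measurable (Rp : set (measurableTypeR R)) by exact: measurable_itv.
pose f s t := (cexp (- (u * rinv t)) - 1) * rinv t * cexp (- (s%:C * p) * (1 + t)%:C).
have df s t : 0 <= t -> cdiff (f s) t.
  move=> t0; apply: cdiffM; first apply: cdiffM; last 2 first.
  - exact: cdiff_rinv.
  - by apply: cdiff_cexp; apply: cdiffM; [exact: cdiff_cst|exact: cdiff_onep].
  apply: cdiffD; last exact: cdiff_cst.
  by apply: cdiff_cexp; apply: cdiffN; apply: cdiffM; [exact: cdiff_cst|exact: cdiff_rinv].
pose g t := 2 * normc u * expR (normc u) * (1 + t) ^- 2.
have nf s t : 0 <= s -> 0 <= t -> normc (f s t) <= g t.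
  move=> s0 t0; rewrite normcM -[leRHS]mulr1 ler_pM ?normc_ge0//.
    rewrite -normcN -mulNr opprB -mulNr; exact: normc_ein.
  rewrite normc_cexp -expR0 ler_expR Re_mul Re_real Im_real mulr0 subr0 mulr_le0_ge0 ?addr_ge0//.
  by rewrite Re_opp oppr_le0 Re_mul Re_real Im_real mul0r subr0 mulr_ge0// ltW.
have iF s : 0 <= s -> cintegrable mu Rp (f s).
  move=> s0; apply: (@cintegrable_halfline _ (f s) g).
  - exact: df.
  - by move=> t; exact: nf.
  - exact: integrable_scale_inv_sqr.
have E s : 0 < s ->
   (cintegral mu Rp (f s) + cintegral mu Rp (fun t => ray_term s t * (w / U t))) +
   (Ein (s%:C * p) - (euler_gamma%:C + clog p)) = besselF s + (ln s)%:C.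
  move=> s0.
  have sp0 : 0 < Re (s%:C * p) by rewrite Re_mul Re_real Im_real mul0r subr0 mulr_gt0.
  have -> : Ein (s%:C * p) = E1 (s%:C * p) + (euler_gamma%:C + ((ln s)%:C + clog p)).
    by rewrite -clog_scale// -Ein_E1// addrC subrK.
  rewrite /besselF (_ : cintegral mu Rp (fun t => segment_term s t * rinv t) =
    cintegral mu Rp (f s) + E1 (s%:C * p)); first by ring.
  rewrite -cintegralD//; [|exact: iF (ltW s0)|exact: cintegrable_eone].
  apply: eq_cintegral => t _; rewrite /f /eone /segment_term cexpD.
  by rewrite (_ : - (s%:C * (p * (1 + t)%:C)) = - (s%:C * p) * (1 + t)%:C); ring.
apply: ccvg_near.
  by near=> s; apply: E; near: s; exact: nbhs_right_gt.
rewrite (_ : _ - _ = ((- Ein u) + ((pi / 2 : R) *i - euler_gamma%:C - clog ('i * u) + Ein u)) +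
   (0 - (euler_gamma%:C + clog p))); last by ring.
apply: ccvgD; first apply: ccvgD.
- have -> : - Ein u = cintegral mu Rp (f 0).
    rewrite -mulN1r -cintegralMl//; last exact: cintegrable_ein.
    apply: eq_cintegral => t _; rewrite /f /ein rmorph0 mul0r oppr0 mul0r cexp0 [- u * _]mulNr.
    by ring.
  apply: (@ccvg_under0 _ _ _ mu f Rp g) => //.
  + move=> s _; apply: cdiff_cmeasurable => //.
    by move=> t /RpE t0; exact: df.
  + move=> s t _ _; apply: cdiffM; first exact: cdiff_cst.
    apply: cdiff_cexp; apply: cdiffM; last exact: cdiff_cst.
    by apply: cdiffN; apply: cdiffM; [exact: cdiff_id|exact: cdiff_cst].
  + exact: integrable_scale_inv_sqr.
  + by move=> s t /andP[s0 _] /RpE; exact: nf.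
- rewrite -integral_cexp_ray.
  have -> : cintegral mu Rp (fun t => cexp (- U t) * (w / U t)) =
    cintegral mu Rp (fun t => ray_term 0 t * (w / U t)).
    by apply: eq_cintegral => t _; rewrite /ray_term rmorph0 mul0r subr0.
  apply: (@ccvg_under0 _ _ _ mu (fun s t => ray_term s t * (w / U t)) Rp
    (fun t => expR (- Re u + 1 * (normc q / m)) * (normc w / m) * expR (- (Re w * t)))) => //.
  + move=> s _; apply: cdiff_cmeasurable => //.
    by move=> t /RpE t0; apply: cdiffM; [exact: cdiff_ray_term|exact: cdiff_wU].
  + move=> s t _ _; apply: cdiffM; last exact: cdiff_cst.
    by eexists; exact: cderive_ray_term.
  + exact: integrable_scale_expRN.
  + move=> s t /andP[s0 s1] /RpE t0; rewrite normcM mulrAC ler_pM ?normc_ge0//.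
      by apply: normc_ray_term => //; rewrite s0 ltW.
    by rewrite normcM ler_wpM2l ?normc_ge0 ?invU_le.
- apply: ccvgD; last exact: ccvg_cst.
  apply: (ccvg_squeeze0 (g := fun s => 2 * (2 * (s * normc p) * expR (s * normc p)))).
    near=> s; have s0 : 0 < s by near: s; exact: nbhs_right_gt.
    have -> : s * normc p = normc (s%:C * p) by rewrite normcM normcC gtr0_norm.
    exact: normc_Ein.
  apply: cvg_at_right_filter.
  have d0 (x : R) : is_derive x (1 : R) (fun s : R => s * normc p) (normc p).
    by under eq_fun do rewrite mulrC; exact: rder_scale.
  have h : 2 * (2 * (s * normc p) * expR (s * normc p)) @[s --> 0] -->
      2 * (2 * (0 * normc p) * expR (0 * normc p)).
    exact: (rder_continuous (rderMl 2 (rderM (rderMl 2 (d0 0)) (rder_expR (d0 0))))).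
  by move: h; rewrite mul0r mulr0 mul0r mulr0.
Unshelve. all: by end_near. Qed.

End macdonald_integral.

(** * The Bessel system: power series and uniqueness *)

Section complex_power_series.
Context {R : realType}.
Implicit Types (c : nat -> R[i]) (z q : R[i]) (s t x : R).

(** This class is stable under formal differentiation and shift, unlike a bound on
    the coefficients of one particular series. *)
Definition exptype c := exists K A : R, [/\ 0 <= K, 0 <= A &
  forall m, normc (c m) <= K * (A ^+ m / m`!%:R)].

Definition cdiffs c m : R[i] := m.+1%:R * c m.+1.

Definition cps c s : R[i] := csum (fun m => c m * s%:C ^+ m).

Lemma normc_nat m : normc (m%:R : R[i]) = m%:R.
Proof.
have -> : (m%:R : R[i]) = (m%:R : R)%:C by rewrite rmorph_nat.
by rewrite normcC normr_nat.
Qed.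

Lemma exptype_cdiffs c : exptype c -> exptype (cdiffs c).
Proof.
move=> [K [A [K0 A0 h]]]; exists (K * A), A; split => //; first exact: mulr_ge0.
move=> m; rewrite /cdiffs normcM normc_nat.
apply: le_trans (ler_wpM2l (ler0n _ _) (h m.+1)) _.
rewrite factS natrM exprS invfM.
have f0 : m`!%:R != 0 :> R by rewrite pnatr_eq0 -lt0n fact_gt0.
have m0 : m.+1%:R != 0 :> R by rewrite pnatr_eq0.
rewrite le_eqVlt; apply/orP; left; apply/eqP; field.
by rewrite f0 addrC natr1 m0.
Qed.

Lemma is_cvg_exptype (a : nat -> R) (K A x : R) : 0 <= K -> 0 <= A ->
  (forall m, `|a m| <= K * (A ^+ m / m`!%:R)) -> cvgn (pseries a x).
Proof.
move=> K0 A0 h; apply: normed_cvg; rewrite /normed_series_of /=.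
have hK : cvgn (series (fun m => K * exp_coeff (A * `|x|) m)).
  by apply: is_cvg_seriesZ; exact: is_cvg_series_exp_coeff.
apply: series_le_cvg hK => [m|m|m] /=; first exact: normr_ge0.
  by rewrite mulr_ge0// exp_coeff_ge0// mulr_ge0.
have -> : exp_coeff (A * `|x|) m = A ^+ m / m`!%:R * `|x| ^+ m.
  by rewrite /exp_coeff /= exprMn mulrAC.
by rewrite normrM normrX mulrA ler_wpM2r ?exprn_ge0.
Qed.

Lemma Re_coef c m s : Re (c m * s%:C ^+ m) = Re (c m) * s ^+ m.
Proof. by rewrite -rmorphXn /= Re_mul Im_real mulr0 subr0. Qed.

Lemma Im_coef c m s : Im (c m * s%:C ^+ m) = Im (c m) * s ^+ m.
Proof. by rewrite -rmorphXn /= Im_mul Im_real mulr0 add0r. Qed.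

Lemma cpsE c s :
  cps c s = (limn (pseries (fun m => Re (c m)) s)) +i*
            (limn (pseries (fun m => Im (c m)) s)).
Proof.
rewrite /cps /csum /pseries; congr (limn (series _) +i* limn (series _)).
  by apply/funext => m; rewrite Re_coef.
by apply/funext => m; rewrite Im_coef.
Qed.

Lemma cvg_cps c s : exptype c ->
  cvgn (pseries (fun m => Re (c m)) s) /\ cvgn (pseries (fun m => Im (c m)) s).
Proof.
move=> [K [A [K0 A0 h]]]; split; apply: (@is_cvg_exptype _ K A) => // m.
  exact: le_trans (Re_le_normc _) (h m).
exact: le_trans (Im_le_normc _) (h m).
Qed.

Lemma Re_cdiffs c : (fun m => Re (cdiffs c m)) = pseries_diffs (fun m => Re (c m)).
Proof.
apply/funext => m; rewrite /cdiffs /pseries_diffs -(rmorph_nat (real_complex R)) /=.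
by rewrite Re_mul Im_real mul0r subr0.
Qed.

Lemma Im_cdiffs c : (fun m => Im (cdiffs c m)) = pseries_diffs (fun m => Im (c m)).
Proof.
apply/funext => m; rewrite /cdiffs /pseries_diffs -(rmorph_nat (real_complex R)) /=.
by rewrite Im_mul Im_real mul0r addr0.
Qed.

Lemma cderive_cps c s : exptype c -> cderive (cps c) s (cps (cdiffs c) s).
Proof.
move=> hc; have hd := exptype_cdiffs hc; have hdd := exptype_cdiffs hd.
pose K := `|s| + 1.
have sK : `|s| < `|K| by rewrite [ltRHS]ger0_norm ?addr_ge0// ltrDl.
have [c1 c2] := cvg_cps K hc.
have [d1 d2] := cvg_cps K hd.
have [e1 e2] := cvg_cps K hdd.
split.
  rewrite cpsE [Re (_ +i* _)]/= Re_cdiffs.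
  have -> : (fun s => Re (cps c s)) = (fun s => limn (pseries (fun m => Re (c m)) s)).
    by apply/funext => x; rewrite cpsE.
  by apply: (@pseries_snd_diffs _ _ K) => //; rewrite -?Re_cdiffs.
rewrite cpsE [Im (_ +i* _)]/= Im_cdiffs.
have -> : (fun s => Im (cps c s)) = (fun s => limn (pseries (fun m => Im (c m)) s)).
  by apply/funext => x; rewrite cpsE.
by apply: (@pseries_snd_diffs _ _ K) => //; rewrite -?Im_cdiffs.
Qed.

Lemma lim_pseries_shift (a : nat -> R) s : cvgn (pseries (fun m => a m.+1) s) ->
  limn (pseries a s) = a 0 + s * limn (pseries (fun m => a m.+1) s).
Proof.
move=> h; apply/cvg_lim => //; rewrite -(cvg_shiftS _) /=.
have -> : (fun n => pseries a s n.+1) = (fun n => a 0 + s * pseries (fun m => a m.+1) s n).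
  apply/funext => n; rewrite /pseries /series /= big_nat_recl// expr0 mulr1; congr (_ + _).
  by rewrite mulr_sumr; apply: eq_bigr => i _; rewrite exprS; ring.
by apply: cvgD; [exact: cvg_cst|apply: cvgM; [exact: cvg_cst|exact: h]].
Qed.

Lemma exptype_shift c : exptype c -> exptype (fun m => c m.+1).
Proof.
move=> [K [A [K0 A0 h]]]; exists (K * A), A; split => //; first exact: mulr_ge0.
move=> m; apply: le_trans (h m.+1) _; rewrite exprS -!mulrA ler_wpM2l// ler_wpM2l//.
rewrite ler_wpM2l ?exprn_ge0// lef_pV2 ?posrE ?ltr0n ?fact_gt0//.
by rewrite ler_nat factS leq_pmull.
Qed.

Lemma cps_shift c s : exptype c -> cps c s = c 0%N + s%:C * cps (fun m => c m.+1) s.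
Proof.
move=> hc; have [h1 h2] := cvg_cps s (exptype_shift hc).
rewrite !cpsE; apply: complex_ext.
  rewrite [RHS]Re_add [in RHS]Re_mul [in RHS]Re_real [in RHS]Im_real mul0r subr0.
  exact: (@lim_pseries_shift (fun m => Re (c m)) s h1).
rewrite [RHS]Im_add [in RHS]Im_mul [in RHS]Re_real [in RHS]Im_real mul0r addr0.
exact: (@lim_pseries_shift (fun m => Im (c m)) s h2).
Qed.

Lemma cps0 c : exptype c -> cps c 0 = c 0%N.
Proof. by move=> hc; rewrite cps_shift// rmorph0 mul0r addr0. Qed.

Lemma exptypeZ q c : exptype c -> exptype (fun m => q * c m).
Proof.
move=> [K [A [K0 A0 h]]]; exists (normc q * K), A; split => //.
  by rewrite mulr_ge0 ?normc_ge0.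
by move=> m; rewrite normcM -mulrA ler_wpM2l ?normc_ge0.
Qed.

Lemma lim_pseriesD (a b : nat -> R) s : cvgn (pseries a s) -> cvgn (pseries b s) ->
  limn (pseries (fun m => a m + b m) s) = limn (pseries a s) + limn (pseries b s).
Proof.
move=> ha hb; apply/cvg_lim => //.
have -> : pseries (fun m => a m + b m) s = (fun n => pseries a s n + pseries b s n).
  apply/funext => n; rewrite /pseries /series /= -big_split /=.
  by apply: eq_bigr => i _; rewrite mulrDl.
exact: cvgD.
Qed.

Lemma lim_pseriesZ (k : R) (a : nat -> R) s : cvgn (pseries a s) ->
  limn (pseries (fun m => k * a m) s) = k * limn (pseries a s).
Proof.
move=> ha; apply/cvg_lim => //.
have -> : pseries (fun m => k * a m) s = (fun n => k * pseries a s n).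
  apply/funext => n; rewrite /pseries /series /= mulr_sumr.
  by apply: eq_bigr => i _; rewrite mulrA.
by apply: cvgM; [exact: cvg_cst|exact: ha].
Qed.

Lemma cpsD c c' s : exptype c -> exptype c' ->
  cps (fun m => c m + c' m) s = cps c s + cps c' s.
Proof.
move=> /(cvg_cps s)[h1 h2] /(cvg_cps s)[h1' h2']; rewrite !cpsE.
apply: complex_ext; rewrite ?Re_add ?Im_add /=.
  by rewrite -lim_pseriesD//; congr (limn (pseries _ _)); apply/funext => m; rewrite Re_add.
by rewrite -lim_pseriesD//; congr (limn (pseries _ _)); apply/funext => m; rewrite Im_add.
Qed.

Lemma is_cvg_pseriesZ (k : R) (a : nat -> R) s : cvgn (pseries a s) ->
  cvgn (pseries (fun m => k * a m) s).
Proof.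
move=> ha.
have -> : pseries (fun m => k * a m) s = (fun n => k * pseries a s n).
  apply/funext => n; rewrite /pseries /series /= mulr_sumr.
  by apply: eq_bigr => i _; rewrite mulrA.
by apply: is_cvgM => //; exact: is_cvg_cst.
Qed.

Lemma cpsZ q c s : exptype c -> cps (fun m => q * c m) s = q * cps c s.
Proof.
move=> /(cvg_cps s)[h1 h2]; rewrite !cpsE.
apply: complex_ext; rewrite ?Re_mul ?Im_mul /=.
  rewrite -!lim_pseriesZ// -mulN1r -lim_pseriesZ; last exact: is_cvg_pseriesZ.
  rewrite -lim_pseriesD//; [|exact: is_cvg_pseriesZ|by do 2?apply: is_cvg_pseriesZ].
  by congr (limn (pseries _ _)); apply/funext => m; rewrite Re_mul mulN1r.
rewrite -!lim_pseriesZ// -lim_pseriesD//; try exact: is_cvg_pseriesZ.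
by congr (limn (pseries _ _)); apply/funext => m; rewrite Im_mul.
Qed.

End complex_power_series.

Section bessel_system_uniqueness.
Context {R : realType}.
Implicit Types (z q : R[i]) (s t x : R).

Lemma nondecreasing_of_derive (f f' : R -> R) (a b : R) : a <= b ->
  (forall x, a <= x <= b -> is_derive x (1 : R) f (f' x)) ->
  (forall x, a <= x <= b -> 0 <= f' x) -> f a <= f b.
Proof.
rewrite le_eqVlt => /predU1P[->//|ab] df f0.
have [||c cab h] := @MVT _ f f' a b ab.
- move=> x; rewrite in_itv /= => /andP[ax xb]; apply: df.
  by rewrite (ltW ax) (ltW xb).
- apply: continuous_in_subspaceT => x /set_mem /=; rewrite in_itv /= => xab.
  exact: rder_continuous (df x xab).
rewrite -subr_ge0 h mulr_ge0 ?subr_ge0 ?(ltW ab)//.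
by apply: f0; move: cab; rewrite in_itv /= => /andP[ax xb]; rewrite (ltW ax) (ltW xb).
Qed.

(** Each application gains a power of [x] and a factor [1 / (n + 1)]. *)
Lemma power_bound (f f' : R -> R) (c : R) n : 0 <= c ->
  (forall x, 0 < x <= 1 -> is_derive x (1 : R) f (f' x)) ->
  (forall x, 0 < x <= 1 -> `|f' x| <= c * x ^+ n) ->
  f x @[x --> 0^'+] --> 0 ->
  forall x, 0 < x <= 1 -> `|f x| <= c / n.+1%:R * x ^+ n.+1.
Proof.
move=> c0 df f'c f0 x /andP[x0 x1].
apply/ler_addgt0Pr => e e0.
have [y [y0 yx fy]] : exists y, [/\ 0 < y, y < x & `|f y| < e].
  near (0 : R)^'+ => y; exists y; split.
  - near: y; exact: nbhs_right_gt.
  - near: y; exact: nbhs_right_lt.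
  - by near: y; move/cvgr0Pnorm_lt : f0 => /(_ e e0).
suff : `|f x - f y| <= c / n.+1%:R * x ^+ n.+1.
  move=> h; rewrite -(subrK (f y) (f x)); apply: le_trans (ler_normD _ _) _.
  by rewrite lerD// ltW.
have hd t : y <= t <= x -> is_derive t (1 : R) (fun x => c / n.+1%:R * x ^+ n.+1) (c * t ^+ n).
  move=> _; have := rderMl (c / n.+1%:R) (rder_exp n (is_derive_id t (1 : R))).
  by move=> /is_derive_eq; apply; rewrite mulr1 mulrA divfK.
have in01 t : y <= t <= x -> 0 < t <= 1.
  by move=> /andP[a b]; rewrite (lt_le_trans y0 a) (le_trans b x1).
have hy : 0 <= c / n.+1%:R * y ^+ n.+1 by rewrite mulr_ge0 ?exprn_ge0 ?divr_ge0// ltW.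
rewrite ler_norml; apply/andP; split.
  have := @nondecreasing_of_derive (fun x => c / n.+1%:R * x ^+ n.+1 + f x) _ y x (ltW yx)
    (fun t h => rderD (hd t h) (df t (in01 t h))).
  move=> h; have {h} : c / n.+1%:R * y ^+ n.+1 + f y <= c / n.+1%:R * x ^+ n.+1 + f x.
    by apply: h => t /in01 /f'c; rewrite ler_norml -lerBlDl sub0r => /andP[].
  move: hy; set a := _ * y ^+ _; set b := _ * x ^+ _ => ha hb; lra.
have := @nondecreasing_of_derive (fun x => c / n.+1%:R * x ^+ n.+1 - f x) _ y x (ltW yx)
    (fun t h => rderB (hd t h) (df t (in01 t h))).
move=> h; have {h} : c / n.+1%:R * y ^+ n.+1 - f y <= c / n.+1%:R * x ^+ n.+1 - f x.
  by apply: h => t /in01 /f'c; rewrite ler_norml subr_ge0 => /andP[].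
move: hy; set a := _ * y ^+ _; set b := _ * x ^+ _ => ha hb; lra.
Unshelve. all: by end_near. Qed.

Lemma bounded_of_cvg0 (f f' : R -> R) :
  (forall x, 0 < x <= 1 -> is_derive x (1 : R) f (f' x)) ->
  f x @[x --> 0^'+] --> 0 ->
  exists2 M, 0 <= M & forall x, 0 < x <= 1 -> `|f x| <= M.
Proof.
move=> df f0.
have [y [y0 y1 fy]] : exists y, [/\ 0 < y, y < 1 & forall x, 0 < x <= y -> `|f x| < 1].
  move/cvgr0Pnorm_lt : f0 => /(_ 1 ltr01).
  rewrite near_withinE near_nbhs /= => -[e /= e0 he].
  exists (Num.min (e / 2) 2^-1); split.
  - by rewrite lt_min divr_gt0//= invr_gt0.
  - by rewrite gt_min invf_lt1 ?ltr1n// orbT.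
  - move=> x /andP[x0]; rewrite le_min => /andP[xe _].
    apply: he => //=; rewrite sub0r normrN gtr0_norm//.
    by rewrite (le_lt_trans xe)// ltr_pdivrMr// ltr_pMr// ltr1n.
have [|c cy1 hc] := @EVT_max R (fun x => `|f x|) y 1 (ltW y1).
  apply: continuous_in_subspaceT => x /set_mem /=; rewrite in_itv /= => /andP[yx x1].
  have h : {for x, continuous f} by apply: (rder_continuous (df x _)); rewrite (lt_le_trans y0 yx).
  exact: (continuous_comp h (@norm_continuous _ _ _)).
exists (Num.max 1 `|f c|); first by rewrite le_max ler01.
move=> x /andP[x0 x1]; rewrite le_max; have [xy|yx] := leP x y.
  by rewrite (ltW (fy x _))// x0.
by rewrite hc ?orbT// in_itv /= (ltW yx).
Qed.

(** Iterating [power_bound] on both equations yields [D = O (A ^ n s ^ n / n!)] for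
    every [n]; the singular factor [1 / s] costs only the power gained from the
    second equation. *)
Lemma bessel_system_unique (q : R[i]) (D E : R -> R[i]) :
  (forall s, 0 < s -> cderive D s (- (s^-1)%:C * E s)) ->
  (forall s, 0 < s -> cderive E s (- q * D s)) ->
  ccvg 0^'+ D 0 -> ccvg 0^'+ E 0 -> D 1 = 0.
Proof.
move=> dD dE [D1 D2] [E1 E2].
pose d1 s := Re (D s); pose d2 s := Im (D s).
pose A := 2 * normc q.
have A0 : 0 <= A by rewrite mulr_ge0 ?normc_ge0.
have dD1 x : 0 < x <= 1 -> is_derive x (1 : R) d1 (- (x^-1 * Re (E x))).
  move=> /andP[x0 _]; have [h _] := dD x x0; apply: (is_derive_eq h).
  by rewrite Re_mul Re_opp Im_opp Re_real Im_real oppr0 mul0r subr0 mulNr.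
have dD2 x : 0 < x <= 1 -> is_derive x (1 : R) d2 (- (x^-1 * Im (E x))).
  move=> /andP[x0 _]; have [_ h] := dD x x0; apply: (is_derive_eq h).
  by rewrite Im_mul Re_opp Im_opp Re_real Im_real oppr0 mul0r addr0 mulNr.
have [M1 M10 hM1] := bounded_of_cvg0 dD1 D1.
have [M2 M20 hM2] := bounded_of_cvg0 dD2 D2.
pose M := M1 + M2.
have M0 : 0 <= M by rewrite addr_ge0.
have key n : forall x, 0 < x <= 1 ->
    `|d1 x| <= M * exp_coeff A n * x ^+ n /\ `|d2 x| <= M * exp_coeff A n * x ^+ n.
  elim: n => [|n IH].
    move=> x x01; rewrite /exp_coeff /= expr0 fact0 divr1 !mulr1; split.
      by rewrite (le_trans (hM1 x x01))// lerDl.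
    by rewrite (le_trans (hM2 x x01))// lerDr.
  set cn := M * exp_coeff A n in IH.
  have cn0 : 0 <= cn by rewrite mulr_ge0// exp_coeff_ge0.
  have nD x : 0 < x <= 1 -> normc (- q * D x) <= A * cn * x ^+ n.
    move=> x01; have [h1 h2] := IH x x01; rewrite normcM normcN.
    have h3 : normc (D x) <= 2 * (cn * x ^+ n).
      apply: le_trans (normc_le_ReIm _) _; rewrite mulr_natl mulr2n; exact: lerD.
    apply: le_trans (ler_wpM2l (normc_ge0 q) h3) _.
    by rewrite /A (_ : normc q * _ = 2 * normc q * cn * x ^+ n)//; ring.
  have Acn0 : 0 <= A * cn by rewrite mulr_ge0.
  have bE1 := @power_bound (fun s => Re (E s)) (fun s => Re (- q * D s)) (A * cn) n Acn0
    (fun x h => (dE x (proj1 (andP h))).1) (fun x h => le_trans (Re_le_normc _) (nD x h)) E1.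
  have bE2 := @power_bound (fun s => Im (E s)) (fun s => Im (- q * D s)) (A * cn) n Acn0
    (fun x h => (dE x (proj1 (andP h))).2) (fun x h => le_trans (Im_le_normc _) (nD x h)) E2.
  have Acn1 : 0 <= A * cn / n.+1%:R by rewrite divr_ge0.
  (* Two factors [1 / (n + 1)] are available; one suffices. *)
  have en : A * cn / n.+1%:R / n.+1%:R <= M * exp_coeff A n.+1.
    have -> : M * exp_coeff A n.+1 = A * cn / n.+1%:R.
      rewrite /cn /exp_coeff /= exprS factS natrM invfM.
      have f0 : n`!%:R != 0 :> R by rewrite pnatr_eq0 -lt0n fact_gt0.
      by field; rewrite f0 addrC natr1 pnatr_eq0.
    by rewrite ler_piMr// invf_le1 ?ltr0n// ler1n.
  have bd (e : R) x : 0 < x <= 1 -> `|e| <= A * cn / n.+1%:R * x ^+ n.+1 ->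
      `|- (x^-1 * e)| <= A * cn / n.+1%:R * x ^+ n.
    move=> /andP[x0 x1] he; rewrite normrN normrM gtr0_norm ?invr_gt0//.
    rewrite ler_pdivrMl// (_ : x * _ = A * cn / n.+1%:R * x ^+ n.+1)//.
    by rewrite exprS; ring.
  have b1 := power_bound Acn1 dD1 (fun x h => bd _ x h (bE1 x h)) D1.
  have b2 := power_bound Acn1 dD2 (fun x h => bd _ x h (bE2 x h)) D2.
  move=> x x01; have /andP[x0 x1] := x01.
  have xn0 : 0 <= x ^+ n.+1 by rewrite exprn_ge0// ltW.
  by split; [apply: le_trans (b1 x x01) _|apply: le_trans (b2 x x01) _]; rewrite ler_wpM2r.
have lim0 (e : R) : (forall n, `|e| <= M * exp_coeff A n) -> e = 0.
  move=> he; apply/eqP; rewrite -normr_le0.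
  have h : M * exp_coeff A n @[n --> \oo] --> 0.
    rewrite -[X in _ --> X](mulr0 M); apply: cvgM; first exact: cvg_cst.
    exact: cvg_exp_coeff.
  by rewrite -(cvg_lim _ h)//; apply: limr_ge; [exact: cvgP h|exact: nearW].
apply: complex_ext; apply: lim0 => n; have [|h1 h2] := key n 1.
- by rewrite ltr01 lexx.
- by rewrite expr1n mulr1 in h1.
- by rewrite ltr01 lexx.
- by rewrite expr1n mulr1 in h2.
Qed.

End bessel_system_uniqueness.

(** * The Bessel system: solution by series *)

Section hankel_integral.
Context {R : realType}.
Notation mu := (@lebesgue_measure R).
Notation Rp := (`[(0:R), +oo[%classic).
Implicit Types (z q : R[i]) (s t x : R).

Definition j0coef q m : R[i] := q ^+ m / (m`!%:R) ^+ 2.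
Definition y0coef q m : R[i] := (series harmonic m : R)%:C * j0coef q m.

Lemma fact_neq0 m : (m`!%:R : R[i]) != 0.
Proof. by rewrite pnatr_eq0 -lt0n fact_gt0. Qed.

Lemma j0coefS q m : (m.+1%:R : R[i]) ^+ 2 * j0coef q m.+1 = q * j0coef q m.
Proof.
rewrite /j0coef factS natrM exprMn invfM (exprS q).
have : (m.+1%:R : R[i]) != 0 by rewrite pnatr_eq0.
have := fact_neq0 m; move: (m.+1%:R : R[i]) (m`!%:R : R[i]) => n f f0 n0.
by field; rewrite n0 f0.
Qed.

Lemma normc_X z n : normc (z ^+ n) = normc z ^+ n.
Proof. by elim: n => [|n IH]; rewrite ?expr0 ?normc1// !exprS normcM IH. Qed.

Lemma normc_j0coef q m : normc (j0coef q m) <= normc q ^+ m / m`!%:R.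
Proof.
rewrite normcM normcV !normc_X normc_nat ler_wpM2l ?exprn_ge0 ?normc_ge0//.
rewrite lef_pV2 ?posrE ?exprn_gt0 ?ltr0n ?fact_gt0//.
by rewrite expr2 ler_peMr// ler1n fact_gt0.
Qed.

Lemma harmonic_le m : 0 <= (series harmonic m : R) <= 2 ^+ m.
Proof.
elim: m => [|m /andP[IH0 IH]]; first by rewrite /series /= big_nil lexx ler01.
rewrite /series /= big_nat_recr//= -/(series harmonic m) addr_ge0 ?invr_ge0//=.
rewrite exprS mulr_natl mulr2n lerD// (@le_trans _ _ 1) ?invf_le1 ?ler1n ?ltr0n//.
by rewrite exprn_ege1// ler1n.
Qed.

Lemma exptype_j0 q : exptype (j0coef q).
Proof.
exists 1, (normc q); split => //; first exact: normc_ge0.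
by move=> m; rewrite mul1r normc_j0coef.
Qed.

Lemma exptype_y0 q : exptype (y0coef q).
Proof.
exists 1, (2 * normc q); split => //; first by rewrite mulr_ge0 ?normc_ge0.
move=> m; have /andP[h0 h1] := harmonic_le m.
rewrite mul1r exprMn -mulrA normcM normcC ger0_norm// ler_pM ?normc_ge0//.
exact: normc_j0coef.
Qed.

(** The operator [s d / d s] on series, in terms of which the Bessel equation has no
    singular coefficient. *)
Definition euler_coef (c : nat -> R[i]) m : R[i] := m%:R * c m.

Lemma exptype_euler c : exptype c -> exptype (euler_coef c).
Proof.
move=> [K [A [K0 A0 h]]]; exists K, (2 * A); split => //; first exact: mulr_ge0.
move=> m; rewrite normcM normc_nat exprMn.
have h2 : m%:R <= 2 ^+ m :> R by rewrite -natrX ler_nat ltnW// ltn_expl.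
apply: le_trans (ler_pM _ (normc_ge0 _) h2 (h m)) _ => //.
by rewrite (_ : 2 ^+ m * _ = K * (2 ^+ m * A ^+ m / m`!%:R))//; ring.
Qed.

Lemma cps_euler c s : exptype c -> cps (euler_coef c) s = s%:C * cps (cdiffs c) s.
Proof.
by move=> hc; rewrite cps_shift; [rewrite /euler_coef mul0r add0r|exact: exptype_euler].
Qed.

Lemma cdiffs_euler_j0 q : cdiffs (euler_coef (j0coef q)) = (fun m => q * j0coef q m).
Proof.
by apply/funext => m; rewrite /cdiffs /euler_coef mulrA -expr2 j0coefS.
Qed.

Lemma cdiffs_euler_y0 q : cdiffs (euler_coef (y0coef q)) =
  (fun m => q * y0coef q m + cdiffs (j0coef q) m).
Proof.
apply/funext => m; rewrite /cdiffs /euler_coef /y0coef.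
have -> : (series harmonic m.+1 : R)%:C = (series harmonic m : R)%:C + (m.+1%:R : R[i])^-1.
  rewrite /series /= big_nat_recr//= rmorphD /=; congr (_ + _).
  by rewrite fmorphV rmorph_nat.
rewrite (mulrCA q) -j0coefS.
have : (m.+1%:R : R[i]) != 0 by rewrite pnatr_eq0.
move: (m.+1%:R : R[i]) => n n0.
by field.
Qed.

Variables (q L : R[i]).
Let I := cps (j0coef q).
Let S := cps (y0coef q).
Let TI := cps (euler_coef (j0coef q)).
Let TS := cps (euler_coef (y0coef q)).
Let lnc s : R[i] := (ln s)%:C + L.
(* The solution with a logarithm of the system satisfied by [besselF] and [besselP],
   with a free constant [L]; [Ps] is [- s] times the derivative of [Fs]. *)
Let Fs s := 2 * S s - lnc s * I s.
Let Ps s := I s + lnc s * TI s - 2 * TS s.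

Let cderive_lnc s : 0 < s -> cderive lnc s (s^-1)%:C.
Proof.
move=> s0; apply: cderive_eq (cderiveD (cderive_real (is_derive1_ln s0)) (cderive_cst L s)) _.
by rewrite addr0.
Qed.

Let cderive_I s : cderive I s (cps (cdiffs (j0coef q)) s).
Proof. by apply: cderive_cps; exact: exptype_j0. Qed.

Let cderive_S s : cderive S s (cps (cdiffs (y0coef q)) s).
Proof. by apply: cderive_cps; exact: exptype_y0. Qed.

Let cderive_TI s : cderive TI s (q * I s).
Proof.
apply: cderive_eq (cderive_cps s (exptype_euler (exptype_j0 q))) _.
by rewrite cdiffs_euler_j0 cpsZ//; exact: exptype_j0.
Qed.

Let cderive_TS s : cderive TS s (q * S s + cps (cdiffs (j0coef q)) s).
Proof.
apply: cderive_eq (cderive_cps s (exptype_euler (exptype_y0 q))) _.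
rewrite cdiffs_euler_y0 cpsD ?cpsZ//; first exact: exptype_y0.
  by apply: exptypeZ; exact: exptype_y0.
by apply: exptype_cdiffs; exact: exptype_j0.
Qed.

Let TIE s : TI s = s%:C * cps (cdiffs (j0coef q)) s.
Proof. by apply: cps_euler; exact: exptype_j0. Qed.

Let TSE s : TS s = s%:C * cps (cdiffs (y0coef q)) s.
Proof. by apply: cps_euler; exact: exptype_y0. Qed.

Lemma cderive_series_F s : 0 < s -> cderive Fs s (- (s^-1)%:C * Ps s).
Proof.
move=> s0.
have h := cderiveB (cderiveMl 2 (cderive_S s)) (cderiveM (cderive_lnc s0) (cderive_I s)).
apply: cderive_eq h _; rewrite /Ps TIE TSE.
have -> : (s^-1)%:C = (s%:C : R[i])^-1 by rewrite fmorphV.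
have s1 : s%:C != 0 :> R[i] by rewrite eq_complex /= gt_eqF.
by field.
Qed.

Lemma cderive_series_P s : 0 < s -> cderive Ps s (- q * Fs s).
Proof.
move=> s0.
have h := cderiveB (cderiveD (cderive_I s) (cderiveM (cderive_lnc s0) (cderive_TI s)))
  (cderiveMl 2 (cderive_TS s)).
apply: cderive_eq h _; rewrite /Fs TIE.
have -> : (s^-1)%:C = (s%:C : R[i])^-1 by rewrite fmorphV.
have s1 : s%:C != 0 :> R[i] by rewrite eq_complex /= gt_eqF.
by field.
Qed.

Lemma cvg_mul_ln : s * ln s @[s --> (0 : R)^'+] --> 0.
Proof.
have h : - (2 * Num.sqrt s) @[s --> (0 : R)^'+] --> - (2 * Num.sqrt (0 : R)).
  apply: cvg_at_right_filter; apply: cvgN; apply: cvgM; first exact: cvg_cst.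
  exact: sqrt_continuous.
rewrite sqrtr0 mulr0 oppr0 in h.
apply: (@squeeze_cvgr _ _ _ _ (fun s => - (2 * Num.sqrt s)) (fun=> 0)) => //; last exact: cvg_cst.
near=> s.
have s0 : 0 < s by near: s; exact: nbhs_right_gt.
have s1 : s < 1 by near: s; exact: nbhs_right_lt.
apply/andP; split; last first.
  by rewrite mulr_ge0_le0 ?(ltW s0)// -(@ln1 R) ler_ln ?posrE// ltW.
pose r := Num.sqrt s.
have r0 : 0 < r by rewrite sqrtr_gt0.
have sr : s = r ^+ 2 by rewrite sqr_sqrtr// ltW.
have h1 : - ln r <= r^-1.
  by rewrite -lnV ?posrE// ltW// ln_sublinear// invr_gt0.
rewrite -/r sr lnXn// lerNl.
rewrite (_ : - _ = 2 * (r ^+ 2 * - ln r)); last by rewrite -mulr_natl; ring.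
rewrite ler_wpM2l//.
apply: le_trans (ler_wpM2l (sqr_ge0 r) h1) _.
by rewrite expr2 mulfK// gt_eqF.
Unshelve. all: by end_near. Qed.

Let ccvg_cps (c : nat -> R[i]) : exptype c -> ccvg 0^'+ (cps c) (c 0%N).
Proof.
move=> hc; have [h1 h2] := cderive_continuous (cderive_cps 0 hc).
split; rewrite -(cps0 hc); apply: cvg_at_right_filter; [exact: h1|exact: h2].
Qed.

Lemma ccvg_series_P : ccvg 0^'+ Ps 1.
Proof.
have s0 : ccvg 0^'+ (fun s => s%:C) (0 : R)%:C.
  by apply: ccvg_real; apply: cvg_at_right_filter; exact: cvg_id.
have sl : ccvg 0^'+ (fun s => (s * ln s)%:C) (0 : R)%:C by apply: ccvg_real; exact: cvg_mul_ln.
have e0 : exptype (cdiffs (j0coef q)) by apply: exptype_cdiffs; exact: exptype_j0.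
have e1 : exptype (cdiffs (y0coef q)) by apply: exptype_cdiffs; exact: exptype_y0.
have -> : Ps = (fun s => I s + ((s * ln s)%:C + L * s%:C) * cps (cdiffs (j0coef q)) s
   + (- 2) * (s%:C * cps (cdiffs (y0coef q)) s)).
  by apply/funext => s; rewrite /Ps TIE TSE /lnc rmorphM /=; ring.
have h := ccvgD (ccvgD (ccvg_cps (exptype_j0 q)) (ccvgM (ccvgD sl (ccvgM (ccvg_cst L) s0)) (ccvg_cps e0)))
  (ccvgM (ccvg_cst (- 2)) (ccvgM s0 (ccvg_cps e1))).
move: h; rewrite rmorph0 mulr0 addr0 !mul0r mulr0 !addr0 /j0coef expr0 fact0 expr1n divr1.
exact.
Qed.

Lemma ccvg_series_F : ccvg 0^'+ (fun s => Fs s + (ln s)%:C) (- L).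
Proof.
have s0 : ccvg 0^'+ (fun s => s%:C) (0 : R)%:C.
  by apply: ccvg_real; apply: cvg_at_right_filter; exact: cvg_id.
have sl : ccvg 0^'+ (fun s => (s * ln s)%:C) (0 : R)%:C by apply: ccvg_real; exact: cvg_mul_ln.
have j0 : j0coef q 0 = 1 by rewrite /j0coef expr0 fact0 expr1n divr1.
have e0 := exptype_shift (exptype_j0 q).
have -> : (fun s => Fs s + (ln s)%:C) =
   (fun s => 2 * S s + (- 1) * ((s * ln s)%:C * cps (fun m => j0coef q m.+1) s) + - L * I s).
  apply/funext => s; rewrite /Fs /lnc rmorphM /=.
  have -> : I s = 1 + s%:C * cps (fun m => j0coef q m.+1) s.
    by rewrite /I cps_shift ?j0//; exact: exptype_j0.
  by ring.
have h := ccvgD (ccvgD (ccvgM (ccvg_cst 2) (ccvg_cps (exptype_y0 q)))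
  (ccvgM (ccvg_cst (- 1)) (ccvgM sl (ccvg_cps e0)))) (ccvgM (ccvg_cst (- L)) (ccvg_cps (exptype_j0 q))).
move: h; rewrite rmorph0 mul0r mulr0 j0 mulr1 /y0coef /series /= big_nil rmorph0 mul0r mulr0 !add0r.
exact.
Qed.

End hankel_integral.

(** * The Hankel function as a contour integral *)

Section hankel_representation.
Context {R : realType}.
Implicit Types (z q : R[i]) (s t x : R).

Lemma cos_eq1 x : `|x| < 2 * pi -> cos x = 1 -> x = 0.
Proof.
move=> xpi c1; apply/eqP; rewrite -normr_eq0; apply/eqP.
have c2 : cos `|x| = 1 by case: (ger0P x) => _; rewrite ?cosN.
have := normr_ge0 x; rewrite le_eqVlt => /predU1P[<-//|x0].
have h : 0 < sin (`|x| / 2).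
  by apply: sin_gt0_pi; rewrite divr_gt0//= ltr_pdivrMr// mulrC.
move: c2; rewrite -(@divfK _ (2 : R) _ `|x|)// mulr_natr cos_mulr2n => c2.
have c3 : cos (`|x| / 2) ^+ 2 = 1.
  have : cos (`|x| / 2) ^+ 2 *+ 2 = 2 by rewrite -[RHS]/(1 + 1) -[X in _ = 1 + X]c2 addrC subrK.
  by rewrite -mulr_natl => /(congr1 (fun y => 2^-1 * y)); rewrite mulrA mulVf// mul1r => ->.
have := cos2Dsin2 (`|x| / 2); rewrite c3 => /eqP; rewrite -subr_eq0 addrAC subrr add0r sqrf_eq0.
by rewrite gt_eqF.
Qed.

Lemma cexp_inj (a b : R[i]) : cexp a = cexp b -> `|Im a - Im b| < 2 * pi -> a = b.
Proof.
move=> e im.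
have r : Re a = Re b.
  by apply: expR_inj; rewrite -!normc_cexp e.
apply: complex_ext => //; apply/eqP; rewrite -subr_eq0; apply/eqP; apply: cos_eq1 => //.
have : cexp (a - b) = 1 by rewrite cexpD cexpN e divff// cexp_neq0.
by move=> /(congr1 (@Re R)); rewrite /cexp /= Re_sub Im_sub r subrr expR0 mul1r.
Qed.

Lemma Im_clog_bound z : - (pi / 2) < Im (clog z) < pi / 2.
Proof. by rewrite /clog /= atan_gtNpi2 atan_ltpi2. Qed.

Lemma Re_div_normc_bound z : z != 0 -> -1 <= Re z / normc z <= 1.
Proof.
move=> z0; have n0 := normc_gt0 z0.
rewrite -ler_norml normrM normfV (gtr0_norm n0) ler_pdivrMr// mul1r.
exact: Re_le_normc.
Qed.

Lemma carg_bound z : 0 < Re z -> 0 <= Im z -> 0 <= carg z < pi / 2.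
Proof.
move=> x0 y0; rewrite /carg y0.
have z0 := Re_gt0_neq0 x0; have n0 := normc_gt0 z0.
have b := Re_div_normc_bound z0.
rewrite acos_ge0//= ltNge; apply/negP => h.
have a1 := acos_lepi b; have := pi_gt0 R => pi0.
have : 0 < cos (acos (Re z / normc z)) by rewrite acosK ?in_itv//= divr_gt0.
rewrite ltNge => /negP; apply.
have i1 : acos (Re z / normc z) \in `[0, pi] by rewrite in_itv/= acos_ge0.
have i2 : pi / 2 \in `[0 : R, pi] by rewrite in_itv/=; apply/andP; split; lra.
by rewrite -(@cos_pihalf R) leNgt (ltr_cos i1 i2) -leNgt.
Qed.

Lemma cexp_cln z : 0 < Re z -> 0 <= Im z -> cexp (cln z) = z.
Proof.
move=> x0 y0.
have z0 := Re_gt0_neq0 x0; have n0 := normc_gt0 z0.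
have b := Re_div_normc_bound z0.
rewrite /cexp /cln /= lnK ?posrE// /carg y0.
apply: complex_ext => /=.
  by rewrite acosK ?in_itv//= mulrC divfK// gt_eqF.
rewrite sin_acos//.
rewrite (_ : 1 - _ = (Im z / normc z) ^+ 2); last first.
  rewrite !exprMn exprVn normc_sqr; field.
  exact: sqr_Re_Im_neq0.
by rewrite sqrtr_sqr ger0_norm ?divr_ge0 ?normc_ge0// mulrC divfK// gt_eqF.
Qed.

Lemma cexp_pihalf : cexp (- (pi / 2 : R) *i) = - 'i.
Proof.
rewrite /cexp /= oppr0 expR0 !mul1r cosN sinN cos_pihalf sin_pihalf.
by apply: complex_ext; rewrite /= ?oppr0.
Qed.

(** Both sides have the same exponential; the branches agree because the imaginary
    parts of both sides are confined to a range of length less than [2 pi]. *)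
Lemma clog_add_cln (p u z : R[i]) : 0 < Re z -> 0 <= Im z -> 0 < Re p -> Im u < 0 ->
  p * u = - (z ^+ 2 / 4) ->
  clog p + clog ('i * u) = 2 * cln (z / 2) - (pi / 2 : R) *i.
Proof.
move=> z0 z1 p0 u0 e.
have h2 : (2 : R[i])^-1 = (2^-1 : R)%:C by rewrite fmorphV rmorph_nat.
have z20 : 0 < Re (z / 2) by rewrite h2 Re_mul Im_real mulr0 subr0 Re_real divr_gt0.
have z21 : 0 <= Im (z / 2) by rewrite h2 Im_mul Im_real mulr0 add0r Re_real divr_ge0.
have E : - (pi / 2 : R) *i = (- (pi / 2 : R)) *i :> R[i].
  by apply: complex_ext; rewrite /= ?oppr0.
have iu0 : 0 < Re ('i * u) by rewrite Re_muli oppr_gt0.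
apply: cexp_inj.
  rewrite cexpD !cexp_clog// (mulrCA p) e.
  rewrite cexpD cexp_pihalf mulr_natl mulr2n cexpD cexp_cln//.
  have : (2 : R[i]) != 0 by rewrite pnatr_eq0.
  have -> : (4 : R[i]) = 2 * 2 by rewrite -natrM.
  move: ('i : R[i]) (2 : R[i]) => i n n0; field; exact: n0.
have /andP[a1 a2] := Im_clog_bound p.
have /andP[b1 b2] := Im_clog_bound ('i * u).
have /andP[c1 c2] := carg_bound z20 z21.
have Ec : Im (2 * cln (z / 2) - (pi / 2 : R) *i) = 2 * carg (z / 2) - pi / 2.
  have h2' : (2 : R[i]) = (2 : R)%:C by rewrite rmorph_nat.
  by rewrite Im_sub {1}h2' Im_mul Re_real Im_real mul0r addr0.
rewrite Ec Im_add ltr_norml; have := pi_gt0 R => pi0.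
by apply/andP; split; lra.
Qed.

(** [besselF] and the logarithmic series solve the same system and have the same
    behaviour at 0+, once the constant [L] is matched. *)
Lemma besselF_at1 (u w p : R[i]) : Im u < 0 -> 0 < Re w -> Im w <= 0 -> 0 < Re p ->
  besselF u w p 1 = 2 * cps (y0coef (p * u)) 1 -
    (euler_gamma%:C + euler_gamma%:C + clog p + clog ('i * u) - (pi / 2 : R) *i)
      * cps (j0coef (p * u)) 1.
Proof.
move=> u0 w0 w1 p0; set L := (X in _ - X * _).
pose Fs s := 2 * cps (y0coef (p * u)) s - ((ln s)%:C + L) * cps (j0coef (p * u)) s.
pose Ps s := cps (j0coef (p * u)) s + ((ln s)%:C + L) * cps (euler_coef (j0coef (p * u))) s
   - 2 * cps (euler_coef (y0coef (p * u))) s.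
have h : besselF u w p 1 - Fs 1 = 0.
  apply: (@bessel_system_unique _ (p * u) (fun s => besselF u w p s - Fs s)
     (fun s => besselP u w p s - Ps s)).
  - move=> s s0; apply: cderive_eq (cderiveB (cderive_besselF u0 w0 w1 p0 s0) (cderive_series_F (p * u) L s0)) _.
    by rewrite /Ps; ring.
  - move=> s s0; apply: cderive_eq (cderiveB (cderive_besselP u0 w0 w1 p0 s0) (cderive_series_P (p * u) L s0)) _.
    by rewrite /Fs; ring.
  - have h1 := ccvgD (ccvg_besselF u0 w0 w1 p0) (ccvgN (ccvg_series_F (p * u) L)).
    have -> : (0 : R[i]) = (pi / 2 : R) *i - euler_gamma%:C - clog ('i * u) -
         (euler_gamma%:C + clog p) - - L by rewrite /L; ring.
    have -> : (fun s => besselF u w p s - Fs s) =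
      (fun s => besselF u w p s + (ln s)%:C - (Fs s + (ln s)%:C)).
      by apply/funext => s; ring.
    exact: h1.
  - have -> : (0 : R[i]) = 1 - 1 by rewrite subrr.
    exact: ccvgD (ccvg_besselP u0 w0 w1 p0) (ccvgN (ccvg_series_P (p * u) L)).
move/eqP: h; rewrite subr_eq0 => /eqP ->.
by rewrite /Fs ln1 rmorph0 add0r.
Qed.

Lemma hankel_algebra (i P S J c g : R[i]) : i * i = -1 -> P != 0 ->
  2 * S - (g + g + 2 * c - i * P / 2 - i * P / 2) * J =
    i * P * (J + i * (2 / P * ((c + g) * J - S))).
Proof.
move=> i2 P0.
have -> : i * P * (J + i * (2 / P * ((c + g) * J - S))) =
   i * P * J + (i * i) * 2 * ((c + g) * J - S) by field.
rewrite i2.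
have h : i * P / 2 + i * P / 2 = i * P by rewrite -splitr.
have -> : g + g + 2 * c - i * P / 2 - i * P / 2 = g + g + 2 * c - (i * P / 2 + i * P / 2) by ring.
by rewrite h; ring.
Qed.

(** Schlaefli's integral: the integral of [exp (- v + z ^ 2 / (4 v)) / v] along any
    broken path of this kind is a multiple of the Hankel function. *)
Lemma besselF_hankel (z u w p : R[i]) :
  0 < Re z -> 0 <= Im z -> Im u < 0 -> 0 < Re w -> Im w <= 0 -> 0 < Re p ->
  p * u = - (z ^+ 2 / 4) -> besselF u w p 1 = 'i * pi%:C * hankel10 z.
Proof.
move=> z0 z1 u0 w0 w1 p0 e.
rewrite besselF_at1// e.
have q m : (- (z ^+ 2 / 4)) ^+ m = (-1) ^+ m * (z ^+ 2 / 4) ^+ m :> R[i].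
  exact: exprNn.
have -> : cps (j0coef (- (z ^+ 2 / 4))) 1 = besselJ0 z.
  rewrite /cps /besselJ0; congr csum; apply/funext => m.
  by rewrite rmorph1 expr1n mulr1 /j0coef q.
have Y : cps (y0coef (- (z ^+ 2 / 4))) 1 =
   csum (fun m => (-1) ^+ m * (series harmonic m)%:C * (z ^+ 2 / 4) ^+ m / (m`!%:R) ^+ 2).
  rewrite /cps; congr csum; apply/funext => m.
  by rewrite rmorph1 expr1n mulr1 /y0coef /j0coef q; ring.
rewrite Y /hankel10 /besselY0.
have := clog_add_cln z0 z1 p0 u0 e => h.
have -> : euler_gamma%:C + euler_gamma%:C + clog p + clog ('i * u) - (pi / 2 : R) *i =
   euler_gamma%:C + euler_gamma%:C + 2 * cln (z / 2) - (pi / 2 : R) *i - (pi / 2 : R) *i.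
  by rewrite -!addrA (addrA (clog p)) h; ring.
have pi2 : (pi / 2 : R) *i = 'i * (pi : R)%:C / 2 :> R[i].
  have -> : (2 : R[i])^-1 = (2^-1 : R)%:C by rewrite fmorphV rmorph_nat.
  by rewrite -mulrA -rmorphM /=; apply: complex_ext; rewrite ?Re_muli ?Im_muli //= oppr0.
have pi3 : (2 / pi)%:C = 2 / (pi : R)%:C :> R[i] by rewrite rmorphM fmorphV rmorph_nat.
have i2 : ('i : R[i]) * 'i = -1 by rewrite -expr2 sqr_i.
rewrite pi2 pi3.
have pn0 : (pi : R)%:C != 0 :> R[i] by rewrite eq_complex /= gt_eqF ?pi_gt0.
set S := csum _; set J := besselJ0 z; set c := cln _; set g := euler_gamma%:C.
exact: hankel_algebra.
Qed.

End hankel_representation.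

(** * Measurability and Fubini's theorem for complex-valued functions *)

Section complex_measurability.
Context {R : realType} {d : measure_display} {T : measurableType d}.
Implicit Types (f g : T -> R[i]) (r : T -> R).

Lemma measurable_funV r : measurable_fun setT r -> measurable_fun setT (fun x => (r x)^-1).
Proof.
move=> mr; apply: (measurableT_comp (f := fun x : R => x^-1)) => //.
have -> : [set: R] = [set 0] `|` ~` [set 0] by rewrite setUv.
have m0 : measurable ([set 0] : set (measurableTypeR R)) by exact: measurable_set1.
apply/measurable_funU => //; first by apply: measurableC.
split; first exact: measurable_fun_set1.
apply: continuous_measurable_on; first exact: measurableC.
by move=> t /eqP t0; exact: inv_continuous.
Qed.

Lemma cmeasurable_cst (c : R[i]) : cmeasurable setT (fun _ : T => c).
Proof. by split; exact: measurable_cst. Qed.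

Lemma cmeasurable_real r : measurable_fun setT r -> cmeasurable setT (fun x => (r x)%:C).
Proof. by move=> mr; split => //; exact: measurable_cst. Qed.

Lemma cmeasurableD f g : cmeasurable setT f -> cmeasurable setT g ->
  cmeasurable setT (fun x => f x + g x).
Proof.
move=> [f1 f2] [g1 g2]; split.
  by under eq_fun do rewrite Re_add; exact: measurable_funD.
by under eq_fun do rewrite Im_add; exact: measurable_funD.
Qed.

Lemma cmeasurableM f g : cmeasurable setT f -> cmeasurable setT g ->
  cmeasurable setT (fun x => f x * g x).
Proof.
move=> [f1 f2] [g1 g2]; split.
  by under eq_fun do rewrite Re_mul; apply: measurable_funB; exact: measurable_funM.
by under eq_fun do rewrite Im_mul; apply: measurable_funD; exact: measurable_funM.
Qed.

Lemma cmeasurableN f : cmeasurable setT f -> cmeasurable setT (fun x => - f x).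
Proof.
move=> h; have := cmeasurableM (cmeasurable_cst (-1)) h.
by under eq_fun do rewrite mulN1r.
Qed.

Lemma cmeasurable_conj f : cmeasurable setT f -> cmeasurable setT (fun x => (f x)^*%C).
Proof.
move=> [f1 f2]; split; first by have -> : (fun x => Re (f x)^*%C) = (fun x => Re (f x)) by apply/funext => x; case: (f x).
have -> : (fun x => Im (f x)^*%C) = (fun x => - Im (f x)) by apply/funext => x; case: (f x).
exact: measurable_funN.
Qed.

Lemma cmeasurable_cexp f : cmeasurable setT f -> cmeasurable setT (fun x => cexp (f x)).
Proof.
move=> [f1 f2]; split; rewrite /cexp /=; apply: measurable_funM.
- exact: (measurableT_comp (@measurable_expR R)).
- by apply: (measurableT_comp _ f2); apply: continuous_measurable_fun; exact: continuous_cos.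
- exact: (measurableT_comp (@measurable_expR R)).
- by apply: (measurableT_comp _ f2); apply: continuous_measurable_fun; exact: continuous_sin.
Qed.

Lemma cmeasurableV f : cmeasurable setT f -> cmeasurable setT (fun x => (f x)^-1).
Proof.
move=> [f1 f2].
have h : measurable_fun setT (fun x => (Re (f x) ^+ 2 + Im (f x) ^+ 2)^-1).
  by apply: measurable_funV; apply: measurable_funD; exact: measurable_funX.
split.
  by under eq_fun do rewrite Re_inv; apply: measurable_funM.
by under eq_fun do rewrite Im_inv; apply: measurable_funM => //; exact: measurable_funN.
Qed.

Lemma measurable_normc f : cmeasurable setT f -> measurable_fun setT (fun x => normc (f x)).
Proof.
move=> [f1 f2].
have -> : (fun x => normc (f x)) = (fun x => Num.sqrt (Re (f x) ^+ 2 + Im (f x) ^+ 2)).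
  by apply/funext => x; case: (f x).
have ms : measurable_fun setT (@Num.sqrt R) by apply: continuous_measurable_fun; exact: sqrt_continuous.
apply: (measurableT_comp ms).
by apply: measurable_funD; exact: measurable_funX.
Qed.

End complex_measurability.

Lemma cmeasurable_comp (R : realType) d d' (T : measurableType d) (T' : measurableType d')
    (f : T' -> R[i]) (h : T -> T') : cmeasurable setT f -> measurable_fun setT h ->
  cmeasurable setT (fun x => f (h x)).
Proof. by move=> [f1 f2] mh; split; [exact: (measurableT_comp f1 mh) | exact: (measurableT_comp f2 mh)]. Qed.

Section nonneg_integrals.
Context {R : realType} {d : measure_display} {T : measurableType d}.
Variable m : {measure set T -> \bar R}.
Implicit Types (f g : T -> R).

Lemma le_nonneg_integral f g : measurable_fun setT f -> measurable_fun setT g ->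
  (forall x, 0 <= f x) -> (forall x, f x <= g x) ->
  (\int[m]_x (f x)%:E <= \int[m]_x (g x)%:E)%E.
Proof.
move=> mf mg f0 fg; apply: ge0_le_integral => //.
- by move=> x _; rewrite lee_fin.
- exact/measurable_EFinP.
- exact/measurable_EFinP.
- by move=> x _; rewrite lee_fin.
Qed.

(** By integrating [2 p q <= (B / A) p ^ 2 + (A / B) q ^ 2], where [A] and [B] slightly
    exceed [a] and [b], so that they do not vanish. *)
Lemma cauchy_schwarz f g (a b : R) : measurable_fun setT f -> measurable_fun setT g ->
  (forall x, 0 <= f x) -> (forall x, 0 <= g x) -> 0 <= a -> 0 <= b ->
  (\int[m]_x (f x ^+ 2)%:E <= (a ^+ 2)%:E)%E ->
  (\int[m]_x (g x ^+ 2)%:E <= (b ^+ 2)%:E)%E ->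
  (\int[m]_x (f x * g x)%:E <= (a * b)%:E)%E.
Proof.
move=> mf mg f0 g0 a0 b0 fa gb.
have key (e : R) : 0 < e -> (\int[m]_x (f x * g x)%:E <= ((a + e) * (b + e))%:E)%E.
  move=> e0; set A := a + e; set B := b + e.
  have A0 : 0 < A by rewrite /A; lra.
  have B0 : 0 < B by rewrite /B; lra.
  have aA : a ^+ 2 <= A ^+ 2 by rewrite ler_pXn2r ?nnegrE// ?ltW// /A; lra.
  have bB : b ^+ 2 <= B ^+ 2 by rewrite ler_pXn2r ?nnegrE// ?ltW// /B; lra.
  apply: (@le_trans _ _ (\int[m]_x (B / A / 2 * f x ^+ 2 + A / B / 2 * g x ^+ 2)%:E)%E).
    apply: le_nonneg_integral; first exact: measurable_funM.
    - by apply: measurable_funD; apply: measurable_funM => //; exact: measurable_funX.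
    - by move=> x; rewrite mulr_ge0.
    move=> x; set p := f x; set q := g x.
    have -> : B / A / 2 * p ^+ 2 + A / B / 2 * q ^+ 2 =
      p * q + (B * p - A * q) ^+ 2 / (2 * A * B) by field; rewrite !gt_eqF.
    by rewrite lerDl divr_ge0// ?sqr_ge0// !mulr_ge0// ltW.
  have BA : 0 <= B / A / 2 by rewrite !divr_ge0// ltW.
  have AB : 0 <= A / B / 2 by rewrite !divr_ge0// ltW.
  under eq_integral do rewrite EFinD.
  rewrite ge0_integralD//; last 4 first.
  - by move=> x _; rewrite lee_fin mulr_ge0// sqr_ge0.
  - by apply/measurable_EFinP; apply: measurable_funM => //; exact: measurable_funX.
  - by move=> x _; rewrite lee_fin mulr_ge0// sqr_ge0.
  - by apply/measurable_EFinP; apply: measurable_funM => //; exact: measurable_funX.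
  under eq_integral do rewrite EFinM.
  under [X in (_ + X)%E]eq_integral do rewrite EFinM.
  rewrite !ge0_integralZl_EFin//; last 4 first.
  - by move=> x _; rewrite lee_fin sqr_ge0.
  - by apply/measurable_EFinP; exact: measurable_funX.
  - by move=> x _; rewrite lee_fin sqr_ge0.
  - by apply/measurable_EFinP; exact: measurable_funX.
  have -> : ((A * B)%:E = (B / A / 2)%:E * (A ^+ 2)%:E + (A / B / 2)%:E * (B ^+ 2)%:E)%E.
    by rewrite -!EFinM -EFinD; congr EFin; field; rewrite !gt_eqF.
  apply: leeD; apply: lee_wpmul2l; rewrite ?lee_fin//.
    by apply: le_trans fa _; rewrite lee_fin.
  by apply: le_trans gb _; rewrite lee_fin.
have [I HI] : exists I, (\int[m]_x (f x * g x)%:E = I%:E)%E.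
  have := key 1 ltr01; have : (0 <= \int[m]_x (f x * g x)%:E)%E.
    by apply: integral_ge0 => x _; rewrite lee_fin mulr_ge0.
  case: (\int[m]_x (f x * g x)%:E)%E => [r _ _| _ |//]; first by exists r.
  by rewrite leye_eq.
rewrite HI lee_fin; apply/ler_addgt0Pl => e e0.
pose c := a + b + 1; have c0 : 0 < c by rewrite /c; lra.
pose z := Num.min 1 (e / c).
have z0 : 0 < z by rewrite lt_min ltr01 divr_gt0.
have z1 : z <= 1 by rewrite ge_min lexx.
have ze : z * c <= e by rewrite -ler_pdivlMr// ge_min lexx orbT.
have := key z z0; rewrite HI lee_fin => h; apply: le_trans h _.
have : z * z <= z * 1 by rewrite ler_pM2l.
by move: ze; rewrite /c; nra.
Qed.

End nonneg_integrals.

Lemma ae_eq_integrable (R : realType) d (T : measurableType d)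
    (m : {measure set T -> \bar R}) (f g : T -> \bar R) :
  measurable_fun setT g -> m.-integrable setT f -> ae_eq m setT f g -> m.-integrable setT g.
Proof.
move=> mg /integrableP[mf fi] fg; apply/integrableP; split => //.
rewrite (@ge0_ae_eq_integral _ _ _ m setT _ (fun x => `|f x|)%E)//.
- exact: measurableT_comp.
- exact: measurableT_comp.
- by apply: filterS fg => x h Dx; rewrite h.
Qed.

Section complex_fubini.
Context {R : realType} {d1 d2 : measure_display}.
Context {X : measurableType d1} {Y : measurableType d2}.
Variables (m1 : {sigma_finite_measure set X -> \bar R}).
Variables (m2 : {sigma_finite_measure set Y -> \bar R}).
Implicit Types f : X * Y -> R[i].

Lemma cmeasurable_slice1 f x : cmeasurable setT f -> cmeasurable setT (fun y => f (x, y)).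
Proof. by move=> h; apply: (cmeasurable_comp h); exact: measurable_pair1. Qed.

Lemma cmeasurable_slice2 f y : cmeasurable setT f -> cmeasurable setT (fun x => f (x, y)).
Proof. by move=> h; apply: (cmeasurable_comp h); exact: measurable_pair2. Qed.

Lemma measurable_Rintegral2 (f : X * Y -> R) : measurable_fun setT f ->
  measurable_fun setT (fun x => \int[m2]_y f (x, y)).
Proof.
move=> mf; rewrite /Rintegral.
apply: (measurableT_comp (f := fine)) => //.
have mE : measurable_fun setT (EFin \o f) by exact/measurable_EFinP.
have -> : (fun x => (\int[m2]_y (f (x, y))%:E)%E) =
   (fun x => (\int[m2]_y ((EFin \o f)^\+ (x, y)) - \int[m2]_y ((EFin \o f)^\- (x, y)))%E).
  apply/funext => x; rewrite [LHS]integralE.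
  by congr (_ - _)%E; apply: eq_integral => y _; rewrite ?funeposE ?funenegE.
by apply: emeasurable_funB; apply: measurable_fun_fubini_tonelli_F => //;
  [exact: measurable_funepos|exact: measurable_funeneg].
Qed.

Lemma cmeasurable_cintegral2 f : cmeasurable setT f ->
  cmeasurable setT (fun x => cintegral m2 setT (fun y => f (x, y))).
Proof.
move=> [f1 f2]; split; rewrite /cintegral /=.
  exact: (measurable_Rintegral2 f1).
exact: (measurable_Rintegral2 f2).
Qed.

Lemma cintegrable_iter12 f : cmeasurable setT f ->
  (\int[m1]_x \int[m2]_y (normc (f (x, y)))%:E < +oo)%E ->
  cintegrable (m1 \x m2)%E setT f.
Proof.
move=> mf h; have mn := measurable_normc mf.
apply: (cintegrable_dominated (g := fun z => normc (f z))) => //.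
apply/integrable12ltyP; first exact/measurable_EFinP.
apply: le_lt_trans h; rewrite le_eqVlt; apply/orP; left; apply/eqP.
apply: eq_integral => x _; apply: eq_integral => y _ /=.
by rewrite ger0_norm ?normc_ge0.
Qed.

Lemma cfubini1 f : cintegrable (m1 \x m2)%E setT f ->
  [/\ {ae m1, forall x, cintegrable m2 setT (fun y => f (x, y))},
      cintegrable m1 setT (fun x => cintegral m2 setT (fun y => f (x, y))) &
      cintegral m1 setT (fun x => cintegral m2 setT (fun y => f (x, y))) =
        cintegral (m1 \x m2)%E setT f].
Proof.
have aux (h : X * Y -> R) : (m1 \x m2)%E.-integrable setT (EFin \o h) ->
  [/\ {ae m1, forall x, m2.-integrable setT (fun y => (h (x, y))%:E)},
    m1.-integrable setT (fun x => (\int[m2]_y h (x, y))%:E) &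
    \int[m1]_x \int[m2]_y h (x, y) = \int[(m1 \x m2)%E]_z h z].
  move=> ih; have ae := ae_integrable1 ih; split => //.
    have ii := integrable_fubini_F ih.
    apply: (ae_eq_integrable _ ii).
  - apply/measurable_EFinP; apply: measurable_Rintegral2.
    by have /measurable_int/measurable_EFinP := ih.
  - apply: filterS ae => x hx _; rewrite /fubini_F /= /Rintegral fineK//.
    exact: integrable_fin_num.
  rewrite {1 3}/Rintegral -(integral12_prod_meas1 ih); congr fine.
  apply: ae_eq_integral => //.
  - apply/measurable_EFinP; apply: measurable_Rintegral2.
    by have /measurable_int/measurable_EFinP := ih.
  - exact: (measurable_fubini_F ih).
  - apply: filterS ae => x hx _; rewrite /fubini_F /= /Rintegral fineK//.
    exact: integrable_fin_num.
move=> [/aux [a1 b1 c1] /aux [a2 b2 c2]]; split.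
- by apply: filterS2 a1 a2 => x h1 h2; split.
- by split.
- by rewrite /cintegral /=; congr Complex.
Qed.

Lemma cfubini2 f : cintegrable (m1 \x m2)%E setT f ->
  [/\ {ae m2, forall y, cintegrable m1 setT (fun x => f (x, y))},
      cintegrable m2 setT (fun y => cintegral m1 setT (fun x => f (x, y))) &
      cintegral m2 setT (fun y => cintegral m1 setT (fun x => f (x, y))) =
        cintegral (m1 \x m2)%E setT f].
Proof.
have aux (h : X * Y -> R) : (m1 \x m2)%E.-integrable setT (EFin \o h) ->
  [/\ {ae m2, forall y, m1.-integrable setT (fun x => (h (x, y))%:E)},
    m2.-integrable setT (fun y => (\int[m1]_x h (x, y))%:E) &
    \int[m2]_y \int[m1]_x h (x, y) = \int[(m1 \x m2)%E]_z h z].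
  move=> ih; have ae := ae_integrable2 ih.
  have ii : m2.-integrable setT (fubini_G m1 (EFin \o h)).
    apply/integrableP; split; first exact: (measurable_fubini_G ih).
    have mh := measurable_int _ ih.
    apply: le_lt_trans ((integrable21ltyP m1 m2 mh).1 ih).
    apply: ge0_le_integral => //.
    - by apply: measurableT_comp => //; exact: (measurable_fubini_G ih).
    - apply: (@measurable_fun_fubini_tonelli_G _ _ _ _ _ m1 (fun z => `|(h z)%:E|)%E) => //.
      exact: measurableT_comp.
    - move=> y _; apply: le_abse_integral => //.
      by apply: (measurableT_comp mh); exact: measurable_pair2.
  have mG : measurable_fun setT (fun y => (\int[m1]_x h (x, y))%:E).
    by apply/measurable_EFinP; apply: (measurableT_comp (f := fine)) (measurable_fubini_G ih).
    have eqG : ae_eq m2 setT (fubini_G m1 (EFin \o h)) (fun y => (\int[m1]_x h (x, y))%:E).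
    apply: filterS ae => y hy _; rewrite /fubini_G /= /Rintegral fineK//.
    exact: integrable_fin_num.
  split => //; first exact: (ae_eq_integrable mG ii).
  rewrite {1 3}/Rintegral -(integral21_prod_meas1 ih); congr fine.
  apply: ae_eq_integral => //; first exact: (measurable_fubini_G ih).
  by apply: filterS eqG => y hy Dy; rewrite hy.
move=> [/aux [a1 b1 c1] /aux [a2 b2 c2]]; split.
- by apply: filterS2 a1 a2 => x h1 h2; split.
- by split.
- by rewrite /cintegral /=; congr Complex.
Qed.

End complex_fubini.

(** * Integral operators and bilinear forms *)

Section complex_integral_lemmas.
Context {R : realType} {d : measure_display} {T : measurableType d}.
Variable m : {measure set T -> \bar R}.
Implicit Types (f g : T -> R[i]).

Lemma eq_cintegral_ae f g : cmeasurable setT f -> cmeasurable setT g ->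
  {ae m, forall x, f x = g x} -> cintegral m setT f = cintegral m setT g.
Proof.
move=> [f1 f2] [g1 g2] fg; rewrite /cintegral; congr Complex; congr fine;
  (apply: ae_eq_integral => //; try exact/measurable_EFinP);
  by apply: filterS fg => x -> _.
Qed.

Lemma cintegrable_ae f g : cmeasurable setT g -> cintegrable m setT f ->
  {ae m, forall x, f x = g x} -> cintegrable m setT g.
Proof.
move=> [g1 g2] [f1 f2] fg; split.
  apply: (ae_eq_integrable _ f1); first exact/measurable_EFinP.
  by apply: filterS fg => x -> _.
apply: (ae_eq_integrable _ f2); first exact/measurable_EFinP.
by apply: filterS fg => x -> _.
Qed.

Lemma integrable_normc f : cmeasurable setT f ->
  (\int[m]_x (normc (f x))%:E < +oo)%E -> m.-integrable setT (fun x => (normc (f x))%:E).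
Proof.
move=> mf h; apply/integrableP; split; first by apply/measurable_EFinP; exact: measurable_normc.
apply: le_lt_trans h; rewrite le_eqVlt; apply/orP; left; apply/eqP.
by apply: eq_integral => x _ /=; rewrite ger0_norm ?normc_ge0.
Qed.

Lemma cintegrableP f : cmeasurable setT f ->
  (\int[m]_x (normc (f x))%:E < +oo)%E -> cintegrable m setT f.
Proof.
move=> mf h; apply: (cintegrable_dominated (g := fun x => normc (f x))) => //.
exact: integrable_normc.
Qed.

Lemma cintegrable_cmeasurable f : cintegrable m setT f -> cmeasurable setT f.
Proof. by move=> [/measurable_int/measurable_EFinP ? /measurable_int/measurable_EFinP ?]. Qed.

Lemma cintegralMl_any (c : R[i]) f : cintegrable m setT (fun x => c * f x) ->
  cintegral m setT (fun x => c * f x) = c * cintegral m setT f.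
Proof.
have [->|c0] := eqVneq c 0.
  move=> _; rewrite mul0r; under eq_cintegral do rewrite mul0r.
  by rewrite /cintegral /= /Rintegral !integral0.
move=> h; have h' : cintegrable m setT f.
  have := cintegrableMl c^-1 measurableT h.
  by under eq_fun do rewrite mulKf//.
exact: cintegralMl.
Qed.

(** Rotate the integral onto the real axis. *)
Lemma normc_cintegral_le f : cmeasurable setT f ->
  ((normc (cintegral m setT f))%:E <= \int[m]_x (normc (f x))%:E)%E.
Proof.
move=> mf; have [/eqP h|] := boolP ((\int[m]_x (normc (f x))%:E) == +oo)%E.
  by rewrite h leey.
rewrite -ltey => h; have fi := cintegrableP mf h.
set z := cintegral m setT f.
have n0 := normc_ge0 z.
have [z0|z0] := eqVneq (normc z) 0.
  by rewrite z0; apply: integral_ge0 => x _; rewrite lee_fin normc_ge0.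
have zp : 0 < normc z by rewrite lt_neqAle eq_sym z0 n0.
have e : \int[m]_x Re (z^*%C * f x) = normc z ^+ 2.
  have := cintegralMl z^*%C measurableT fi; rewrite -/z => /(congr1 (@Re R)) h2.
  rewrite (_ : \int[m]_x _ = Re (cintegral m setT (fun t => z^*%C * f t)))// h2 normc_sqr.
  by case: (z) => a b /=; rewrite mulNr opprK !expr2.
have [i1 _] := cintegrableMl z^*%C measurableT fi.
have le : (\int[m]_x (Re (z^*%C * f x))%:E <= \int[m]_x ((normc z)%:E * (normc (f x))%:E))%E.
  apply: le_integral => //.
    by apply: integrableZl => //; exact: integrable_normc.
  move=> x _; rewrite -EFinM lee_fin.
  apply: le_trans (ler_norm _) _; apply: le_trans (Re_le_normc _) _.
  rewrite normcM le_eqVlt; apply/orP; left; apply/eqP; congr (_ * _).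
  by case: (z) => a b /=; rewrite sqrrN.
move: le; rewrite ge0_integralZl_EFin//; last 2 first.
- by move=> x _; rewrite lee_fin normc_ge0.
- by apply/measurable_EFinP; exact: measurable_normc.
have -> : (\int[m]_x (Re (z^*%C * f x))%:E = (normc z ^+ 2)%:E)%E.
  rewrite -e /Rintegral fineK//; exact: integrable_fin_num.
have : (0 <= \int[m]_x (normc (f x))%:E)%E.
  by apply: integral_ge0 => x _; rewrite lee_fin normc_ge0.
case: (\int[m]_x (normc (f x))%:E)%E h => [r _ _| |]//.
by rewrite -EFinM !lee_fin expr2 ler_pM2l.
Qed.

End complex_integral_lemmas.

Section weighted_tonelli.
Context {R : realType} {d1 d2 : measure_display}.
Context {X : measurableType d1} {Y : measurableType d2}.
Variables (m1 : {sigma_finite_measure set X -> \bar R}).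
Variables (m2 : {sigma_finite_measure set Y -> \bar R}).

(** Integrating in [x] first replaces [a] by its bound [c]. *)
Lemma weighted_tonelli2 (a : X * Y -> R) (b c : Y -> R) :
  measurable_fun setT a -> measurable_fun setT b -> measurable_fun setT c ->
  (forall z, 0 <= a z) -> (forall y, 0 <= b y) -> (forall y, 0 <= c y) ->
  {ae m2, forall y, (\int[m1]_x (a (x, y))%:E <= (c y)%:E)%E} ->
  (\int[m1 \x m2]_z (a z * b z.2)%:E <= \int[m2]_y (c y * b y)%:E)%E.
Proof.
move=> ma mb mc a0 b0 c0 h.
have mab : measurable_fun setT (fun z : X * Y => (a z * b z.2)%:E).
  apply/measurable_EFinP; apply: measurable_funM => //.
  exact: (measurableT_comp mb).
have ab0 (z : X * Y) : (0 <= (a z * b z.2)%:E)%E by rewrite lee_fin mulr_ge0.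
rewrite (fubini_tonelli2 _ mab ab0).
apply: ae_ge0_le_integral => //.
- by move=> y _; apply: integral_ge0 => x _.
- exact: (@measurable_fun_fubini_tonelli_G _ _ _ _ _ m1 (fun z => (a z * b z.2)%:E)).
- by move=> y _; rewrite lee_fin mulr_ge0.
- by apply/measurable_EFinP; exact: measurable_funM.
apply: filterS h => y hy _; rewrite /fubini_G /=.
under eq_integral do rewrite mulrC EFinM.
rewrite ge0_integralZl_EFin//; last 2 first.
- by move=> x _; rewrite lee_fin.
- by apply/measurable_EFinP; apply: (measurableT_comp ma); exact: measurable_pair2.
by rewrite muleC EFinM; apply: lee_wpmul2r; rewrite ?lee_fin.
Qed.

Lemma weighted_tonelli1 (a : X * Y -> R) (b c : X -> R) :
  measurable_fun setT a -> measurable_fun setT b -> measurable_fun setT c ->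
  (forall z, 0 <= a z) -> (forall x, 0 <= b x) -> (forall x, 0 <= c x) ->
  {ae m1, forall x, (\int[m2]_y (a (x, y))%:E <= (c x)%:E)%E} ->
  (\int[m1 \x m2]_z (a z * b z.1)%:E <= \int[m1]_x (c x * b x)%:E)%E.
Proof.
move=> ma mb mc a0 b0 c0 h.
have mab : measurable_fun setT (fun z : X * Y => (a z * b z.1)%:E).
  apply/measurable_EFinP; apply: measurable_funM => //.
  exact: (measurableT_comp mb).
have ab0 (z : X * Y) : (0 <= (a z * b z.1)%:E)%E by rewrite lee_fin mulr_ge0.
rewrite (fubini_tonelli1 _ mab ab0).
apply: ae_ge0_le_integral => //.
- by move=> x _; apply: integral_ge0 => y _.
- exact: (@measurable_fun_fubini_tonelli_F _ _ _ _ _ m2 (fun z => (a z * b z.1)%:E)).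
- by move=> x _; rewrite lee_fin mulr_ge0.
- by apply/measurable_EFinP; exact: measurable_funM.
apply: filterS h => x hx _; rewrite /fubini_F /=.
under eq_integral do rewrite mulrC EFinM.
rewrite ge0_integralZl_EFin//; last 2 first.
- by move=> y _; rewrite lee_fin.
- by apply/measurable_EFinP; apply: (measurableT_comp ma); exact: measurable_pair1.
by rewrite muleC EFinM; apply: lee_wpmul2r; rewrite ?lee_fin.
Qed.

End weighted_tonelli.

Section kernels.
Context {R : realType} {d : measure_display} {T : measurableType d}.
Variable m : {sigma_finite_measure set T -> \bar R}.
Implicit Types (g v : T -> R[i]) (K : T -> T -> R[i]).

Definition sqnorm (m' : {measure set T -> \bar R}) g : \bar R := (\int[m']_x (normc (g x) ^+ 2)%:E)%E.

Definition kop (m' : {measure set T -> \bar R}) K g x := cintegral m' setT (fun y => K x y * g y).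

(** Schur's condition bounds the operator, but serves mainly to make all double
    integrals absolutely convergent; sharper bounds come from [l2bound]. *)
Definition schur (m' : {measure set T -> \bar R}) K (S : R) :=
  [/\ cmeasurable setT (fun z : T * T => K z.1 z.2),
      forall x, (\int[m']_y (normc (K x y))%:E <= S%:E)%E &
      forall y, (\int[m']_x (normc (K x y))%:E <= S%:E)%E].

Definition l2bound (m' : {measure set T -> \bar R}) K (C : R) := forall g, cmeasurable setT g ->
  (sqnorm m' (kop m' K g) <= (C ^+ 2)%:E * sqnorm m' g)%E.

(** Bounding the form instead of the operator allows integration over families of
    kernels without measurability of operator-valued maps. *)
Definition formbound (m' : {sigma_finite_measure set T -> \bar R}) K (N : R) :=
  forall g v (G V : R), cmeasurable setT g -> cmeasurable setT v -> 0 <= G -> 0 <= V ->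
  (sqnorm m' g <= (G ^+ 2)%:E)%E -> (sqnorm m' v <= (V ^+ 2)%:E)%E ->
  normc (cintegral (m' \x m')%E setT (fun z => K z.1 z.2 * g z.2 * v z.1)) <= N * G * V.

Lemma sqnorm_ge0 (m' : {measure set T -> \bar R}) g : (0 <= sqnorm m' g)%E.
Proof. by apply: integral_ge0 => x _; rewrite lee_fin sqr_ge0. Qed.

Lemma cmeasurable_form K g v : cmeasurable setT (fun z : T * T => K z.1 z.2) ->
  cmeasurable setT g -> cmeasurable setT v ->
  cmeasurable setT (fun z : T * T => K z.1 z.2 * g z.2 * v z.1).
Proof.
move=> mK mg mv; apply: cmeasurableM; first apply: cmeasurableM => //.
  exact: (cmeasurable_comp mg).
exact: (cmeasurable_comp mv).
Qed.

Lemma cmeasurable_kop K g : cmeasurable setT (fun z : T * T => K z.1 z.2) ->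
  cmeasurable setT g -> cmeasurable setT (kop m K g).
Proof.
move=> mK mg.
apply: (cmeasurable_cintegral2 m (f := fun z => K z.1 z.2 * g z.2)).
by apply: cmeasurableM => //; exact: (cmeasurable_comp mg).
Qed.

(** The Cauchy-Schwarz inequality for [sqrt |K| g] and [sqrt |K| v]. *)
Lemma schur_form K S g v (G V : R) : schur m K S -> 0 <= S ->
  cmeasurable setT g -> cmeasurable setT v -> 0 <= G -> 0 <= V ->
  (sqnorm m g <= (G ^+ 2)%:E)%E -> (sqnorm m v <= (V ^+ 2)%:E)%E ->
  (\int[m \x m]_z (normc (K z.1 z.2 * g z.2 * v z.1))%:E <= (S * G * V)%:E)%E.
Proof.
move=> [mK K1 K2] S0 mg mv G0 V0 gG vV.
have nK := measurable_normc mK.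
have mg2 : cmeasurable setT (fun z : T * T => g z.2) by exact: (cmeasurable_comp mg).
have mv1 : cmeasurable setT (fun z : T * T => v z.1) by exact: (cmeasurable_comp mv).
have msqrt : measurable_fun setT (@Num.sqrt R) by apply: continuous_measurable_fun; exact: sqrt_continuous.
have ms : measurable_fun setT (fun z : T * T => Num.sqrt (normc (K z.1 z.2))).
  exact: (measurableT_comp msqrt nK).
have -> : (\int[m \x m]_z (normc (K z.1 z.2 * g z.2 * v z.1))%:E =
   \int[m \x m]_z ((Num.sqrt (normc (K z.1 z.2)) * normc (g z.2)) *
                 (Num.sqrt (normc (K z.1 z.2)) * normc (v z.1)))%:E)%E.
  apply: eq_integral => z _; rewrite !normcM; congr EFin.
  rewrite -{1}(sqr_sqrtr (normc_ge0 (K z.1 z.2))); set s := Num.sqrt _; ring.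
have -> : S * G * V = (Num.sqrt S * G) * (Num.sqrt S * V).
  by rewrite -{1}(sqr_sqrtr S0); set s := Num.sqrt _; ring.
apply: cauchy_schwarz.
- by apply: measurable_funM => //; exact: measurable_normc.
- by apply: measurable_funM => //; exact: measurable_normc.
- by move=> z; rewrite mulr_ge0 ?sqrtr_ge0 ?normc_ge0.
- by move=> z; rewrite mulr_ge0 ?sqrtr_ge0 ?normc_ge0.
- by rewrite mulr_ge0 ?sqrtr_ge0.
- by rewrite mulr_ge0 ?sqrtr_ge0.
- rewrite exprMn sqr_sqrtr//.
  under eq_integral do rewrite exprMn sqr_sqrtr ?normc_ge0//.
  apply: le_trans (weighted_tonelli2 (a := fun z => normc (K z.1 z.2)) (b := fun y => normc (g y) ^+ 2)
     (c := cst S) _ _ _ _ _ _ _) _ => //.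
  + by apply: measurable_funX; exact: measurable_normc.
  + by move=> z; exact: normc_ge0.
  + by move=> z; exact: sqr_ge0.
  + by apply: aeW => y /=; exact: K2.
  under eq_integral do rewrite EFinM.
  rewrite ge0_integralZl_EFin//; last 2 first.
  + by move=> y _; rewrite lee_fin sqr_ge0.
  + by apply/measurable_EFinP; apply: measurable_funX; exact: measurable_normc.
  by rewrite EFinM; apply: lee_wpmul2l.
- rewrite exprMn sqr_sqrtr//.
  under eq_integral do rewrite exprMn sqr_sqrtr ?normc_ge0//.
  apply: le_trans (weighted_tonelli1 (a := fun z => normc (K z.1 z.2)) (b := fun y => normc (v y) ^+ 2)
     (c := cst S) _ _ _ _ _ _ _) _ => //.
  + by apply: measurable_funX; exact: measurable_normc.
  + by move=> z; exact: normc_ge0.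
  + by move=> z; exact: sqr_ge0.
  + by apply: aeW => y /=; exact: K1.
  under eq_integral do rewrite EFinM.
  rewrite ge0_integralZl_EFin//; last 2 first.
  + by move=> y _; rewrite lee_fin sqr_ge0.
  + by apply/measurable_EFinP; apply: measurable_funX; exact: measurable_normc.
  by rewrite EFinM; apply: lee_wpmul2l.
Qed.

Lemma cintegrable_form K S g v (G V : R) : schur m K S -> 0 <= S ->
  cmeasurable setT g -> cmeasurable setT v -> 0 <= G -> 0 <= V ->
  (sqnorm m g <= (G ^+ 2)%:E)%E -> (sqnorm m v <= (V ^+ 2)%:E)%E ->
  cintegrable (m \x m)%E setT (fun z => K z.1 z.2 * g z.2 * v z.1).
Proof.
move=> sK S0 mg mv G0 V0 gG vV; have [mK _ _] := sK.
apply: cintegrableP; first exact: cmeasurable_form.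
exact: le_lt_trans (schur_form sK S0 mg mv G0 V0 gG vV) (ltry _).
Qed.

Lemma formbound_schur K S : schur m K S -> 0 <= S -> formbound m K S.
Proof.
move=> sK S0 g v G V mg mv G0 V0 gG vV; have [mK _ _] := sK.
rewrite -lee_fin; apply: le_trans (schur_form sK S0 mg mv G0 V0 gG vV).
exact: (normc_cintegral_le _ (cmeasurable_form mK mg mv)).
Qed.

Lemma formbound_l2bound K S C : schur m K S -> 0 <= S -> 0 <= C ->
  l2bound m K C -> formbound m K C.
Proof.
move=> sK S0 C0 lK g v G V mg mv G0 V0 gG vV; have [mK _ _] := sK.
have ci := cintegrable_form sK S0 mg mv G0 V0 gG vV.
have [ae _ <-] := cfubini1 ci.
have mk := cmeasurable_kop mK mg.
rewrite (@eq_cintegral_ae _ _ _ _ _ (fun x => v x * kop m K g x)); last 3 first.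
- exact: (cmeasurable_cintegral2 m (cmeasurable_form mK mg mv)).
- exact: cmeasurableM.
- apply: filterS ae => x /= hx; rewrite /kop.
  have e : (fun y => K x y * g y * v x) = (fun y => v x * (K x y * g y)).
    by apply/funext => y; ring.
  by rewrite e in hx *; exact: cintegralMl_any.
rewrite -lee_fin; apply: le_trans (normc_cintegral_le _ (cmeasurableM mv mk)) _.
under eq_integral do rewrite normcM.
have -> : C * G * V = V * (C * G) by ring.
apply: cauchy_schwarz => //.
- exact: measurable_normc.
- exact: measurable_normc.
- by move=> x; exact: normc_ge0.
- by move=> x; exact: normc_ge0.
- exact: mulr_ge0.
apply: le_trans (lK g mg) _; have -> : (((C * G) ^+ 2)%:E = (C ^+ 2)%:E * (G ^+ 2)%:E)%E by rewrite -EFinM exprMn.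
by apply: lee_wpmul2l => //; rewrite lee_fin sqr_ge0.
Qed.

Lemma formboundD K1 K2 S1 S2 N1 N2 : schur m K1 S1 -> schur m K2 S2 -> 0 <= S1 -> 0 <= S2 ->
  formbound m K1 N1 -> formbound m K2 N2 -> formbound m (fun x y => K1 x y + K2 x y) (N1 + N2).
Proof.
move=> s1 s2 S10 S20 f1 f2 g v G V mg mv G0 V0 gG vV.
have c1 := cintegrable_form s1 S10 mg mv G0 V0 gG vV.
have c2 := cintegrable_form s2 S20 mg mv G0 V0 gG vV.
under eq_cintegral do rewrite !mulrDl.
rewrite cintegralD// !mulrDl; apply: le_trans (normcD_le _ _) _.
by apply: lerD; [exact: f1|exact: f2].
Qed.

Lemma schurD K1 K2 S1 S2 : schur m K1 S1 -> schur m K2 S2 ->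
  schur m (fun x y => K1 x y + K2 x y) (S1 + S2).
Proof.
move=> [m1 a1 b1] [m2 a2 b2]; split; first exact: cmeasurableD.
- move=> x.
  have n1 := measurable_normc (cmeasurable_slice1 x m1).
  have n2 := measurable_normc (cmeasurable_slice1 x m2).
  apply: (@le_trans _ _ (\int[m]_y ((normc (K1 x y))%:E + (normc (K2 x y))%:E))%E).
    apply: (@le_nonneg_integral _ _ _ m _ (fun y => normc (K1 x y) + normc (K2 x y))).
    + exact: (measurable_normc (cmeasurable_slice1 x (cmeasurableD m1 m2))).
    + exact: measurable_funD.
    + by move=> y; exact: normc_ge0.
    + by move=> y; exact: normcD_le.
  rewrite ge0_integralD//; first by rewrite EFinD; exact: leeD.
  + by move=> y _; rewrite lee_fin normc_ge0.
  + exact/measurable_EFinP.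
  + by move=> y _; rewrite lee_fin normc_ge0.
  + exact/measurable_EFinP.
- move=> y.
  have n1 := measurable_normc (cmeasurable_slice2 y m1).
  have n2 := measurable_normc (cmeasurable_slice2 y m2).
  apply: (@le_trans _ _ (\int[m]_x ((normc (K1 x y))%:E + (normc (K2 x y))%:E))%E).
    apply: (@le_nonneg_integral _ _ _ m _ (fun x => normc (K1 x y) + normc (K2 x y))).
    + exact: (measurable_normc (cmeasurable_slice2 y (cmeasurableD m1 m2))).
    + exact: measurable_funD.
    + by move=> x; exact: normc_ge0.
    + by move=> x; exact: normcD_le.
  rewrite ge0_integralD//; first by rewrite EFinD; exact: leeD.
  + by move=> x _; rewrite lee_fin normc_ge0.
  + exact/measurable_EFinP.
  + by move=> x _; rewrite lee_fin normc_ge0.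
  + exact/measurable_EFinP.
Qed.

Lemma schurZ (c : R[i]) K S : schur m K S -> schur m (fun x y => c * K x y) (normc c * S).
Proof.
move=> [mK a b]; split.
- by apply: cmeasurableM => //; exact: cmeasurable_cst.
- move=> x; under eq_integral do rewrite normcM EFinM.
  rewrite ge0_integralZl_EFin ?normc_ge0//; last 2 first.
  + by move=> y _; rewrite lee_fin normc_ge0.
  + by apply/measurable_EFinP; exact: (measurable_normc (cmeasurable_slice1 x mK)).
  by rewrite EFinM; apply: lee_wpmul2l => //; rewrite lee_fin normc_ge0.
- move=> y; under eq_integral do rewrite normcM EFinM.
  rewrite ge0_integralZl_EFin ?normc_ge0//; last 2 first.
  + by move=> x _; rewrite lee_fin normc_ge0.
  + by apply/measurable_EFinP; exact: (measurable_normc (cmeasurable_slice2 y mK)).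
  by rewrite EFinM; apply: lee_wpmul2l => //; rewrite lee_fin normc_ge0.
Qed.

Lemma formboundZ (c : R[i]) K S N : schur m K S -> 0 <= S -> formbound m K N ->
  formbound m (fun x y => c * K x y) (normc c * N).
Proof.
move=> sK S0 fK g v G V mg mv G0 V0 gG vV.
under eq_cintegral do rewrite -!mulrA.
rewrite cintegralMl//; last first.
  have := cintegrable_form sK S0 mg mv G0 V0 gG vV.
  by under eq_fun do rewrite -mulrA.
rewrite normcM -!mulrA; apply: ler_wpM2l; first exact: normc_ge0.
have := fK g v G V mg mv G0 V0 gG vV.
by under eq_cintegral do rewrite -mulrA; rewrite mulrA.
Qed.

(** A kernel bounded by 1 and integrable in each variable is square integrable in
    each variable, so that the integral converges at every point. *)
Lemma cintegrable_kop K S g x : schur m K S -> (forall x y, normc (K x y) <= 1) ->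
  cmeasurable setT g -> (sqnorm m g < +oo)%E -> cintegrable m setT (fun y => K x y * g y).
Proof.
move=> [mK K1 _] Kb mg gf.
have mKx := cmeasurable_slice1 x mK.
have n1 := measurable_normc mKx; have n2 := measurable_normc mg.
apply: cintegrableP; first exact: cmeasurableM.
apply: (@le_lt_trans _ _ (\int[m]_y ((normc (K x y))%:E + (normc (g y) ^+ 2)%:E))%E).
  apply: (@le_nonneg_integral _ _ _ m _ (fun y => normc (K x y) + normc (g y) ^+ 2)).
  - exact: (measurable_normc (cmeasurableM mKx mg)).
  - by apply: measurable_funD => //; exact: measurable_funX.
  - by move=> y; exact: normc_ge0.
  - move=> y; rewrite normcM; have := Kb x y; have := normc_ge0 (K x y).
    have := normc_ge0 (g y); move: (normc _) (normc _) => p q; nra.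
rewrite ge0_integralD//; first last.
- by apply/measurable_EFinP; exact: measurable_funX.
- by move=> y _; rewrite lee_fin sqr_ge0.
- exact/measurable_EFinP.
- by move=> y _; rewrite lee_fin normc_ge0.
by rewrite lte_add_pinfty//; exact: le_lt_trans (K1 x) (ltry _).
Qed.

Lemma l2bound_finite K C : 0 < C ->
  (forall g, cmeasurable setT g -> (sqnorm m g < +oo)%E ->
     (sqnorm m (kop m K g) <= (C ^+ 2)%:E * sqnorm m g)%E) -> l2bound m K C.
Proof.
move=> C0 h g mg; have [gy|/eqP] := boolP ((sqnorm m g) == +oo)%E.
  by rewrite (eqP gy) gt0_muley ?leey// lte_fin exprn_gt0.
by move=> gy; apply: h => //; rewrite ltey; exact/eqP.
Qed.

End kernels.

(** * Schur's test with weights and composition with the adjoint *)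

Ltac mproj := repeat first [exact: measurable_fst | exact: measurable_snd | exact: measurable_id
  | apply: measurable_fun_pair | apply: (measurableT_comp measurable_fst) | apply: (measurableT_comp measurable_snd)].

Section product_measure.
Context {R : realType} {d1 d2 : measure_display}.
Context {X : measurableType d1} {Y : measurableType d2}.
Variables (m1 : {sigma_finite_measure set X -> \bar R}).
Variables (m2 : {sigma_finite_measure set Y -> \bar R}).

(** An alias that carries the structure of a sigma-finite measure, so that products
    can be iterated. *)
Definition prodm := (m1 \x m2)%E.

HB.instance Definition _ := Measure.on prodm.

Lemma prodm_sigma_finite : sigma_finite setT prodm.
Proof.
have /sigma_finiteP[F [TF ndF Foo]] := sigma_finiteT m1.
have /sigma_finiteP[G [TG ndG Goo]] := sigma_finiteT m2.
exists (fun n => F n `*` G n).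
  rewrite -setXTT TF TG predeqE => -[x y]; split.
    move=> [/= [n _ Fnx] [k _ Gky]]; exists (maxn n k) => //; split.
    - by move: x Fnx; exact/subsetPset/ndF/leq_maxl.
    - by move: y Gky; exact/subsetPset/ndG/leq_maxr.
  by move=> [n _ []/= ? ?]; split; exists n.
move=> k; have [? ?] := Foo k; have [? ?] := Goo k.
split; first exact: measurableX.
by rewrite /prodm product_measure1E// lte_mul_pinfty// ge0_fin_numE.
Qed.

HB.instance Definition _ := Measure_isSigmaFinite.Build _ _ _ prodm prodm_sigma_finite.

End product_measure.

Section positive_kernels.
Context {R : realType} {d : measure_display} {T : measurableType d}.
Variable m : {sigma_finite_measure set T -> \bar R}.

Definition pkop (L : T -> T -> R) (f : T -> R) x : \bar R := (\int[m]_y (L x y * f y)%:E)%E.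

Lemma measurable_pkop (L : T -> T -> R) (f : T -> R) :
  measurable_fun setT (fun z : T * T => L z.1 z.2) -> (forall x y, 0 <= L x y) ->
  measurable_fun setT f -> (forall x, 0 <= f x) -> measurable_fun setT (pkop L f).
Proof.
move=> mL L0 mf f0.
apply: (@measurable_fun_fubini_tonelli_F _ _ _ _ _ m (fun z => (L z.1 z.2 * f z.2)%:E)) => //.
  apply/measurable_EFinP; apply: measurable_funM => //; exact: (measurableT_comp mf).
by move=> z; rewrite lee_fin mulr_ge0.
Qed.

Lemma pkop_ge0 (L : T -> T -> R) (f : T -> R) x : (forall x y, 0 <= L x y) ->
  (forall x, 0 <= f x) -> (0 <= pkop L f x)%E.
Proof. by move=> L0 f0; apply: integral_ge0 => y _; rewrite lee_fin mulr_ge0. Qed.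

(** Schur's test with a weight: split [L = sqrt (L w) * sqrt (L / w)] and use the
    Cauchy-Schwarz inequality at almost every point. *)
Lemma pos_l2bound (L : T -> T -> R) (w : T -> R) (C : R) : 0 < C ->
  measurable_fun setT (fun z : T * T => L z.1 z.2) -> (forall x y, 0 <= L x y) ->
  measurable_fun setT w -> (forall x, 0 < w x) ->
  {ae m, forall x, (\int[m]_y (L x y * w y)%:E <= (C * w x)%:E)%E} ->
  {ae m, forall y, (\int[m]_x (L x y * w x)%:E <= (C * w y)%:E)%E} ->
  forall f : T -> R, measurable_fun setT f -> (forall x, 0 <= f x) ->
  (\int[m]_x (pkop L f x * pkop L f x) <= (C ^+ 2)%:E * \int[m]_x (f x ^+ 2)%:E)%E.
Proof.
move=> C0 mL L0 mw w0 h1 h2 f mf f0.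
have mL1 x : measurable_fun setT (L x).
  exact: (measurableT_comp mL (measurable_pair1 x)).
(* The half of the splitting that carries [f], squared. *)
pose q y := f y ^+ 2 / w y.
have mq : measurable_fun setT q.
  by apply: measurable_funM; [exact: measurable_funX|exact: measurable_funV].
have q0 y : 0 <= q y by rewrite /q divr_ge0 ?sqr_ge0 ?ltW.
have mA := measurable_pkop mL L0 mf f0.
have mJ := measurable_pkop mL L0 mq q0.
have msqrt : measurable_fun setT (@Num.sqrt R) by apply: continuous_measurable_fun; exact: sqrt_continuous.
apply: (@le_trans _ _ (\int[m]_x ((C * w x)%:E * pkop L q x))%E).
  apply: ae_ge0_le_integral => //.
  - by move=> x _; rewrite mule_ge0// pkop_ge0.
  - exact: emeasurable_funM.
  - by move=> x _; rewrite mule_ge0 ?pkop_ge0// lee_fin mulr_ge0 ?ltW.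
  - by apply: emeasurable_funM => //; apply/measurable_EFinP; exact: measurable_funM.
  apply: filterS h1 => x hx _.
  have J0 : (0 <= pkop L q x)%E by exact: pkop_ge0.
  have cw : 0 < C * w x by exact: mulr_gt0.
  case JE : (pkop L q x) => [j| |]; last 2 first.
  - by rewrite gt0_muley ?leey ?lte_fin.
  - by rewrite JE in J0.
  have j0 : 0 <= j by rewrite JE lee_fin in J0.
  have A0 : (0 <= pkop L f x)%E by exact: pkop_ge0.
  have : (pkop L f x <= (Num.sqrt (C * w x) * Num.sqrt j)%:E)%E.
    rewrite /pkop; have -> : (\int[m]_y (L x y * f y)%:E =
       \int[m]_y (Num.sqrt (L x y * w y) * (Num.sqrt (L x y / w y) * f y))%:E)%E.
      apply: eq_integral => y _; congr EFin; rewrite mulrA -sqrtrM ?mulr_ge0//; last exact: ltW.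
      have -> : L x y * w y * (L x y / w y) = L x y ^+ 2 by field; rewrite gt_eqF.
      by rewrite sqrtr_sqr ger0_norm.
    apply: cauchy_schwarz.
    - by apply: (measurableT_comp msqrt); exact: measurable_funM.
    - apply: measurable_funM => //; apply: (measurableT_comp msqrt).
      by apply: measurable_funM => //; exact: measurable_funV.
    - by move=> y; exact: sqrtr_ge0.
    - by move=> y; rewrite mulr_ge0 ?sqrtr_ge0.
    - exact: sqrtr_ge0.
    - exact: sqrtr_ge0.
    - rewrite sqr_sqrtr ?(ltW cw)//.
      by under eq_integral do rewrite sqr_sqrtr ?mulr_ge0 ?(ltW (w0 _))//.
    - rewrite sqr_sqrtr// -JE /pkop.
      under eq_integral do rewrite exprMn sqr_sqrtr ?divr_ge0 ?(ltW (w0 _))// mulrAC -mulrA.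
      exact: lexx.
  case: (pkop L f x) A0 => [r| |]// r0; rewrite -!EFinM !lee_fin in r0 * => h.
  apply: (@le_trans _ _ ((Num.sqrt (C * w x) * Num.sqrt j) ^+ 2)).
    by rewrite -expr2 ler_pXn2r// ?nnegrE ?mulr_ge0 ?sqrtr_ge0.
  by rewrite exprMn !sqr_sqrtr// ltW.
rewrite (_ : (\int[m]_x _)%E = (\int[m \x m]_z (w z.1 * L z.1 z.2 * (C * q z.2))%:E)%E); last first.
  rewrite (fubini_tonelli1 _ _ _)/=; last 2 first.
  - apply/measurable_EFinP; apply: measurable_funM.
      by apply: measurable_funM => //; exact: (measurableT_comp mw).
    by apply: (measurableT_comp (f := fun y => C * q y)) => //; exact: measurable_funM.
  - by move=> z; rewrite lee_fin; apply: mulr_ge0; apply: mulr_ge0 => //; exact: ltW.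
  apply: eq_integral => x _; rewrite /fubini_F /= /pkop.
  rewrite -ge0_integralZl_EFin//; last 3 first.
  - by move=> y _; rewrite lee_fin mulr_ge0.
  - by apply/measurable_EFinP; exact: measurable_funM.
  - by rewrite mulr_ge0 ?ltW.
  apply: eq_integral => y _; rewrite -EFinM; congr EFin; ring.
apply: le_trans (weighted_tonelli2 (a := fun z => w z.1 * L z.1 z.2) (b := fun y => C * q y)
   (c := fun y => C * w y) _ _ _ _ _ _ _) _.
- by apply: measurable_funM => //; exact: (measurableT_comp mw).
- exact: measurable_funM.
- exact: measurable_funM.
- by move=> z; rewrite mulr_ge0// ltW.
- by move=> y; rewrite mulr_ge0// ltW.
- by move=> y; rewrite mulr_ge0 ?ltW.
- by apply: filterS h2 => y hy; under eq_integral do rewrite mulrC.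
rewrite -ge0_integralZl_EFin ?sqr_ge0//; last 2 first.
- by move=> x _; rewrite lee_fin sqr_ge0.
- by apply/measurable_EFinP; exact: measurable_funX.
rewrite le_eqVlt; apply/orP; left; apply/eqP; apply: eq_integral => y _.
by rewrite -EFinM; congr EFin; rewrite /q; field; rewrite gt_eqF.
Qed.

Lemma pos_l2bound1 (L : T -> T -> R) (C : R) : 0 < C ->
  measurable_fun setT (fun z : T * T => L z.1 z.2) -> (forall x y, 0 <= L x y) ->
  (forall x, (\int[m]_y (L x y)%:E <= C%:E)%E) ->
  (forall y, (\int[m]_x (L x y)%:E <= C%:E)%E) ->
  forall f : T -> R, measurable_fun setT f -> (forall x, 0 <= f x) ->
  (\int[m]_x (pkop L f x * pkop L f x) <= (C ^+ 2)%:E * \int[m]_x (f x ^+ 2)%:E)%E.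
Proof.
move=> C0 mL L0 h1 h2; apply: (pos_l2bound (w := cst 1)) => //.
  by apply: aeW => x /=; rewrite mulr1; under eq_integral do rewrite mulr1.
by apply: aeW => x /=; rewrite mulr1; under eq_integral do rewrite mulr1.
Qed.

End positive_kernels.

Section TstarT.
Context {R : realType} {d : measure_display} {T : measurableType d}.
Variable m : {sigma_finite_measure set T -> \bar R}.

Lemma square_tonelli (a : T -> R) : measurable_fun setT a -> (forall x, 0 <= a x) ->
  (\int[m \x m]_z (a z.1 * a z.2)%:E = (\int[m]_x (a x)%:E) * (\int[m]_x (a x)%:E))%E.
Proof.
move=> ma a0; rewrite (fubini_tonelli1 _ _ _)/=; last 2 first.
- by apply/measurable_EFinP; apply: measurable_funM; apply: (measurableT_comp ma).
- by move=> z; rewrite lee_fin mulr_ge0.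
rewrite -ge0_integralZr//; last 3 first.
- exact/measurable_EFinP.
- by move=> x _; rewrite lee_fin.
- by apply: integral_ge0 => x _; rewrite lee_fin.
apply: eq_integral => x _; rewrite /fubini_F /=.
rewrite -ge0_integralZl_EFin//.
- by move=> y _; rewrite lee_fin.
- exact/measurable_EFinP.
Qed.

Lemma cintegral_conj (f : T -> R[i]) : cintegrable m setT f ->
  cintegral m setT (fun x => (f x)^*%C) = (cintegral m setT f)^*%C.
Proof.
move=> [_ fi]; rewrite /cintegral /=; congr Complex.
  by apply: eq_Rintegral => x _; case: (f x).
have -> : (fun x => Im (f x)^*%C) = (fun x => - Im (f x)) by apply/funext => x; case: (f x).
rewrite /Rintegral -fineN; congr fine.
by rewrite -integralN//; exact: integrable_add_def.
Qed.

Lemma mulc_conj (z : R[i]) : z * z^*%C = (normc z ^+ 2)%:C.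
Proof.
rewrite normc_sqr; case: z => a b; apply: complex_ext => /=; first by ring.
by rewrite /=; ring.
Qed.

Lemma normc_conj (z : R[i]) : normc z^*%C = normc z.
Proof. by case: z => a b /=; rewrite sqrrN. Qed.

Lemma cintegral_square (f : T -> R[i]) : cintegrable m setT f ->
  cintegral (m \x m)%E setT (fun z => f z.1 * (f z.2)^*%C) = (normc (cintegral m setT f) ^+ 2)%:C.
Proof.
move=> fi; have mf := cintegrable_cmeasurable fi.
have nf : (\int[m]_x (normc (f x))%:E < +oo)%E.
  have [/integrableP[_ i1] /integrableP[_ i2]] := fi.
  apply: le_lt_trans (lte_add_pinfty i1 i2).
  rewrite -ge0_integralD//; last 2 first.
  - by apply: measurableT_comp => //; apply/measurable_EFinP; case: mf.
  - by apply: measurableT_comp => //; apply/measurable_EFinP; case: mf.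
  apply: ge0_le_integral => //.
  - by move=> x _; rewrite lee_fin normc_ge0.
  - by apply/measurable_EFinP; exact: measurable_normc.
  - by apply: emeasurable_funD; apply: measurableT_comp => //; apply/measurable_EFinP; case: mf.
  - by move=> x _ /=; rewrite -EFinD lee_fin normc_le_ReIm.
have mF : cmeasurable setT (fun z : T * T => f z.1 * (f z.2)^*%C).
  apply: cmeasurableM; first exact: (cmeasurable_comp mf).
  by apply: cmeasurable_conj; exact: (cmeasurable_comp mf).
have ci : cintegrable (m \x m)%E setT (fun z => f z.1 * (f z.2)^*%C).
  apply: cintegrableP => //.
  under eq_integral do rewrite normcM normc_conj.
  rewrite (square_tonelli (a := fun x => normc (f x))) ?lte_mul_pinfty//.
  - by apply: integral_ge0 => x _; rewrite lee_fin normc_ge0.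
  - rewrite ge0_fin_numE//; apply: integral_ge0 => x _; rewrite lee_fin normc_ge0//.
  - exact: measurable_normc.
  - by move=> x; exact: normc_ge0.
have [_ _ <-] := cfubini1 ci.
have fc : cintegrable m setT (fun x => (f x)^*%C).
  by apply: cintegrableP; [exact: cmeasurable_conj|under eq_integral do rewrite normc_conj].
rewrite (@eq_cintegral _ _ _ m setT _ (fun x => (cintegral m setT f)^*%C * f x)); last first.
  by move=> x _ /=; have /= -> := cintegralMl (f x) measurableT fc; rewrite cintegral_conj// mulrC.
by rewrite cintegralMl// mulrC mulc_conj.
Qed.

(** The norm of an operator is the square root of the norm of its adjoint composed
    with it. The kernel of the latter, the overlap of two columns of [K], may be
    absolutely small by cancellation where [K] itself is not. *)
Lemma TstarT (K : T -> T -> R[i]) (S B : R) (N : T -> T -> R) :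
  schur m K S -> 0 < S -> (forall x y, normc (K x y) <= 1) ->
  measurable_fun setT (fun z : T * T => N z.1 z.2) -> (forall y y', 0 <= N y y') -> 0 < B ->
  (forall y, (\int[m]_y' (N y y')%:E <= B%:E)%E) -> (forall y', (\int[m]_y (N y y')%:E <= B%:E)%E) ->
  (forall y y', normc (cintegral m setT (fun x => K x y * (K x y')^*%C)) <= N y y') ->
  l2bound m K (Num.sqrt B).
Proof.
move=> sK S0 Kb mN N0 B0 N1 N2 MN.
apply: l2bound_finite; first by rewrite sqrtr_gt0.
move=> g mg gf; rewrite (sqr_sqrtr (ltW B0)).
have [mK K1 K2] := sK.
set G := Num.sqrt (fine (sqnorm m g)).
have gE : sqnorm m g = (G ^+ 2)%:E.
  rewrite sqr_sqrtr ?fine_ge0 ?sqnorm_ge0// fineK// ge0_fin_numE ?sqnorm_ge0//.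
have G0 : 0 <= G by exact: sqrtr_ge0.
pose Q (w : T * (T * T)) := K w.1 w.2.1 * g w.2.1 * (K w.1 w.2.2 * g w.2.2)^*%C.
have mn := measurable_normc mK.
have ng := measurable_normc mg.
have mKg : cmeasurable setT (fun z : T * T => K z.1 z.2 * g z.2).
  by apply: cmeasurableM => //; exact: (cmeasurable_comp mg).
have mQ : cmeasurable setT Q.
  apply: cmeasurableM; last apply: cmeasurable_conj.
    by apply: (cmeasurable_comp mKg (h := fun w : T * (T * T) => (w.1, w.2.1))); mproj.
  by apply: (cmeasurable_comp mKg (h := fun w : T * (T * T) => (w.1, w.2.2))); mproj.
pose mm : {sigma_finite_measure set (T * T)%type -> \bar R} := prodm m m.
have ciQ : cintegrable (m \x mm)%E setT Q.
  apply: cintegrable_iter12 => //.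
  apply: (@le_lt_trans _ _ ((S ^+ 2)%:E * \int[m]_x (normc (g x) ^+ 2)%:E)%E); last first.
    by rewrite -/(sqnorm m g) gE -EFinM ltry.
  apply: le_trans (@pos_l2bound1 _ _ _ m (fun x y => normc (K x y)) S S0 mn _ K1 K2 _ ng _) => //; last 2 first.
  - by move=> x y; exact: normc_ge0.
  - by move=> x; exact: normc_ge0.
  rewrite le_eqVlt; apply/orP; left; apply/eqP; apply: eq_integral => x _.
  rewrite /Q /= /pkop -square_tonelli//.
  - by apply: eq_integral => z _; rewrite !normcM normc_conj normcM.
  - by apply: measurable_funM => //; exact: (measurable_normc (cmeasurable_slice1 x mK)).
  - by move=> y; rewrite mulr_ge0 ?normc_ge0.
have hE x : cintegral mm setT (fun z => Q (x, z)) = (normc (kop m K g x) ^+ 2)%:C.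
  rewrite /Q /kop -cintegral_square//; exact: cintegrable_kop sK Kb mg gf.
have [_ hi hI] := cfubini1 ciQ.
have [_ _ hJ] := cfubini2 ciQ.
(* Integrating [Q] in [(y, y')] gives the square of the image of [g]; integrating in
   [x] gives the overlap. *)
have QE z : cintegral m setT (fun x => Q (x, z)) =
   (g z.1 * (g z.2)^*%C) * cintegral m setT (fun x => K x z.1 * (K x z.2)^*%C).
  rewrite -cintegralMl//; last first.
    apply: (cintegrable_dominated (g := fun x => normc (K x z.1))) => //.
    - apply: cmeasurableM; first exact: (cmeasurable_slice2 z.1 mK).
      exact/cmeasurable_conj/(cmeasurable_slice2 z.2 mK).
    - move=> x _; rewrite normcM normc_conj ler_piMr// normc_ge0//.
    - apply: integrable_normc; first exact: (cmeasurable_slice2 z.1 mK).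
      exact: le_lt_trans (K2 _) (ltry _).
  apply: eq_cintegral => x _; rewrite /Q /=.
  have cM (a b : R[i]) : (a * b)^*%C = a^*%C * b^*%C.
    by case: a b => [a1 a2] [b1 b2]; apply: complex_ext => /=; ring.
  by rewrite cM; ring.
have sN : schur m (fun y y' => (N y y')%:C) B.
  have e y y' : normc (N y y')%:C = N y y' by rewrite normcC ger0_norm.
  split; first exact: cmeasurable_real.
  - by move=> y; under eq_integral do rewrite e.
  - by move=> y; under eq_integral do rewrite e.
have key : normc (cintegral m setT (fun x => (normc (kop m K g x) ^+ 2)%:C)) <= B * G ^+ 2.
  have -> : cintegral m setT (fun x => (normc (kop m K g x) ^+ 2)%:C) =
     cintegral mm setT (fun z => cintegral m setT (fun x => Q (x, z))).
    by rewrite hJ -hI; apply: eq_cintegral => x _; rewrite hE.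
  have mQi : cmeasurable setT (fun z => cintegral m setT (fun x => Q (x, z))).
    have [_ hi2 _] := cfubini2 ciQ; exact: cintegrable_cmeasurable hi2.
  rewrite -lee_fin; apply: le_trans (normc_cintegral_le _ mQi) _.
  rewrite expr2 mulrA.
  have gG : (sqnorm m g <= (G ^+ 2)%:E)%E by rewrite gE.
  apply: le_trans (schur_form sN (ltW B0) mg mg G0 G0 gG gG).
  apply: le_nonneg_integral.
  - exact: measurable_normc.
  - by apply: measurable_normc; apply: (cmeasurable_form (K := fun y y' => (N y y')%:C)) => //; exact: cmeasurable_real.
  - by move=> z; exact: normc_ge0.
  - move=> z; rewrite QE !normcM normc_conj normcC (ger0_norm (N0 _ _)).
    have := MN z.1 z.2; set M := normc (cintegral _ _ _) => hM.
    have p1 := normc_ge0 (g z.1); have p2 := normc_ge0 (g z.2).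
    rewrite (_ : _ * M = M * normc (g z.2) * normc (g z.1)); last by ring.
    by do 2 (apply: ler_wpM2r => //).
rewrite gE -EFinM.
have [hi1 _] : cintegrable m setT (fun x => (normc (kop m K g x) ^+ 2)%:C).
  by move: hi; under eq_fun do rewrite hE.
rewrite /sqnorm; have -> : (\int[m]_x (normc (kop m K g x) ^+ 2)%:E =
   (Re (cintegral m setT (fun x => (normc (kop m K g x) ^+ 2)%:C)))%:E)%E.
  by rewrite /cintegral /= /Rintegral fineK//; exact: integrable_fin_num.
rewrite lee_fin; apply: le_trans key; apply: le_trans (ler_norm _) (Re_le_normc _).
Qed.

End TstarT.

(** * Tensor products of kernels *)

Section tensor.
Context {R : realType} {d1 d2 : measure_display}.
Context {X1 : measurableType d1} {X2 : measurableType d2}.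
Variables (m1 : {sigma_finite_measure set X1 -> \bar R}).
Variables (m2 : {sigma_finite_measure set X2 -> \bar R}).
Variables (K1 : X1 -> X1 -> R[i]) (K2 : X2 -> X2 -> R[i]) (S1 S2 C1 C2 : R).
Hypotheses (S1p : 0 <= S1) (S2p : 0 <= S2) (C1p : 0 < C1) (C2p : 0 < C2).
Hypotheses (s1 : schur m1 K1 S1) (s2 : schur m2 K2 S2).

Definition tensor (x y : X1 * X2) := K1 x.1 y.1 * K2 x.2 y.2.

Lemma cmeasurable_tensor : cmeasurable setT (fun z => tensor z.1 z.2).
Proof.
have [k1 _ _] := s1; have [k2 _ _] := s2; apply: cmeasurableM.
  by apply: (cmeasurable_comp k1 (h := fun z : (X1 * X2) * (X1 * X2) => (z.1.1, z.2.1))); mproj.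
by apply: (cmeasurable_comp k2 (h := fun z : (X1 * X2) * (X1 * X2) => (z.1.2, z.2.2))); mproj.
Qed.

Lemma schur_tensor : schur (prodm m1 m2) tensor (S1 * S2).
Proof.
have [k1 a1 b1] := s1; have [k2 a2 b2] := s2; split; first exact: cmeasurable_tensor.
- move=> x.
  have n1 := measurable_normc (cmeasurable_slice1 x.1 k1).
  have n2 := measurable_normc (cmeasurable_slice1 x.2 k2).
  have -> : (\int[prodm m1 m2]_y (normc (tensor x y))%:E =
     \int[m1 \x m2]_y (normc (K2 x.2 y.2) * normc (K1 x.1 y.1))%:E)%E.
    by apply: eq_integral => y _; rewrite /tensor normcM mulrC.
  apply: le_trans (weighted_tonelli1 (a := fun y => normc (K2 x.2 y.2))
    (b := fun y => normc (K1 x.1 y)) (c := cst S2) _ _ _ _ _ _ _) _ => //.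
  + exact: (measurableT_comp n2).
  + by move=> z; exact: normc_ge0.
  + by move=> z; exact: normc_ge0.
  + by apply: aeW => y /=; exact: a2.
  under eq_integral do rewrite EFinM.
  rewrite ge0_integralZl_EFin//; last 2 first.
  + by move=> y _; rewrite lee_fin normc_ge0.
  + exact/measurable_EFinP.
  by rewrite mulrC EFinM; apply: lee_wpmul2l.
- move=> x.
  have n1 := measurable_normc (cmeasurable_slice2 x.1 k1).
  have n2 := measurable_normc (cmeasurable_slice2 x.2 k2).
  have -> : (\int[prodm m1 m2]_y (normc (tensor y x))%:E =
     \int[m1 \x m2]_y (normc (K2 y.2 x.2) * normc (K1 y.1 x.1))%:E)%E.
    by apply: eq_integral => y _; rewrite /tensor normcM mulrC.
  apply: le_trans (weighted_tonelli1 (a := fun y => normc (K2 y.2 x.2))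
    (b := fun y => normc (K1 y x.1)) (c := cst S2) _ _ _ _ _ _ _) _ => //.
  + exact: (measurableT_comp n2).
  + by move=> z; exact: normc_ge0.
  + by move=> z; exact: normc_ge0.
  + by apply: aeW => y /=; exact: b2.
  under eq_integral do rewrite EFinM.
  rewrite ge0_integralZl_EFin//; last 2 first.
  + by move=> y _; rewrite lee_fin normc_ge0.
  + exact/measurable_EFinP.
  by rewrite mulrC EFinM; apply: lee_wpmul2l.
Qed.

Hypotheses (n1 : forall x y, normc (K1 x y) <= 1) (n2 : forall x y, normc (K2 x y) <= 1).
Hypotheses (l1 : l2bound m1 K1 C1) (l2 : l2bound m2 K2 C2).

Lemma normc_tensor x y : normc (tensor x y) <= 1.
Proof. by rewrite normcM mulr_ile1 ?normc_ge0. Qed.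

(** Apply the first operator in the first variable, with the second one frozen,
    and then the second operator. *)
Lemma l2bound_tensor : l2bound (prodm m1 m2) tensor (C1 * C2).
Proof.
apply: l2bound_finite; first exact: mulr_gt0.
move=> g mg gf; have [k1 _ _] := s1; have [k2 _ _] := s2.
pose h (z : X1 * X2) := cintegral m1 setT (fun y1 => K1 z.1 y1 * g (y1, z.2)).
pose H (z : X1 * X2) := cintegral m2 setT (fun y2 => K2 z.2 y2 * h (z.1, y2)).
have mh : cmeasurable setT h.
  apply: (cmeasurable_cintegral2 m1 (f := fun w : (X1 * X2) * X1 => K1 w.1.1 w.2 * g (w.2, w.1.2))).
  apply: cmeasurableM.
    by apply: (cmeasurable_comp k1 (h := fun w : (X1 * X2) * X1 => (w.1.1, w.2))); mproj.
  by apply: (cmeasurable_comp mg (h := fun w : (X1 * X2) * X1 => (w.2, w.1.2))); mproj.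
have mH : cmeasurable setT H.
  apply: (cmeasurable_cintegral2 m2 (f := fun w : (X1 * X2) * X2 => K2 w.1.2 w.2 * h (w.1.1, w.2))).
  apply: cmeasurableM.
    by apply: (cmeasurable_comp k2 (h := fun w : (X1 * X2) * X2 => (w.1.2, w.2))); mproj.
  by apply: (cmeasurable_comp mh (h := fun w : (X1 * X2) * X2 => (w.1.1, w.2))); mproj.
have msq (d' : measure_display) (T' : measurableType d') (f : T' -> R[i]) :
    cmeasurable setT f -> measurable_fun setT (fun x => (normc (f x) ^+ 2)%:E).
  by move=> mf; apply/measurable_EFinP; apply: measurable_funX; exact: measurable_normc.
have sq0 (T' : Type) (f : T' -> R[i]) x : (0 <= (normc (f x) ^+ 2)%:E)%E.
  by rewrite lee_fin sqr_ge0.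
have kE x : kop (prodm m1 m2) tensor g x = H x.
  have ci : cintegrable (m1 \x m2)%E setT (fun y => tensor x y * g y).
    exact: (cintegrable_kop x schur_tensor normc_tensor mg gf).
  have [ae i e] := cfubini2 ci.
  rewrite /kop [LHS](_ : _ = cintegral (m1 \x m2)%E setT (fun y => tensor x y * g y))//.
  rewrite -e /H; apply: eq_cintegral_ae.
  - exact: cintegrable_cmeasurable i.
  - apply: cmeasurableM; first exact: (cmeasurable_slice1 x.2 k2).
    exact: (cmeasurable_slice1 x.1 mh).
  apply: filterS ae => y2 /= hy; rewrite /h /=.
  have e2 : (fun y1 => tensor x (y1, y2) * g (y1, y2)) =
    (fun y1 => K2 x.2 y2 * (K1 x.1 y1 * g (y1, y2))).
    by apply/funext => y1; rewrite /tensor /=; ring.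
  by rewrite e2 in hy *; exact: cintegralMl_any.
have -> : sqnorm (prodm m1 m2) (kop (prodm m1 m2) tensor g) = (\int[m1 \x m2]_x (normc (H x) ^+ 2)%:E)%E.
  by apply: eq_integral => x _; rewrite kE.
rewrite (fubini_tonelli1 _ (msq _ _ _ mH) (sq0 _ _))/=.
apply: (@le_trans _ _ (\int[m1]_x1 ((C2 ^+ 2)%:E * \int[m2]_x2 (normc (h (x1, x2)) ^+ 2)%:E))%E).
  apply: ge0_le_integral => //.
  - by move=> x _; apply: integral_ge0 => y _.
  - exact: (@measurable_fun_fubini_tonelli_F _ _ _ _ _ m2 (fun z => (normc (H z) ^+ 2)%:E)%E (msq _ _ _ mH) (sq0 _ _)).
  - apply: emeasurable_funM => //.
    exact: (@measurable_fun_fubini_tonelli_F _ _ _ _ _ m2 (fun z => (normc (h z) ^+ 2)%:E)%E (msq _ _ _ mh) (sq0 _ _)).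
  - by move=> x1 _; exact: (l2 (cmeasurable_slice1 x1 mh)).
rewrite ge0_integralZl_EFin ?sqr_ge0//; last 2 first.
- by move=> x _; apply: integral_ge0 => y _.
- exact: (@measurable_fun_fubini_tonelli_F _ _ _ _ _ m2 (fun z => (normc (h z) ^+ 2)%:E)%E (msq _ _ _ mh) (sq0 _ _)).
have -> : (((C1 * C2) ^+ 2)%:E = (C2 ^+ 2)%:E * (C1 ^+ 2)%:E)%E by rewrite -EFinM; congr EFin; ring.
rewrite -muleA; apply: lee_wpmul2l; first by rewrite lee_fin sqr_ge0.
have -> : (\int[m1]_x1 \int[m2]_x2 (normc (h (x1, x2)) ^+ 2)%:E =
   \int[m2]_x2 \int[m1]_x1 (normc (h (x1, x2)) ^+ 2)%:E)%E.
  exact: (@fubini_tonelli _ _ _ _ _ m1 m2 (fun z => (normc (h z) ^+ 2)%:E)%E (msq _ _ _ mh) (sq0 _ _)).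
rewrite /sqnorm [X in (_ <= _ * X)%E](_ : _ = \int[m2]_y2 \int[m1]_y1 (normc (g (y1, y2)) ^+ 2)%:E)%E; last first.
  exact: (@fubini_tonelli2 _ _ _ _ _ m1 m2 (fun z => (normc (g z) ^+ 2)%:E)%E (msq _ _ _ mg) (sq0 _ _)).
rewrite -ge0_integralZl_EFin ?sqr_ge0//; last 2 first.
- by move=> x _; apply: integral_ge0 => y _.
- exact: (@measurable_fun_fubini_tonelli_G _ _ _ _ _ m1 (fun z => (normc (g z) ^+ 2)%:E)%E (msq _ _ _ mg) (sq0 _ _)).
apply: ge0_le_integral => //.
- by move=> x _; apply: integral_ge0 => y _.
- exact: (@measurable_fun_fubini_tonelli_G _ _ _ _ _ m1 (fun z => (normc (h z) ^+ 2)%:E)%E (msq _ _ _ mh) (sq0 _ _)).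
- apply: emeasurable_funM => //.
  exact: (@measurable_fun_fubini_tonelli_G _ _ _ _ _ m1 (fun z => (normc (g z) ^+ 2)%:E)%E (msq _ _ _ mg) (sq0 _ _)).
- by move=> y2 _; exact: (l1 (cmeasurable_slice2 y2 mg)).
Qed.

End tensor.

(** * Integrals of Lorentzian type *)

Section line_integrals.
Context {R : realType}.
Implicit Types (c l x y : R).
Local Notation mu := (@lebesgue_measure R).

(** By monotone convergence over the segments; neither integrability nor limits of
    the primitive at the ends are assumed. *)
Lemma ge0_FTC_le (D : set R) (a b : nat -> R) (f F : R -> R) (L : R) :
  (forall n, a n < b n) -> nondecreasing_seq (fun n => `[a n, b n]%classic) ->
  D = \bigcup_n `[a n, b n]%classic ->
  (forall x, D x -> is_derive x (1 : R) F (f x)) -> (forall x, D x -> {for x, continuous f}) ->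
  (forall x, D x -> 0 <= f x) -> (forall x y, D x -> D y -> F y - F x <= L) ->
  (\int[mu]_(x in D) (f x)%:E <= L%:E)%E.
Proof.
move=> ab nd DE dF cf f0 FL.
have sub n x : a n <= x <= b n -> D x.
  by move=> xn; rewrite DE; exists n => //=; rewrite in_itv.
have mf n : measurable_fun (`[a n, b n]%classic : set (measurableTypeR R)) f.
  apply: continuous_measurable_on => // t /=; rewrite in_itv /= => /sub; exact: cf.
have h := @ge0_nondecreasing_set_cvg_integral _ _ _ (fun n => `[a n, b n]%classic : set (measurableTypeR R))
  (fun x => (f x)%:E) mu nd (fun n => measurable_itv _).
have {}h := h (fun n => iffRL (measurable_EFinP _ _) (mf n)).
rewrite DE; apply: cvge_le (h _); last first.
  by move=> n x /=; rewrite in_itv /= => /sub Dx; rewrite lee_fin f0.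
apply: nearW => n.
rewrite (@continuous_FTC2 _ f F (a n) (b n) (ab n)).
- rewrite -EFinB lee_fin; apply: FL; apply: (sub n); rewrite lexx ?andbT /=; exact: ltW (ab n).
- by apply: continuous_in_subspaceT => t /set_mem /=; rewrite in_itv /= => /sub; exact: cf.
- split => [t|t|].
  + rewrite in_itv /= => /andP[t0 t1]; have Dt : D t by apply: (sub n); rewrite !ltW.
    exact: (@ex_derive _ _ _ _ _ _ _ (dF t Dt)).
  + apply: cvg_at_right_filter; apply: (rder_continuous (dF (a n) _)).
    by apply: (sub n); rewrite lexx /= ltW.
  + apply: cvg_at_left_filter; apply: (rder_continuous (dF (b n) _)).
    by apply: (sub n); rewrite lexx andbT ltW.
- move=> t; rewrite in_itv /= => /andP[t0 t1]; have Dt : D t by apply: (sub n); rewrite !ltW.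
  by rewrite derive1E; apply: derive_val; exact: dF.
Qed.

Lemma line_exhaustion : [set: R] = \bigcup_n `[- n.+1%:R, n.+1%:R]%classic.
Proof.
apply/seteqP; split => // x _.
exists (Num.truncn `|x|) => //=; rewrite in_itv /= -ler_norml ltW//.
exact: truncnS_gt.
Qed.

Lemma line_nondecreasing : nondecreasing_seq (fun n : nat => `[- n.+1%:R, n.+1%:R : R]%classic).
Proof.
move=> n m nm; apply/subsetPset => x /=; rewrite !in_itv /= => /andP[h1 h2].
have h : n.+1%:R <= m.+1%:R :> R by rewrite ler_nat ltnS.
by apply/andP; split; lra.
Qed.

Lemma right_halfline_exhaustion l :
  `]l, +oo[%classic = \bigcup_n `[l + n.+1%:R^-1, l + n.+2%:R]%classic.
Proof.
apply/seteqP; split => x /=; rewrite in_itv /= ?andbT; last first.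
  move=> [n _] /=; rewrite in_itv /= => /andP[h _]; apply: lt_le_trans h.
  by rewrite ltrDl invr_gt0.
move=> lx; have x0 : 0 < x - l by rewrite subr_gt0.
pose n := maxn (Num.truncn (x - l)) (Num.truncn (x - l)^-1).
exists n => //=; rewrite in_itv /=; apply/andP; split.
  rewrite -lerBrDl invf_ple ?posrE//; apply: (le_trans (ltW (truncnS_gt _))).
  by rewrite ler_nat ltnS leq_maxr.
rewrite -lerBlDl; apply: (le_trans (ltW (truncnS_gt _))).
by rewrite ler_nat ltnS; apply: (leq_trans (leq_maxl _ _)) (leqnSn _).
Qed.

Lemma right_halfline_nondecreasing l :
  nondecreasing_seq (fun n : nat => `[l + n.+1%:R^-1, l + n.+2%:R]%classic).
Proof.
move=> n m nm; apply/subsetPset => x /=; rewrite !in_itv /= => /andP[h1 h2].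
have h : n.+2%:R <= m.+2%:R :> R by rewrite ler_nat !ltnS.
have h' : m.+1%:R^-1 <= n.+1%:R^-1 :> R by rewrite lef_pV2 ?posrE// ler_nat ltnS.
move: h h' h1 h2; move: (n.+2%:R) (m.+2%:R) (n.+1%:R^-1) (m.+1%:R^-1) => p q r s *.
by apply/andP; split; lra.
Qed.

Lemma left_halfline_exhaustion l :
  `]-oo, l[%classic = \bigcup_n `[l - n.+2%:R, l - n.+1%:R^-1]%classic.
Proof.
apply/seteqP; split => x /=; rewrite in_itv /=; last first.
  move=> [n _] /=; rewrite in_itv /= => /andP[_ h]; apply: le_lt_trans h _.
  by rewrite ltrBlDr ltrDl invr_gt0.
move=> lx; have x0 : - l < - x by rewrite ltrN2.
have : `]- l, +oo[%classic (- x) by rewrite /= in_itv /= x0.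
rewrite right_halfline_exhaustion => -[n _ /=]; rewrite in_itv /= => /andP[h1 h2].
exists n => //=; rewrite in_itv /=; move: h1 h2; move: (n.+2%:R) (n.+1%:R^-1) => p q *.
by apply/andP; split; lra.
Qed.

Lemma left_halfline_nondecreasing l :
  nondecreasing_seq (fun n : nat => `[l - n.+2%:R, l - n.+1%:R^-1]%classic).
Proof.
move=> n m nm; apply/subsetPset => x /=; rewrite !in_itv /= => /andP[h1 h2].
have h : n.+2%:R <= m.+2%:R :> R by rewrite ler_nat !ltnS.
have h' : m.+1%:R^-1 <= n.+1%:R^-1 :> R by rewrite lef_pV2 ?posrE// ler_nat ltnS.
move: h h' h1 h2; move: (n.+2%:R) (m.+2%:R) (n.+1%:R^-1) (m.+1%:R^-1) => p q r s *.
by apply/andP; split; lra.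
Qed.

Definition lorentz c x := (1 + c * x ^+ 2)^-1.

Lemma lorentz_gt0 c x : 0 <= c -> 0 < lorentz c x.
Proof. by move=> c0; rewrite invr_gt0 ltr_pwDl// mulr_ge0// sqr_ge0. Qed.

Lemma lorentz_le1 c x : 0 <= c -> lorentz c x <= 1.
Proof.
move=> c0; have h : 0 <= c * x ^+ 2 by rewrite mulr_ge0// sqr_ge0.
by rewrite /lorentz invf_le1; lra.
Qed.

Lemma lorentzN c x : lorentz c (- x) = lorentz c x.
Proof. by rewrite /lorentz sqrrN. Qed.

Lemma expRN_le_inv x : 0 <= x -> expR (- x) <= (1 + x)^-1.
Proof. by move=> x0; rewrite expRN lef_pV2 ?posrE ?expR_gt0 ?expR_ge1Dx// ltr_pwDl. Qed.

Lemma expR_le_lorentz c x : 0 <= c -> expR (- (c * x ^+ 2)) <= lorentz c x.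
Proof. by move=> c0; rewrite expRN_le_inv// mulr_ge0// sqr_ge0. Qed.

Lemma lorentz_continuous c m x : 0 <= c -> {for x, continuous (fun y => lorentz c (y - m))}.
Proof.
move=> c0; have d1 : is_derive x (1 : R) (fun s => s - m) (1 - 0).
  exact: (rderB (is_derive_id _ _) (is_derive_cst _ _ _)).
have d2 : is_derive x (1 : R) (fun s => 1 + c * (s - m) ^+ 2) (0 + c * ((1 - 0) * (x - m) + (x - m) * (1 - 0))).
  have -> : (fun s => 1 + c * (s - m) ^+ 2) = (fun s => 1 + c * ((s - m) * (s - m))).
    by apply/funext => s; rewrite expr2.
  exact: (rderD (is_derive_cst _ _ _) (rderMl _ (rderM d1 d1))).
apply: (rder_continuous (rderV _ d2)).
by rewrite gt_eqF// -invr_gt0; exact: lorentz_gt0.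
Qed.

Lemma integral_lorentz c m : 0 < c ->
  (\int[mu]_x (lorentz c (x - m))%:E <= (pi / Num.sqrt c)%:E)%E.
Proof.
move=> c0; have s0 : 0 < Num.sqrt c by rewrite sqrtr_gt0.
apply: (@ge0_FTC_le setT (fun n => - n.+1%:R) (fun n => n.+1%:R) _
  (fun x => (Num.sqrt c)^-1 * atan (Num.sqrt c * (x - m)))).
- by move=> n; rewrite -subr_gt0 opprK addr_gt0.
- exact: line_nondecreasing.
- exact: line_exhaustion.
- move=> x _; have d1 : is_derive x (1 : R) (fun s => Num.sqrt c * (s - m)) (Num.sqrt c * (1 - 0)).
    exact: (rderMl _ (rderB (is_derive_id _ _) (is_derive_cst _ _ _))).
  apply: (is_derive_eq (rderMl _ (rder_comp (is_derive1_atan _) d1))).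
  rewrite /lorentz -[c in RHS](sqr_sqrtr (ltW c0)); set s := Num.sqrt c in s0 *.
  have h : 1 + (s * (x - m)) ^+ 2 != 0 by rewrite gt_eqF// ltr_pwDl// sqr_ge0.
  by rewrite -exprMn; field; rewrite h gt_eqF.
- by move=> x _; apply: lorentz_continuous; exact: ltW.
- by move=> x _; rewrite ltW// lorentz_gt0// ltW.
- move=> x y _ _; rewrite -mulrBr mulrC ler_pM2r ?invr_gt0//.
  have := atan_ltpi2 (Num.sqrt c * (y - m)); have := atan_gtNpi2 (Num.sqrt c * (x - m)).
  by move=> *; lra.
Qed.

(** The primitive is a multiple of the arctangent of [sqrt (c (x - l))]. *)
Lemma integral_weight_right c l : 0 < c ->
  (\int[mu]_(x in `]l, +oo[) ((Num.sqrt (x - l))^-1 * (1 + c * (x - l))^-1)%:E <= (pi / Num.sqrt c)%:E)%E.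
Proof.
move=> c0; have s0 : 0 < Num.sqrt c by rewrite sqrtr_gt0.
have d (x : R) : l < x -> is_derive x (1 : R) (fun s => Num.sqrt (s - l)) ((2 * Num.sqrt (x - l))^-1).
  move=> lx; apply: (is_derive_eq (rder_comp (f := Num.sqrt) (g := fun s => s - l) (is_derive1_sqrt _)
    (rderB (is_derive_id _ _) (is_derive_cst _ _ _)))); first by rewrite subr_gt0.
  by rewrite subr0 mulr1.
apply: (@ge0_FTC_le `]l, +oo[%classic (fun n => l + n.+1%:R^-1) (fun n => l + n.+2%:R)
  (fun x => (Num.sqrt (x - l))^-1 * (1 + c * (x - l))^-1)
  (fun x => 2 / Num.sqrt c * atan (Num.sqrt c * Num.sqrt (x - l))) (pi / Num.sqrt c)).
- move=> n; rewrite ltrD2l; apply: (@le_lt_trans _ _ 1); last by rewrite ltr1n.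
  by rewrite invf_le1// ler1n.
- exact: right_halfline_nondecreasing.
- exact: right_halfline_exhaustion.
- move=> x /=; rewrite in_itv /= andbT => lx.
  apply: (is_derive_eq (rderMl _ (rder_comp (is_derive1_atan _) (rderMl _ (d x lx))))).
  have p0 : 0 < Num.sqrt (x - l) by rewrite sqrtr_gt0 subr_gt0.
  have -> : c * (x - l) = (Num.sqrt c * Num.sqrt (x - l)) ^+ 2.
    by rewrite exprMn !sqr_sqrtr// ?subr_ge0 ltW.
  set s := Num.sqrt c in s0 *; set p := Num.sqrt (x - l) in p0 *.
  have h : 1 + (s * p) ^+ 2 != 0 by rewrite gt_eqF// ltr_pwDl// sqr_ge0.
  by field; rewrite h !gt_eqF.
- move=> x /=; rewrite in_itv /= andbT => lx.
  have p0 : 0 < Num.sqrt (x - l) by rewrite sqrtr_gt0 subr_gt0.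
  have d2 : is_derive x (1 : R) (fun s => 1 + c * (s - l)) (0 + c * (1 - 0)).
    exact: (rderD (is_derive_cst _ _ _) (rderMl _ (rderB (is_derive_id _ _) (is_derive_cst _ _ _)))).
  apply: (rder_continuous (rderM (rderV _ (d x lx)) (rderV _ d2))); first by rewrite gt_eqF.
  by rewrite gt_eqF// ltr_pwDl// mulr_ge0 ?ltW// subr_gt0.
- move=> x /=; rewrite in_itv /= andbT => lx.
  by rewrite mulr_ge0// ?invr_ge0 ?sqrtr_ge0// addr_ge0// mulr_ge0 ?ltW// subr_gt0.
- move=> x y /=; rewrite !in_itv /= !andbT => lx ly; rewrite -mulrBr.
  have h1 := atan_ltpi2 (Num.sqrt c * Num.sqrt (y - l)).
  have h2 : 0 <= atan (Num.sqrt c * Num.sqrt (x - l)).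
    by rewrite -(@atan0 R) le_atan// mulr_ge0 ?sqrtr_ge0.
  rewrite mulrAC ler_pM2r ?invr_gt0//; lra.
Qed.

Lemma integral_weight_left c l : 0 < c ->
  (\int[mu]_(x in `]-oo, l[) ((Num.sqrt (l - x))^-1 * (1 + c * (l - x))^-1)%:E <= (pi / Num.sqrt c)%:E)%E.
Proof.
move=> c0; have s0 : 0 < Num.sqrt c by rewrite sqrtr_gt0.
have d (x : R) : x < l -> is_derive x (1 : R) (fun s => Num.sqrt (l - s)) (- (2 * Num.sqrt (l - x))^-1).
  move=> lx; apply: (is_derive_eq (rder_comp (f := Num.sqrt) (g := fun s => l - s) (is_derive1_sqrt _)
    (rderB (is_derive_cst _ _ _) (is_derive_id _ _)))); first by rewrite subr_gt0.
  by rewrite sub0r mulrN1.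
apply: (@ge0_FTC_le `]-oo, l[%classic (fun n => l - n.+2%:R) (fun n => l - n.+1%:R^-1)
  (fun x => (Num.sqrt (l - x))^-1 * (1 + c * (l - x))^-1)
  (fun x => - (2 / Num.sqrt c) * atan (Num.sqrt c * Num.sqrt (l - x))) (pi / Num.sqrt c)).
- move=> n; rewrite ltrD2l ltrN2; apply: (@le_lt_trans _ _ 1); last by rewrite ltr1n.
  by rewrite invf_le1// ler1n.
- exact: left_halfline_nondecreasing.
- exact: left_halfline_exhaustion.
- move=> x /=; rewrite in_itv /= => lx.
  apply: (is_derive_eq (rderMl _ (rder_comp (is_derive1_atan _) (rderMl _ (d x lx))))).
  have p0 : 0 < Num.sqrt (l - x) by rewrite sqrtr_gt0 subr_gt0.
  have -> : c * (l - x) = (Num.sqrt c * Num.sqrt (l - x)) ^+ 2.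
    by rewrite exprMn !sqr_sqrtr// ?subr_ge0 ltW.
  set s := Num.sqrt c in s0 *; set p := Num.sqrt (l - x) in p0 *.
  have h : 1 + (s * p) ^+ 2 != 0 by rewrite gt_eqF// ltr_pwDl// sqr_ge0.
  by field; rewrite h !gt_eqF.
- move=> x /=; rewrite in_itv /= => lx.
  have p0 : 0 < Num.sqrt (l - x) by rewrite sqrtr_gt0 subr_gt0.
  have d2 : is_derive x (1 : R) (fun s => 1 + c * (l - s)) (0 + c * (0 - 1)).
    exact: (rderD (is_derive_cst _ _ _) (rderMl _ (rderB (is_derive_cst _ _ _) (is_derive_id _ _)))).
  apply: (rder_continuous (rderM (rderV _ (d x lx)) (rderV _ d2))); first by rewrite gt_eqF.
  by rewrite gt_eqF// ltr_pwDl// mulr_ge0 ?ltW// subr_gt0.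
- move=> x /=; rewrite in_itv /= => lx.
  by rewrite mulr_ge0// ?invr_ge0 ?sqrtr_ge0// addr_ge0// mulr_ge0 ?ltW// subr_gt0.
- move=> x y /=; rewrite !in_itv /= => lx ly; rewrite -mulrBr.
  have h1 := atan_ltpi2 (Num.sqrt c * Num.sqrt (l - x)).
  have h2 : 0 <= atan (Num.sqrt c * Num.sqrt (l - y)).
    by rewrite -(@atan0 R) le_atan// mulr_ge0 ?sqrtr_ge0.
  rewrite mulNr -mulrN opprB mulrAC ler_pM2r ?invr_gt0//; lra.
Qed.

(** The primitive is [O (1 / |t|)], hence vanishes at both ends. *)
Lemma FTC_line0 (F f : R -> R) (C : R) :
  (forall t, is_derive t (1 : R) F (f t)) -> (forall t, {for t, continuous f}) ->
  mu.-integrable setT (EFin \o f) -> (forall t, `|F t| * `|t| <= C) ->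
  \int[mu]_t f t = 0.
Proof.
move=> dF cf fi FC.
pose fn (n : nat) (t : R) : R := (f \_ `[- n.+1%:R, n.+1%:R]) t.
have mf : measurable_fun setT f by apply: continuous_measurable_on.
have key n : (\int[mu]_t (fn n t)%:E)%E = (F n.+1%:R - F (- n.+1%:R))%:E.
  rewrite EFinB -(@continuous_FTC2 _ f F (- n.+1%:R) n.+1%:R) //.
  - rewrite [in RHS]integral_mkcond; apply: eq_integral => t _.
    by rewrite /fn patchE [RHS]patchE; case: ifP.
  - by rewrite -subr_gt0 opprK addr_gt0.
  - by apply: continuous_in_subspaceT => t _; exact: cf.
  - split => [t _|t|].
    + exact: (@ex_derive _ _ _ _ _ _ _ (dF t)).
    + apply: cvg_at_right_filter; exact: rder_continuous (dF _).
    + apply: cvg_at_left_filter; exact: rder_continuous (dF _).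
  - by move=> t _; rewrite derive1E; apply: derive_val; exact: dF.
have lim1 : \int[mu]_t fn n t @[n --> \oo] --> \int[mu]_t f t.
  apply: (@Rdominated_cvg _ _ _ mu setT fn f (fun t => `|f t|)) => //.
  - move=> n; apply: (measurable_restrictT f (measurable_itv `[- n.+1%:R, n.+1%:R])).1.
    exact: measurable_funTS.
  - move=> t _; apply: cvg_near_cst.
    near=> n; rewrite /fn patchE mem_set//= in_itv /= -ler_norml.
    apply: (@le_trans _ _ n%:R); last by rewrite ler_nat.
    by near: n; exact: nbhs_infty_ger.
  - exact: (integrable_norm fi).
  - move=> n t _ /=; rewrite /fn patchE; case: ifP => //= _.
    by rewrite normr0.
have lim2 : F n.+1%:R - F (- n.+1%:R) @[n --> \oo] --> 0.
  apply: (@squeeze_cvgr _ _ _ _ (fun n => - (2 * C * n.+1%:R^-1)) (fun n => 2 * C * n.+1%:R^-1)).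
  - apply: nearW => n; rewrite -ler_norml.
    have n0 : 0 < n.+1%:R :> R by [].
    have h1 := FC n.+1%:R; have h2 := FC (- n.+1%:R).
    rewrite normrN !(ger0_norm (ltW n0)) in h1 h2.
    apply: le_trans (ler_normB _ _) _; rewrite ler_pdivlMr//; lra.
  - rewrite -[0]oppr0 -[X in - X](mulr0 (2 * C)); apply: cvgN; apply: cvgMr; exact: cvg_harmonic.
  - rewrite -[0](mulr0 (2 * C)); apply: cvgMr; exact: cvg_harmonic.
have E : (fun n => \int[mu]_t fn n t) = (fun n => F n.+1%:R - F (- n.+1%:R)).
  by apply/funext => n; rewrite /Rintegral key.
rewrite E in lim1.
exact: (cvg_unique (@Rhausdorff R) lim1 lim2).
Unshelve. all: by end_near. Qed.

Lemma cFTC_line0 (F f : R -> R[i]) (C : R) :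
  (forall t, cderive F t (f t)) -> (forall t, cdiff f t) ->
  cintegrable mu setT f -> (forall t, normc (F t) * `|t| <= C) ->
  cintegral mu setT f = 0.
Proof.
move=> dF df [i1 i2] FC; rewrite /cintegral; congr Complex.
  apply: (FTC_line0 (F := fun t => Re (F t)) (C := C)) => //.
  - by move=> t; have [] := dF t.
  - by move=> t; have [l /cderive_continuous[]] := df t.
  - by move=> t; apply: le_trans (FC t); rewrite ler_wpM2r// Re_le_normc.
apply: (FTC_line0 (F := fun t => Im (F t)) (C := C)) => //.
- by move=> t; have [] := dF t.
- by move=> t; have [l /cderive_continuous[]] := df t.
- by move=> t; apply: le_trans (FC t); rewrite ler_wpM2r// Im_le_normc.
Qed.

End line_integrals.

(** * The oscillating Gaussian kernel *)

Lemma Re_pair (R : realType) (u v : R) : Re (u +i* v) = u. Proof. by []. Qed.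
Lemma Im_pair (R : realType) (u v : R) : Im (u +i* v) = v. Proof. by []. Qed.
Definition ReIm_pair := (Re_pair, Im_pair).

Lemma conj_cexp (R : realType) (z : R[i]) : (cexp z)^*%C = cexp z^*%C.
Proof. by case: z => u v; rewrite /cexp /= cosN sinN mulrN. Qed.

Section gaussian_kernel.
Context {R : realType}.
Local Notation mu := (@lebesgue_measure R).
Variables (b e : R).
Hypotheses (b0 : 0 < b) (e0 : 0 < e).
Implicit Types x y : R.

Definition gauss_kernel x y : R[i] := cexp (((- b) +i* e) * (x - y)%:C ^+ 2).

Lemma normc_gauss_kernel x y : normc (gauss_kernel x y) = expR (- (b * (x - y) ^+ 2)).
Proof.
by rewrite normc_cexp -rmorphXn Re_mul Re_real Im_real mulr0 subr0 [Re (_ +i* _)]/= mulNr.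
Qed.

Lemma normc_gauss_kernel_lorentz x y : normc (gauss_kernel x y) <= lorentz b (x - y).
Proof. by rewrite normc_gauss_kernel expR_le_lorentz// ltW. Qed.

Lemma normc_gauss_kernel_le1 x y : normc (gauss_kernel x y) <= 1.
Proof. by apply: le_trans (normc_gauss_kernel_lorentz x y) _; rewrite lorentz_le1// ltW. Qed.

Lemma measurable_lorentz d (T : measurableType d) (c : R) (f : T -> R) : measurable_fun setT f ->
  measurable_fun setT (fun z => lorentz c (f z)).
Proof.
move=> mf; apply: measurable_funV; apply: measurable_funD => //.
by apply: measurable_funM => //; exact: measurable_funX.
Qed.

Lemma cintegral_lorentz (h : R -> R[i]) (A c m : R) : 0 < c -> 0 <= A ->
  cmeasurable setT h -> (forall x, normc (h x) <= A * lorentz c (x - m)) ->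
  cintegrable mu setT h /\ normc (cintegral mu setT h) <= A * (pi / Num.sqrt c).
Proof.
move=> c0 A0 mh hA.
have ml : measurable_fun setT (fun x => lorentz c (x - m)).
  by apply: measurable_lorentz; exact: measurable_funB.
have le : (\int[mu]_x (normc (h x))%:E <= (A * (pi / Num.sqrt c))%:E)%E.
  apply: (@le_trans _ _ (\int[mu]_x (A * lorentz c (x - m))%:E)%E).
    apply: (@le_nonneg_integral _ _ _ mu (fun x => normc (h x)) (fun x => A * lorentz c (x - m))) => //.
    - exact: measurable_normc.
    - exact: measurable_funM.
    - by move=> x; exact: normc_ge0.
  under eq_integral do rewrite EFinM.
  rewrite ge0_integralZl_EFin//; last 2 first.
  - by move=> x _; rewrite lee_fin ltW// lorentz_gt0// ltW.
  - exact/measurable_EFinP.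
  by rewrite EFinM; apply: lee_wpmul2l => //; exact: integral_lorentz.
split; first by apply: cintegrableP => //; exact: le_lt_trans le (ltry _).
have le' := normc_cintegral_le mu (mh : @cmeasurable _ (measurableTypeR R) _ setT h).
by rewrite -lee_fin; exact: le_trans le' le.
Qed.

Lemma schur_gauss_kernel : schur mu gauss_kernel (pi / Num.sqrt b).
Proof.
have mk : cmeasurable setT (fun z : R * R => gauss_kernel z.1 z.2).
  apply: cmeasurable_cexp; apply: cmeasurableM; first exact: cmeasurable_cst.
  under eq_fun do rewrite -rmorphXn; apply: cmeasurable_real; apply: measurable_funX.
  by apply: measurable_funB; [exact: measurable_fst|exact: measurable_snd].
split => //.
- move=> x; apply: le_trans (integral_lorentz x b0).
  apply: le_nonneg_integral.
  + exact: (measurable_normc (cmeasurable_slice1 x mk)).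
  + by apply: measurable_lorentz; exact: measurable_funB.
  + by move=> y; exact: normc_ge0.
  + by move=> y; rewrite -lorentzN opprB; exact: normc_gauss_kernel_lorentz.
- move=> y; apply: le_trans (integral_lorentz y b0).
  apply: le_nonneg_integral.
  + exact: (measurable_normc (cmeasurable_slice2 y mk)).
  + by apply: measurable_lorentz; exact: measurable_funB.
  + by move=> x; exact: normc_ge0.
  + by move=> x; exact: normc_gauss_kernel_lorentz.
Qed.

Definition gauss_overlap y y' := cintegral mu setT (fun x => gauss_kernel x y * (gauss_kernel x y')^*%C).

(** The product of the two Gaussians is [cexp q] with [q' = D - 4 b X], where [X] is
    the distance to the midpoint and [D], proportional to [e (y - y')], is
    imaginary. The integral of the derivative of [(D + 4 b X) cexp q] vanishes; as
    the term [D ^ 2] is negative, the overlap decays quadratically in [y - y']. *)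
Lemma normc_gauss_overlap y y' :
  normc (gauss_overlap y y') <= 2 * (pi / Num.sqrt b) * lorentz (e ^+ 2 / (4 * b)) (y - y').
Proof.
pose c : R[i] := (- b) +i* e; pose c' : R[i] := (- b) +i* (- e).
pose m := (y + y') / 2.
pose q x : R[i] := c * (x - y)%:C ^+ 2 + c' * (x - y')%:C ^+ 2.
pose P x : R[i] := - 2 * (c * (x - y')%:C + c' * (x - y)%:C).
pose E x := cexp (q x).
have E1 x : gauss_kernel x y * (gauss_kernel x y')^*%C = E x.
  rewrite /E /q cexpD conj_cexp; congr (_ * cexp _); rewrite -rmorphXn.
  by move: ((x - y') ^+ 2) => z; apply: complex_ext; rewrite /c' /=; ring.
have [nb nbE] : exists nb, nb = - b by exists (- b).
have [ne neE] : exists ne, ne = - e by exists (- e).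
have dl (z x : R) : cderive (fun s => (s - z)%:C) x 1.
  apply: cderive_eq (cderive_real (rderB (is_derive_id _ _) (is_derive_cst _ _ _))) _.
  by rewrite subr0.
have dE x : cderive E x ((2 * (c * (x - y)%:C + c' * (x - y')%:C)) * E x).
  apply: cderive_cexp; rewrite /q; under eq_fun do rewrite !expr2.
  apply: cderive_eq (cderiveD (cderiveMl c (cderiveM (dl y x) (dl y x)))
    (cderiveMl c' (cderiveM (dl y' x) (dl y' x)))) _.
  by ring.
have dP x : cderive P x (- 2 * (c + c')).
  apply: cderive_eq (cderiveMl (- 2) (cderiveD (cderiveMl c (dl y' x)) (cderiveMl c' (dl y x)))) _.
  by ring.
pose r x := 4 * b - 16 * b ^+ 2 * (x - m) ^+ 2.
(* The derivative of [P E] is [(r - s) E], with [s = - D ^ 2]. *)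
pose s := 4 * e ^+ 2 * (y - y') ^+ 2.
have dF x : cderive (fun x => P x * E x) x ((r x)%:C * E x - s%:C * E x).
  apply: cderive_eq (cderiveM (dP x) (dE x)) _.
  have -> : - 2 * (c + c') * E x + P x * (2 * (c * (x - y)%:C + c' * (x - y')%:C) * E x) =
    (- 2 * (c + c') + P x * (2 * (c * (x - y)%:C + c' * (x - y')%:C))) * E x by ring.
  rewrite -mulrBl; congr (_ * _).
  have h2 : (2 : R[i]) = (2 : R)%:C by rewrite rmorph_nat.
  by rewrite /P h2 /c /c' -nbE -neE; apply: complex_ext; rewrite /r /s /m !ReImE ?ReIm_pair nbE neE; field.
have nE x : normc (E x) <= lorentz b (x - m) ^+ 2.
  have -> : lorentz b (x - m) ^+ 2 = ((1 + b * (x - m) ^+ 2) ^-1) ^+ 2 by [].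
  have z0 : 0 <= b * (x - m) ^+ 2 by rewrite mulr_ge0 ?sqr_ge0// ltW.
  apply: (@le_trans _ _ (expR (- (b * (x - m) ^+ 2)) ^+ 2)); last first.
    rewrite ler_pXn2r// ?nnegrE ?expR_ge0 ?expRN_le_inv// invr_ge0; lra.
  rewrite -expRM_natl normc_cexp ler_expR /q /c /c' -nbE -neE -!rmorphXn !ReImE ?ReIm_pair nbE neE.
  rewrite -mulr_natl /m.
  have : 0 <= b * (y - y') ^+ 2 by rewrite mulr_ge0 ?sqr_ge0// ltW.
  by rewrite !expr2; nra.
have cE x : cdiff E x by exact: cdiff_of (dE x).
have mE : cmeasurable setT E by apply: cdiff_cmeasurable.
have l0 x : 0 < lorentz b x by apply: lorentz_gt0; exact: ltW.
have l1 x : lorentz b x <= 1 by apply: lorentz_le1; exact: ltW.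
have n0 : 0 < Num.sqrt b by rewrite sqrtr_gt0.
have [iE bE] : cintegrable mu setT E /\ normc (cintegral mu setT E) <= 1 * (pi / Num.sqrt b).
  apply: (@cintegral_lorentz E 1 b m) => // x; apply: le_trans (nE x) _.
  by rewrite mul1r expr2 ler_piMr// ltW.
have [irE brE] : cintegrable mu setT (fun x => (r x)%:C * E x) /\
   normc (cintegral mu setT (fun x => (r x)%:C * E x)) <= (16 * b) * (pi / Num.sqrt b).
  apply: (@cintegral_lorentz _ (16 * b) b m) => //.
  - by rewrite mulr_ge0 ?ltW.
  - apply: cmeasurableM => //; apply: cmeasurable_real; apply: continuous_measurable_on => // t _.
    have d1 : is_derive t (1 : R) (fun s => s - m) (1 - 0).
      exact: (rderB (is_derive_id _ _) (is_derive_cst _ _ _)).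
    have -> : r = (fun s => 4 * b - 16 * b ^+ 2 * ((s - m) * (s - m))).
      by apply/funext => z; rewrite /r expr2.
    exact: (rder_continuous (rderB (is_derive_cst _ _ _) (rderMl _ (rderM d1 d1)))).
  - move=> x; rewrite normcM normcC.
    have z0 : 0 <= b * (x - m) ^+ 2 by rewrite mulr_ge0 ?sqr_ge0// ltW.
    have hr : `|r x| <= 16 * b * (1 + b * (x - m) ^+ 2).
      rewrite /r ler_norml; move: z0; rewrite !expr2; move: ((x - m) * (x - m)) => X z0.
      have : 0 <= b * (b * X) by rewrite mulr_ge0// ltW.
      by move: b0 => ? ?; apply/andP; split; nra.
    apply: le_trans (ler_pM (normr_ge0 _) (normc_ge0 _) hr (nE x)) _.
    have h1 : (1 + b * (x - m) ^+ 2) * lorentz b (x - m) = 1 by rewrite /lorentz mulfV// gt_eqF// ltr_pwDl.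
    by rewrite [lorentz _ _ ^+ 2]expr2 mulrA -(mulrA (16 * b)) h1 mulr1.
have FF : cintegral mu setT (fun x => (r x)%:C * E x - s%:C * E x) = 0.
  pose A := 2 * e * `|y - y'| ; pose C := A * `|m| + (A + 4 * b * `|m|) + (A + 4 * b * `|m| + 4 * b) / b.
  apply: (@cFTC_line0 _ (fun x => P x * E x) _ C) => //.
  - move=> t.
    have d1 : is_derive t (1 : R) (fun s => s - m) (1 - 0).
      exact: (rderB (is_derive_id _ _) (is_derive_cst _ _ _)).
    have dr : is_derive t (1 : R) r (0 - 16 * b ^+ 2 * ((1 - 0) * (t - m) + (t - m) * (1 - 0))).
      have -> : r = (fun s => 4 * b - 16 * b ^+ 2 * ((s - m) * (s - m))).
        by apply/funext => z; rewrite /r expr2.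
      exact: (rderB (is_derive_cst _ _ _) (rderMl _ (rderM d1 d1))).
    apply: cdiffD; first by apply: cdiffM => //; exact: (cdiff_of (cderive_real dr)).
    by apply: cdiffN; apply: cdiffM => //; exact: cdiff_cst.
  - split.
      by have [i1 _] := cintegrableD measurableT irE (cintegrableMl (- s%:C) measurableT iE); under eq_fun do rewrite -mulNr.
    by have [_ i1] := cintegrableD measurableT irE (cintegrableMl (- s%:C) measurableT iE); under eq_fun do rewrite -mulNr.
  - move=> t; rewrite normcM.
    have nP : normc (P t) <= A + 4 * b * `|t - m|.
      apply: le_trans (normc_le_ReIm _) _.
      have h2 : (2 : R[i]) = (2 : R)%:C by rewrite rmorph_nat.
      have -> : Re (P t) = 4 * b * (t - m).
        by rewrite /P h2 /m /c /c' -nbE -neE !ReImE ?ReIm_pair nbE neE; field.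
      have -> : Im (P t) = - (2 * e * (y - y')).
        by rewrite /P h2 /c /c' -nbE -neE !ReImE ?ReIm_pair nbE neE; ring.
      by rewrite normrN normrM (normrM (2 * e)) addrC /A (gtr0_norm (mulr_gt0 (ltr0Sn _ 1) e0)) (gtr0_norm (mulr_gt0 (ltr0Sn _ 3) b0)).
    have z0 : 0 <= b * (t - m) ^+ 2 by rewrite mulr_ge0 ?sqr_ge0// ltW.
    have nE1 : normc (E t) <= (1 + b * (t - m) ^+ 2)^-1.
      by apply: le_trans (nE t) _; rewrite expr2 ler_piMr// ltW// l0.
    have tm : `|t| <= `|t - m| + `|m| by rewrite -{1}(subrK m t) ler_normD.
    have A0 : 0 <= A by rewrite /A !mulr_ge0// (ltW e0).
    have M0 := normr_ge0 m; have X0 := normr_ge0 (t - m).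
    have XX : (t - m) ^+ 2 = `|t - m| * `|t - m| by rewrite -expr2 real_normK ?num_real.
    apply: (@le_trans _ _ ((A + 4 * b * `|t - m|) * (1 + b * (t - m) ^+ 2)^-1 * (`|t - m| + `|m|))).
      by apply: ler_pM => //; [rewrite mulr_ge0 ?normc_ge0|apply: ler_pM => //; exact: normc_ge0].
    rewrite mulrAC ler_pdivrMr; last by rewrite ltr_pwDl.
    rewrite XX in z0 *; rewrite /C; move: (`|t - m|) (`|m|) X0 M0 z0 => X M X0 M0 z0.
    have hb : (A + 4 * b * M + 4 * b) / b * (1 + b * (X * X)) = (A + 4 * b * M + 4 * b) / b + (A + 4 * b * M + 4 * b) * (X * X).
      by field; rewrite gt_eqF.
    rewrite [leRHS]mulrDl hb.
    have p7 : 0 <= b by exact: ltW.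
    have p3 : 0 <= b * M by rewrite mulr_ge0.
    have p1 : 0 <= (A + 4 * b * M + 4 * b) / b by apply: divr_ge0 => //; lra.
    have p4 : X <= 1 + X * X by nra.
    have p5 : (A + 4 * b * M) * X <= (A + 4 * b * M) * (1 + X * X).
      by apply: ler_wpM2l => //; lra.
    have p2 : 0 <= A * M by rewrite mulr_ge0.
    have p6 : 0 <= (A * M + (A + 4 * b * M)) * (b * (X * X)) by apply: mulr_ge0 => //; lra.
    move: p1; set q1 := (_ / b) => p1; lra.
have sM : s%:C * cintegral mu setT E = cintegral mu setT (fun x => (r x)%:C * E x).
  move: FF; rewrite cintegralB//; last exact: cintegrableMl.
  by rewrite cintegralMl// => /eqP; rewrite subr_eq0 => /eqP ->.
have -> : gauss_overlap y y' = cintegral mu setT E.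
  by apply: eq_cintegral => x _; exact: E1.
have sM' : s * normc (cintegral mu setT E) <= 16 * b * (pi / Num.sqrt b).
  apply: le_trans brE; rewrite -sM normcM normcC ger0_norm// /s.
  by apply: mulr_ge0; [apply: mulr_ge0 => //; exact: sqr_ge0|exact: sqr_ge0].
have k0 : 0 <= e ^+ 2 / (4 * b) * (y - y') ^+ 2.
  apply: mulr_ge0; last exact: sqr_ge0.
  by apply: divr_ge0; [exact: sqr_ge0|apply: mulr_ge0 => //; exact: ltW].
rewrite /lorentz ler_pdivlMr; last by rewrite ltr_pwDl.
have -> : e ^+ 2 / (4 * b) * (y - y') ^+ 2 = s / (16 * b) by rewrite /s; field; rewrite gt_eqF.
move: sM' bE; set N := normc _; rewrite mul1r; set Q := pi / _ => sM' bE.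
rewrite mulrDr mulr1 mulrA (mulrC N) -mulrA.
have h16 : s * N / (16 * b) <= Q by rewrite ler_pdivrMr ?mulr_gt0// (mulrC Q).
rewrite mulrA; lra.
Qed.

(** The bound does not depend on [b], which measures the damping: the overlap is of
    size [1 / sqrt b] over a distance [sqrt b / e]. *)
Lemma l2bound_gauss_kernel : l2bound mu gauss_kernel (Num.sqrt (4 * pi ^+ 2 / e)).
Proof.
have sb : 0 < Num.sqrt b by rewrite sqrtr_gt0.
have p0 := pi_gt0 R.
pose k := e ^+ 2 / (4 * b).
have k0 : 0 < k by rewrite divr_gt0 ?exprn_gt0// mulr_gt0.
have sk : Num.sqrt k = e / (2 * Num.sqrt b).
  have -> : k = (e / (2 * Num.sqrt b)) ^+ 2.
    by rewrite /k expr_div_n exprMn sqr_sqrtr ?(ltW b0)//; congr (_ / (_ * _)); ring.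
  by rewrite sqrtr_sqr ger0_norm// ltW// divr_gt0// mulr_gt0.
have A0 : 0 <= 2 * (pi / Num.sqrt b) by rewrite mulr_ge0// divr_ge0// ltW.
have B1 m : (\int[mu]_y (2 * (pi / Num.sqrt b) * lorentz k (y - m))%:E <= (4 * pi ^+ 2 / e)%:E)%E.
  under eq_integral do rewrite EFinM.
  have ml : measurable_fun setT (fun x => lorentz k (x - m)).
    by apply: measurable_lorentz; exact: measurable_funB.
  rewrite ge0_integralZl_EFin//; last 2 first.
  - by move=> x _; rewrite lee_fin ltW// lorentz_gt0// ltW.
  - exact/measurable_EFinP.
  apply: (@le_trans _ _ ((2 * (pi / Num.sqrt b))%:E * (pi / Num.sqrt k)%:E)%E).
    by apply: lee_wpmul2l => //; exact: integral_lorentz.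
  rewrite -EFinM lee_fin sk le_eqVlt; apply/orP; left; apply/eqP.
  by field; rewrite !gt_eqF.
apply: (@TstarT _ _ _ mu gauss_kernel (pi / Num.sqrt b) (4 * pi ^+ 2 / e)
   (fun y y' => 2 * (pi / Num.sqrt b) * lorentz k (y - y')) schur_gauss_kernel).
- by rewrite divr_gt0.
- exact: normc_gauss_kernel_le1.
- apply: measurable_funM => //; apply: measurable_lorentz.
  by apply: measurable_funB; [exact: measurable_fst|exact: measurable_snd].
- by move=> y y'; rewrite mulr_ge0// ltW// lorentz_gt0// ltW.
- by rewrite divr_gt0// mulr_gt0// exprn_gt0.
- by move=> y; under eq_integral do rewrite -lorentzN opprB; exact: B1.
- by move=> y'; exact: B1.
- exact: normc_gauss_overlap.
Qed.

End gaussian_kernel.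

(** * Stretched coordinates and the stretched Gaussian kernel *)

Section stretched_coordinate.
Context {R : realType}.
Variables (l s0 : R).
Hypothesis l0 : 0 < l.
Implicit Types x y : R.

(** The signed distance to the interval from [- l] to [l], which is the imaginary part
    of the stretched coordinate divided by the height of the absorption. *)
Definition excess x := Num.max (x - l) 0 - Num.max (- l - x) 0.

Lemma excessP x : [\/ l < x /\ excess x = x - l, x < - l /\ excess x = x + l |
  - l <= x <= l /\ excess x = 0].
Proof.
have lp := l0; rewrite /excess; case: (ltP l x) => h1.
  apply: Or31; split => //.
  have a1 : 0 <= x - l by lra.
  have a2 : - l - x <= 0 by lra.
  by rewrite (max_l a1) (max_r a2) subr0.
case: (ltP x (- l)) => h2.
  apply: Or32; split => //.
  have a1 : x - l <= 0 by lra.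
  have a2 : 0 <= - l - x by lra.
  rewrite (max_r a1) (max_l a2); lra.
apply: Or33; split => //.
have a1 : x - l <= 0 by lra.
have a2 : - l - x <= 0 by lra.
by rewrite (max_r a1) (max_r a2) subrr.
Qed.

Lemma excess_lipschitz x y :
  (excess x - excess y) ^+ 2 <= (x - y) * (excess x - excess y).
Proof.
have lp := l0; rewrite expr2.
by case: (excessP x) => -[h1 ->]; case: (excessP y) => -[h2 ->];
  try (move: h1 => /andP[? ?]); try (move: h2 => /andP[? ?]); nra.
Qed.

Lemma excess_monotone x y : 0 <= (x - y) * (excess x - excess y).
Proof. exact: le_trans (sqr_ge0 _) (excess_lipschitz x y). Qed.

Lemma excess_far x y : 4 * l <= `|x - y| ->
  (x - y) ^+ 2 / 2 <= (x - y) * (excess x - excess y).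
Proof.
have lp := l0; have : - (2 * l) <= (x - y) - (excess x - excess y) <= 2 * l.
  by case: (excessP x) => -[h1 ->]; case: (excessP y) => -[h2 ->];
    try (move: h1 => /andP[? ?]); try (move: h2 => /andP[? ?]); apply/andP; split; lra.
rewrite expr2; move: (excess x - excess y) (x - y) => w d /andP[h1 h2].
case: (ger0P d) => h h3.
  have : 0 <= d * (w - d / 2) by apply: mulr_ge0; lra.
  lra.
have : 0 <= (- d) * (d / 2 - w) by apply: mulr_ge0; lra.
lra.
Qed.

Lemma excess_box x : `|x| <= l -> excess x = 0.
Proof.
have lp := l0; rewrite ler_norml => /andP[h1 h2]; by case: (excessP x) => -[h ->] //; lra.
Qed.

(** On the same side the excesses differ by [x - y]. Otherwise an endpoint of the
    interval lies between [x] and [y], and one of the points is outside: the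
    difference of the excesses is at least its distance to the endpoint, and [x - y]
    at least that of the other point. *)
Lemma excess_outside x y : ~~ ((`|x| <= l) && (`|y| <= l)) ->
  [\/ (x - y) ^+ 2 <= (x - y) * (excess x - excess y),
      `|x - l| * `|y - l| <= (x - y) * (excess x - excess y) |
      `|x + l| * `|y + l| <= (x - y) * (excess x - excess y)].
Proof.
have lp := l0; rewrite !ler_norml !expr2 => h.
case: (excessP x) => -[h1 ->]; case: (excessP y) => -[h2 ->].
- by apply: Or31; rewrite opprB addrA subrK.
- apply: Or32; rewrite (gtr0_norm (_ : 0 < x - l)) ?subr_gt0// ltr0_norm ?subr_lt0; last lra.
  by nra.
- move: h2 => /andP[h2 h3]; apply: Or32; rewrite (gtr0_norm (_ : 0 < x - l)) ?subr_gt0// ler0_norm ?subr_le0//.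
  by nra.
- apply: Or32; rewrite (gtr0_norm (_ : 0 < y - l)) ?subr_gt0// ltr0_norm ?subr_lt0; last lra.
  by nra.
- by apply: Or31; rewrite opprD addrACA subrr addr0.
- move: h2 => /andP[h2 h3]; apply: Or33; rewrite ltr0_norm; last lra.
  by rewrite ger0_norm; last lra; nra.
- move: h1 => /andP[h1 h3]; apply: Or32; rewrite (gtr0_norm (_ : 0 < y - l)) ?subr_gt0// ler0_norm ?subr_le0//.
  by nra.
- move: h1 => /andP[h1 h3]; apply: Or33; rewrite mulrC ltr0_norm; last lra.
  by rewrite ger0_norm; last lra; nra.
- by rewrite h1 h2 in h.
Qed.

Lemma measurable_excess : measurable_fun setT excess.
Proof.
apply: measurable_funB; apply: measurable_maxr => //; apply: measurable_funB => //.
Qed.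

Definition stretched x : R[i] := x +i* (s0 * excess x).

Lemma cmeasurable_stretched : cmeasurable setT stretched.
Proof. by split => //=; apply: measurable_funM => //; exact: measurable_excess. Qed.

End stretched_coordinate.

Section stretched_kernel.
Context {R : realType}.
Local Notation mu := (@lebesgue_measure R).
Variables (l s0 e k : R).
Hypotheses (l0 : 0 < l) (s0p : 0 < s0) (e0 : 0 < e) (k0 : 0 < k) (ks : k * s0 <= 1).
Implicit Types x y : R.

Local Notation ex := (excess l).
(** One factor of the kernel [exp (i (x - y) ^ 2 / (4 tau))] in stretched coordinates, with
    [i / (4 tau) = e (i - k)]: [e] is the frequency and [e k] the damping. *)
Definition stretched_kernel x y : R[i] :=
  cexp (((- (e * k)) +i* e) * (stretched l s0 x - stretched l s0 y) ^+ 2).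

(** The condition [k * s0 <= 1] lets the absorption, linear in [excess], dominate the
    growth that is due to its square. *)
Lemma normc_stretched_kernel x y : normc (stretched_kernel x y) <=
  expR (- (e * (k * (x - y) ^+ 2 + s0 * ((x - y) * (ex x - ex y))))).
Proof.
rewrite normc_cexp ler_expR /stretched.
have [ne neE] : exists ne, ne = - (e * k) by exists (- (e * k)).
rewrite -neE expr2 !ReImE ?Re_sub ?Im_sub ?ReIm_pair neE.
have h1 := excess_lipschitz l0 x y; have h2 := excess_monotone l0 x y.
set d := x - y in h1 h2 *; rewrite -!mulrBr; set w := ex x - ex y in h1 h2 *.
have h3 : k * s0 * (s0 * (w ^+ 2)) <= 1 * (s0 * (d * w)).
  apply: ler_pM => //; first by rewrite mulr_ge0// ltW.
    by rewrite mulr_ge0 ?sqr_ge0// ltW.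
  by apply: ler_wpM2l => //; exact: ltW.
have h4 : 0 <= e * (1 * (s0 * (d * w)) - k * s0 * (s0 * w ^+ 2)).
  by apply: mulr_ge0; [exact: ltW|rewrite subr_ge0].
move: h4; rewrite !expr2; lra.
Qed.

Lemma normc_stretched_kernel_le1 x y : normc (stretched_kernel x y) <= 1.
Proof.
apply: le_trans (normc_stretched_kernel x y) _; rewrite -expR0 ler_expR oppr_le0.
apply: mulr_ge0; first exact: ltW.
apply: addr_ge0; apply: mulr_ge0; [exact: ltW|exact: sqr_ge0|exact: ltW|exact: excess_monotone].
Qed.

Lemma normc_stretched_kernel_lorentz x y : normc (stretched_kernel x y) <= lorentz (e * k) (x - y).
Proof.
apply: le_trans (normc_stretched_kernel x y) _.
apply: le_trans (expR_le_lorentz (x - y) _); last by rewrite mulr_ge0// ltW.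
rewrite ler_expR lerN2 mulrDr mulrA lerDl; apply: mulr_ge0; first exact: ltW.
by apply: mulr_ge0; [exact: ltW|exact: excess_monotone].
Qed.

Lemma cmeasurable_stretched_kernel : cmeasurable setT (fun z : R * R => stretched_kernel z.1 z.2).
Proof.
apply: cmeasurable_cexp; apply: cmeasurableM; first exact: cmeasurable_cst.
have h : cmeasurable setT (fun z : R * R => stretched l s0 z.1 - stretched l s0 z.2).
  apply: cmeasurableD.
    exact: (cmeasurable_comp (cmeasurable_stretched l s0) measurable_fst).
  exact: (cmeasurableN (cmeasurable_comp (cmeasurable_stretched l s0) measurable_snd)).
by under eq_fun do rewrite expr2; exact: cmeasurableM.
Qed.

Lemma schur_stretched_kernel : schur mu stretched_kernel (pi / Num.sqrt (e * k)).
Proof.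
have mk := cmeasurable_stretched_kernel.
have ek : 0 < e * k by rewrite mulr_gt0.
split => //.
- move=> x; apply: le_trans (integral_lorentz x ek).
  apply: le_nonneg_integral.
  + exact: (measurable_normc (cmeasurable_slice1 x mk)).
  + by apply: measurable_lorentz; exact: measurable_funB.
  + by move=> y; exact: normc_ge0.
  + by move=> y; rewrite -lorentzN opprB; exact: normc_stretched_kernel_lorentz.
- move=> y; apply: le_trans (integral_lorentz y ek).
  apply: le_nonneg_integral.
  + exact: (measurable_normc (cmeasurable_slice2 y mk)).
  + by apply: measurable_lorentz; exact: measurable_funB.
  + by move=> x; exact: normc_ge0.
  + by move=> x; exact: normc_stretched_kernel_lorentz.
Qed.

Lemma stretched_kernel_box x y : `|x| <= l -> `|y| <= l ->
  stretched_kernel x y = gauss_kernel (e * k) e x y.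
Proof.
move=> hx hy; rewrite /stretched_kernel /gauss_kernel /stretched !excess_box//.
congr (cexp (_ * _ ^+ 2)); apply: complex_ext; rewrite ?Re_sub ?Im_sub //=; lra.
Qed.

(** The size of the kernel near the corner of the region where absorption starts:
    [x] and [y] on different sides of the endpoint [m]. *)
Definition hyperbolic (c m x y : R) := (1 + c * (`|x - m| * `|y - m|))^-1.

Lemma stretched_kernel_outside x y : ~~ ((`|x| <= l) && (`|y| <= l)) ->
  normc (stretched_kernel x y) <=
    lorentz (e * s0) (x - y) + (hyperbolic (e * s0) l x y + hyperbolic (e * s0) (- l) x y).
Proof.
move=> h; set c := e * s0; have c0 : 0 < c by rewrite mulr_gt0.
set D := (x - y) * (ex x - ex y).
have D0 : 0 <= D by exact: excess_monotone.
have K : normc (stretched_kernel x y) <= (1 + c * D)^-1.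
  apply: le_trans (normc_stretched_kernel x y) _.
  apply: le_trans (expRN_le_inv _); last by rewrite mulr_ge0// ltW.
  rewrite ler_expR lerN2 mulrDr -/D /c mulrA -[e * s0 * D]mulrA lerDr; apply: mulr_ge0; last exact: sqr_ge0.
  by rewrite mulr_ge0// ltW.
have key z : 0 <= z -> z <= D -> (1 + c * D)^-1 <= (1 + c * z)^-1.
  move=> z0 zD; have cz : 0 <= c * z by rewrite mulr_ge0// ltW.
  have : c * z <= c * D by rewrite ler_pM2l.
  by move=> ?; rewrite lef_pV2 ?posrE; lra.
have p1 : 0 <= lorentz c (x - y) by rewrite ltW// lorentz_gt0// ltW.
have hy0 m : 0 <= hyperbolic c m x y.
  by rewrite /hyperbolic invr_ge0 addr_ge0// mulr_ge0 ?mulr_ge0// ltW.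
have := hy0 l; have := hy0 (- l) => p2 p3.
apply: le_trans K _; case: (excess_outside l0 h) => hD.
- have := key _ (sqr_ge0 _) hD; rewrite -/(lorentz c (x - y)) => ?; lra.
- have := key _ (mulr_ge0 (normr_ge0 _) (normr_ge0 _)) hD; rewrite -/(hyperbolic c l x y) => ?; lra.
- rewrite -[l in x + l]opprK -[l in y + l]opprK in hD.
  have := key _ (mulr_ge0 (normr_ge0 _) (normr_ge0 _)) hD; rewrite -/(hyperbolic c (- l) x y) => ?; lra.
Qed.

End stretched_kernel.

(** * The norm of the stretched Gaussian kernel *)

Lemma schur_cmeasurable (R : realType) d (T : measurableType d)
    (m : {sigma_finite_measure set T -> \bar R}) (K : T -> T -> R[i]) (S : R) :
  schur m K S -> cmeasurable setT (fun z : T * T => K z.1 z.2).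
Proof. by case. Qed.

Section hyperbolic_kernel.
Context {R : realType}.
Local Notation mu := (@lebesgue_measure R).
Variables (c m : R).
Hypothesis c0 : 0 < c.
Implicit Types x y : R.

(** The weight [1 / sqrt |x - m|], for which the homogeneity of the hyperbolic kernel
    makes Schur's test work; its value at [m] only has to be positive. *)
Definition weight x := if x == m then 1 else (Num.sqrt `|x - m|)^-1.

Lemma weight_gt0 x : 0 < weight x.
Proof.
rewrite /weight; case: eqVneq => // xm.
by rewrite invr_gt0 sqrtr_gt0 normr_gt0 subr_eq0.
Qed.

Lemma measurable_weight : measurable_fun setT weight.
Proof.
apply: measurable_fun_ifT => //.
  by apply: measurable_fun_eqr.
apply: measurable_funV; apply: (measurableT_comp (f := @Num.sqrt R)).
  by apply: continuous_measurable_fun; exact: sqrt_continuous.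
by apply: measurableT_comp => //; exact: measurable_funB.
Qed.

Lemma hyperbolic_ge0 x y : 0 <= hyperbolic c m x y.
Proof. by rewrite invr_ge0 addr_ge0// mulr_ge0 ?mulr_ge0// ltW. Qed.

Lemma hyperbolicC x y : hyperbolic c m x y = hyperbolic c m y x.
Proof. by rewrite /hyperbolic (mulrC `|x - m|). Qed.

Lemma measurable_hyperbolic : measurable_fun setT (fun z : R * R => hyperbolic c m z.1 z.2).
Proof.
apply: measurable_funV; apply: measurable_funD => //; apply: measurable_funM => //.
by apply: measurable_funM; apply: measurableT_comp => //; exact: measurable_funB.
Qed.

Lemma integral_split_point (f : R -> R) : measurable_fun setT f -> (forall x, 0 <= f x) ->
  (\int[mu]_x (f x)%:E = \int[mu]_(x in `]-oo, m[) (f x)%:E + \int[mu]_(x in `]m, +oo[) (f x)%:E)%E.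
Proof.
move=> mf f0.
have e : [set: R] = `]-oo, m[%classic `|` `[m, +oo[%classic.
  apply/seteqP; split => // x _ /=; rewrite !in_itv /= andbT.
  by case: (ltP x m); [left|right].
rewrite [in LHS]e ge0_integral_setU//=.
- congr (_ + _)%E; apply/esym/integral_itv_obnd_cbnd.
  by apply/measurable_EFinP; exact: measurable_funTS.
- by apply/measurable_EFinP; exact: measurable_funTS.
- by move=> x _; rewrite lee_fin.
- apply/disj_setPS => x /= []; rewrite !in_itv /= andbT => h1 h2.
  by move: (lt_le_trans h1 h2); rewrite ltxx.
Qed.

(** The kernel depends on [y] through [c |x - m| |y - m|] only, so that the integral
    scales like [1 / sqrt (c |x - m|)]. *)
Lemma hyperbolic_weight x : x != m ->
  (\int[mu]_y (hyperbolic c m x y * weight y)%:E <= (2 * (pi / Num.sqrt c) * weight x)%:E)%E.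
Proof.
move=> xm; have d0 : 0 < `|x - m| by rewrite normr_gt0 subr_eq0.
have cd : 0 < c * `|x - m| by rewrite mulr_gt0.
have mf : measurable_fun setT (fun y => hyperbolic c m x y * weight y).
  apply: measurable_funM; last exact: measurable_weight.
  exact: (measurableT_comp measurable_hyperbolic (measurable_pair1 x)).
rewrite integral_split_point//; last first.
  by move=> y; rewrite mulr_ge0 ?hyperbolic_ge0// ltW// weight_gt0.
have -> : (2 * (pi / Num.sqrt c) * weight x)%:E =
   ((pi / Num.sqrt (c * `|x - m|))%:E + (pi / Num.sqrt (c * `|x - m|))%:E)%E.
  rewrite -EFinD /weight (negbTE xm); congr EFin; rewrite sqrtrM ?(ltW c0)//.
  by field; rewrite !gt_eqF ?sqrtr_gt0.
apply: leeD.
  apply: le_trans (integral_weight_left m cd); rewrite le_eqVlt; apply/orP; left; apply/eqP.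
  apply: eq_integral => y /set_mem /=; rewrite in_itv /= => ym; congr EFin.
  rewrite /weight (lt_eqF ym) /hyperbolic (ltr0_norm (_ : y - m < 0)) ?subr_lt0// opprB.
  by rewrite mulrA mulrC.
apply: le_trans (integral_weight_right m cd); rewrite le_eqVlt; apply/orP; left; apply/eqP.
apply: eq_integral => y /set_mem /=; rewrite in_itv /= andbT => ym; congr EFin.
rewrite /weight (gt_eqF ym) /hyperbolic (gtr0_norm (_ : 0 < y - m)) ?subr_gt0//.
by rewrite mulrA mulrC.
Qed.

Lemma hyperbolic_l2bound (f : R -> R) : measurable_fun setT f -> (forall x, 0 <= f x) ->
  (\int[mu]_x (pkop mu (hyperbolic c m) f x * pkop mu (hyperbolic c m) f x) <=
    ((2 * (pi / Num.sqrt c)) ^+ 2)%:E * \int[mu]_x (f x ^+ 2)%:E)%E.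
Proof.
have ae (P : R -> Prop) : (forall x, x != m -> P x) -> {ae mu, forall x, P x}.
  move=> hP; exists [set m]; split; [exact: measurable_set1|exact: lebesgue_measure_set1|].
  by move=> x /= h; apply: contrapT => xm; apply: h; apply: hP; exact/eqP.
apply: (@pos_l2bound _ _ _ mu (hyperbolic c m) weight).
- by rewrite mulr_gt0// divr_gt0 ?pi_gt0// sqrtr_gt0.
- exact: measurable_hyperbolic.
- exact: hyperbolic_ge0.
- exact: measurable_weight.
- exact: weight_gt0.
- exact/ae/hyperbolic_weight.
- apply: ae => y ym; under eq_integral do rewrite hyperbolicC; exact: hyperbolic_weight.
Qed.

End hyperbolic_kernel.

Section stretched_l2bound.
Context {R : realType}.
Local Notation mu := (@lebesgue_measure R).
Variables (l s0 e k : R).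
Hypotheses (l0 : 0 < l) (s0p : 0 < s0) (e0 : 0 < e) (k0 : 0 < k) (ks : k * s0 <= 1).
Local Notation K := (stretched_kernel l s0 e k).
Local Notation H1 := (hyperbolic (e * s0) l).
Local Notation H2 := (hyperbolic (e * s0) (- l)).
Local Notation H0 := (fun x y : R => lorentz (e * s0) (x - y)).

Lemma square_sum4_le (u a : R) (A B C : \bar R) : 0 <= u -> 0 <= a ->
  (0 <= A)%E -> (0 <= B)%E -> (0 <= C)%E -> (u%:E <= a%:E + (A + (B + C)))%E ->
  ((u ^+ 2)%:E <= 4%:E * ((a ^+ 2)%:E + (A * A + (B * B + C * C))))%E.
Proof.
move=> u0 a0; case: A => [A| |]//; last first.
  move=> _ B0 C0 _; rewrite mulyy addye; last by rewrite -ltNye (lt_le_trans ltNy0)// adde_ge0// mule_ge0.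
  by rewrite !addey// gt0_muley ?leey// lte_fin.
case: B => [B| |]//; last first.
  move=> _ _ C0 _; rewrite mulyy addye; last by rewrite -ltNye (lt_le_trans ltNy0)// mule_ge0.
  by rewrite !addey// gt0_muley ?leey// lte_fin.
case: C => [C| |]//; last first.
  by move=> _ _ _ _; rewrite mulyy !addey// gt0_muley ?leey// lte_fin.
move=> A0 B0 C0 h.
have {}h : u <= a + (A + (B + C)) by exact: h.
rewrite !lee_fin in A0 B0 C0.
suff : u ^+ 2 <= 4 * (a ^+ 2 + (A * A + (B * B + C * C))) by [].
have : u ^+ 2 <= (a + (A + (B + C))) ^+ 2 by rewrite ler_pXn2r// ?nnegrE// !addr_ge0.
move=> /le_trans; apply; rewrite !expr2.
have := sqr_ge0 (a - A); have := sqr_ge0 (a - B); have := sqr_ge0 (a - C).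
have := sqr_ge0 (A - B); have := sqr_ge0 (A - C); have := sqr_ge0 (B - C).
rewrite !expr2; lra.
Qed.

Definition boxed (g : R -> R[i]) x := if `|x| <= l then g x else 0.

Lemma measurable_box d (T : measurableType d) (f : T -> R) : measurable_fun setT f ->
  measurable_fun setT (fun x => `|f x| <= l).
Proof.
by move=> mf; apply: measurable_fun_ler => //; exact: measurableT_comp.
Qed.

Lemma cmeasurable_boxed g : cmeasurable setT g -> cmeasurable setT (boxed g).
Proof.
move=> [g1 g2]; rewrite /boxed; split.
  have -> : (fun x => Re (if `|x| <= l then g x else 0)) = (fun x => if `|x| <= l then Re (g x) else 0).
    by apply/funext => x; case: ifP.
  by apply: measurable_fun_ifT => //; exact: measurable_box.
have -> : (fun x => Im (if `|x| <= l then g x else 0)) = (fun x => if `|x| <= l then Im (g x) else 0).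
  by apply/funext => x; case: ifP.
by apply: measurable_fun_ifT => //; exact: measurable_box.
Qed.

Lemma sqnorm_boxed g : cmeasurable setT g -> (sqnorm mu (boxed g) <= sqnorm mu g)%E.
Proof.
move=> mg; apply: le_nonneg_integral.
- by apply: measurable_funX; exact: (measurable_normc (cmeasurable_boxed mg)).
- by apply: measurable_funX; exact: measurable_normc.
- by move=> x; exact: sqr_ge0.
- by move=> x; rewrite /boxed; case: ifP => // _; rewrite normc0 expr0n sqr_ge0.
Qed.

(** With both variables in the box the kernel is a plain Gaussian, small only through
    its oscillation; otherwise the absorption makes it absolutely small. *)
Lemma kop_stretched_le g x : cmeasurable setT g -> (sqnorm mu g < +oo)%E ->
  ((normc (kop mu K g x))%:E <= (normc (kop mu (gauss_kernel (e * k) e) (boxed g) x))%:E +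
   (pkop mu H0 (fun y => normc (g y)) x +
     (pkop mu H1 (fun y => normc (g y)) x + pkop mu H2 (fun y => normc (g y)) x)))%E.
Proof.
move=> mg gf; have ek : 0 < e * k by rewrite mulr_gt0.
have es : 0 < e * s0 by rewrite mulr_gt0.
have c1 := cintegrable_kop x (schur_stretched_kernel l0 s0p e0 k0 ks) (normc_stretched_kernel_le1 l0 s0p e0 k0 ks) mg gf.
have c2 := cintegrable_kop x (schur_gauss_kernel e ek) (normc_gauss_kernel_le1 e ek)
  (cmeasurable_boxed mg) (le_lt_trans (sqnorm_boxed mg) gf).
(* [r] is what remains of the kernel when its values on the box are removed. *)
pose b : R[i] := if `|x| <= l then 1 else 0.
pose r y := K x y * g y - b * (gauss_kernel (e * k) e x y * boxed g y).
have ir : cintegrable mu setT r.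
  have h := cintegrableD measurableT c1 (cintegrableMl (- b) measurableT c2).
  by move: h; under eq_fun do rewrite mulNr.
have mr := cintegrable_cmeasurable ir.
have -> : kop mu K g x = b * kop mu (gauss_kernel (e * k) e) (boxed g) x + cintegral mu setT r.
  rewrite /kop /r cintegralB//; last exact: cintegrableMl.
  by rewrite cintegralMl// addrC subrK.
have ng := measurable_normc mg.
have mH0 : measurable_fun setT (fun y : R => H0 x y).
  by apply: measurable_lorentz; exact: measurable_funB.
have mH m : measurable_fun setT (fun y : R => hyperbolic (e * s0) m x y).
  exact: (measurableT_comp (measurable_hyperbolic _ _) (measurable_pair1 x)).
have p0 y : 0 <= H0 x y by rewrite ltW// lorentz_gt0// ltW.
have mq0 := iffRL (measurable_EFinP _ _) (measurable_funM mH0 ng).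
have mq m := iffRL (measurable_EFinP _ _) (measurable_funM (mH m) ng).
have p1 m y : 0 <= hyperbolic (e * s0) m x y by exact: hyperbolic_ge0.
have hr : ((normc (cintegral mu setT r))%:E <= pkop mu H0 (fun y => normc (g y)) x +
     (pkop mu H1 (fun y => normc (g y)) x + pkop mu H2 (fun y => normc (g y)) x))%E.
  apply: le_trans (normc_cintegral_le mu mr) _.
  have n0 y : 0 <= normc (g y) by exact: normc_ge0.
  have w0 y : (0 <= (H0 x y * normc (g y))%:E)%E by rewrite lee_fin mulr_ge0.
  have w m y : (0 <= (hyperbolic (e * s0) m x y * normc (g y))%:E)%E by rewrite lee_fin mulr_ge0.
  rewrite /pkop -(ge0_integralD mu measurableT (fun y _ => w l y) (mq l) (fun y _ => w (- l) y) (mq (- l))).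
  rewrite -(ge0_integralD mu measurableT (fun y _ => w0 y) mq0 (fun y _ => adde_ge0 (w l y) (w (- l) y))
    (emeasurable_funD (mq l) (mq (- l)))).
  apply: ge0_le_integral => //.
  - by move=> y _; rewrite lee_fin normc_ge0.
  - by apply/measurable_EFinP; exact: measurable_normc.
  - exact: (emeasurable_funD mq0 (emeasurable_funD (mq l) (mq (- l)))).
  move=> y _; rewrite -!EFinD lee_fin -!mulrDl /r /b /boxed.
  have [hb|hb] := boolP ((`|x| <= l) && (`|y| <= l)).
    move/andP: hb => [hx hy]; rewrite hx hy mul1r stretched_kernel_box// subrr normc0.
    by rewrite mulr_ge0 ?normc_ge0// !addr_ge0.
  have -> : (if `|x| <= l then 1 else 0) * (gauss_kernel (e * k) e x y * (if `|y| <= l then g y else 0)) = 0 :> R[i].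
    by move: hb; case: ifP => _; case: ifP => _ //=; rewrite ?mulr0 ?mul0r.
  rewrite subr0 normcM; apply: ler_wpM2r; first exact: normc_ge0.
  exact: stretched_kernel_outside.
have hD := normcD_le (b * kop mu (gauss_kernel (e * k) e) (boxed g) x) (cintegral mu setT r).
apply: (@le_trans _ _ ((normc (b * kop mu (gauss_kernel (e * k) e) (boxed g) x))%:E + (normc (cintegral mu setT r))%:E)%E).
  by rewrite -EFinD lee_fin.
apply: leeD hr; rewrite lee_fin /b; case: ifP => _; rewrite ?mul1r// mul0r normc0 normc_ge0//.
Qed.

Definition stretched_const : R := 4 * (4 * pi ^+ 2 + 9 * pi ^+ 2 / s0).

(** The factor [1 / sqrt e] does not involve the damping [e k], which may therefore be
    taken as small as the convergence of the integrals requires. *)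
Lemma l2bound_stretched_kernel : l2bound mu K (Num.sqrt (stretched_const / e)).
Proof.
have ek : 0 < e * k by rewrite mulr_gt0.
have es : 0 < e * s0 by rewrite mulr_gt0.
have pp := pi_gt0 R.
have p2 : 0 < pi ^+ 2 :> R by rewrite exprn_gt0.
have Ce : 0 < stretched_const / e.
  by rewrite divr_gt0// mulr_gt0// addr_gt0 ?divr_gt0// mulr_gt0.
apply: l2bound_finite; first by rewrite sqrtr_gt0.
move=> g mg gf; rewrite (sqr_sqrtr (ltW Ce)).
pose f y := normc (g y).
have mf : measurable_fun setT f := measurable_normc mg.
have f0 y : 0 <= f y by exact: normc_ge0.
have h1 m : (\int[mu]_x (pkop mu (hyperbolic (e * s0) m) f x * pkop mu (hyperbolic (e * s0) m) f x) <=
    ((2 * (pi / Num.sqrt (e * s0))) ^+ 2)%:E * sqnorm mu g)%E.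
  by have := hyperbolic_l2bound m es mf f0; rewrite /sqnorm /f.
have mH0 : measurable_fun setT (fun z : R * R => H0 z.1 z.2).
  by apply: measurable_lorentz; apply: measurable_funB; [exact: measurable_fst|exact: measurable_snd].
have p0 x y : 0 <= H0 x y by rewrite ltW// lorentz_gt0// ltW.
have h0 : (\int[mu]_x (pkop mu H0 f x * pkop mu H0 f x) <= ((pi / Num.sqrt (e * s0)) ^+ 2)%:E * sqnorm mu g)%E.
  apply: (@pos_l2bound1 _ _ _ mu H0) => //.
  - by rewrite divr_gt0// sqrtr_gt0.
  - by move=> x; under eq_integral do rewrite -lorentzN opprB; exact: integral_lorentz.
  - by move=> y; exact: integral_lorentz.
have hg := l2bound_gauss_kernel ek e0 (cmeasurable_boxed mg).
have mK := cmeasurable_kop mu (schur_cmeasurable (schur_stretched_kernel l0 s0p e0 k0 ks)) mg.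
have mG := cmeasurable_kop mu (schur_cmeasurable (schur_gauss_kernel e ek)) (cmeasurable_boxed mg).
have mp0 : measurable_fun setT (pkop mu H0 f) by exact: measurable_pkop.
have mp m : measurable_fun setT (pkop mu (hyperbolic (e * s0) m) f).
  by apply: measurable_pkop => //; [exact: measurable_hyperbolic|move=> *; exact: hyperbolic_ge0].
have q0 x : (0 <= pkop mu H0 f x * pkop mu H0 f x)%E by rewrite mule_ge0// pkop_ge0.
have q m x : (0 <= pkop mu (hyperbolic (e * s0) m) f x * pkop mu (hyperbolic (e * s0) m) f x)%E.
  by rewrite mule_ge0// pkop_ge0// => *; exact: hyperbolic_ge0.
have msq h : cmeasurable setT h -> measurable_fun setT (fun x : R => (normc (h x) ^+ 2)%:E).
  by move=> mh; apply/measurable_EFinP; apply: measurable_funX; exact: measurable_normc.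
apply: (@le_trans _ _ (\int[mu]_x (4%:E * ((normc (kop mu (gauss_kernel (e * k) e) (boxed g) x) ^+ 2)%:E +
   (pkop mu H0 f x * pkop mu H0 f x + (pkop mu H1 f x * pkop mu H1 f x + pkop mu H2 f x * pkop mu H2 f x)))))%E).
  apply: ge0_le_integral => //.
  - by move=> x _; rewrite lee_fin sqr_ge0.
  - exact: msq.
  - apply: emeasurable_funM => //; apply: emeasurable_funD; first exact: msq.
    apply: emeasurable_funD; first exact: emeasurable_funM.
    by apply: emeasurable_funD; exact: emeasurable_funM.
  - move=> x _; apply: square_sum4_le; rewrite ?normc_ge0//.
    + exact: pkop_ge0.
    + by apply: pkop_ge0 => // *; exact: hyperbolic_ge0.
    + by apply: pkop_ge0 => // *; exact: hyperbolic_ge0.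
    + exact: kop_stretched_le.
rewrite ge0_integralZl_EFin//; last 2 first.
- by move=> x _; rewrite adde_ge0 ?lee_fin ?sqr_ge0// adde_ge0// adde_ge0.
- apply: emeasurable_funD; first exact: msq.
  apply: emeasurable_funD; first exact: emeasurable_funM.
  by apply: emeasurable_funD; exact: emeasurable_funM.
rewrite ge0_integralD//; last 4 first.
- by move=> x _; rewrite lee_fin sqr_ge0.
- exact: msq.
- by move=> x _; rewrite adde_ge0// adde_ge0.
- apply: emeasurable_funD; first exact: emeasurable_funM.
  by apply: emeasurable_funD; exact: emeasurable_funM.
rewrite ge0_integralD//; last 3 first.
- exact: emeasurable_funM.
- by move=> x _; rewrite adde_ge0.
- by apply: emeasurable_funD; exact: emeasurable_funM.
rewrite ge0_integralD//; last 2 first.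
- exact: emeasurable_funM.
- exact: emeasurable_funM.
have hg2 : (\int[mu]_x (normc (kop mu (gauss_kernel (e * k) e) (boxed g) x) ^+ 2)%:E <=
  (4 * pi ^+ 2 / e)%:E * sqnorm mu g)%E.
  apply: le_trans hg _; rewrite sqr_sqrtr; last by rewrite divr_ge0 ?mulr_ge0// ltW.
  by apply: lee_wpmul2l; [rewrite lee_fin divr_ge0 ?mulr_ge0// ltW|exact: sqnorm_boxed].
have -> : (stretched_const / e)%:E = (4%:E * ((4 * pi ^+ 2 / e)%:E + (((pi / Num.sqrt (e * s0)) ^+ 2)%:E +
   (((2 * (pi / Num.sqrt (e * s0))) ^+ 2)%:E + ((2 * (pi / Num.sqrt (e * s0))) ^+ 2)%:E))))%E.
  rewrite -!EFinD -EFinM; congr EFin.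
  rewrite !exprMn exprVn sqr_sqrtr ?(ltW es)// /stretched_const.
  by field; rewrite !gt_eqF.
rewrite -muleA; apply: lee_wpmul2l; first by rewrite lee_fin.
have sq0 (a : R) : (0 <= (a ^+ 2)%:E)%E by rewrite lee_fin sqr_ge0.
have g40 : (0 <= (4 * pi ^+ 2 / e)%:E)%E by rewrite lee_fin divr_ge0 ?mulr_ge0// ltW.
rewrite !ge0_muleDl ?adde_ge0//.
exact: (leeD hg2 (leeD h0 (leeD (h1 l) (h1 (- l))))).
Qed.

End stretched_l2bound.

(** * Superposition of kernels *)

Section kernel_families.
Context {R : realType} {d : measure_display} {T : measurableType d}.
Local Notation mu := (@lebesgue_measure R).
Variable m : {sigma_finite_measure set T -> \bar R}.
Implicit Types (K : T -> T -> R[i]) (g v : T -> R[i]).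

Lemma schur_le K S S' : schur m K S -> S <= S' -> schur m K S'.
Proof.
move=> [mK a b] SS; split => //.
  by move=> x; apply: le_trans (a x) _; rewrite lee_fin.
by move=> x; apply: le_trans (b x) _; rewrite lee_fin.
Qed.

Lemma schur_dominated K K' S : cmeasurable setT (fun z : T * T => K z.1 z.2) ->
  (forall x y, normc (K x y) <= normc (K' x y)) -> schur m K' S -> schur m K S.
Proof.
move=> mK KK' [mK' a b]; split => //.
- move=> x; apply: le_trans (a x); apply: le_nonneg_integral => //.
  + exact: (measurable_normc (cmeasurable_slice1 x mK)).
  + exact: (measurable_normc (cmeasurable_slice1 x mK')).
  + by move=> y; exact: normc_ge0.
- move=> x; apply: le_trans (b x); apply: le_nonneg_integral => //.
  + exact: (measurable_normc (cmeasurable_slice2 x mK)).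
  + exact: (measurable_normc (cmeasurable_slice2 x mK')).
  + by move=> y; exact: normc_ge0.
Qed.

Lemma formbound_le K N N' : formbound m K N -> N <= N' -> formbound m K N'.
Proof.
move=> fK NN g v G V mg mv G0 V0 gG vV; apply: le_trans (fK g v G V mg mv G0 V0 gG vV) _.
by do 2 (apply: ler_wpM2r => //).
Qed.

Lemma schur0 : schur m (fun _ _ => 0) 0.
Proof.
split; first exact: cmeasurable_cst.
  by move=> x; under eq_integral do rewrite normc0; rewrite integral0.
by move=> x; under eq_integral do rewrite normc0; rewrite integral0.
Qed.

Lemma formbound0 : formbound m (fun _ _ => 0) 0.
Proof. exact: (formbound_schur schur0 (lexx 0)). Qed.

Lemma cmeasurable_off_point (f h : T -> R[i]) (x : T) : measurable [set x] ->
  cmeasurable setT f -> (forall y, y <> x -> h y = f y) -> cmeasurable setT h.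
Proof.
have aux (p q : T -> R) : measurable [set x] -> measurable_fun setT p ->
    (forall y, y <> x -> q y = p y) -> measurable_fun setT q.
  move=> mx mp pq; have -> : [set: T] = [set x] `|` ~` [set x] by rewrite setUv.
  apply/measurable_funU => //; first exact: measurableC.
  split.
    apply: (eq_measurable_fun (cst (q x))) => [y|]; last exact: measurable_cst.
    by rewrite inE => ->.
  apply: (eq_measurable_fun p) => [y|]; last exact: measurable_funTS.
  by rewrite inE => /= yx; rewrite pq.
move=> mx [f1 f2] hf; split.
  by apply: (aux (fun y => Re (f y))) => // y yx; rewrite hf.
by apply: (aux (fun y => Im (f y))) => // y yx; rewrite hf.
Qed.

Variables (A : R -> T -> T -> R[i]) (S N : R -> R) (C : R) (G : T -> T -> R[i]).
Hypotheses (mA : cmeasurable setT (fun w : R * (T * T) => A w.1 w.2.1 w.2.2))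
  (mS : measurable_fun setT S) (mN : measurable_fun setT N)
  (S0 : forall t, 0 <= S t) (N0 : forall t, 0 <= N t)
  (intS : (\int[mu]_t (S t)%:E < +oo)%E) (intN : (\int[mu]_t (N t)%:E <= C%:E)%E)
  (schurA : forall t, schur m (A t) (S t)) (formA : forall t, formbound m (A t) (N t))
  (intA : forall x y, y <> x -> cintegrable mu setT (fun t => A t x y))
  (GA : forall x y, y <> x -> G x y = cintegral mu setT (fun t => A t x y))
  (mpoint : forall x : T, measurable [set x]) (point0 : forall x, m [set x] = 0%E).

(** A superposition of kernels inherits the sum of their form bounds. Schur's
    condition only justifies exchanging the integrals, so that [S] does not enter
    the constant. The diagonal, where [G] is arbitrary, is negligible in [y] for every
    [x]. *)
Lemma superposition g v (Gn Vn : R) : cmeasurable setT g -> cmeasurable setT v ->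
  0 <= Gn -> 0 <= Vn -> (sqnorm m g <= (Gn ^+ 2)%:E)%E -> (sqnorm m v <= (Vn ^+ 2)%:E)%E ->
  let F x y := G x y * g y * v x in
  let inner x := cintegral m setT (F x) in
  [/\ {ae m, forall x, cintegrable m setT (F x)}, cintegrable m setT inner &
      normc (cintegral m setT inner) <= C * Gn * Vn].
Proof.
move=> mg mv Gn0 Vn0 gG vV F inner.
pose P (w : R * (T * T)) := A w.1 w.2.1 w.2.2 * g w.2.2 * v w.2.1.
have mP : cmeasurable setT P.
  apply: cmeasurableM; first apply: cmeasurableM => //.
    by apply: (cmeasurable_comp mg (h := fun w : R * (T * T) => w.2.2)); mproj.
  by apply: (cmeasurable_comp mv (h := fun w : R * (T * T) => w.2.1)); mproj.
have ciP : cintegrable (mu \x prodm m m)%E setT P.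
  apply: cintegrable_iter12 => //.
  apply: (@le_lt_trans _ _ (\int[mu]_t ((Gn * Vn)%:E * (S t)%:E))%E).
    apply: ge0_le_integral => //.
    - by move=> t _; apply: integral_ge0 => z _; rewrite lee_fin normc_ge0.
    - apply: (@measurable_fun_fubini_tonelli_F _ _ _ _ _ (prodm m m) (fun w => (normc (P w))%:E)).
        by apply/measurable_EFinP; exact: measurable_normc.
      by move=> w; rewrite lee_fin normc_ge0.
    - by apply: emeasurable_funM => //; exact/measurable_EFinP.
    - move=> t _; rewrite -EFinM mulrC mulrA.
      exact: (schur_form (schurA t) (S0 t) mg mv Gn0 Vn0 gG vV).
  rewrite ge0_integralZl_EFin ?mulr_ge0//; last 2 first.
  - by move=> t _; rewrite lee_fin.
  - exact/measurable_EFinP.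
  by apply: lte_mul_pinfty; rewrite ?lee_fin ?mulr_ge0.
have [_ ciI eI] := cfubini1 ciP.
have [_ ciQ eQ] := cfubini2 ciP.
set Q := (fun z : T * T => cintegral mu setT (fun t => P (t, z))) in ciQ eQ.
have [aeQ ciJ eJ] := cfubini1 (ciQ : cintegrable (m \x m)%E setT Q).
have FQ x y : y <> x -> F x y = Q (x, y).
  move=> yx; rewrite /F GA// /Q /P /= -mulrA mulrC -cintegralMl; [|by []|exact: intA].
  by apply: eq_cintegral => t _; ring.
have mQ := cintegrable_cmeasurable (ciQ : cintegrable (m \x m)%E setT Q).
have mF x : cmeasurable setT (F x).
  apply: (@cmeasurable_off_point (fun y => Q (x, y)) _ x) => //; first exact: cmeasurable_slice1.
  exact: FQ.
have aeF x : {ae m, forall y, Q (x, y) = F x y}.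
  exists [set x]; split => // y /= h; apply: contrapT => yx; apply: h; exact/esym/FQ.
have innerE x : inner x = cintegral m setT (fun y => Q (x, y)).
  apply: eq_cintegral_ae => //; first exact: cmeasurable_slice1.
  by apply: filterS (aeF x) => y ->.
have -> : inner = (fun x => cintegral m setT (fun y => Q (x, y))) by apply/funext.
split => //.
  apply: filterS aeQ => x hx; apply: cintegrable_ae (mF x) hx (aeF x).
rewrite eJ (_ : cintegral (m \x m)%E setT Q = cintegral (mu \x prodm m m)%E setT P)// -eI.
rewrite -lee_fin; apply: le_trans (normc_cintegral_le mu (cintegrable_cmeasurable ciI)) _.
apply: (@le_trans _ _ (\int[mu]_t ((Gn * Vn)%:E * (N t)%:E))%E).
  apply: ge0_le_integral => //.
  - by move=> t _; rewrite lee_fin normc_ge0.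
  - by apply/measurable_EFinP; exact: (measurable_normc (cintegrable_cmeasurable ciI)).
  - by apply: emeasurable_funM => //; exact/measurable_EFinP.
  - move=> t _; rewrite -EFinM lee_fin mulrC mulrA.
    exact: (formA t mg mv Gn0 Vn0 gG vV).
rewrite ge0_integralZl_EFin ?mulr_ge0//; last 2 first.
- by move=> t _; rewrite lee_fin.
- exact/measurable_EFinP.
have -> : C * Gn * Vn = (Gn * Vn) * C by ring.
by rewrite [leRHS]EFinM; apply: lee_wpmul2l => //; rewrite lee_fin mulr_ge0.
Qed.

End kernel_families.

(** * The Green function as a superposition of Gaussian kernels *)

Section stretch_formula.
Context {R : realType}.
Local Notation mu := (@lebesgue_measure R).
Variables (l s0 : R).
Hypotheses (l0 : 0 < l) (s0p : 0 < s0).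
Implicit Types x y t : R.

Lemma Rintegral_step (D A : set (measurableTypeR R)) (f : R -> R) : measurable D -> measurable A ->
  (forall t, D t -> f t = s0 * \1_A t) -> \int[mu]_(t in D) f t = s0 * fine (mu (A `&` D)).
Proof.
move=> mD mA fA; rewrite /Rintegral.
have -> : (\int[mu]_(t in D) (f t)%:E = \int[mu]_(t in D) (s0%:E * (\1_A t)%:E))%E.
  by apply: eq_integral => t /set_mem Dt; rewrite fA// EFinM.
rewrite ge0_integralZl_EFin//; last 2 first.
- by apply/measurable_EFinP; exact: measurable_indic.
- exact: ltW.
rewrite integral_indic// -[X in fine (_ * X)%E]/(mu (A `&` D)); case: (mu (A `&` D)) => [r| |] //=.
  by rewrite gt0_muley ?lte_fin//= mulr0.
by rewrite gt0_muleNy ?lte_fin//= mulr0.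
Qed.

Lemma stretchE x : stretch s0 l x = stretched l s0 x.
Proof.
have lp := l0.
have Re_alpha t : Re (alpha s0 l t) = 1 by rewrite /alpha /= mulr0 mul0r subr0 addr0.
have Im_alpha t : Im (alpha s0 l t) = sigma s0 l t by rewrite /alpha /= mul0r mul1r !add0r.
have cst1 (D : set (measurableTypeR R)) : measurable D -> \int[mu]_(t in D) Re (alpha s0 l t) = fine (mu D).
  move=> mD; rewrite /Rintegral; under eq_integral do rewrite Re_alpha.
  by rewrite integral_cst// mul1e.
rewrite /stretch /stretched /excess; case: (lerP 0 x) => x0.
  apply: complex_ext; rewrite /cintegral ?ReIm_pair.
    rewrite cst1; last exact: measurable_itv.
    by rewrite lebesgue_measure_itv /= lte_fin; case: ltP => //= h; lra.
  rewrite (@Rintegral_step `[0, x]%classic `]l, x]%classic); first last.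
  - move=> t Dt; rewrite Im_alpha; move: Dt; rewrite /= in_itv /= => /andP[t0 tx]; rewrite /sigma ger0_norm// indicE mem_setE.
    by rewrite in_itv /= tx andbT; case: leP => /=; rewrite ?mulr0 ?mulr1.
  - exact: measurable_itv.
  - exact: measurable_itv.
  have -> : `]l, x]%classic `&` `[0, x]%classic = `]l, x]%classic :> set R.
    apply/seteqP; split => [t []//|t]; rewrite /= !in_itv /= => /andP[h1 h2].
    by rewrite h1 h2; split => //; lra.
  rewrite lebesgue_measure_itv /= lte_fin; have a2 : - l - x <= 0 by lra.
  rewrite (max_r a2) subr0; case: ltP => h /=; first by rewrite max_l//; lra.
  by rewrite max_r//; lra.
apply: complex_ext; rewrite ?Re_opp ?Im_opp /cintegral ?ReIm_pair.
  rewrite cst1; last exact: measurable_itv.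
  by rewrite lebesgue_measure_itv /= lte_fin x0 /= add0r opprK.
rewrite (@Rintegral_step `[x, 0]%classic `[x, - l[%classic); first last.
- move=> t Dt; rewrite Im_alpha; move: Dt; rewrite /= in_itv /= => /andP[t0 tx]; rewrite /sigma ler0_norm// indicE mem_setE.
  by rewrite in_itv /= t0 /=; rewrite lerNl; case: ltP => /=; rewrite ?mulr0 ?mulr1.
- exact: measurable_itv.
- exact: measurable_itv.
have -> : `[x, - l[%classic `&` `[x, 0]%classic = `[x, - l[%classic :> set R.
  apply/seteqP; split => [t []//|t]; rewrite /= !in_itv /= => /andP[h1 h2].
  by rewrite h1 h2; split => //; lra.
rewrite lebesgue_measure_itv /= lte_fin; have a2 : x - l <= 0 by lra.
rewrite (max_r a2) sub0r -mulrN; congr (_ * _); congr (- _); case: ltP => h /=; first by rewrite max_l//; lra.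
by rewrite max_r//; lra.
Qed.

End stretch_formula.

Section distance.
Context {R : realType}.
Variables (l1 l2 s0 : R).
Hypotheses (l1p : 0 < l1) (l2p : 0 < l2) (s0p : 0 < s0).
Implicit Types x y : R * R.

Definition dist2 x y : R[i] :=
  (stretched l1 s0 x.1 - stretched l1 s0 y.1) ^+ 2 + (stretched l2 s0 x.2 - stretched l2 s0 y.2) ^+ 2.

Local Notation e1 x y := (excess l1 x.1 - excess l1 y.1).
Local Notation e2 x y := (excess l2 x.2 - excess l2 y.2).

Lemma Re_dist2 x y : Re (dist2 x y) =
  ((x.1 - y.1) ^+ 2 - (s0 * e1 x y) ^+ 2) + ((x.2 - y.2) ^+ 2 - (s0 * e2 x y) ^+ 2).
Proof.
by rewrite /dist2 /stretched ![in LHS]expr2 !ReImE ?Re_sub ?Im_sub ?ReIm_pair -!mulrBr !expr2.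
Qed.

Lemma Im_dist2 x y : Im (dist2 x y) =
  2 * (s0 * ((x.1 - y.1) * e1 x y)) + 2 * (s0 * ((x.2 - y.2) * e2 x y)).
Proof.
rewrite /dist2 /stretched ![in LHS]expr2 !ReImE ?Re_sub ?Im_sub ?ReIm_pair -!mulrBr.
by ring.
Qed.

Lemma Im_dist2_ge0 x y : 0 <= Im (dist2 x y).
Proof.
have h1 := excess_monotone l1p x.1 y.1; have h2 := excess_monotone l2p x.2 y.2.
by rewrite Im_dist2 addr_ge0// mulr_ge0// mulr_ge0// ltW.
Qed.

(** The negative terms of the real part are squares of differences of excesses, which
    [excess_lipschitz] bounds by the imaginary part. *)
Lemma coercive_dist2 (k : R) x y : 0 < k -> k * s0 <= 1 -> y <> x ->
  0 < k * Re (dist2 x y) + Im (dist2 x y).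
Proof.
move=> k0 ks yx; rewrite Re_dist2 Im_dist2.
have key (d e : R) : e ^+ 2 <= d * e -> 0 <= d * e ->
    k * d ^+ 2 <= k * (d ^+ 2 - (s0 * e) ^+ 2) + 2 * (s0 * (d * e)).
  move=> h1 h2; have h3 : k * s0 * (s0 * e ^+ 2) <= 1 * (s0 * (d * e)).
    have sp := ltW s0p; apply: ler_pM => //; first by rewrite mulr_ge0// ltW.
      by rewrite mulr_ge0 ?sqr_ge0.
    by apply: ler_wpM2l.
  have h4 : 0 <= s0 * (d * e) by rewrite mulr_ge0// ltW.
  move: h3 h4; rewrite !expr2; lra.
have h1 := key _ _ (excess_lipschitz l1p x.1 y.1) (excess_monotone l1p x.1 y.1).
have h2 := key _ _ (excess_lipschitz l2p x.2 y.2) (excess_monotone l2p x.2 y.2).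
have : 0 < k * (x.1 - y.1) ^+ 2 + k * (x.2 - y.2) ^+ 2.
  rewrite -mulrDr pmulr_rgt0// lt_neqAle addr_ge0 ?sqr_ge0// andbT eq_sym paddr_eq0 ?sqr_ge0// !sqrf_eq0 !subr_eq0.
  by apply/negP => /andP[/eqP a1 /eqP a2]; apply: yx; apply/esym; rewrite (surjective_pairing x) a1 a2 -surjective_pairing.
by move=> h; lra.
Qed.

Lemma rho_stretch2 x y : rho (stretch2 s0 l1 l2 x) (stretch2 s0 l1 l2 y) = sqrtc (dist2 x y).
Proof. by rewrite /rho /stretch2 /= !stretchE. Qed.

Lemma Im_sqrtc_ge0 (z : R[i]) : 0 <= Im z -> 0 <= Im (sqrtc z).
Proof.
case: z => a b /= b0; apply: mulr_ge0; last exact: sqrtr_ge0.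
by case: eqP => // _; rewrite sgr_ge0.
Qed.

End distance.

Section green_integral.
Context {R : realType}.
Local Notation mu := (@lebesgue_measure R).
Local Notation Rp := (`[(0:R), +oo[%classic).
Variables (l1 l2 s0 a k kap m : R).
Hypotheses (l1p : 0 < l1) (l2p : 0 < l2) (s0p : 0 < s0) (ap : 0 < a) (kp : 0 < k)
  (kapp : 0 < kap) (ks : kap * s0 <= 1) (mp : 0 < m).
Implicit Types x y : R * R.

(** The path of the complex time [tau] goes from 0 to [a (1 - i kap)] along a segment and
    then to infinity in the direction [1 + i m]. The variable of Schlaefli's integral
    is [- i k ^ 2 tau], so that [start] and [direction] are the images of the end of
    the segment and of the direction of the ray, and [slope * (1 + t)] is
    [i / (4 tau)] at the point of the segment with parameter [t]. *)
Definition eta1 := (4 * a * (1 + kap ^+ 2))^-1.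
Definition start : R[i] := (- (k ^+ 2 * (a * kap))) +i* (- (k ^+ 2 * a)).
Definition direction : R[i] := (k ^+ 2 * m) +i* (- (k ^+ 2)).
Definition ray t : R[i] := start + t%:C * direction.

Definition near_kernel t x y : R[i] := cexp (- (start * rinv t)) * rinv t *
  (stretched_kernel l1 s0 (eta1 * (1 + t)) kap x.1 y.1 * stretched_kernel l2 s0 (eta1 * (1 + t)) kap x.2 y.2).

Definition far_kernel t x y : R[i] :=
  cexp (- ray t + (k ^+ 2 / 4)%:C * dist2 l1 l2 s0 x y / ray t) * (direction / ray t).

Definition slope : R[i] := (- (eta1 * kap)) +i* eta1.

Lemma Re_start : Re start = - (k ^+ 2 * (a * kap)). Proof. by []. Qed.
Lemma Im_start : Im start = - (k ^+ 2 * a). Proof. by []. Qed.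
Lemma Re_direction : Re direction = k ^+ 2 * m. Proof. by []. Qed.
Lemma Im_direction : Im direction = - (k ^+ 2). Proof. by []. Qed.
Lemma Re_slope : Re slope = - (eta1 * kap). Proof. by []. Qed.
Lemma Im_slope : Im slope = eta1. Proof. by []. Qed.
Definition path_coordinates := (Re_start, Im_start, Re_direction, Im_direction, Re_slope, Im_slope).

Lemma eta1_gt0 : 0 < eta1.
Proof. by rewrite invr_gt0 !mulr_gt0// ltr_pwDl// sqr_ge0. Qed.

Lemma Re_ray t : Re (ray t) = k ^+ 2 * (m * t - a * kap).
Proof. by rewrite /ray Re_add Re_mul !path_coordinates Re_real Im_real; ring. Qed.

Lemma Im_ray t : Im (ray t) = - (k ^+ 2 * (a + t)).
Proof. by rewrite /ray Im_add Im_mul !path_coordinates Re_real Im_real; ring. Qed.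

Lemma slope_start : slope * start = (k ^+ 2 / 4)%:C.
Proof.
have n0 : 1 + kap ^+ 2 != 0 by rewrite gt_eqF// ltr_pwDl// sqr_ge0.
apply: complex_ext; rewrite ?Re_mul ?Im_mul !path_coordinates ?Re_real ?Im_real /eta1.
  by field; rewrite n0 gt_eqF.
by ring.
Qed.

(** Schlaefli's integral with [z = k rho]; its condition on [p = - slope * rho ^ 2] is
    coercivity. *)
Lemma green_integral x y : y <> x ->
  green k (stretch2 s0 l1 l2 x) (stretch2 s0 l1 l2 y) =
    (4 * pi)^-1%:C * (cintegral mu Rp (fun t => near_kernel t x y) +
                    cintegral mu Rp (fun t => far_kernel t x y)).
Proof.
move=> yx; rewrite /green rho_stretch2//; set Z := dist2 l1 l2 s0 x y.
have kgt := mulr_gt0 (exprn_gt0 2 kp) ap.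
have co := coercive_dist2 l1p l2p s0p kapp ks yx; rewrite -/Z in co.
have Z0 : 0 <= Im Z by exact: Im_dist2_ge0.
have rho0 : 0 < Re (sqrtc Z).
  apply: Re_sqrtc_gt0 => -[h1 h2]; move: co; rewrite h2 addr0 pmulr_rgt0// => h3.
  by move: (lt_le_trans h3 h1); rewrite ltxx.
have rho1 : 0 <= Im (sqrtc Z) by exact: Im_sqrtc_ge0.
pose p := - (slope * Z).
have p0 : 0 < Re p.
  have -> : Re p = eta1 * (kap * Re Z + Im Z).
    by rewrite /p Re_opp Re_mul !path_coordinates; ring.
  by rewrite mulr_gt0 ?eta1_gt0.
have z0 : 0 < Re (k%:C * sqrtc Z) by rewrite Re_mul Re_real Im_real mul0r subr0 mulr_gt0.
have z1 : 0 <= Im (k%:C * sqrtc Z) by rewrite Im_mul Re_real Im_real mul0r addr0 mulr_ge0// ltW.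
have k20 : 0 < k ^+ 2 by rewrite exprn_gt0.
have u0 : Im start < 0 by rewrite /start /= oppr_lt0.
have w0 : 0 < Re direction by rewrite /direction /= mulr_gt0.
have w1 : Im direction <= 0 by rewrite /direction /= oppr_le0 ltW.
have pu : p * start = - ((k%:C * sqrtc Z) ^+ 2 / 4).
  rewrite /p mulNr mulrAC slope_start exprMn sqr_sqrtc rmorphM fmorphV rmorph_nat rmorphXn /=.
  by congr (- _); ring.
have h := besselF_hankel z0 z1 u0 w0 w1 p0 pu.
have -> : 'i / 4 * hankel10 (k%:C * sqrtc Z) = (4 * pi)^-1%:C * besselF start direction p 1.
  rewrite h fmorphV rmorphM rmorph_nat /=.
  have pn : (pi : R)%:C != 0 :> R[i] by rewrite eq_complex /= gt_eqF ?pi_gt0.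
  have n4 : (4 : R[i]) != 0 by rewrite pnatr_eq0.
  move: (hankel10 _) ('i : R[i]) (pi%:C : R[i]) pn => H i P pn.
  by field.
congr (_ * _); rewrite /besselF; congr (_ + _); apply: eq_cintegral => t Rt.
  rewrite /segment_term /near_kernel /stretched_kernel rmorph1 mul1r mulrAC; congr (_ * _).
  rewrite -!cexpD; congr cexp; rewrite /p /Z /dist2.
  have -> : (- (eta1 * (1 + t) * kap)) +i* (eta1 * (1 + t)) = slope * (1 + t)%:C.
    have [n nE] : exists n, n = - (eta1 * (1 + t) * kap) by exists (- (eta1 * (1 + t) * kap)).
    rewrite -nE; apply: complex_ext; rewrite ?Re_mul ?Im_mul !path_coordinates ?ReIm_pair ?Re_real ?Im_real ?nE; ring.
  by ring.
rewrite /ray_term /far_kernel rmorph1 mul1r; congr (cexp _ * _); congr (_ + _).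
by rewrite -slope_start /p /ray -/Z; ring.
Qed.

End green_integral.

(** * Bounds along the path *)

Section near_kernel_bounds.
Context {R : realType}.
Local Notation mu := (@lebesgue_measure R).
Variables (l1 l2 s0 a k kap : R).
Hypotheses (l1p : 0 < l1) (l2p : 0 < l2) (s0p : 0 < s0) (ap : 0 < a) (kp : 0 < k)
  (kapp : 0 < kap) (ks : kap * s0 <= 1).

Local Notation nk := (near_kernel l1 l2 s0 a k kap).
Local Notation eta t := (eta1 a kap * (1 + t)).

Definition near_factor t : R[i] := cexp (- (start a k kap * rinv t)) * rinv t.

Lemma eta_gt0 t : 0 <= t -> 0 < eta t.
Proof. by move=> t0; rewrite mulr_gt0 ?eta1_gt0// ltr_pwDl. Qed.

Lemma normc_near_factor t : 0 <= t ->
  normc (near_factor t) <= expR (k ^+ 2 * (a * kap)) * (1 + t)^-1.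
Proof.
move=> t0; rewrite normcM normc_rinv// ler_pM2r ?invr_gt0 ?ltr_pwDl//.
rewrite normc_cexp ler_expR /rinv Re_opp Re_mul !path_coordinates Re_real Im_real mulr0 subr0 mulNr opprK.
have h : 0 <= k ^+ 2 * (a * kap).
  by apply: mulr_ge0; [exact: sqr_ge0|apply: mulr_ge0; exact: ltW].
by rewrite ler_piMr ?rinv_le1.
Qed.

Lemma near_kernelE t : nk t = fun x y : R * R => near_factor t *
  tensor (stretched_kernel l1 s0 (eta t) kap) (stretched_kernel l2 s0 (eta t) kap) x y.
Proof. by []. Qed.

(** This bound blows up as the damping [kap] vanishes, unlike the next one. *)
Lemma schur_near_kernel t : 0 <= t -> schur (prodm mu mu) (nk t)
  (expR (k ^+ 2 * (a * kap)) * pi ^+ 2 / (eta1 a kap * kap) * (1 + t) ^- 2).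
Proof.
move=> t0; have e0 := eta_gt0 t0; have ek : 0 < eta t * kap by rewrite mulr_gt0.
have s1 := schur_stretched_kernel l1p s0p e0 kapp ks.
have s2 := schur_stretched_kernel l2p s0p e0 kapp ks.
have h0 : 0 <= pi / Num.sqrt (eta t * kap) by rewrite divr_ge0 ?sqrtr_ge0// ltW// pi_gt0.
rewrite near_kernelE; apply: schur_le (schurZ _ (schur_tensor h0 s1 s2)) _.
rewrite -expr2 exprMn exprVn sqr_sqrtr ?(ltW ek)//.
apply: (@le_trans _ _ (expR (k ^+ 2 * (a * kap)) * (1 + t)^-1 * (pi ^+ 2 / (eta t * kap)))).
  apply: ler_wpM2r; first by rewrite divr_ge0 ?sqr_ge0// ltW.
  exact: normc_near_factor.
rewrite le_eqVlt; apply/orP; left; apply/eqP.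
have n1 : eta1 a kap != 0 by rewrite gt_eqF ?eta1_gt0.
by field; rewrite n1 !gt_eqF// ltr_pwDl.
Qed.

(** The product of the two one-dimensional norms is proportional to [|tau|],
    which compensates the density [1 / |tau|]. *)
Lemma formbound_near_kernel t : 0 <= t -> formbound (prodm mu mu) (nk t)
  (expR (k ^+ 2 * (a * kap)) * stretched_const s0 / eta1 a kap * (1 + t) ^- 2).
Proof.
move=> t0; have e0 := eta_gt0 t0; have ek : 0 < eta t * kap by rewrite mulr_gt0.
have s1 := schur_stretched_kernel l1p s0p e0 kapp ks.
have s2 := schur_stretched_kernel l2p s0p e0 kapp ks.
have h0 : 0 <= pi / Num.sqrt (eta t * kap) by rewrite divr_ge0 ?sqrtr_ge0// ltW// pi_gt0.
have C0 : 0 < stretched_const s0 / eta t.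
  rewrite divr_gt0// mulr_gt0// addr_gt0 ?divr_gt0 ?mulr_gt0 ?exprn_gt0 ?pi_gt0//.
have q0 : 0 < Num.sqrt (stretched_const s0 / eta t) by rewrite sqrtr_gt0.
have lt := l2bound_tensor h0 q0 q0 s1 s2
  (normc_stretched_kernel_le1 l1p s0p e0 kapp ks) (normc_stretched_kernel_le1 l2p s0p e0 kapp ks)
  (l2bound_stretched_kernel l1p s0p e0 kapp ks) (l2bound_stretched_kernel l2p s0p e0 kapp ks).
have st := schur_tensor h0 s1 s2.
have fb := formbound_l2bound st (mulr_ge0 h0 h0) (mulr_ge0 (ltW q0) (ltW q0)) lt.
rewrite near_kernelE; apply: formbound_le (formboundZ _ st (mulr_ge0 h0 h0) fb) _.
rewrite -expr2 sqr_sqrtr ?(ltW C0)//.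
apply: (@le_trans _ _ (expR (k ^+ 2 * (a * kap)) * (1 + t)^-1 * (stretched_const s0 / eta t))).
  by apply: ler_wpM2r; [exact: ltW|exact: normc_near_factor].
rewrite le_eqVlt; apply/orP; left; apply/eqP.
have n1 : eta1 a kap != 0 by rewrite gt_eqF ?eta1_gt0.
by field; rewrite n1 !gt_eqF// ltr_pwDl.
Qed.

End near_kernel_bounds.

Section far_kernel_bounds.
Context {R : realType}.
Local Notation mu := (@lebesgue_measure R).
Variables (l1 l2 s0 a k kap : R).
Hypotheses (l1p : 0 < l1) (l2p : 0 < l2) (s0p : 0 < s0) (ap : 0 < a) (kp : 0 < k)
  (kapp : 0 < kap) (ks : kap * s0 <= 1) (kap1 : kap <= 1)
  (al : 16 * (l1 ^+ 2 + l2 ^+ 2) <= (k * a) ^+ 2).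
Implicit Types x y : R * R.
Let m := s0 / 4.
Local Notation fk := (far_kernel l1 l2 s0 a k kap m).

(** The part of the squared distance that produces decay; below the threshold the
    interval without absorption may contain both points. *)
Definition far_part (l d : R) := if 4 * l <= `|d| then d ^+ 2 else 0.

(** The contribution of one coordinate difference [d], with excess difference [e], to
    the exponent; [m * t - a * kap] and [a + t] are the imaginary and the real part of
    the point [t] of the ray. The slope [m = s0 / 4] is small enough for the
    absorption to win against the growth of [d ^ 2 * (m * t)] as soon as
    [|d| >= 4 l]; for smaller [d] this growth is at most [16 l ^ 2 * (m * t)]. *)
Lemma coordinate_exponent (l d e t : R) : 0 < l -> 0 <= t ->
  e ^+ 2 <= d * e -> 0 <= d * e -> (4 * l <= `|d| -> d ^+ 2 / 2 <= d * e) ->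
  (d ^+ 2 - (s0 * e) ^+ 2) * (m * t - a * kap) - 2 * (s0 * (d * e)) * (a + t) <=
    16 * l ^+ 2 * (m * t) - s0 / 2 * (a + t) * far_part l d.
Proof.
move=> l0 t0 h1 h2 h3; have [sp ap' kp'] := And3 s0p ap kapp.
have m0 : 0 < m by rewrite divr_gt0.
have mt0 : 0 <= m * t by rewrite mulr_ge0// ltW.
have T0 : 0 < a + t by rewrite ltr_pwDl.
have lm : 0 <= 16 * l ^+ 2 * (m * t) by apply: mulr_ge0 => //; rewrite mulr_ge0// sqr_ge0.
have de0 : 0 <= s0 * (d * e) by rewrite mulr_ge0// ltW.
have deT : 0 <= s0 * (d * e) * (a + t) by rewrite mulr_ge0// ltW.
have d20 := sqr_ge0 d; have e20 := sqr_ge0 (s0 * e).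
have ak0 : 0 <= a * kap by rewrite mulr_ge0// ltW.
case: (lerP 0 (m * t - a * kap)) => hS.
  have p1 : 0 <= (s0 * e) ^+ 2 * (m * t - a * kap) by rewrite mulr_ge0.
  have p2 : 0 <= d ^+ 2 * (a * kap) by rewrite mulr_ge0.
  rewrite /far_part; case: ifP => hl.
    have b2 : d ^+ 2 * (m * t) <= d ^+ 2 * (s0 / 4 * (a + t)).
      apply: ler_wpM2l => //; rewrite -/m; apply: ler_wpM2l; first exact: ltW.
      by rewrite lerDr ltW.
    have b3 : s0 * (d ^+ 2 / 2) * (a + t) <= s0 * (d * e) * (a + t).
      by apply: ler_wpM2r; [exact: ltW|apply: ler_wpM2l; [exact: ltW|exact: h3]].
    have b4 : 0 <= s0 * d ^+ 2 * (a + t) by apply: mulr_ge0; [apply: mulr_ge0 => //|]; exact: ltW.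
    lra.
  have b2 : d ^+ 2 * (m * t) <= 16 * l ^+ 2 * (m * t).
    apply: ler_wpM2r => //; rewrite -[d ^+ 2]real_normK ?num_real//.
    have -> : 16 * l ^+ 2 = (4 * l) ^+ 2 by ring.
    rewrite ler_pXn2r// ?nnegrE//; last by rewrite mulr_ge0// ltW.
    by rewrite ltW// ltNge hl.
  rewrite mulr0 subr0; lra.
have c0 : d ^+ 2 * (m * t - a * kap) <= 0 by rewrite mulr_ge0_le0// ltW.
have c1 : 0 <= (s0 * e) ^+ 2 * (m * t) by rewrite mulr_ge0.
have c2 : (s0 * e) ^+ 2 * (a * kap) <= s0 * (d * e) * a.
  have -> : (s0 * e) ^+ 2 * (a * kap) = kap * s0 * (s0 * e ^+ 2) * a by ring.
  apply: ler_wpM2r; first exact: ltW.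
  rewrite -[leRHS]mul1r; apply: ler_pM => //.
  - by rewrite mulr_ge0// ltW.
  - by apply: mulr_ge0; [exact: ltW|exact: sqr_ge0].
  - by apply: ler_wpM2l => //; exact: ltW.
have c3 : 0 <= s0 * (d * e) * t by rewrite mulr_ge0.
rewrite /far_part; case: ifP => hl; last by rewrite mulr0 subr0; lra.
have b3 : s0 * (d ^+ 2 / 2) * (a + t) <= s0 * (d * e) * (a + t).
  by apply: ler_wpM2r; [exact: ltW|apply: ler_wpM2l; [exact: ltW|exact: h3]].
lra.
Qed.

(** Where [tau] has real part [a + t], the kernel decays like
    [exp (- spread * d ^ 2 / (a + t))] in the far differences [d]; the denominator comes
    from [|tau| ^ 2 <= (1 + (1 + m) ^ 2) (a + t) ^ 2]. *)
Definition spread := s0 / (8 * (1 + (1 + m) ^+ 2)).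

Lemma spread_gt0 : 0 < spread.
Proof. by rewrite divr_gt0// mulr_gt0// ltr_pwDl// sqr_ge0. Qed.

Lemma far_part_ge0 l d : 0 <= far_part l d.
Proof. by rewrite /far_part; case: ifP => // _; exact: sqr_ge0. Qed.

(** The hypothesis on [a] lets a quarter of the decay of [exp (i k ^ 2 tau)] along the ray
    absorb the growth from both intervals without absorption. *)
Lemma far_exponent t x y : 0 <= t ->
  Re (- ray a k kap m t + (k ^+ 2 / 4)%:C * dist2 l1 l2 s0 x y / ray a k kap m t) <=
    k ^+ 2 * (a * kap) - 3 / 4 * (k ^+ 2 * m * t) -
      spread / (a + t) * (far_part l1 (x.1 - y.1) + far_part l2 (x.2 - y.2)).
Proof.
move=> t0; have [sp ap' kp'] := And3 s0p ap kapp.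
have m0 : 0 < m by rewrite divr_gt0.
have T0 : 0 < a + t by rewrite ltr_pwDl.
have h1 := coordinate_exponent l1p t0 (excess_lipschitz l1p x.1 y.1) (excess_monotone l1p x.1 y.1)
  (@excess_far _ _ l1p x.1 y.1).
have h2 := coordinate_exponent l2p t0 (excess_lipschitz l2p x.2 y.2) (excess_monotone l2p x.2 y.2)
  (@excess_far _ _ l2p x.2 y.2).
rewrite Re_add Re_opp Re_mul Re_inv Im_inv Re_ray Im_ray Re_mul Im_mul Re_dist2 Im_dist2 Re_real Im_real.
move: h1 h2.
set A1 := (x.1 - y.1) ^+ 2 - _; set B1 := 2 * (s0 * ((x.1 - y.1) * _)).
set A2 := (x.2 - y.2) ^+ 2 - _; set B2 := 2 * (s0 * ((x.2 - y.2) * _)).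
set D1 := far_part l1 _; set D2 := far_part l2 _.
have D0 : 0 <= D1 + D2 by rewrite addr_ge0 ?far_part_ge0.
set S := m * t - a * kap; set T := a + t in T0 *; move=> h1 h2.
have Q0 : 0 < S ^+ 2 + T ^+ 2 by rewrite ltr_wpDl ?sqr_ge0// exprn_gt0.
have k0 : k != 0 by rewrite gt_eqF.
have n0 : S ^+ 2 + T ^+ 2 != 0 by rewrite gt_eqF.
have -> : - (k ^+ 2 * S) + ((k ^+ 2 / 4 * (A1 + A2) - 0 * (B1 + B2)) * ((k ^+ 2 * S) / ((k ^+ 2 * S) ^+ 2 + (- (k ^+ 2 * T)) ^+ 2))
    - (k ^+ 2 / 4 * (B1 + B2) + 0 * (A1 + A2)) * (- (- (k ^+ 2 * T)) / ((k ^+ 2 * S) ^+ 2 + (- (k ^+ 2 * T)) ^+ 2))) =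
    - (k ^+ 2 * S) + ((A1 + A2) * S - (B1 + B2) * T) / (4 * (S ^+ 2 + T ^+ 2)).
  have -> : (k ^+ 2 * S) ^+ 2 + (- (k ^+ 2 * T)) ^+ 2 = k ^+ 4 * (S ^+ 2 + T ^+ 2) by ring.
  by field; rewrite n0 k0.
have aT : a ^+ 2 <= S ^+ 2 + T ^+ 2.
  have aT1 : a <= T by rewrite /T lerDl.
  have : a ^+ 2 <= T ^+ 2 by rewrite ler_pXn2r ?nnegrE ?(ltW ap) ?(ltW T0).
  by have := sqr_ge0 S; lra.
have mt0 : 0 <= m * t by rewrite mulr_ge0// ltW.
have ST : S ^+ 2 <= ((1 + m) * T) ^+ 2.
  rewrite -[S ^+ 2]real_normK ?num_real// ler_pXn2r// ?nnegrE//; last by rewrite mulr_ge0 ?addr_ge0// ltW.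
  have ak : a * kap <= a by rewrite ler_piMr// ltW.
  have ma : 0 <= m * a by rewrite mulr_ge0// ltW.
  have ak0 : 0 <= a * kap by rewrite mulr_ge0// ltW.
  by rewrite ler_norml /S /T; apply/andP; split; lra.
have key : ((A1 + A2) * S - (B1 + B2) * T) / (4 * (S ^+ 2 + T ^+ 2)) <=
   k ^+ 2 * m * t / 4 - spread / T * (D1 + D2).
  rewrite ler_pdivrMr ?mulr_gt0//.
  have q1 : 16 * (l1 ^+ 2 + l2 ^+ 2) * (m * t) <= k ^+ 2 * (S ^+ 2 + T ^+ 2) * (m * t).
    apply: ler_wpM2r => //; apply: le_trans al _; rewrite exprMn.
    by apply: ler_wpM2l => //; exact: sqr_ge0.
  have q2 : spread / T * (D1 + D2) * (4 * (S ^+ 2 + T ^+ 2)) <= s0 / 2 * T * (D1 + D2).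
    have -> : s0 / 2 * T * (D1 + D2) = spread / T * (D1 + D2) * (4 * (((1 + m) * T) ^+ 2 + T ^+ 2)).
      rewrite /spread; have n1 : 1 + (1 + m) ^+ 2 != 0 by rewrite gt_eqF// ltr_pwDl// sqr_ge0.
      by field; rewrite n1 gt_eqF.
    apply: ler_wpM2l; first by apply: mulr_ge0 => //; apply: divr_ge0; [exact: ltW spread_gt0|exact: ltW].
    by rewrite ler_pM2l// lerD2r.
  move: q1 q2; set W := S ^+ 2 + T ^+ 2; set V := spread / T * (D1 + D2); move: h1 h2.
  lra.
move: key; set V := spread / T * (D1 + D2); set W := (_ / (4 * _)); rewrite /S; lra.
Qed.

Definition far_profile l t d := (if `|d| <= 4 * l then 1 else 0) + lorentz (spread / (a + t)) d.

Lemma spreadT_gt0 t : 0 <= t -> 0 < spread / (a + t).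
Proof. by move=> t0; rewrite divr_gt0 ?spread_gt0// ltr_pwDl. Qed.

Lemma far_profile_ge0 l t d : 0 <= t -> 0 <= far_profile l t d.
Proof.
move=> t0; rewrite /far_profile; have := lorentz_gt0 d (ltW (spreadT_gt0 t0)).
by case: ifP => _ h; lra.
Qed.

Lemma far_profile_le2 l t d : 0 <= t -> far_profile l t d <= 2.
Proof.
move=> t0; rewrite /far_profile; have := lorentz_le1 d (ltW (spreadT_gt0 t0)).
by case: ifP => _ h; lra.
Qed.

Lemma expR_far_part l t d : 0 <= t -> expR (- (spread / (a + t) * far_part l d)) <= far_profile l t d.
Proof.
move=> t0; have h0 := spreadT_gt0 t0; rewrite /far_part /far_profile.
have h := lorentz_gt0 d (ltW h0).
case: (lerP (4 * l) `|d|) => h1.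
  have := expR_le_lorentz d (ltW h0).
  by case: ifP => _ h2; lra.
by rewrite (ltW h1) mulr0 oppr0 expR0; lra.
Qed.

Lemma normc_far_kernel t x y : 0 <= t -> normc (fk t x y) <=
  expR (k ^+ 2 * (a * kap)) * (1 + m) * expR (- (3 / 4 * k ^+ 2 * m * t)) / (a + t) *
    (far_profile l1 t (x.1 - y.1) * far_profile l2 t (x.2 - y.2)).
Proof.
move=> t0; have T0 : 0 < a + t by rewrite ltr_pwDl.
have m0 : 0 < m by rewrite divr_gt0.
have k20 : 0 < k ^+ 2 by rewrite exprn_gt0.
rewrite normcM.
have nd : normc (direction k m / ray a k kap m t) <= (1 + m) / (a + t).
  rewrite normcM normcV ler_pdivrMr; last first.
    apply: normc_gt0; apply/eqP => h; have := Im_ray a k kap m t; rewrite h => /esym/eqP.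
    by rewrite oppr_eq0 mulf_eq0 !gt_eqF.
  have h1 : normc (direction k m) <= k ^+ 2 * (1 + m).
    apply: le_trans (normc_le_ReIm _) _; rewrite /direction !ReIm_pair normrN !ger0_norm ?(ltW k20)//; last by rewrite mulr_ge0 ?ltW.
    lra.
  have h2 : k ^+ 2 * (a + t) <= normc (ray a k kap m t).
    apply: le_trans (Im_le_normc _); rewrite Im_ray normrN ger0_norm// mulr_ge0 ?ltW//.
  apply: le_trans h1 _; rewrite [leRHS]mulrAC ler_pdivlMr//.
  have -> : k ^+ 2 * (1 + m) * (a + t) = (1 + m) * (k ^+ 2 * (a + t)) by ring.
  by apply: ler_wpM2l => //; rewrite addr_ge0// ltW.
have ne : normc (cexp (- ray a k kap m t + (k ^+ 2 / 4)%:C * dist2 l1 l2 s0 x y / ray a k kap m t)) <=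
   expR (k ^+ 2 * (a * kap)) * expR (- (3 / 4 * k ^+ 2 * m * t)) *
   (far_profile l1 t (x.1 - y.1) * far_profile l2 t (x.2 - y.2)).
  rewrite normc_cexp.
  apply: (@le_trans _ _ (expR (k ^+ 2 * (a * kap) + - (3 / 4 * k ^+ 2 * m * t)) *
    (expR (- (spread / (a + t) * far_part l1 (x.1 - y.1))) * expR (- (spread / (a + t) * far_part l2 (x.2 - y.2)))))).
    rewrite -!expRD ler_expR; apply: le_trans (far_exponent x y t0) _; lra.
  rewrite expRD; apply: ler_wpM2l; first by rewrite mulr_ge0 ?expR_ge0.
  by apply: ler_pM; rewrite ?expR_ge0 ?expR_far_part.
apply: le_trans (ler_pM (normc_ge0 _) (normc_ge0 _) ne nd) _.
rewrite le_eqVlt; apply/orP; left; apply/eqP; ring.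
Qed.

Definition profile_kernel l t (x y : R) : R[i] := (far_profile l t (x - y))%:C.

Lemma measurable_far_profile l t d (T : measurableType d) (f : T -> R) : measurable_fun setT f ->
  measurable_fun setT (fun z => far_profile l t (f z)).
Proof.
move=> mf; apply: measurable_funD; last exact: measurable_lorentz.
by apply: measurable_fun_ifT => //; apply: measurable_box.
Qed.

Lemma schur_profile_kernel l t : 0 < l -> 0 <= t ->
  schur mu (profile_kernel l t) (8 * l + pi / Num.sqrt (spread / (a + t))).
Proof.
move=> l0 t0; have c0 := spreadT_gt0 t0.
have mk : cmeasurable setT (fun z : R * R => profile_kernel l t z.1 z.2).
  apply: cmeasurable_real; apply: measurable_far_profile.
  by apply: measurable_funB; [exact: measurable_fst|exact: measurable_snd].
have sym d : far_profile l t (- d) = far_profile l t d by rewrite /far_profile normrN lorentzN.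
have key (x : R) : (\int[mu]_y (far_profile l t (y - x))%:E <= (8 * l + pi / Num.sqrt (spread / (a + t)))%:E)%E.
  have e : forall y : R, (if `|y - x| <= 4 * l then 1 else 0) = \1_(`[x - 4 * l, x + 4 * l]%classic) y :> R.
    move=> y; rewrite indicE mem_setE in_itv /=.
    have -> : (`|y - x| <= 4 * l) = (x - 4 * l <= y <= x + 4 * l).
      by rewrite ler_norml; apply/andP/andP => -[? ?]; split; lra.
    by case: (_ && _).
  under eq_integral do rewrite /far_profile e EFinD.
  rewrite ge0_integralD//; last 3 first.
  - by apply/measurable_EFinP; apply: measurable_indic; exact: measurable_itv.
  - by move=> y _; rewrite lee_fin ltW// lorentz_gt0// ltW.
  - by apply/measurable_EFinP; apply: measurable_lorentz; exact: measurable_funB.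
  rewrite EFinD; apply: leeD; last exact: integral_lorentz.
  rewrite integral_indic//.
  rewrite setIT -[X in (X <= _)%E]/(mu `[x - 4 * l, x + 4 * l]%classic) lebesgue_measure_itv /= lte_fin; case: ifP => _; last by rewrite lee_fin mulr_ge0// ltW.
  by rewrite -EFinB lee_fin; lra.
have e1 (z : R) : normc (far_profile l t z)%:C = far_profile l t z.
  by rewrite normcC ger0_norm// far_profile_ge0.
split => //.
- move=> x; under eq_integral do rewrite /profile_kernel e1 -sym opprB; exact: key.
- move=> y; under eq_integral do rewrite /profile_kernel e1; exact: key.
Qed.

Lemma cmeasurable_dist2 : cmeasurable setT (fun z : (R * R) * (R * R) => dist2 l1 l2 s0 z.1 z.2).
Proof.
have h l (f h : (R * R) * (R * R) -> R) : measurable_fun setT f -> measurable_fun setT h ->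
    cmeasurable setT (fun z => (stretched l s0 (f z) - stretched l s0 (h z)) ^+ 2).
  move=> mf mh; have := cmeasurable_stretched l s0 => ms.
  have hh : cmeasurable setT (fun z => stretched l s0 (f z) - stretched l s0 (h z)).
    apply: cmeasurableD; first exact: (cmeasurable_comp ms mf).
    exact: (cmeasurableN (cmeasurable_comp ms mh)).
  by under eq_fun do rewrite expr2; exact: cmeasurableM.
by apply: cmeasurableD; apply: h; mproj.
Qed.

Lemma cmeasurable_far_kernel : cmeasurable setT
  (fun w : R * ((R * R) * (R * R)) => fk w.1 w.2.1 w.2.2).
Proof.
have mr : cmeasurable setT (fun w : R * ((R * R) * (R * R)) => ray a k kap m w.1).
  apply: cmeasurableD; first exact: cmeasurable_cst.
  apply: cmeasurableM; last exact: cmeasurable_cst.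
  by apply: cmeasurable_real; exact: measurable_fst.
have md := cmeasurable_comp cmeasurable_dist2 (@measurable_snd _ _ R ((R * R) * (R * R))%type).
apply: cmeasurableM; last by apply: cmeasurableM; [exact: cmeasurable_cst|exact: cmeasurableV].
apply: cmeasurable_cexp; apply: cmeasurableD; first exact: cmeasurableN.
by apply: cmeasurableM; [apply: cmeasurableM => //; exact: cmeasurable_cst|exact: cmeasurableV].
Qed.

(** A bound for the integral of the product of the two profiles divided by [a + t]: each
    profile has integral [8 l + pi * sqrt ((a + t) / spread)]. *)
Definition far_const := 64 * (l1 ^+ 2 + l2 ^+ 2) / a + 2 * pi ^+ 2 / spread.

Lemma schur_far_kernel t : 0 <= t -> schur (prodm mu mu) (fk t)
  (expR (k ^+ 2 * (a * kap)) * (1 + m) * far_const * expR (- (3 / 4 * k ^+ 2 * m * t))).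
Proof.
move=> t0; have T0 : 0 < a + t by rewrite ltr_pwDl.
have m0 : 0 < m by rewrite divr_gt0.
have c0 := spreadT_gt0 t0.
have sp1 := schur_profile_kernel l1p t0; have sp2 := schur_profile_kernel l2p t0.
have q0 : 0 <= pi / Num.sqrt (spread / (a + t)) by rewrite divr_ge0 ?sqrtr_ge0// ltW// pi_gt0.
have h2 : 0 <= 8 * l2 + pi / Num.sqrt (spread / (a + t)) by rewrite addr_ge0// mulr_ge0// ltW.
pose E := expR (k ^+ 2 * (a * kap)) * (1 + m) * expR (- (3 / 4 * k ^+ 2 * m * t)).
have E0 : 0 <= E by rewrite /E mulr_ge0 ?expR_ge0// mulr_ge0 ?expR_ge0// addr_ge0// ltW.
have sE := schurZ (E / (a + t))%:C (schur_tensor h2 sp1 sp2).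
have ET0 : 0 <= E / (a + t) by rewrite divr_ge0// ltW.
apply: schur_le (schur_dominated _ _ sE) _.
- apply: (cmeasurable_comp cmeasurable_far_kernel (h := fun z : (R * R) * (R * R) => (t, z))).
  exact: measurable_pair1.
- move=> x y; rewrite [leRHS]normcM normcC (ger0_norm ET0) /tensor [normc (profile_kernel _ _ _ _ * _)]normcM /profile_kernel !normcC.
  by rewrite !ger0_norm ?far_profile_ge0//; exact: normc_far_kernel.
rewrite normcC (ger0_norm ET0).
set B := pi / _ in q0 h2 *.
have B2 : B ^+ 2 = pi ^+ 2 / spread * (a + t).
  rewrite /B exprMn exprVn sqr_sqrtr ?(ltW c0)//.
  by field; rewrite !gt_eqF ?spread_gt0.
have h : (8 * l1 + B) * (8 * l2 + B) / (a + t) <= far_const.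
  rewrite ler_pdivrMr//.
  have : (8 * l1 + B) * (8 * l2 + B) <= 64 * (l1 ^+ 2 + l2 ^+ 2) + 2 * B ^+ 2.
    have := sqr_ge0 (8 * l1 - B); have := sqr_ge0 (8 * l2 - B); have := sqr_ge0 (8 * l1 - 8 * l2).
    rewrite !expr2; lra.
  move=> /le_trans; apply; rewrite B2 /far_const [leRHS]mulrDl; apply: lerD; last by rewrite le_eqVlt; apply/orP; left; apply/eqP; ring.
  rewrite mulrAC ler_pdivlMr//; apply: ler_wpM2l; last by rewrite lerDl.
  by rewrite mulr_ge0// addr_ge0// sqr_ge0.
have -> : E / (a + t) * ((8 * l1 + B) * (8 * l2 + B)) = E * ((8 * l1 + B) * (8 * l2 + B) / (a + t)) by ring.
apply: le_trans (ler_wpM2l E0 h) _.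
rewrite le_eqVlt; apply/orP; left; apply/eqP; rewrite /E; ring.
Qed.

End far_kernel_bounds.

(** * Profiles in the parameter of the path and square norms *)

Section time_profile.
Context {R : realType}.
Local Notation mu := (@lebesgue_measure R).
Local Notation Rp := (`[(0:R), +oo[%classic).
Implicit Types (t r P Q : R).

(** The common shape of all bounds in the parameter of the path: the first term comes
    from the segment, the second one from the ray. *)
Definition time_profile P Q r t :=
  if 0 <= t then P * (1 + t) ^- 2 + Q * expR (- (r * t)) else 0.

Variables (P Q r : R).
Hypotheses (P0 : 0 <= P) (Q0 : 0 <= Q) (r0 : 0 < r).

Lemma time_profile_ge0 t : 0 <= time_profile P Q r t.
Proof.
rewrite /time_profile; case: ifP => // _.
by rewrite addr_ge0// mulr_ge0 ?expR_ge0// invr_ge0 sqr_ge0.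
Qed.

Lemma measurable_nonneg_time : measurable_fun setT (fun t : R => 0 <= t).
Proof. exact: measurable_fun_ler. Qed.

Lemma measurable_time_profile : measurable_fun setT (time_profile P Q r).
Proof.
apply: measurable_fun_ifT => //; first exact: measurable_nonneg_time.
apply: measurable_funD; apply: measurable_funM => //.
  by apply: measurable_funV; apply: measurable_funX; exact: measurable_funD.
apply: (measurableT_comp (@measurable_expR R)); exact: measurableT_comp.
Qed.

Lemma integral_time_profile : (\int[mu]_t (time_profile P Q r t)%:E = (P + Q / r)%:E)%E.
Proof.
have m1 : measurable_fun Rp (fun t : R => ((1 + t) ^- 2)%:E).
  exact: measurable_int (@integrable_inv_sqr R).
have m2 : measurable_fun Rp (fun t : R => (expR (- (r * t)))%:E).
  exact: measurable_int (integrable_expRN r0).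
transitivity (\int[mu]_(t in Rp) (P%:E * ((1 + t) ^- 2)%:E + Q%:E * (expR (- (r * t)))%:E))%E.
  rewrite [RHS]integral_mkcond; apply: eq_integral => t _; rewrite patchE mem_setE in_itv /= andbT /time_profile.
  by case: ifP.
rewrite ge0_integralD//; first last.
- by apply: measurable_funeM.
- by move=> t _; rewrite -EFinM lee_fin mulr_ge0// expR_ge0.
- by apply: measurable_funeM.
- by move=> t _; rewrite -EFinM lee_fin mulr_ge0// invr_ge0 sqr_ge0.
rewrite !ge0_integralZl_EFin//; last first.
  by move=> t _; rewrite lee_fin invr_ge0 sqr_ge0.
by rewrite integral_inv_sqr integral_expRN// mule1 -EFinM -EFinD.
Qed.

Lemma cintegrable_time_profile (f : R -> R[i]) : cmeasurable setT f ->
  (forall t, normc (f t) <= time_profile P Q r t) -> cintegrable mu setT f.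
Proof.
move=> mf fP; apply: cintegrableP => //.
apply: (@le_lt_trans _ _ (\int[mu]_t (time_profile P Q r t)%:E)%E).
  apply: (@le_nonneg_integral _ _ _ mu (fun t => normc (f t)) (time_profile P Q r)) => //.
  - exact: measurable_normc.
  - exact: measurable_time_profile.
  - by move=> t; exact: normc_ge0.
by rewrite integral_time_profile ltry.
Qed.

End time_profile.

Section square_norm.
Context {R : realType} {d : measure_display} {T : measurableType d}.
Variable m : {measure set T -> \bar R}.

Lemma sqnorm_L2norm (g : T -> R[i]) : L2 m g -> sqnorm m g = ((L2norm m g) ^+ 2)%:E.
Proof.
move=> [mg gf]; have g0 : (0 <= eL2norm m g)%E by exact: Lnorm_ge0.
have n2 : (2 : R) != 0 by [].
rewrite /L2norm; have := poweR_Lnorm m (fun x => (normc (g x))%:E) n2.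
rewrite -/(eL2norm m g); move: g0 gf; case: (eL2norm m g) => //= r; rewrite lee_fin => r0 _.
rewrite powR_mulrn// => ->; rewrite /sqnorm; apply: eq_integral => x _.
by rewrite /= ger0_norm ?normc_ge0// powR_mulrn// normc_ge0.
Qed.

End square_norm.

(** * The family of kernels *)

Section causal.
Context {R : realType}.
Local Notation mu := (@lebesgue_measure R).
Local Notation Rp := (`[(0:R), +oo[%classic).

(** Kernels are only meaningful for [t >= 0], but Fubini's theorem is used on the whole
    line. *)
Definition causal (f : R -> R[i]) (t : R) : R[i] := if 0 <= t then f t else 0.

Lemma cintegral_causal f : cintegral mu setT (causal f) = cintegral mu Rp f.
Proof.
have e (g : R[i] -> R) : g 0 = 0 ->
    \int[mu]_(t in Rp) g (f t) = \int[mu]_t g (causal f t).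
  move=> g0; rewrite Rintegral_mkcond; congr Rintegral; apply/funext => t.
  by rewrite patchE mem_setE in_itv /= andbT /causal; case: ifP.
by rewrite /cintegral (e (@Re R))// (e (@Im R)).
Qed.

Lemma cmeasurable_causal d (T : measurableType d) (f : T -> R[i]) (h : T -> R) :
  cmeasurable setT f -> measurable_fun setT h ->
  cmeasurable setT (fun z => causal (fun=> f z) (h z)).
Proof.
move=> [f1 f2] mh.
have mb : measurable_fun setT (fun z => 0 <= h z) by exact: measurable_fun_ler.
split; rewrite /causal.
  by under eq_fun do rewrite (fun_if (@Re R)); exact: measurable_fun_ifT.
by under eq_fun do rewrite (fun_if (@Im R)); exact: measurable_fun_ifT.
Qed.

End causal.

Section green_family.
Context {R : realType}.
Local Notation mu := (@lebesgue_measure R).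
Variables (l1 l2 s0 a k kap : R).
Hypotheses (l1p : 0 < l1) (l2p : 0 < l2) (s0p : 0 < s0) (ap : 0 < a) (kp : 0 < k)
  (kapp : 0 < kap) (ks : kap * s0 <= 1) (kap1 : kap <= 1)
  (al : 16 * (l1 ^+ 2 + l2 ^+ 2) <= (k * a) ^+ 2).
Implicit Types x y : R * R.
Local Notation m := (s0 / 4).
Local Notation nk := (near_kernel l1 l2 s0 a k kap).
Local Notation fk := (far_kernel l1 l2 s0 a k kap m).
Local Notation growth := (expR (k ^+ 2 * (a * kap))).
Local Notation rate := (3 / 4 * k ^+ 2 * m).

Definition green_family t x y : R[i] := (4 * pi)^-1%:C *
  (causal (fun t => nk t x y) t + causal (fun t => fk t x y) t).

Lemma cmeasurable_near_kernel : cmeasurable setT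
  (fun w : R * ((R * R) * (R * R)) => nk w.1 w.2.1 w.2.2).
Proof.
have mt : measurable_fun setT (fun w : R * ((R * R) * (R * R)) => 1 + w.1).
  by apply: measurable_funD => //; mproj.
have mr : cmeasurable setT (fun w : R * ((R * R) * (R * R)) => rinv w.1 : R[i]).
  by apply: cmeasurable_real; apply: measurable_funV.
have ms l (f h : R * ((R * R) * (R * R)) -> R) : 0 < l -> measurable_fun setT f -> measurable_fun setT h ->
    cmeasurable setT (fun w : R * ((R * R) * (R * R)) =>
      stretched_kernel l s0 (eta1 a kap * (1 + w.1)) kap (f w) (h w)).
  move=> l0 mf mh; have me : measurable_fun setT (fun w : R * ((R * R) * (R * R)) => eta1 a kap * (1 + w.1)).
    exact: measurable_funM.
  have md : cmeasurable setT (fun w => stretched l s0 (f w) - stretched l s0 (h w)).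
    apply: cmeasurableD; first exact: (cmeasurable_comp (cmeasurable_stretched l s0) mf).
    by apply: cmeasurableN; exact: (cmeasurable_comp (cmeasurable_stretched l s0) mh).
  apply: cmeasurable_cexp; apply: cmeasurableM.
    by split => //=; apply: measurableT_comp => //; exact: measurable_funM.
  exact: (cmeasurableM md md).
apply: cmeasurableM.
  apply: cmeasurableM => //; apply: cmeasurable_cexp; apply: cmeasurableN.
  by apply: cmeasurableM => //; exact: cmeasurable_cst.
by apply: cmeasurableM; apply: ms => //; mproj.
Qed.

Lemma cmeasurable_green_family : cmeasurable setT
  (fun w : R * ((R * R) * (R * R)) => green_family w.1 w.2.1 w.2.2).
Proof.
apply: cmeasurableM; first exact: cmeasurable_cst.
by apply: cmeasurableD; apply: cmeasurable_causal; mproj;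
  [exact: cmeasurable_near_kernel | exact: cmeasurable_far_kernel].
Qed.

Let r0 : 0 < rate.
Proof. by rewrite !mulr_gt0 ?exprn_gt0// invr_gt0. Qed.

Definition schur_profile := time_profile
  ((4 * pi)^-1 * (growth * pi ^+ 2 / (eta1 a kap * kap)))
  ((4 * pi)^-1 * (growth * (1 + m) * far_const l1 l2 s0 a)) rate.

Definition form_profile := time_profile
  ((4 * pi)^-1 * (growth * stretched_const s0 / eta1 a kap))
  ((4 * pi)^-1 * (growth * (1 + m) * far_const l1 l2 s0 a)) rate.

Let c0 : 0 <= (4 * pi : R)^-1.
Proof. by rewrite invr_ge0 mulr_ge0// pi_ge0. Qed.

Let m0 : 0 < 1 + m.
Proof. by rewrite ltr_pwDl// divr_ge0// ltW. Qed.

Lemma far_const_ge0 : 0 <= far_const l1 l2 s0 a.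
Proof.
rewrite /far_const; apply: addr_ge0; apply: divr_ge0; rewrite ?(ltW ap) ?(ltW (spread_gt0 s0p))//.
  by apply: mulr_ge0 => //; apply: addr_ge0; exact: sqr_ge0.
by apply: mulr_ge0 => //; exact: sqr_ge0.
Qed.

Let e0 : 0 < eta1 a kap. Proof. exact: eta1_gt0. Qed.

Lemma far_weight_ge0 : 0 <= (4 * pi)^-1 * (growth * (1 + m) * far_const l1 l2 s0 a).
Proof.
apply: mulr_ge0 => //; apply: mulr_ge0; last exact: far_const_ge0.
by apply: mulr_ge0; [exact: expR_ge0|exact: ltW].
Qed.

Lemma schur_weight_ge0 : 0 <= (4 * pi)^-1 * (growth * pi ^+ 2 / (eta1 a kap * kap)).
Proof.
apply: mulr_ge0 => //; apply: divr_ge0; last by apply: mulr_ge0; exact: ltW.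
by apply: mulr_ge0; [exact: expR_ge0|exact: sqr_ge0].
Qed.

Lemma form_weight_ge0 : 0 <= (4 * pi)^-1 * (growth * stretched_const s0 / eta1 a kap).
Proof.
apply: mulr_ge0 => //; apply: divr_ge0; last exact: ltW.
apply: mulr_ge0; first exact: expR_ge0.
by rewrite /stretched_const ltW// mulr_gt0// addr_gt0 ?divr_gt0 ?mulr_gt0 ?exprn_gt0 ?pi_gt0.
Qed.

Lemma green_family_causal t : 0 <= t -> green_family t =
  fun x y => (4 * pi)^-1%:C * (nk t x y + fk t x y).
Proof. by move=> t0; apply/funext => x; apply/funext => y; rewrite /green_family /causal t0. Qed.

Lemma green_family0 t : ~~ (0 <= t) -> green_family t = fun _ _ => 0.
Proof.
move=> t0; apply/funext => x; apply/funext => y.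
by rewrite /green_family /causal (negbTE t0) addr0 mulr0.
Qed.

Lemma schur_green_family t : schur (prodm mu mu) (green_family t) (schur_profile t).
Proof.
rewrite /schur_profile /time_profile; case: ifPn => t0; last by rewrite green_family0//; exact: schur0.
have sn := schur_near_kernel k l1p l2p s0p ap kapp ks t0.
have sf := schur_far_kernel l1p l2p s0p ap kp kapp ks kap1 al t0.
rewrite green_family_causal//; apply: schur_le (schurZ _ (schurD sn sf)) _.
by rewrite normcC ger0_norm// le_eqVlt; apply/orP; left; apply/eqP; ring.
Qed.

Lemma formbound_green_family t : formbound (prodm mu mu) (green_family t) (form_profile t).
Proof.
rewrite /form_profile /time_profile; case: ifPn => t0; last by rewrite green_family0//; exact: formbound0.
have sn := schur_near_kernel k l1p l2p s0p ap kapp ks t0.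
have sf := schur_far_kernel l1p l2p s0p ap kp kapp ks kap1 al t0.
have fn := formbound_near_kernel k l1p l2p s0p ap kapp ks t0.
have n0 : 0 <= expR (k ^+ 2 * (a * kap)) * pi ^+ 2 / (eta1 a kap * kap) * (1 + t) ^- 2.
  apply: mulr_ge0; last by rewrite invr_ge0 sqr_ge0.
  apply: divr_ge0; last by apply: mulr_ge0; exact: ltW.
  by apply: mulr_ge0; [exact: expR_ge0|exact: sqr_ge0].
have f0 : 0 <= expR (k ^+ 2 * (a * kap)) * (1 + m) * far_const l1 l2 s0 a * expR (- (rate * t)).
  apply: mulr_ge0; last exact: expR_ge0.
  apply: mulr_ge0; last exact: far_const_ge0.
  by apply: mulr_ge0; [exact: expR_ge0|exact: ltW].
have ff := formbound_schur sf f0.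
rewrite green_family_causal//.
apply: formbound_le (formboundZ _ (schurD sn sf) (addr_ge0 n0 f0) (formboundD sn sf n0 f0 fn ff)) _.
by rewrite normcC ger0_norm// le_eqVlt; apply/orP; left; apply/eqP; ring.
Qed.

Lemma lorentz_le_inv (c d t : R) : 0 < c -> 0 <= t -> d != 0 ->
  lorentz (c * (1 + t)) d <= (c * d ^+ 2)^-1 * (1 + t)^-1.
Proof.
move=> cp t0 dn; have t1 : 0 < 1 + t by rewrite ltr_pwDl.
have d2 : 0 < d ^+ 2 by rewrite exprn_even_gt0.
have h : 0 < c * d ^+ 2 * (1 + t) by apply: mulr_gt0 => //; exact: mulr_gt0.
rewrite -invfM /lorentz lef_pV2 ?posrE//.
  by rewrite mulrAC; lra.
by rewrite mulrAC; lra.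
Qed.

(** Off the diagonal, one of the Lorentzian bounds decays like [1 / (1 + t)]. *)
Lemma cintegrable_near_kernel x y : y <> x ->
  cintegrable mu setT (causal (fun t => nk t x y)).
Proof.
move=> yx.
have [d [dn hd]] : exists d, d != 0 /\ forall c, 0 <= c ->
    lorentz c (x.1 - y.1) * lorentz c (x.2 - y.2) <= lorentz c d.
  have [e1|n1] := eqVneq x.1 y.1.
    have n2 : x.2 - y.2 != 0.
      rewrite subr_eq0; apply/eqP => e2; apply: yx.
      by rewrite (surjective_pairing x) (surjective_pairing y) e1 e2.
    exists (x.2 - y.2); split => // c cp; have h := lorentz_gt0 (x.2 - y.2) cp.
    by rewrite ler_piMl ?(ltW h) ?lorentz_le1.
  exists (x.1 - y.1); split; first by rewrite subr_eq0.
  move=> c cp; have h := lorentz_gt0 (x.1 - y.1) cp.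
  by rewrite ler_piMr ?(ltW h) ?lorentz_le1.
have ek : 0 < eta1 a kap * kap by rewrite mulr_gt0.
apply: (@cintegrable_time_profile _ (growth * (eta1 a kap * kap * d ^+ 2)^-1) 0 1) => //.
- apply: mulr_ge0; first exact: expR_ge0.
  by rewrite invr_ge0; apply: mulr_ge0; [exact: ltW|exact: sqr_ge0].
- apply: (cmeasurable_causal (f := fun t => nk t x y)) => //.
  by apply: (cmeasurable_comp cmeasurable_near_kernel (h := fun t => (t, (x, y)))); exact: measurable_pair2.
move=> t; rewrite /causal /time_profile; case: ifPn => t0; last by rewrite normc0.
rewrite mul0r addr0 near_kernelE normcM.
have et : 0 < eta1 a kap * (1 + t) by exact: eta_gt0.
have hn := normc_near_factor k ap kapp t0.
apply: (@le_trans _ _ (growth * (1 + t)^-1 * lorentz (eta1 a kap * (1 + t) * kap) d)).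
  apply: ler_pM => //; try exact: normc_ge0.
  rewrite /tensor normcM; apply: le_trans (hd _ _); last by rewrite mulr_ge0// ltW.
  by apply: ler_pM; try exact: normc_ge0; apply: normc_stretched_kernel_lorentz.
have -> : eta1 a kap * (1 + t) * kap = eta1 a kap * kap * (1 + t) by ring.
apply: le_trans (ler_wpM2l _ (lorentz_le_inv ek t0 dn)) _.
  by apply: mulr_ge0; [exact: expR_ge0|rewrite invr_ge0 addr_ge0].
rewrite -[(1 + t) ^- 2]exprVn le_eqVlt; apply/orP; left; apply/eqP; ring.
Qed.

Lemma cintegrable_far_kernel x y : cintegrable mu setT (causal (fun t => fk t x y)).
Proof.
apply: (@cintegrable_time_profile _ 0 (growth * (1 + m) * (4 / a)) rate) => //.
- apply: mulr_ge0; first by apply: mulr_ge0; [exact: expR_ge0|exact: ltW].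
  by apply: divr_ge0 => //; exact: ltW.
- apply: (cmeasurable_causal (f := fun t => fk t x y)) => //.
  by apply: (cmeasurable_comp (cmeasurable_far_kernel l1 l2 s0 a k kap) (h := fun t => (t, (x, y)))); exact: measurable_pair2.
move=> t; rewrite /causal /time_profile; case: ifPn => t0; last by rewrite normc0.
rewrite mul0r add0r.
apply: le_trans (normc_far_kernel l1p l2p s0p ap kp kapp ks kap1 al x y t0) _.
have -> : growth * (1 + m) * (4 / a) * expR (- (rate * t)) =
  growth * (1 + m) * expR (- (rate * t)) * (a^-1 * (2 * 2)) by ring.
rewrite -mulrA; apply: ler_wpM2l.
  apply: mulr_ge0; last exact: expR_ge0.
  by apply: mulr_ge0; [exact: expR_ge0|exact: ltW].
have f1 d l := far_profile_ge0 s0p ap l d t0.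
have f2 d l := far_profile_le2 s0p ap l d t0.
apply: ler_pM; first by rewrite invr_ge0 addr_ge0// ltW.
- by apply: mulr_ge0; exact: f1.
- by rewrite lef_pV2 ?posrE ?lerDl// ltr_pwDl.
- by apply: ler_pM.
Qed.

Lemma cintegrable_green_family x y : y <> x ->
  cintegrable mu setT (fun t => green_family t x y).
Proof.
move=> yx; apply: cintegrableMl => //; apply: cintegrableD => //.
  exact: cintegrable_near_kernel.
exact: cintegrable_far_kernel.
Qed.

Lemma green_family_integral x y : y <> x ->
  green k (stretch2 s0 l1 l2 x) (stretch2 s0 l1 l2 y) =
    cintegral mu setT (fun t => green_family t x y).
Proof.
move=> yx; have m1 : 0 < m by rewrite divr_gt0.
have ci1 := cintegrable_near_kernel yx; have ci2 := cintegrable_far_kernel x y.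
rewrite (green_integral l1p l2p s0p ap kp kapp ks m1 yx).
by rewrite cintegralMl//; [rewrite cintegralD// !cintegral_causal|exact: cintegrableD].
Qed.

End green_family.

(** * The constant and the estimate *)

Section points.
Context {R : realType}.
Local Notation mu := (@lebesgue_measure R).

Lemma plane_pointE (x : R * R) : [set x] = [set x.1] `*` [set x.2].
Proof.
apply/seteqP; split => [_ ->//|[u w] /= [-> ->]].
by rewrite -surjective_pairing.
Qed.

Lemma measurable_plane_point (x : measurableTypeR R * measurableTypeR R) : measurable [set x].
Proof. by rewrite plane_pointE; apply: measurableX; exact: measurable_set1. Qed.

Lemma leb2_plane_point (x : measurableTypeR R * measurableTypeR R) : leb2 R [set x] = 0%E.
Proof.
rewrite plane_pointE -[LHS]/((mu \x mu)%E ([set x.1] `*` [set x.2])) product_measure1E; [|exact: measurable_set1|exact: measurable_set1].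
by rewrite -[X in (X * _)%E]/(mu [set x.1]) lebesgue_measure_set1 mul0e.
Qed.

End points.

Section constants.
Context {R : realType}.
Variables (l1 l2 s0 : R).
Hypotheses (l1p : 0 < l1) (l2p : 0 < l2) (s0p : 0 < s0).

(** The path turns at [tau = turn / k * (1 - i tilt / k)]. On the segment
    [exp (i k ^ 2 tau)] then grows at most by the factor [exp (turn * tilt)], the norms
    add up to [O (turn / k)], and [turn] is large enough for [far_exponent]. The
    bound on [tilt] by [1 / s0] is the one required by [coercive_dist2]. *)
Definition turn : R := 6 * (l1 + l2).
Definition tilt : R := Num.min 1 s0^-1.

Definition green_const : R :=
  (4 * pi)^-1 * (expR (turn * tilt) * stretched_const s0 * (8 * turn) +
    expR (turn * tilt) * (1 + s0 / 4) * (64 * (l1 ^+ 2 + l2 ^+ 2) / turn + 2 * pi ^+ 2 / spread s0) *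
      (4 / (3 * (s0 / 4)))).

Lemma turn_gt0 : 0 < turn.
Proof. by rewrite mulr_gt0// addr_gt0. Qed.

Lemma tilt_gt0 : 0 < tilt.
Proof. by rewrite /tilt lt_min ltr01 invr_gt0. Qed.

Lemma tilt_le1 : tilt <= 1.
Proof. by rewrite /tilt ge_min lexx. Qed.

Lemma tilt_s0 : tilt * s0 <= 1.
Proof. by rewrite -ler_pdivlMr// mul1r /tilt ge_min lexx orbT. Qed.

Lemma turn_large : 16 * (l1 ^+ 2 + l2 ^+ 2) <= turn ^+ 2.
Proof.
have h1 := mulr_gt0 l1p l2p; have h2 := sqr_ge0 l1; have h3 := sqr_ge0 l2.
by rewrite /turn exprMn sqrrD; lra.
Qed.

(** The segment contributes a multiple of [1 / eta1 <= 8 turn / k]; on the ray,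
    [far_const] is [O (k)] and the time integral is [O (1 / k ^ 2)]. *)
Lemma form_profile_weight (k : R) : 1 <= k ->
  (4 * pi)^-1 * (expR (k ^+ 2 * (turn / k * (tilt / k))) * stretched_const s0 /
    eta1 (turn / k) (tilt / k)) +
  (4 * pi)^-1 * (expR (k ^+ 2 * (turn / k * (tilt / k))) * (1 + s0 / 4) *
    far_const l1 l2 s0 (turn / k)) /
    (3 / 4 * k ^+ 2 * (s0 / 4)) <= green_const * k^-1.
Proof.
move=> k1; have k0 : 0 < k by exact: lt_le_trans k1.
set a := turn / k; set kap := tilt / k; have kn : k != 0 by rewrite gt_eqF.
have sp := s0p; have sn : s0 != 0 by rewrite gt_eqF.
have tp := turn_gt0; have tn : turn != 0 by rewrite gt_eqF.
have -> : k ^+ 2 * (a * kap) = turn * tilt by rewrite /a /kap; field.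
have g0 := expR_gt0 (turn * tilt).
have q0 : 0 <= (4 * pi : R)^-1 by rewrite invr_ge0 mulr_ge0// pi_ge0.
have st0 : 0 < stretched_const s0.
  by rewrite /stretched_const mulr_gt0// addr_gt0 ?divr_gt0 ?mulr_gt0 ?exprn_gt0 ?pi_gt0.
have kapk : kap <= 1.
  by rewrite /kap ler_pdivrMr// mul1r (le_trans tilt_le1).
have kap0 : 0 <= kap by rewrite /kap divr_ge0// ltW// tilt_gt0.
have h1 : (eta1 a kap)^-1 <= 8 * turn * k^-1.
  rewrite /eta1 invrK.
  have h : kap ^+ 2 <= 1 by rewrite exprn_ile1.
  have -> : 8 * turn / k = 4 * a * 2 by rewrite /a; field.
  by apply: ler_wpM2l; [apply: mulr_ge0 => //; apply: divr_ge0; exact: ltW | lra].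
set D := 64 * (l1 ^+ 2 + l2 ^+ 2) / turn + 2 * pi ^+ 2 / spread s0.
have s1 : 0 < spread s0 by exact: spread_gt0.
have h2 : far_const l1 l2 s0 a <= k * D.
  rewrite /far_const /D [leRHS]mulrDr; apply: lerD.
    by rewrite /a le_eqVlt; apply/orP; left; apply/eqP; field; rewrite kn tn.
  rewrite ler_peMl//; apply: divr_ge0; last exact: ltW.
  by apply: mulr_ge0 => //; exact: sqr_ge0.
rewrite /green_const -/D [X in _ <= X * _]mulrDr [leRHS]mulrDl; apply: lerD.
  rewrite -[leRHS]mulrA; apply: ler_wpM2l => //.
  rewrite -[leRHS]mulrA; apply: ler_wpM2l => //.
  by apply: mulr_ge0; exact: ltW.
have -> : (4 * pi)^-1 * (expR (turn * tilt) * (1 + s0 / 4) * D * (4 / (3 * (s0 / 4)))) / k =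
  (4 * pi)^-1 * (expR (turn * tilt) * (1 + s0 / 4) * (k * D)) / (3 / 4 * k ^+ 2 * (s0 / 4)).
  move: (4 * pi : R)^-1 => q; by field; rewrite kn sn.
apply: ler_wpM2r.
  rewrite invr_ge0; apply: mulr_ge0; last by rewrite divr_ge0// ltW.
  by apply: mulr_ge0 => //; exact: sqr_ge0.
apply: ler_wpM2l => //; apply: ler_wpM2l => //.
by apply: mulr_ge0; [exact: ltW|lra].
Qed.

End constants.

Theorem theorem3p6 (R : realType) (l1 l2 sigma0 : R)
    (hl1 : 0 < l1) (hl2 : 0 < l2) (hsigma0 : 0 < sigma0) :
  exists C : R, forall k : R, 1 <= k ->
    forall g v : R * R -> R[i], L2 (leb2 R) g -> L2 (leb2 R) v ->
    let F (x y : R * R) : R[i] :=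
      green k (stretch2 sigma0 l1 l2 x) (stretch2 sigma0 l1 l2 y) * g y * v x in
    let inner (x : R * R) : R[i] := cintegral (leb2 R) setT (F x) in
    [/\ {ae leb2 R, forall x, cintegrable (leb2 R) setT (F x)},
        cintegrable (leb2 R) setT inner &
        Normc.normc (cintegral (leb2 R) setT inner)
          <= C * k^-1 * L2norm (leb2 R) g * L2norm (leb2 R) v].
Proof.
exists (green_const l1 l2 sigma0) => k k1 g v Lg Lv.
have k0 : 0 < k by exact: lt_le_trans k1.
pose a := turn l1 l2 / k; pose kap := tilt sigma0 / k.
have ap : 0 < a by rewrite divr_gt0// turn_gt0.
have kapp : 0 < kap by rewrite divr_gt0// tilt_gt0.
have kap_tilt : kap <= tilt sigma0.
  by rewrite ler_pdivrMr// ler_peMr// ltW// tilt_gt0.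
have ks : kap * sigma0 <= 1.
  by apply: le_trans (tilt_s0 hsigma0); apply: ler_wpM2r => //; exact: ltW.
have kap1 : kap <= 1 by exact: le_trans kap_tilt (tilt_le1 _).
have al : 16 * (l1 ^+ 2 + l2 ^+ 2) <= (k * a) ^+ 2.
  rewrite (_ : k * a = turn l1 l2) ?turn_large//.
  by rewrite /a mulrC divfK// gt_eqF.
have r0 : 0 < 3 / 4 * k ^+ 2 * (sigma0 / 4) by rewrite !mulr_gt0 ?exprn_gt0// invr_gt0.
have fw := far_weight_ge0 l1 l2 k kap hsigma0 ap.
have sw := schur_weight_ge0 k ap kapp.
have ow := form_weight_ge0 k kap hsigma0 ap.
apply: (@superposition R _ _ (prodm (@lebesgue_measure R) (@lebesgue_measure R))
  (green_family l1 l2 sigma0 a k kap) (schur_profile l1 l2 sigma0 a k kap)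
  (form_profile l1 l2 sigma0 a k kap) (green_const l1 l2 sigma0 * k^-1)
  (fun x y => green k (stretch2 sigma0 l1 l2 x) (stretch2 sigma0 l1 l2 y))).
- exact: cmeasurable_green_family.
- exact: measurable_time_profile.
- exact: measurable_time_profile.
- by move=> t; exact: time_profile_ge0.
- by move=> t; exact: time_profile_ge0.
- by rewrite /schur_profile integral_time_profile// ltry.
- by rewrite /form_profile integral_time_profile// lee_fin; exact: form_profile_weight.
- exact: schur_green_family.
- exact: formbound_green_family.
- exact: cintegrable_green_family.
- exact: green_family_integral.
- exact: measurable_plane_point.
- exact: leb2_plane_point.
- exact: Lg.1.
- exact: Lv.1.
- exact: fine_ge0 (Lnorm_ge0 _ _ _).
- exact: fine_ge0 (Lnorm_ge0 _ _ _).
- by rewrite -(sqnorm_L2norm Lg).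
- by rewrite -(sqnorm_L2norm Lv).
Qed.
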